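(* Let $r\ge 3$ be an integer, let $T>0$, and let $(\eta,u)$ be the solution, 1-periodic in $x$, of the periodic initial-value problem for the Serre system $$\eta_t+(\eta u)_x=0,\qquad \eta u_t+\eta\eta_x+\eta uu_x-\tfrac13\bigl[\eta^3(u_{xt}+uu_{xx}-u_x^2)\bigr]_x=0,\qquad (x,t)\in[0,1]\times[0,T],$$ $$\eta(x,0)=\eta_0(x),\quad u(x,0)=u_0(x),\quad 0\le x\le 1,$$ where $\eta_0,u_0$ are given 1-periodic functions. Suppose that $(\eta,u)$ is sufficiently smooth and satisfies $\min_{0\le x\le 1}\eta(x,t)\ge c_0$ for $t\in[0,T]$, for some positive constant $c_0$. Suppose that $h=1/N$ is sufficiently small. Then there is a unique solution $(\eta_h,u_h)$ on $[0,T]$, with $\eta_h(t),u_h(t)\in S_h$, of the semidiscrete problem: for $t\in[0,T]$, $$(\eta_{ht},\phi)+((\eta_hu_h)_x,\phi)=0\quad\forall\phi\in S_h,$$ $$(\eta_hu_{ht},\chi)+\tfrac13(\eta_h^3u_{htx},\chi')+(\eta_h\eta_{hx},\chi)+(\eta_hu_hu_{hx},\chi)+\tfrac13\bigl(\eta_h^3(u_hu_{hxx}-u_{hx}^2),\chi'\bigr)=0\quad\forall\chi\in S_h,$$ with initial conditions $\eta_h(0)=Q_h\eta_0$, $u_h(0)=Q_hu_0$. Moreover, this solution satisfies $$\max_{0\le t\le T}\bigl(\|\eta(t)-\eta_h(t)\|+\|u(t)-u_h(t)\|\bigr)\le Ch^r,$$ where $C$ is a constant independent of $h$.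
   Context: Notation: $(\cdot,\cdot)$ and $\|\cdot\|$ denote the inner product and norm of $L^2(0,1)$. $C^k_{per}[0,1]$ denotes the $k$-times continuously differentiable 1-periodic functions, and $\mathbb{P}_k$ the polynomials of degree at most $k$. Subscripts $x,t$ denote partial derivatives ($\eta_{ht}=\partial_t\eta_h$, $u_{htx}=\partial_x\partial_tu_h$, etc.) and $\chi'$ is the derivative in $x$. ''Sufficiently smooth'' means having continuous (1-periodic in $x$) derivatives up to some sufficiently high order. Spline space: for a positive integer $N$ let $h=1/N$, $x_i=ih$, $0\le i\le N$, and for an integer $r\ge2$ let $$S_h=\{\phi\in C^{r-2}_{per}[0,1]:\ \phi|_{[x_{i-1},x_i]}\in\mathbb{P}_{r-1},\ 1\le i\le N\},$$ an $N$-dimensional space. Quasiinterpolant (Thomée–Wendroff): there is a basis $\{\phi_j\}_{j=1}^N$ of $S_h$, with supports of size $O(h)$, fixed throughout, such that, defining $Q_hv=\sum_{j=1}^Nv(x_j)\phi_j$, the following hold, with constants (also those implied in $O(\cdot)$) independent of $h$ and $i$: (0) $\|Q_hv-v\|\le Ch^r\|v^{(r)}\|$ for every sufficiently smooth 1-periodic $v$, with $C$ independent of $v$. (i) $\|\psi\|\le Ch^{-1}\max_{1\le i\le N}|(\psi,\phi_i)|$ for all $\psi\in S_h$. (ii) For $w$ sufficiently smooth and 1-periodic and integers $0\le\nu,\kappa\le r-1$, $$\bigl((Q_hw)^{(\nu)},\phi_i^{(\kappa)}\bigr)=(-1)^\kappa h\,w^{(\nu+\kappa)}(x_i)+O(h^{2r+j-\nu-\kappa}),\quad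 1\le i\le N,$$ where $j=1$ if $\nu+\kappa$ is even and $j=2$ if $\nu+\kappa$ is odd. (iii) For $f,g$ sufficiently smooth and 1-periodic and $\nu,\kappa,j$ as in (ii), $$\max_{1\le i\le N}\Bigl|\bigl(f(Q_hg)^{(\nu)},\phi_i^{(\kappa)}\bigr)-(-1)^\kappa\bigl(Q_h[(fg^{(\nu)})^{(\kappa)}],\phi_i\bigr)\Bigr|=O(h^{2r+j-\nu-\kappa}).$$ Standing assumption: $\eta_0,u_0$ are smooth enough and the initial-value problem for the Serre system has a unique sufficiently smooth solution $(\eta,u)$ that is 1-periodic in $x$ for all $t\in[0,T]$. *)

(* Defs.v *)
(* Real numbers and Riemann integrals of Stdlib and Coquelicot.
   Functions on [0,1] with periodic boundary conditions are represented by
   1-periodic functions R -> R, and time-dependent ones by f : R -> R -> R with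
   the time variable first, so that [f t] is the spatial function f(., t). *)
From Stdlib Require Export Reals List RList.
From Coquelicot Require Export Coquelicot.
Open Scope R_scope.

Definition L2ip (f g : R -> R) : R := RInt (fun x => f x * g x) 0 1.
Definition L2norm (f : R -> R) : R := sqrt (L2ip f f).

Definition Ck_per (k : nat) (f : R -> R) : Prop :=
  (forall x, f (x + 1) = f x) /\
  (forall j, (j <= k)%nat ->
     forall x, ex_derive_n f j x /\ continuous (Derive_n f j) x).

(* Derivative at t of f relative to the set D; for D = [0,T] it is one-sided at
   the two endpoints. *)
Definition is_derive_on (D : R -> Prop) (f : R -> R) (t l : R) : Prop :=
  filterlim (fun s => (f s - f t) / (s - t)) (within D (locally' t)) (locally l).
Definition ex_derive_on (D : R -> Prop) (f : R -> R) (t : R) : Prop :=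
  exists l, is_derive_on D f t l.
Definition Derive_on (D : R -> Prop) (f : R -> R) (t : R) : R :=
  iota (fun l : R => is_derive_on D f t l).

Definition Icc (a b t : R) : Prop := a <= t <= b.

Definition dx (f : R -> R -> R) : R -> R -> R := fun t => Derive (f t).
Definition dt (T : R) (f : R -> R -> R) : R -> R -> R :=
  fun t x => Derive_on (Icc 0 T) (fun s => f s x) t.

(* All mixed partial derivatives of order at most k, taken in any order, exist
   and are jointly continuous on the closed strip [0,T] x R. *)
Fixpoint Ck_strip (T : R) (k : nat) (f : R -> R -> R) : Prop :=
  continuous_on (fun p : R * R => Icc 0 T (fst p)) (fun p => f (fst p) (snd p)) /\
  match k with
  | O => True
  | S k' =>
      (forall t x, Icc 0 T t ->
         ex_derive (f t) x /\ ex_derive_on (Icc 0 T) (fun s => f s x) t) /\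
      Ck_strip T k' (dx f) /\ Ck_strip T k' (dt T f)
  end.

Definition Ck_strip_per (T : R) (k : nat) (f : R -> R -> R) : Prop :=
  Ck_strip T k f /\ (forall t x, Icc 0 T t -> f t (x + 1) = f t x).

Definition serre_solution (M : nat) (T : R) (eta0 u0 : R -> R)
    (eta u : R -> R -> R) : Prop :=
  Ck_strip_per T M eta /\ Ck_strip_per T M u /\
  (forall t x, Icc 0 T t -> Icc 0 1 x ->
     dt T eta t x + Derive (fun y => eta t y * u t y) x = 0 /\
     eta t x * dt T u t x + eta t x * dx eta t x + eta t x * u t x * dx u t x
     - 1 / 3 * Derive (fun y => eta t y ^ 3 *
                 (dt T (dx u) t y + u t y * dx (dx u) t y - dx u t y ^ 2)) x = 0) /\
  (forall x, Icc 0 1 x -> eta 0 x = eta0 x /\ u 0 x = u0 x).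

Definition hstep (N : nat) : R := / INR N.
Definition node (N i : nat) : R := INR i * hstep N.

Definition spline (r N : nat) (f : R -> R) : Prop :=
  Ck_per (r - 2) f /\
  (forall i, (1 <= i <= N)%nat ->
     exists a : nat -> R, forall x, Icc (node N (i - 1)) (node N i) x ->
       f x = sum_n (fun k => a k * x ^ k) (r - 1)).

(* A family of bases is phi : nat -> nat -> R -> R, where [phi N j], 1 <= j <= N,
   is the j-th basis function for h = 1/N. *)
Definition lincomb (phi : nat -> nat -> R -> R) (N : nat) (c : nat -> R) : R -> R :=
  fun x => sum_n_m (fun j => c j * phi N j x) 1 N.

Definition Qh (phi : nat -> nat -> R -> R) (N : nat) (v : R -> R) : R -> R :=
  lincomb phi N (fun j => v (node N j)).

Definition max1N (N : nat) (F : nat -> R) : R := MaxRlist (map F (seq 1 N)).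

Definition jpar (m : nat) : nat := if Nat.even m then 1%nat else 2%nat.

(* K is the order of smoothness meant by "sufficiently smooth".  The constants
   in [qi_moment] and [qi_product] may depend on w, f, g.  Derivatives of order
   r - 1 of splines are only piecewise defined: at the nodes Derive_n takes an
   irrelevant value, which does not affect the integrals. *)
Record quasi_interpolant_basis (r K : nat) (phi : nat -> nat -> R -> R) : Prop := {
  qi_spline : forall N j, (1 <= N)%nat -> (1 <= j <= N)%nat -> spline r N (phi N j);
  qi_span : forall N psi, (1 <= N)%nat -> spline r N psi ->
    exists c, forall x, psi x = lincomb phi N c x;
  qi_free : forall N c, (1 <= N)%nat -> (forall x, lincomb phi N c x = 0) ->
    forall j, (1 <= j <= N)%nat -> c j = 0;
  (* up to integer translations the support lies in an interval of length C h *)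
  qi_support : exists C, forall N j, (1 <= N)%nat -> (1 <= j <= N)%nat ->
    exists a, forall x, phi N j x <> 0 ->
      exists k : Z, Icc a (a + C * hstep N) (x + IZR k);
  qi_approx : exists C, forall v, Ck_per K v -> forall N, (1 <= N)%nat ->
    L2norm (fun x => Qh phi N v x - v x) <= C * hstep N ^ r * L2norm (Derive_n v r);
  qi_norm : exists C, forall N psi, (1 <= N)%nat -> spline r N psi ->
    L2norm psi <= C * / hstep N * max1N N (fun i => Rabs (L2ip psi (phi N i)));
  qi_moment : forall w nu kappa, Ck_per K w ->
    (nu <= r - 1)%nat -> (kappa <= r - 1)%nat ->
    exists C, forall N i, (1 <= N)%nat -> (1 <= i <= N)%nat ->
      Rabs (L2ip (Derive_n (Qh phi N w) nu) (Derive_n (phi N i) kappa)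
            - (-1) ^ kappa * hstep N * Derive_n w (nu + kappa) (node N i))
      <= C * hstep N ^ (2 * r + jpar (nu + kappa) - nu - kappa);
  qi_product : forall f g nu kappa, Ck_per K f -> Ck_per K g ->
    (nu <= r - 1)%nat -> (kappa <= r - 1)%nat ->
    exists C, forall N, (1 <= N)%nat ->
      max1N N (fun i => Rabs
        (L2ip (fun x => f x * Derive_n (Qh phi N g) nu x) (Derive_n (phi N i) kappa)
         - (-1) ^ kappa *
           L2ip (Qh phi N (Derive_n (fun x => f x * Derive_n g nu x) kappa)) (phi N i)))
      <= C * hstep N ^ (2 * r + jpar (nu + kappa) - nu - kappa)
}.

Definition semidiscrete_solution (r N : nat) (phi : nat -> nat -> R -> R) (T : R)
    (eta0 u0 : R -> R) (eta_h u_h : R -> R -> R) : Prop :=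
  (forall t, Icc 0 T t -> spline r N (eta_h t) /\ spline r N (u_h t)) /\
  (forall t x, Icc 0 T t ->
     ex_derive_on (Icc 0 T) (fun s => eta_h s x) t /\
     ex_derive_on (Icc 0 T) (fun s => u_h s x) t) /\
  (forall t, Icc 0 T t -> forall chi, spline r N chi ->
     L2ip (dt T eta_h t) chi
     + L2ip (Derive (fun x => eta_h t x * u_h t x)) chi = 0) /\
  (forall t, Icc 0 T t -> forall chi, spline r N chi ->
     L2ip (fun x => eta_h t x * dt T u_h t x) chi
     + 1 / 3 * L2ip (fun x => eta_h t x ^ 3 * dx (dt T u_h) t x) (Derive chi)
     + L2ip (fun x => eta_h t x * dx eta_h t x) chi
     + L2ip (fun x => eta_h t x * u_h t x * dx u_h t x) chi
     + 1 / 3 * L2ip (fun x => eta_h t x ^ 3 *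
                       (u_h t x * Derive_n (u_h t) 2 x - dx u_h t x ^ 2)) (Derive chi)
     = 0) /\
  (forall x, eta_h 0 x = Qh phi N eta0 x /\ u_h 0 x = Qh phi N u0 x).

(* Main.v *)
(* The quasi-interpolants (Q_h eta, Q_h u) of the exact solution serve as comparison
   functions.  Combining the product estimates of the quasi-interpolant with the
   approximation property shows that they satisfy the semidiscrete equations up to a
   defect which, tested with a spline chi, is O(h^r) (||chi|| + ||chi'||).  The hypotheses on
   the quasi-interpolant give constants for each single function only; since they
   bound linear functionals of the function, a gliding-hump argument turns
   them into one constant for all functions with bounded derivatives, hence into
   constants uniform in t.

   With e = Q_h eta - eta_h and v = Q_h u - u_h the error is measured by the energy
   ||e||^2 + (eta_h v, v) + (1/3) (eta_h^3 v', v'), which is equivalent to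
   ||e||^2 + ||v||^2 + ||v'||^2.  As long as the error is below h^2, inverse
   inequalities control the nonlinear terms, and Gronwall's lemma bounds the error by
   C h^r; since r >= 3, a continuity argument shows that the threshold h^2 is never
   reached.

   Existence and uniqueness follow from Picard iteration for the ODE of the spline
   coordinates, after replacing the state by its radial retraction to the
   h^2-neighbourhood of the comparison function, where the mass operator
   (eta_h ., .) + (1/3) (eta_h^3 .', .') is coercive and the right-hand side is
   Lipschitz.  Solutions of either problem stay inside the neighbourhood, so the
   retraction acts on neither. *)

From Stdlib Require Import ZArith Psatz.
From Stdlib Require Import FunctionalExtensionality ClassicalEpsilon.
Require Import Defs.

(** * Finite sums and linear systems *)

(** Differentiating [Q_h] loses one order per derivative, so the second derivative in the momentum
    flux would naively leave a defect of order r-2. Only the part linear in the interpolation error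
    is that large, and it can be brought against the derivative of a test spline: there the product
    estimate gives order r+1 on each basis function, and passing to all splines costs one power of
    h. The quadratic part is harmless for r at least 3.

    The energy contains no derivative of e. Hence the defect of the mass equation must be bounded by
    the norm of chi alone, and the error terms carrying e' or v'' must be absorbed into exact
    derivatives of periodic functions.

    The threshold h^2 beats the factor h^(-3/2) that an inverse inequality costs for a first
    derivative: below it e' and v' are O(h^(1/2)) in the maximum norm and eta_h stays positive.

    Uniform boundedness is proved on the unit ball of C^(k+2) for functionals continuous on C^k, so
    that the hump series can be differentiated termwise by a Taylor bound, without completeness of
    C^k. It is used twice because the product estimate is bilinear. *)

Fixpoint rsum (n : nat) (f : nat -> R) : R :=
  match n with O => 0 | S k => rsum k f + f k end.

Lemma rsum_ext n f g : (forall k, (k < n)%nat -> f k = g k) -> rsum n f = rsum n g.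
Proof.
  induction n; intros H; simpl; auto. rewrite IHn by (intros; apply H; lia).
  rewrite H by lia; reflexivity.
Qed.

Lemma rsum_plus n f g : rsum n (fun k => f k + g k) = rsum n f + rsum n g.
Proof. induction n; simpl; lra. Qed.

Lemma rsum_minus n f g : rsum n (fun k => f k - g k) = rsum n f - rsum n g.
Proof. induction n; simpl; lra. Qed.

Lemma rsum_scal n c f : rsum n (fun k => c * f k) = c * rsum n f.
Proof. induction n; simpl; lra. Qed.

Lemma rsum_scal_r n c f : rsum n (fun k => f k * c) = rsum n f * c.
Proof. induction n; simpl; lra. Qed.

Lemma rsum_zero n f : (forall k, (k < n)%nat -> f k = 0) -> rsum n f = 0.
Proof. induction n; intros H; simpl; auto. rewrite IHn, H by (auto; lia). lra. Qed.

Lemma rsum_le n f g : (forall k, (k < n)%nat -> f k <= g k) -> rsum n f <= rsum n g.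
Proof.
  induction n; intros H; simpl; try lra.
  pose proof (IHn ltac:(intros; apply H; lia)). pose proof (H n ltac:(lia)). lra.
Qed.

Lemma rsum_nonneg n f : (forall k, (k < n)%nat -> 0 <= f k) -> 0 <= rsum n f.
Proof.
  intros H. rewrite <- (rsum_zero n (fun _ => 0)) by auto. apply rsum_le; auto.
Qed.

Lemma rsum_abs n f : Rabs (rsum n f) <= rsum n (fun k => Rabs (f k)).
Proof.
  induction n; simpl. rewrite Rabs_R0; lra.
  pose proof (Rabs_triang (rsum n f) (f n)). lra.
Qed.

Lemma rsum_const n c : rsum n (fun _ => c) = INR n * c.
Proof. induction n; [simpl; lra|]. rewrite S_INR. simpl rsum. rewrite IHn. lra. Qed.

Lemma rsum_term_le n f k : (k < n)%nat -> (forall j, (j < n)%nat -> 0 <= f j) ->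
  f k <= rsum n f.
Proof.
  induction n; intros Hk H; [lia|]. simpl.
  destruct (Nat.eq_dec k n) as [->|].
  - pose proof (rsum_nonneg n f ltac:(intros; apply H; lia)). lra.
  - pose proof (IHn ltac:(lia) ltac:(intros; apply H; lia)).
    pose proof (H n ltac:(lia)). lra.
Qed.

Lemma rsum_exchange n m (f : nat -> nat -> R) :
  rsum n (fun i => rsum m (fun j => f i j)) = rsum m (fun j => rsum n (fun i => f i j)).
Proof.
  induction n; simpl.
  - symmetry; apply rsum_zero; auto.
  - rewrite IHn, <- rsum_plus. reflexivity.
Qed.

Lemma rsum_delta n k f : (k < n)%nat ->
  rsum n (fun j => (if Nat.eqb j k then 1 else 0) * f j) = f k.
Proof.
  induction n; intros H; [lia|]. simpl.
  destruct (Nat.eq_dec k n) as [->|].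
  - rewrite Nat.eqb_refl, rsum_zero; [lra|].
    intros j Hj. replace (Nat.eqb j n) with false; [lra|].
    symmetry; apply Nat.eqb_neq; lia.
  - replace (Nat.eqb n k) with false by (symmetry; apply Nat.eqb_neq; lia).
    rewrite IHn by lia. lra.
Qed.

Lemma rsum_shift n f : rsum (S n) f = f O + rsum n (fun k => f (S k)).
Proof. induction n; simpl in *; lra. Qed.

Lemma sum_n_rsum (f : nat -> R) n : sum_n f n = rsum (S n) f.
Proof.
  induction n; [rewrite sum_O; simpl; lra|].
  rewrite sum_Sn, IHn. reflexivity.
Qed.

Lemma sum_n_m_rsum (f : nat -> R) n :
  sum_n_m f 1 n = rsum n (fun k => f (S k)).
Proof.
  induction n.
  - rewrite sum_n_m_zero by lia. reflexivity.
  - rewrite sum_n_Sm by lia. rewrite IHn. reflexivity.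
Qed.

(* Elimination of the last unknown; the Schur complement stays positive definite. *)
Lemma pd_solve n : forall A : nat -> nat -> R,
  (forall z, (exists k, (k < n)%nat /\ z k <> 0) ->
     0 < rsum n (fun i => z i * rsum n (fun j => A i j * z j))) ->
  forall b, exists z, forall i, (i < n)%nat -> rsum n (fun j => A i j * z j) = b i.
Proof.
  induction n; intros A HA b.
  { exists (fun _ => 0); intros; lia. }
  (* The pivot is the value of the form at the last unit vector. *)
  assert (Hp : 0 < A n n).
  { specialize (HA (fun j => if Nat.eqb j n then 1 else 0)).
    assert (H1 : forall i, rsum (S n) (fun j => A i j * (if Nat.eqb j n then 1 else 0)) = A i n).
    { intros i. rewrite <- (rsum_delta (S n) n (fun j => A i j)) by lia.
      apply rsum_ext; intros; ring. }
    rewrite (rsum_ext (S n) _ (fun i => (if Nat.eqb i n then 1 else 0) * A i n)) in HA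
      by (intros; rewrite H1; reflexivity).
    rewrite rsum_delta in HA by lia. apply HA. exists n; split; [lia|].
    rewrite Nat.eqb_refl; lra. }
  set (A' := fun i j => A i j - A i n * A n j / A n n).
  destruct (IHn A') with (b := fun i => b i - A i n * b n / A n n) as [z Hz].
  { intros z [k [Hk Hz]].
    (* This last coordinate annihilates the last row of [A] applied to [w], so the form of [A] at
       [w] equals the form of [A'] at [z]; no symmetry of [A] is needed. *)
    set (zn := - rsum n (fun j => A n j * z j) / A n n).
    set (w := fun j => if Nat.eqb j n then zn else z j).
    assert (Hw : forall j, (j < n)%nat -> w j = z j).
    { intros j Hj. unfold w. replace (Nat.eqb j n) with false; auto.
      symmetry; apply Nat.eqb_neq; lia. }
    assert (Hwn : w n = zn) by (unfold w; rewrite Nat.eqb_refl; auto).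
    assert (HQ := HA w ltac:(exists k; split; [lia|rewrite Hw; auto])).
    simpl in HQ. rewrite Hwn in HQ.
    rewrite (rsum_ext n (fun j => A n j * w j) (fun j => A n j * z j)) in HQ
      by (intros; rewrite Hw; auto).
    replace (zn * (rsum n (fun j => A n j * z j) + A n n * zn)) with 0 in HQ
      by (unfold zn; field; lra).
    rewrite Rplus_0_r in HQ.
    erewrite rsum_ext; [exact HQ|]. intros i Hi. simpl. rewrite Hw by auto. f_equal.
    rewrite (rsum_ext n (fun j => A i j * w j) (fun j => A i j * z j))
      by (intros; rewrite Hw; auto).
    unfold A', zn.
    rewrite (rsum_ext n _ (fun j => A i j * z j - A i n / A n n * (A n j * z j)))
      by (intros; field; lra).
    rewrite rsum_minus, rsum_scal. field; lra. }
  set (zn := (b n - rsum n (fun j => A n j * z j)) / A n n).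
  exists (fun j => if Nat.eqb j n then zn else z j).
  assert (HS : forall i, rsum (S n) (fun j => A i j * (if Nat.eqb j n then zn else z j))
                 = rsum n (fun j => A i j * z j) + A i n * zn).
  { intros i. simpl. rewrite Nat.eqb_refl. f_equal. apply rsum_ext. intros j Hj.
    replace (Nat.eqb j n) with false; auto. symmetry; apply Nat.eqb_neq; lia. }
  intros i Hi. rewrite HS. destruct (Nat.eq_dec i n) as [->|].
  - unfold zn. field; lra.
  - specialize (Hz i ltac:(lia)). unfold A' in Hz.
    rewrite (rsum_ext n _ (fun j => A i j * z j - A i n / A n n * (A n j * z j))) in Hz
      by (intros; field; lra).
    rewrite rsum_minus, rsum_scal in Hz.
    apply (f_equal (fun x => x + A i n * b n / A n n)) in Hz.
    unfold zn. transitivity (b i - A i n * b n / A n n + A i n * b n / A n n); [|field; lra].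
    rewrite <- Hz. field; lra.
Qed.

Lemma rsum_sq_pos n z : (exists k, (k < n)%nat /\ z k <> 0) -> 0 < rsum n (fun k => z k * z k).
Proof.
  intros [k [Hk Hz]].
  apply Rlt_le_trans with (z k * z k). { nra. }
  apply (rsum_term_le n (fun k => z k * z k)); auto. intros; nra.
Qed.

(* Normal equations: [V^T V] is positive definite when [V] is injective. *)
Lemma left_inverse n m (V : nat -> nat -> R) :
  (forall z, (forall k, (k < m)%nat -> rsum n (fun j => V k j * z j) = 0) ->
     forall j, (j < n)%nat -> z j = 0) ->
  exists W : nat -> nat -> R, forall z j, (j < n)%nat ->
    rsum m (fun k => W j k * rsum n (fun i => V k i * z i)) = z j.
Proof.
  intros Hinj.
  assert (HQ : forall y z, rsum n (fun i => y i * rsum n (fun j => rsum m (fun k => V k i * V k j) * z j))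
     = rsum m (fun k => rsum n (fun i => V k i * y i) * rsum n (fun j => V k j * z j))).
  { intros y z.
    transitivity (rsum n (fun i => rsum m (fun k => V k i * y i * rsum n (fun j => V k j * z j)))).
    - apply rsum_ext; intros i Hi.
      rewrite (rsum_ext n _ (fun j => rsum m (fun k => V k i * (V k j * z j)))).
      2:{ intros j Hj. rewrite <- rsum_scal_r. apply rsum_ext; intros; ring. }
      rewrite rsum_exchange, <- rsum_scal. apply rsum_ext. intros k Hk.
      rewrite rsum_scal. ring.
    - rewrite rsum_exchange. apply rsum_ext; intros k Hk. apply rsum_scal_r. }
  assert (Hs : forall j, exists w, (j < n)%nat -> forall i, (i < n)%nat ->
     rsum n (fun l => rsum m (fun k => V k i * V k l) * w l) = if Nat.eqb i j then 1 else 0).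
  { intros j.
    destruct (pd_solve n (fun i l => rsum m (fun k => V k i * V k l)))
      with (b := fun i => if Nat.eqb i j then 1 else 0) as [w Hw]; [|exists w; auto].
    intros z [k [Hk Hz]]. rewrite HQ. apply rsum_sq_pos.
    destruct (classic (exists k0, (k0 < m)%nat /\ rsum n (fun i => V k0 i * z i) <> 0)); auto.
    exfalso. apply Hz. apply Hinj; auto. intros k0 Hk0. apply NNPP. intros Hn.
    apply H; exists k0; auto. }
  apply choice in Hs. destruct Hs as [w Hw].
  (* The matrix [(V^T V)^-1 V^T]: as [V^T V] is symmetric, the solution [w j] for the j-th unit
     vector is also the j-th row of the inverse. *)
  exists (fun j k => rsum n (fun i => V k i * w j i)).
  intros z j Hj. rewrite <- HQ.
  assert (Hsym : forall y z, rsum n (fun i => y i * rsum n (fun j => rsum m (fun k => V k i * V k j) * z j))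
    = rsum n (fun i => z i * rsum n (fun j => rsum m (fun k => V k i * V k j) * y j))).
  { intros. rewrite !HQ. apply rsum_ext; intros; ring. }
  rewrite Hsym. rewrite <- (rsum_delta n j z) by auto.
  apply rsum_ext. intros i Hi. rewrite Hw by auto. ring.
Qed.

(** * Piecewise continuous functions and their integrals *)

Definition elt (N i : nat) (x : R) : Prop := node N i < x < node N (S i).
Definition off (N : nat) (x : R) : Prop := exists i, (i < N)%nat /\ elt N i x.
(** A continuous extension of each piece to the whole line gives integrability up to the nodes,
    while the values at the nodes stay arbitrary. Second derivatives of splines need this freedom:
    at a node [Derive_n] may return a meaningless value. *)
Definition pwc (N : nat) (f : R -> R) : Prop :=
  forall i, (i < N)%nat -> exists g : R -> R,
    (forall x, continuous g x) /\ forall x, elt N i x -> f x = g x.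
(** [L2ip f g] unfolds to [I] of the product, so facts about [I] apply to inner products by
    conversion. *)
Definition I (f : R -> R) : R := RInt f 0 1.
Definition cont (f : R -> R) : Prop := forall x, continuous f x.

Lemma cont_plus f g : cont f -> cont g -> cont (fun x => f x + g x).
Proof. intros Hf Hg x. apply (continuous_plus f g); auto. Qed.
Lemma cont_minus f g : cont f -> cont g -> cont (fun x => f x - g x).
Proof. intros Hf Hg x. apply (continuous_minus f g); auto. Qed.
Lemma cont_mult f g : cont f -> cont g -> cont (fun x => f x * g x).
Proof. intros Hf Hg x. apply (continuous_mult f g); auto. Qed.
Lemma cont_const c : cont (fun _ => c).
Proof. intros x. apply continuous_const. Qed.
Lemma cont_pow f n : cont f -> cont (fun x => f x ^ n).
Proof. intros Hf. induction n; simpl. apply cont_const. apply cont_mult; auto. Qed.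
Lemma cont_rsum n (f : nat -> R -> R) : (forall k, (k < n)%nat -> cont (f k)) ->
  cont (fun x => rsum n (fun k => f k x)).
Proof.
  induction n; intros H; simpl. apply cont_const.
  apply cont_plus; auto.
Qed.

Lemma hstep_pos N : (1 <= N)%nat -> 0 < hstep N.
Proof. intros H. unfold hstep. apply Rinv_0_lt_compat. apply lt_0_INR; lia. Qed.
Lemma hstep_le1 N : (1 <= N)%nat -> hstep N <= 1.
Proof.
  intros H. unfold hstep. rewrite <- Rinv_1. apply Rinv_le_contravar; [lra|].
  replace 1 with (INR 1) by reflexivity. apply le_INR; lia.
Qed.
Lemma node_0 N : node N 0 = 0.
Proof. unfold node; simpl; lra. Qed.
Lemma node_N N : (1 <= N)%nat -> node N N = 1.
Proof. intros H. unfold node, hstep. field. apply not_0_INR; lia. Qed.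
Lemma node_S N i : node N (S i) = node N i + hstep N.
Proof. unfold node. rewrite S_INR. ring. Qed.
Lemma node_mono N i j : (1 <= N)%nat -> (i <= j)%nat -> node N i <= node N j.
Proof.
  intros HN H. unfold node. apply Rmult_le_compat_r. left; apply hstep_pos; auto.
  apply le_INR; auto.
Qed.

Lemma cont_pwc N f : cont f -> pwc N f.
Proof. intros H i Hi. exists f; auto. Qed.
Lemma pwc_ext N f g : (forall x, off N x -> f x = g x) -> pwc N f -> pwc N g.
Proof.
  intros E H i Hi. destruct (H i Hi) as [k [Hk Ek]]. exists k; split; auto.
  intros x Hx. rewrite <- E; auto. exists i; auto.
Qed.
Lemma pwc_plus N f g : pwc N f -> pwc N g -> pwc N (fun x => f x + g x).
Proof.
  intros Hf Hg i Hi. destruct (Hf i Hi) as [a [Ha Ea]], (Hg i Hi) as [b [Hb Eb]].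
  exists (fun x => a x + b x). split. apply cont_plus; auto.
  intros; rewrite Ea, Eb; auto.
Qed.
Lemma pwc_minus N f g : pwc N f -> pwc N g -> pwc N (fun x => f x - g x).
Proof.
  intros Hf Hg i Hi. destruct (Hf i Hi) as [a [Ha Ea]], (Hg i Hi) as [b [Hb Eb]].
  exists (fun x => a x - b x). split. apply cont_minus; auto.
  intros; rewrite Ea, Eb; auto.
Qed.
Lemma pwc_mult N f g : pwc N f -> pwc N g -> pwc N (fun x => f x * g x).
Proof.
  intros Hf Hg i Hi. destruct (Hf i Hi) as [a [Ha Ea]], (Hg i Hi) as [b [Hb Eb]].
  exists (fun x => a x * b x). split. apply cont_mult; auto.
  intros; rewrite Ea, Eb; auto.
Qed.
Lemma pwc_const N c : pwc N (fun _ => c).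
Proof. apply cont_pwc, cont_const. Qed.
Lemma pwc_opp N f : pwc N f -> pwc N (fun x => - f x).
Proof.
  intros Hf. apply pwc_ext with (fun x => -1 * f x). intros; ring.
  apply pwc_mult; auto. apply pwc_const.
Qed.
Lemma pwc_pow N f n : pwc N f -> pwc N (fun x => f x ^ n).
Proof. intros Hf. induction n; simpl. apply pwc_const. apply pwc_mult; auto. Qed.
Lemma pwc_rsum N n (f : nat -> R -> R) : (forall k, (k < n)%nat -> pwc N (f k)) ->
  pwc N (fun x => rsum n (fun k => f k x)).
Proof.
  induction n; intros H; simpl. apply pwc_const. apply pwc_plus; auto.
Qed.

Lemma elt_ex_RInt N i f : (1 <= N)%nat -> (i < N)%nat -> pwc N f ->
  ex_RInt f (node N i) (node N (S i)).
Proof.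
  intros HN Hi Hf. destruct (Hf i Hi) as [g [Hg E]].
  apply (ex_RInt_ext g).
  - intros x Hx. rewrite Rmin_left, Rmax_right in Hx by (apply node_mono; lia).
    symmetry; apply E; auto.
  - apply (ex_RInt_continuous g). intros; apply Hg.
Qed.

Lemma node_ex_RInt N n f : (1 <= N)%nat -> (n <= N)%nat -> pwc N f ->
  ex_RInt f 0 (node N n).
Proof.
  intros HN. induction n; intros Hn Hf.
  - rewrite node_0. apply ex_RInt_point.
  - apply ex_RInt_Chasles with (node N n). apply IHn; auto; lia.
    apply elt_ex_RInt; auto.
Qed.

Lemma pwc_ex_RInt N f : (1 <= N)%nat -> pwc N f -> ex_RInt f 0 1.
Proof. intros HN Hf. rewrite <- (node_N N) by auto. apply node_ex_RInt; auto. Qed.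

Lemma I_elt_sum N f : (1 <= N)%nat -> pwc N f ->
  I f = rsum N (fun i => RInt f (node N i) (node N (S i))).
Proof.
  intros HN Hf. unfold I. rewrite <- (node_N N) at 1 by auto.
  assert (H : forall n, (n <= N)%nat ->
    RInt f 0 (node N n) = rsum n (fun i => RInt f (node N i) (node N (S i)))).
  { induction n; intros Hn; simpl.
    - rewrite node_0. apply (RInt_point 0 f).
    - rewrite <- IHn by lia.
      change (RInt f 0 (node N (S n)) =
              plus (RInt f 0 (node N n)) (RInt f (node N n) (node N (S n)))).
      rewrite RInt_Chasles; auto. apply node_ex_RInt; auto; lia. apply elt_ex_RInt; auto. }
  apply H; auto.
Qed.

Lemma I_le N f g : (1 <= N)%nat -> pwc N f -> pwc N g ->
  (forall x, off N x -> f x <= g x) -> I f <= I g.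
Proof.
  intros HN Hf Hg H. rewrite (I_elt_sum N f), (I_elt_sum N g) by auto.
  apply rsum_le. intros i Hi. apply RInt_le.
  - apply node_mono; auto.
  - apply elt_ex_RInt; auto.
  - apply elt_ex_RInt; auto.
  - intros x Hx. apply H. exists i; auto.
Qed.

Lemma I_ext N f g : (1 <= N)%nat -> pwc N f ->
  (forall x, off N x -> f x = g x) -> I f = I g.
Proof.
  intros HN Hf H. assert (Hg : pwc N g) by (apply pwc_ext with f; auto).
  apply Rle_antisym; apply (I_le N); auto; intros x Hx; rewrite H; auto; lra.
Qed.

Lemma I_plus N f g : (1 <= N)%nat -> pwc N f -> pwc N g ->
  I (fun x => f x + g x) = I f + I g.
Proof. intros HN Hf Hg. apply (RInt_plus f g); apply (pwc_ex_RInt N); auto. Qed.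
Lemma I_minus N f g : (1 <= N)%nat -> pwc N f -> pwc N g ->
  I (fun x => f x - g x) = I f - I g.
Proof. intros HN Hf Hg. apply (RInt_minus f g); apply (pwc_ex_RInt N); auto. Qed.
Lemma I_scal N c f : (1 <= N)%nat -> pwc N f -> I (fun x => c * f x) = c * I f.
Proof. intros HN Hf. apply (RInt_scal f); apply (pwc_ex_RInt N); auto. Qed.
Lemma I_const c : I (fun _ => c) = c.
Proof. unfold I. rewrite RInt_const. change ((1 - 0) * c = c). lra. Qed.
Lemma I_rsum N n (f : nat -> R -> R) : (1 <= N)%nat ->
  (forall k, (k < n)%nat -> pwc N (f k)) ->
  I (fun x => rsum n (fun k => f k x)) = rsum n (fun k => I (f k)).
Proof.
  intros HN. induction n; intros H; simpl. apply I_const.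
  rewrite (I_plus N) by (auto; apply pwc_rsum; auto). rewrite IHn; auto.
Qed.
Lemma I_ge0 N f : (1 <= N)%nat -> pwc N f -> (forall x, off N x -> 0 <= f x) -> 0 <= I f.
Proof.
  intros HN Hf H. rewrite <- (I_const 0). apply (I_le N); auto. apply pwc_const.
Qed.
Lemma I_le_const N f c : (1 <= N)%nat -> pwc N f -> (forall x, off N x -> f x <= c) -> I f <= c.
Proof.
  intros HN Hf H. rewrite <- (I_const c). apply (I_le N); auto. apply pwc_const.
Qed.

(** [F] is differentiable only inside the element. It is compared with the primitive of the
    continuous extension of [f]: their difference is continuous up to the nodes with zero derivative
    inside, hence constant by the mean value theorem. *)
Lemma elt_FTC N i F f : (1 <= N)%nat -> (i < N)%nat -> pwc N f -> cont F ->
  (forall x, elt N i x -> is_derive F x (f x)) ->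
  RInt f (node N i) (node N (S i)) = F (node N (S i)) - F (node N i).
Proof.
  intros HN Hi Hf HF HD. destruct (Hf i Hi) as [g [Hg E]].
  assert (Hab : node N i < node N (S i)) by (rewrite node_S; pose proof (hstep_pos N HN); lra).
  set (a := node N i) in *. set (b := node N (S i)) in *.
  rewrite (RInt_ext f g).
  2:{ intros x Hx. rewrite Rmin_left, Rmax_right in Hx by lra. apply E; auto. }
  assert (HG : forall x, is_derive (fun y => RInt g a y) x (g x)).
  { intros x. apply (is_derive_RInt g _ a x); auto.
    exists (mkposreal 1 Rlt_0_1). intros y _. apply (RInt_correct g).
    apply (ex_RInt_continuous g). intros; apply Hg. }
  destruct (MVT_gen (fun x => F x - RInt g a x) a b (fun x => 0)) as [c [_ Hc]].
  - intros x Hx. rewrite Rmin_left, Rmax_right in Hx by lra.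
    replace 0 with (f x - g x) by (rewrite E; [lra|auto]).
    apply (is_derive_minus F (fun y => RInt g a y)); auto.
  - intros x Hx. apply continuity_pt_minus.
    apply continuity_pt_filterlim. apply HF.
    apply continuity_pt_filterlim. apply (ex_derive_continuous (fun y => RInt g a y)).
    eexists; apply HG.
  - rewrite RInt_point in Hc. change (zero : R) with 0 in Hc. lra.
Qed.

Lemma rsum_telescope n (F : nat -> R) : rsum n (fun i => F (S i) - F i) = F n - F O.
Proof. induction n; simpl; lra. Qed.

(** Continuity of [F] across the nodes makes the boundary terms of the elements telescope. For
    periodic [F] the right-hand side is zero; every integration by parts against a spline below has
    this form. *)
Lemma I_FTC N F f : (1 <= N)%nat -> pwc N f -> cont F ->
  (forall x, off N x -> is_derive F x (f x)) -> I f = F 1 - F 0.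
Proof.
  intros HN Hf HF HD. rewrite (I_elt_sum N) by auto.
  rewrite (rsum_ext N _ (fun i => F (node N (S i)) - F (node N i))).
  - rewrite (rsum_telescope N (fun i => F (node N i))), node_0, node_N; auto.
  - intros i Hi. apply elt_FTC; auto. intros x Hx. apply HD. exists i; auto.
Qed.

(** The integral of [(s f + t g)^2] is a nonnegative quadratic form in (s, t), so its discriminant
    has a sign. *)
Lemma CS N f g : (1 <= N)%nat -> pwc N f -> pwc N g ->
  I (fun x => f x * g x) ^ 2 <= I (fun x => f x ^ 2) * I (fun x => g x ^ 2).
Proof.
  intros HN Hf Hg.
  set (a := I (fun x => f x ^ 2)). set (b := I (fun x => f x * g x)).
  set (c := I (fun x => g x ^ 2)).
  assert (Hq : forall s t, 0 <= s * s * a + 2 * s * t * b + t * t * c).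
  { intros s t.
    replace (s * s * a + 2 * s * t * b + t * t * c) with (I (fun x => (s * f x + t * g x) ^ 2)).
    - apply (I_ge0 N); auto.
      + apply pwc_pow, pwc_plus; apply pwc_mult; auto; apply pwc_const.
      + intros. apply pow2_ge_0.
    - unfold a, b, c.
      rewrite <- !(I_scal N) by (auto; try (apply pwc_pow; auto); try (apply pwc_mult; auto)).
      rewrite <- !(I_plus N); auto.
      2-5: repeat first [ assumption | apply pwc_plus | apply pwc_mult | apply pwc_const | apply pwc_pow].
      f_equal. extensionality x. ring. }
  assert (Ha : 0 <= a) by (specialize (Hq 1 0); nra).
  assert (Hc : 0 <= c) by (specialize (Hq 0 1); nra).
  destruct (Req_dec a 0) as [Ha0|Ha0].
  - rewrite Ha0 in *. destruct (Req_dec b 0) as [->|Hb]; [nra|].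
    (* If [a] is zero and [b] is not, this choice of s would give the form the value -1. *)
    exfalso. specialize (Hq (- (c + 1) / (2 * b)) 1).
    replace ((- (c + 1) / (2 * b)) * (- (c + 1) / (2 * b)) * 0 + 2 * (- (c + 1) / (2 * b)) * 1 * b + 1 * 1 * c)
      with (-1) in Hq by (field; auto). lra.
  - specialize (Hq (-b) a). assert (0 < a) by lra. nra.
Qed.

Ltac pw := repeat first
  [ assumption | apply pwc_const | apply pwc_plus | apply pwc_minus | apply pwc_mult
  | apply pwc_opp | apply pwc_pow | (apply cont_pwc; assumption) ].

(** * The L2 norm on piecewise continuous functions *)

Lemma L2norm_sqrt f : L2norm f = sqrt (I (fun x => f x ^ 2)).
Proof.
  unfold L2norm, L2ip, I. do 2 f_equal. extensionality x. ring.
Qed.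

Lemma L2norm_pos f : 0 <= L2norm f.
Proof. apply sqrt_pos. Qed.

Lemma L2norm_sq N f : (1 <= N)%nat -> pwc N f -> L2norm f ^ 2 = I (fun x => f x ^ 2).
Proof.
  intros HN Hf. rewrite L2norm_sqrt, pow2_sqrt; auto.
  apply (I_ge0 N); auto. pw. intros; apply pow2_ge_0.
Qed.

Lemma L2norm_ext N f g : (1 <= N)%nat -> pwc N f -> (forall x, off N x -> f x = g x) ->
  L2norm f = L2norm g.
Proof.
  intros HN Hf H. rewrite !L2norm_sqrt. f_equal. apply (I_ext N); auto. pw.
  intros; rewrite H; auto.
Qed.

Lemma L2norm_CS N f g : (1 <= N)%nat -> pwc N f -> pwc N g ->
  Rabs (I (fun x => f x * g x)) <= L2norm f * L2norm g.
Proof.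
  intros HN Hf Hg. pose proof (CS N f g HN Hf Hg) as H.
  rewrite <- (L2norm_sq N f), <- (L2norm_sq N g) in H by auto.
  apply Rabs_le_between. pose proof (L2norm_pos f). pose proof (L2norm_pos g).
  assert (0 <= L2norm f * L2norm g) by (apply Rmult_le_pos; auto).
  nra.
Qed.

Lemma L2norm_triang N f g : (1 <= N)%nat -> pwc N f -> pwc N g ->
  L2norm (fun x => f x + g x) <= L2norm f + L2norm g.
Proof.
  intros HN Hf Hg.
  assert (E : L2norm (fun x => f x + g x) ^ 2 =
    L2norm f ^ 2 + 2 * I (fun x => f x * g x) + L2norm g ^ 2).
  { rewrite !(L2norm_sq N) by (auto; pw).
    rewrite <- (I_scal N), <- !(I_plus N) by (auto; pw).
    f_equal. extensionality x. ring. }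
  pose proof (L2norm_CS N f g HN Hf Hg) as H. apply Rabs_le_between in H.
  pose proof (L2norm_pos f). pose proof (L2norm_pos g).
  pose proof (L2norm_pos (fun x => f x + g x)). nra.
Qed.

Lemma L2norm_scal N c f : (1 <= N)%nat -> pwc N f ->
  L2norm (fun x => c * f x) = Rabs c * L2norm f.
Proof.
  intros HN Hf. apply Rsqr_inj; [apply L2norm_pos|apply Rmult_le_pos; [apply Rabs_pos|apply L2norm_pos]|].
  rewrite !Rsqr_pow2, Rpow_mult_distr, pow2_abs, !(L2norm_sq N) by (auto; pw).
  rewrite <- (I_scal N) by (auto; pw). f_equal. extensionality x. ring.
Qed.

Lemma L2norm_le N f g : (1 <= N)%nat -> pwc N f -> pwc N g ->
  (forall x, off N x -> Rabs (f x) <= Rabs (g x)) -> L2norm f <= L2norm g.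
Proof.
  intros HN Hf Hg H. rewrite !L2norm_sqrt. apply sqrt_le_1_alt.
  apply (I_le N); auto; pw. intros x Hx. rewrite <- (pow2_abs (g x)). apply pow_maj_Rabs; auto.
Qed.

Lemma L2norm_le_const N f c : (1 <= N)%nat -> pwc N f -> 0 <= c ->
  (forall x, off N x -> Rabs (f x) <= c) -> L2norm f <= c.
Proof.
  intros HN Hf Hc H. rewrite L2norm_sqrt. rewrite <- (sqrt_pow2 c) by auto.
  apply sqrt_le_1_alt. apply (I_le_const N); auto; pw.
  intros x Hx. apply pow_maj_Rabs. auto.
Qed.

Lemma L2norm_mult N f g B : (1 <= N)%nat -> pwc N f -> pwc N g -> 0 <= B ->
  (forall x, off N x -> Rabs (f x) <= B) -> L2norm (fun x => f x * g x) <= B * L2norm g.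
Proof.
  intros HN Hf Hg HB H. rewrite <- (Rabs_pos_eq B), <- (L2norm_scal N B) by auto.
  apply (L2norm_le N); auto; pw. intros x Hx. rewrite !Rabs_mult.
  apply Rmult_le_compat_r; [apply Rabs_pos|]. rewrite (Rabs_pos_eq B); auto.
Qed.

(** Continuity keeps the square positive on an interval around [x], and the rest contributes nothing
    negative. This is what makes the Gram matrices below positive definite. *)
Lemma cont_RInt_sq_pos f a b x : a < x < b -> cont f -> f x <> 0 -> 0 < RInt (fun x => f x ^ 2) a b.
Proof.
  intros Hx Hf Hnz.
  assert (Hc : cont (fun x => f x ^ 2)) by (apply cont_pow; auto).
  assert (Hp : 0 < f x ^ 2) by (apply pow2_gt_0; auto).
  destruct (proj1 (filterlim_locally _ _) (Hc x) (mkposreal _ Hp)) as [d Hd].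
  set (l := Rmax a (x - d)). set (u := Rmin b (x + d)).
  assert (Hd0 := cond_pos d).
  assert (Hl : a <= l /\ x - d <= l /\ l < x).
  { unfold l; repeat split. apply Rmax_l. apply Rmax_r. apply Rmax_lub_lt; lra. }
  assert (Hu : u <= b /\ u <= x + d /\ x < u).
  { unfold u; repeat split. apply Rmin_l. apply Rmin_r. apply Rmin_glb_lt; lra. }
  assert (Hex : forall a b, ex_RInt (fun x => f x ^ 2) a b).
  { intros. apply (ex_RInt_continuous (fun x => f x ^ 2)). intros; apply Hc. }
  assert (E : RInt (fun x => f x ^ 2) a b =
     RInt (fun x => f x ^ 2) a l + RInt (fun x => f x ^ 2) l u + RInt (fun x => f x ^ 2) u b).
  { rewrite <- (RInt_Chasles (fun x => f x ^ 2) a l b) by auto.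
    rewrite <- (RInt_Chasles (fun x => f x ^ 2) l u b) by auto.
    unfold plus; simpl. ring. }
  rewrite E.
  assert (0 <= RInt (fun x => f x ^ 2) a l).
  { apply RInt_ge_0; auto. lra. intros; apply pow2_ge_0. }
  assert (0 <= RInt (fun x => f x ^ 2) u b).
  { apply RInt_ge_0; auto. lra. intros; apply pow2_ge_0. }
  assert (0 < RInt (fun x => f x ^ 2) l u).
  { apply RInt_gt_0. lra. 2: intros; apply Hc.
    intros y Hy. assert (Hb : ball x d y).
    { unfold ball; simpl; unfold AbsRing_ball, abs, minus, plus, opp; simpl.
      apply Rabs_def1; lra. }
    specialize (Hd y Hb). unfold ball in Hd; simpl in Hd;
      unfold AbsRing_ball, abs, minus, plus, opp in Hd; simpl in Hd.
    apply Rabs_def2 in Hd. lra. }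
  lra.
Qed.

(** * Polynomials *)

Definition pol (n : nat) (a : nat -> R) (x : R) : R := rsum (S n) (fun k => a k * x ^ k).
(** Coefficients of the derivative of the polynomial with coefficients [a]. *)
Definition dco (a : nat -> R) (k : nat) : R := INR (S k) * a (S k).

Lemma pol_0 a x : pol 0 a x = a O.
Proof. unfold pol; simpl. ring. Qed.

Lemma pol_S n a x : pol (S n) a x = a O + x * pol n (fun k => a (S k)) x.
Proof.
  unfold pol. rewrite rsum_shift, <- rsum_scal.
  f_equal. simpl; ring. apply rsum_ext; intros. simpl; ring.
Qed.

Lemma is_derive_rsum n (f : nat -> R -> R) (d : nat -> R) x :
  (forall k, (k < n)%nat -> is_derive (f k) x (d k)) ->
  is_derive (fun y => rsum n (fun k => f k y)) x (rsum n d).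
Proof.
  induction n; intros H; simpl.
  - apply (is_derive_const 0 x).
  - apply (is_derive_plus (fun y => rsum n (fun k => f k y)) (f n)); auto.
Qed.

Lemma is_derive_pol n a x : is_derive (pol (S n) a) x (pol n (dco a) x).
Proof.
  apply is_derive_ext with (fun x => a O + rsum (S n) (fun k => a (S k) * x ^ S k)).
  { intros t. unfold pol. rewrite (rsum_shift (S n)). f_equal. simpl; ring. }
  replace (pol n (dco a) x) with (0 + pol n (dco a) x) by ring.
  apply (is_derive_plus (fun _ => a O)). apply (is_derive_const (a O) x).
  apply is_derive_rsum. intros k Hk. unfold dco.
  replace (INR (S k) * a (S k) * x ^ k) with (a (S k) * (INR (S k) * 1 * x ^ k)) by ring.
  apply (is_derive_scal (fun x => x ^ S k)).
  apply (is_derive_pow (fun x => x) (S k) x 1). apply (is_derive_id x).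
Qed.

Lemma cont_pol n a : cont (pol n a).
Proof.
  unfold pol. apply (cont_rsum (S n) (fun k x => a k * x ^ k)). intros k Hk.
  apply cont_mult. apply cont_const. apply cont_pow. intros x; apply continuous_id.
Qed.

Lemma pol_raise n a : exists b, forall x, pol (S n) b x = pol n a x.
Proof.
  exists (fun k => if Nat.eqb k (S n) then 0 else a k). intros x. unfold pol.
  replace (S (S n)) with (S (S n)) by auto. cbn [rsum]. rewrite Nat.eqb_refl.
  replace (Nat.eqb n (S n)) with false by (symmetry; apply Nat.eqb_neq; lia).
  rewrite (rsum_ext n _ (fun k => a k * x ^ k)). ring.
  intros k Hk. replace (Nat.eqb k (S n)) with false; auto. symmetry; apply Nat.eqb_neq; lia.
Qed.

Lemma pol_plus n a b x : pol n (fun k => a k + b k) x = pol n a x + pol n b x.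
Proof. unfold pol. rewrite <- rsum_plus. apply rsum_ext; intros; ring. Qed.

Lemma pol_scal n c a x : pol n (fun k => c * a k) x = c * pol n a x.
Proof. unfold pol. rewrite <- rsum_scal. apply rsum_ext; intros; ring. Qed.

Lemma pol_rsum n m (a : nat -> nat -> R) x :
  pol n (fun k => rsum m (fun j => a j k)) x = rsum m (fun j => pol n (a j) x).
Proof.
  unfold pol. rewrite rsum_exchange. apply rsum_ext; intros. rewrite rsum_scal_r; auto.
Qed.

(** Induction in Horner form, with [c + h s] as the outer factor. *)
Lemma pol_affine n : forall a c h, exists b, forall s, pol n a (c + h * s) = pol n b s.
Proof.
  induction n; intros a c h.
  - exists a. intros; rewrite !pol_0; auto.
  - destruct (IHn (fun k => a (S k)) c h) as [b Hb].
    destruct (pol_raise n b) as [b' Hb'].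
    exists (fun k => c * b' k + (match k with O => a O | S j => h * b j end)).
    intros s. rewrite pol_plus, pol_scal, Hb', pol_S, Hb.
    rewrite (pol_S n (fun k => match k with O => a O | S j => h * b j end)), pol_scal. ring.
Qed.

Lemma cont_zero_at0 f : cont f -> (forall x, 0 < x < 1 -> f x = 0) -> f 0 = 0.
Proof.
  intros Hf H. apply NNPP. intros Hn.
  destruct (proj1 (filterlim_locally _ _) (Hf 0) (mkposreal _ (Rabs_pos_lt _ Hn))) as [d Hd].
  assert (Hd0 := cond_pos d).
  set (y := Rmin (d / 2) (1 / 2)).
  assert (Hy : 0 < y /\ y <= d / 2 /\ y <= 1 / 2).
  { unfold y; repeat split. apply Rmin_glb_lt; lra. apply Rmin_l. apply Rmin_r. }
  specialize (Hd y). unfold ball in Hd; simpl in Hd;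
      unfold AbsRing_ball, abs, minus, plus, opp in Hd; simpl in Hd.
  rewrite (H y) in Hd by lra.
  assert (Rabs (0 + - f 0) < Rabs (f 0)). { apply Hd. rewrite Rabs_pos_eq; lra. }
  rewrite Rplus_0_l, Rabs_Ropp in H0. lra.
Qed.

Lemma pol_zero n : forall a, (forall x, 0 < x < 1 -> pol n a x = 0) ->
  forall k, (k <= n)%nat -> a k = 0.
Proof.
  induction n; intros a H k Hk.
  - replace k with O by lia. rewrite <- (H (1/2)) by lra. rewrite pol_0; auto.
  - assert (H0 : a O = 0).
    { pose proof (cont_zero_at0 _ (cont_pol (S n) a) H) as E. rewrite pol_S in E. lra. }
    destruct k; auto.
    apply (IHn (fun k => a (S k))); [|lia].
    intros x Hx. specialize (H x Hx). rewrite pol_S, H0 in H.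
    apply Rmult_eq_reg_l with x; lra.
Qed.

(** Rolle: n+1 increasing zeros leave n increasing zeros of the derivative, so all coefficients but
    the constant one vanish by induction. It makes a spline piece determined by finitely many of its
    values. *)
Lemma pol_roots n : forall a z, (forall k, (k <= n)%nat -> pol n a (z k) = 0) ->
  (forall k, (k < n)%nat -> z k < z (S k)) -> forall k, (k <= n)%nat -> a k = 0.
Proof.
  induction n; intros a z Hz Hm k Hk.
  - replace k with O by lia. rewrite <- (Hz O) by lia. rewrite pol_0; auto.
  - assert (Hr : forall k, exists y, (k <= n)%nat -> z k < y < z (S k) /\ pol n (dco a) y = 0).
    { intros j. destruct (classic (j <= n)%nat) as [Hj|Hj]; [|exists 0; tauto].
      assert (Hlt := Hm j ltac:(lia)).
      destruct (MVT_cor2 (pol (S n) a) (pol n (dco a)) (z j) (z (S j)) Hlt) as [y [Hy1 Hy2]].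
      - intros c _. apply is_derive_Reals, is_derive_pol.
      - exists y. intros _. split; auto. rewrite !Hz in Hy1 by lia.
        apply Rmult_eq_reg_r with (z (S j) - z j); lra. }
    apply choice in Hr. destruct Hr as [y Hy].
    assert (Hd : forall k, (k <= n)%nat -> dco a k = 0).
    { apply (IHn _ y). intros j Hj; apply (Hy j); auto.
      intros j Hj. destruct (Hy j ltac:(lia)), (Hy (S j) ltac:(lia)). lra. }
    assert (HS : forall j, (j <= n)%nat -> a (S j) = 0).
    { intros j Hj. specialize (Hd j Hj). unfold dco in Hd.
      apply Rmult_eq_reg_l with (INR (S j)); [lra|]. apply not_0_INR; lia. }
    destruct k; [|apply HS; lia].
    rewrite <- (Hz O) by lia. rewrite pol_S. unfold pol. rewrite rsum_zero; [ring|].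
    intros j Hj. rewrite HS by lia. ring.
Qed.

(** Each coefficient is a linear functional on polynomials, hence the inner product with a dual
    polynomial [d k], found by inverting the Gram matrix of the monomials; Cauchy-Schwarz does the
    rest. *)
Lemma pol_coef_bound n : exists C, 0 <= C /\ forall a k, (k <= n)%nat ->
  Rabs (a k) <= C * L2norm (pol n a).
Proof.
  assert (H1 : (1 <= 1)%nat) by lia.
  assert (Hp : forall a, pwc 1 (pol n a)) by (intros; apply cont_pwc, cont_pol).
  assert (Hm : pwc 1 (fun x : R => x)).
  { apply cont_pwc. intros x; apply continuous_id. }
  set (A := fun i j => I (fun x => x ^ i * x ^ j)).
  assert (HA : forall y z, rsum (S n) (fun i => y i * rsum (S n) (fun j => A i j * z j))
     = I (fun x => pol n y x * pol n z x)).
  { intros y z.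
    transitivity (I (fun x => rsum (S n) (fun i => y i * rsum (S n) (fun j => z j * (x ^ i * x ^ j))))).
    - rewrite (I_rsum 1); auto.
      2:{ intros. apply pwc_mult; [apply pwc_const|]. apply pwc_rsum. intros; pw; auto. }
      apply rsum_ext. intros i Hi. rewrite (I_scal 1); auto.
      2:{ apply pwc_rsum; intros; pw; auto. }
      rewrite (I_rsum 1); auto. 2: intros; pw; auto.
      f_equal. apply rsum_ext; intros j Hj. rewrite (I_scal 1); auto. unfold A; ring. pw; auto.
    - f_equal. extensionality x. unfold pol. rewrite <- rsum_scal_r. apply rsum_ext; intros i Hi.
      rewrite <- !rsum_scal. apply rsum_ext; intros; ring. }
  assert (Hd : forall k, exists d, (k <= n)%nat -> forall a, I (fun x => pol n d x * pol n a x) = a k).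
  { intros k.
    destruct (pd_solve (S n) A) with (b := fun i => if Nat.eqb i k then 1 else 0) as [d Hd].
    - intros z [j [Hj Hz]]. rewrite HA.
      assert (Hex : exists x, 0 < x < 1 /\ pol n z x <> 0).
      { apply NNPP. intros Hno. apply Hz. apply (pol_zero n z); [|lia].
        intros x Hx. apply NNPP. intros E; apply Hno; exists x; auto. }
      destruct Hex as [x [Hx Hnz]].
      replace (fun x => pol n z x * pol n z x) with (fun x => pol n z x ^ 2)
        by (extensionality y; ring).
      apply (cont_RInt_sq_pos (pol n z) 0 1 x); auto. apply cont_pol.
    - exists d. intros Hk a.
      rewrite <- (rsum_delta (S n) k a) by lia.
      transitivity (I (fun x => pol n a x * pol n d x)). f_equal; extensionality x; ring.
      rewrite <- HA. apply rsum_ext. intros i Hi. rewrite Hd by auto. ring. }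
  apply choice in Hd. destruct Hd as [d Hd].
  exists (rsum (S n) (fun k => L2norm (pol n (d k)))). split.
  { apply rsum_nonneg; intros; apply L2norm_pos. }
  intros a k Hk. rewrite <- (Hd k Hk a) at 1.
  eapply Rle_trans. apply (L2norm_CS 1); auto.
  apply Rmult_le_compat_r. apply L2norm_pos.
  apply (rsum_term_le (S n) (fun k => L2norm (pol n (d k)))). lia. intros; apply L2norm_pos.
Qed.

Lemma pol_sup n a s B : 0 <= s <= 1 -> (forall k, (k <= n)%nat -> Rabs (a k) <= B) ->
  Rabs (pol n a s) <= INR (S n) * B.
Proof.
  intros Hs H. unfold pol. eapply Rle_trans. apply rsum_abs.
  rewrite <- rsum_const. apply rsum_le. intros k Hk.
  rewrite Rabs_mult, <- RPow_abs, (Rabs_pos_eq s) by lra.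
  assert (0 <= s ^ k <= 1).
  { split. apply pow_le; lra. rewrite <- (pow1 k). apply pow_incr; lra. }
  specialize (H k ltac:(lia)). pose proof (Rabs_pos (a k)). nra.
Qed.

Lemma is_derive_eq (f : R -> R) (x l1 l2 : R) : is_derive f x l1 -> is_derive f x l2 -> l1 = l2.
Proof. intros H1 H2. rewrite <- (is_derive_unique _ _ _ H1). apply is_derive_unique; auto. Qed.

Lemma pol_affine_derive n a b c h : (forall s, pol (S n) a (c + h * s) = pol (S n) b s) ->
  forall s, h * pol n (dco a) (c + h * s) = pol n (dco b) s.
Proof.
  intros H s. apply is_derive_eq with (pol (S n) b) s; [|apply is_derive_pol].
  apply is_derive_ext with (fun s => pol (S n) a (c + h * s)). auto.
  apply (is_derive_comp (pol (S n) a) (fun s => c + h * s)). apply is_derive_pol.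
  auto_derive; auto. ring.
Qed.

(** Inverse inequalities by scaling to the unit interval. The chain rule yields one factor [h] per
    derivative, the change of variables in the norm a factor [sqrt h]; both are kept on the left to
    avoid divisions. *)
Lemma pol_inverse m : exists C, 0 <= C /\ forall a c h x, 0 < h -> c <= x <= c + h ->
  let s := sqrt (RInt (fun y => pol (S (S m)) a y ^ 2) c (c + h)) in
  Rabs (pol (S (S m)) a x) * sqrt h <= C * s /\
  Rabs (pol (S m) (dco a) x) * (h * sqrt h) <= C * s /\
  Rabs (pol m (dco (dco a)) x) * (h ^ 2 * sqrt h) <= C * s.
Proof.
  destruct (pol_coef_bound (S (S m))) as [C [HC H]].
  set (K := INR (S (S (S m)))).
  assert (HK : 1 <= K) by (unfold K; rewrite !S_INR; pose proof (pos_INR m); lra).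
  (* One factor [K] counts the monomials, and each of up to two differentiations multiplies a
     coefficient by at most [K]. *)
  exists (K * (K * K * C)). split. { repeat apply Rmult_le_pos; lra. }
  intros a c h x Hh Hx s.
  destruct (pol_affine (S (S m)) a c h) as [b Hb].
  pose proof (pol_affine_derive _ _ _ _ _ Hb) as Hb1.
  assert (Hb2 : forall s, h * (h * pol m (dco (dco a)) (c + h * s)) = pol m (dco (dco b)) s).
  { intros t. rewrite <- (pol_affine_derive m (fun k => h * dco a k) (dco b) c h).
    - rewrite <- !pol_scal. unfold pol, dco.
      apply rsum_ext; intros; ring.
    - intros u. rewrite pol_scal. apply Hb1. }
  set (t := (x - c) / h).
  assert (Ht : 0 <= t <= 1).
  { unfold t; split. apply Rdiv_le_0_compat; lra. apply Rmult_le_reg_r with h; [lra|]. unfold Rdiv. rewrite Rmult_assoc, Rinv_l; lra. }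
  assert (Ex : x = c + h * t) by (unfold t; field; lra).
  set (L := L2norm (pol (S (S m)) b)).
  (* Substituting [c + h y] in the integral of the square brings out a factor [h]. *)
  assert (EL : sqrt h * L = s).
  { unfold L, s. rewrite L2norm_sqrt, <- sqrt_mult.
    2: lra. 2: { apply (I_ge0 1); auto. apply pwc_pow, cont_pwc, cont_pol. intros; apply pow2_ge_0. }
    f_equal. unfold I. rewrite <- (RInt_scal (fun x => pol (S (S m)) b x ^ 2)).
    2: { apply (pwc_ex_RInt 1); auto. apply pwc_pow, cont_pwc, cont_pol. }
    pose proof (RInt_comp_lin (fun y => pol (S (S m)) a y ^ 2) h c 0 1) as E.
    rewrite Rmult_0_r, Rmult_1_r, Rplus_0_l, (Rplus_comm h c) in E. rewrite <- E.
    - f_equal. extensionality y. rewrite (Rplus_comm (h * y) c), Hb. reflexivity.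
    - apply (ex_RInt_continuous (fun y => pol (S (S m)) a y ^ 2)). intros; apply cont_pow, cont_pol. }
  assert (HL : 0 <= L) by apply L2norm_pos.
  assert (Hsh : 0 < sqrt h) by (apply sqrt_lt_R0; auto).
  assert (B0 : forall k, (k <= S (S m))%nat -> Rabs (b k) <= C * L) by (intros; apply H; auto).
  assert (HCL : 0 <= C * L) by (apply Rmult_le_pos; auto).
  assert (HKk : forall k, (k <= S m)%nat -> 0 <= INR (S k) <= K).
  { intros k Hk; split. apply pos_INR. apply le_INR; lia. }
  assert (B1 : forall k, (k <= S m)%nat -> Rabs (dco b k) <= K * (C * L)).
  { intros k Hk. unfold dco. rewrite Rabs_mult, (Rabs_pos_eq (INR (S k))) by apply pos_INR.
    pose proof (HKk k Hk). specialize (B0 (S k) ltac:(lia)). pose proof (Rabs_pos (b (S k))).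
    apply Rmult_le_compat; lra. }
  assert (B2 : forall k, (k <= m)%nat -> Rabs (dco (dco b) k) <= K * (K * (C * L))).
  { intros k Hk. unfold dco at 1. rewrite Rabs_mult, (Rabs_pos_eq (INR (S k))) by apply pos_INR.
    pose proof (HKk k ltac:(lia)). specialize (B1 (S k) ltac:(lia)). pose proof (Rabs_pos (dco b (S k))).
    apply Rmult_le_compat; lra. }
  apply (pol_sup _ _ t) in B0; auto. apply (pol_sup _ _ t) in B1; auto. apply (pol_sup _ _ t) in B2; auto.
  pose proof (HKk (S m) ltac:(lia)) as K1. pose proof (HKk m ltac:(lia)) as K2.
  fold K in B0.
  rewrite <- Hb1, Rabs_mult, (Rabs_pos_eq h) in B1 by lra.
  rewrite <- Hb2, !Rabs_mult, (Rabs_pos_eq h) in B2 by lra.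
  rewrite <- Hb in B0. rewrite <- Ex in B0, B1, B2.
  assert (HKC : 0 <= K * (C * L)) by (apply Rmult_le_pos; lra).
  assert (HKKC : 0 <= K * (K * (C * L))) by (apply Rmult_le_pos; lra).
  assert (HKKKC : K * (C * L) <= K * (K * (K * (C * L)))) by nra.
  rewrite <- EL.
  replace (K * (K * K * C) * (sqrt h * L)) with (K * (K * (K * (C * L))) * sqrt h) by ring.
  repeat split.
  - apply Rmult_le_compat_r; lra.
  - rewrite <- Rmult_assoc. apply Rmult_le_compat_r; [lra|]. rewrite Rmult_comm.
    eapply Rle_trans; [exact B1|]. nra.
  - rewrite <- Rmult_assoc. apply Rmult_le_compat_r; [lra|].
    replace (Rabs (pol m (dco (dco a)) x) * h ^ 2) with (h * (h * Rabs (pol m (dco (dco a)) x))) by ring.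
    eapply Rle_trans; [exact B2|]. apply Rmult_le_compat_r; lra.
Qed.

(** * Periodic splines *)

Lemma periodic_Z f : (forall x, f (x + 1) = f x :> R) -> forall (k : Z) x, f (x + IZR k) = f x.
Proof.
  intros H.
  assert (Hn : forall (n : nat) x, f (x + INR n) = f x).
  { induction n; intros x. f_equal; simpl; ring.
    rewrite S_INR, <- Rplus_assoc, H. apply IHn. }
  intros k x. destruct (Z.le_gt_cases 0 k).
  - rewrite <- (Z2Nat.id k) by auto. rewrite <- INR_IZR_INZ. apply Hn.
  - rewrite <- (Hn (Z.to_nat (- k)) (x + IZR k)). rewrite INR_IZR_INZ, Z2Nat.id by lia.
    f_equal. rewrite opp_IZR. ring.
Qed.

Lemma periodic_repr f x : (forall x, f (x + 1) = f x :> R) -> exists y, 0 <= y < 1 /\ f x = f y.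
Proof.
  intros H. exists (frac_part x). destruct (base_fp x). split; [lra|].
  rewrite <- (periodic_Z f H (Int_part x) (frac_part x)). f_equal. unfold frac_part. ring.
Qed.

Lemma elt_cover N x : (1 <= N)%nat -> 0 <= x < 1 -> exists i, (i < N)%nat /\ node N i <= x < node N (S i).
Proof.
  intros HN Hx.
  assert (H : forall n, (n <= N)%nat -> x < node N n -> exists i, (i < n)%nat /\ node N i <= x < node N (S i)).
  { induction n; intros Hn Hlt. rewrite node_0 in Hlt; lra.
    destruct (Rlt_dec x (node N n)) as [H1|H1].
    - destruct (IHn ltac:(lia) H1) as [i [Hi Hi']]. exists i; split; auto.
    - exists n; split; auto. lra. }
  apply H; auto. rewrite node_N; auto. lra.
Qed.

Lemma off_01 N x : (1 <= N)%nat -> off N x -> 0 < x < 1.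
Proof.
  intros HN [i [Hi Hx]]. unfold elt in Hx.
  pose proof (node_mono N 0 i HN ltac:(lia)). pose proof (node_mono N (S i) N HN ltac:(lia)).
  rewrite node_0 in *. rewrite node_N in * by auto. lra.
Qed.

Lemma locally_elt N i x : elt N i x -> locally x (elt N i).
Proof.
  intros [H1 H2]. apply (locally_interval _ x (node N i) (node N (S i))); simpl; auto.
  intros y Hy1 Hy2; split; auto.
Qed.

Lemma Ck_per_plus k f g : Ck_per k f -> Ck_per k g -> Ck_per k (fun x => f x + g x).
Proof.
  intros [Pf Df] [Pg Dg]. split. intros; rewrite Pf, Pg; auto.
  intros j Hj x.
  assert (Ef : forall y l, (l <= j)%nat -> ex_derive_n f l y) by (intros; apply Df; lia).
  assert (Eg : forall y l, (l <= j)%nat -> ex_derive_n g l y) by (intros; apply Dg; lia).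
  split.
  - apply ex_derive_n_plus; apply filter_forall; auto.
  - apply continuous_ext with (fun x => Derive_n f j x + Derive_n g j x).
    intros y. symmetry; apply Derive_n_plus; apply filter_forall; auto.
    apply (continuous_plus (Derive_n f j) (Derive_n g j)). apply Df; auto. apply Dg; auto.
Qed.

Lemma Ck_per_scal k c f : Ck_per k f -> Ck_per k (fun x => c * f x).
Proof.
  intros [Pf Df]. split. intros; rewrite Pf; auto.
  intros j Hj x. split.
  - apply ex_derive_n_scal_l. apply Df; auto.
  - apply continuous_ext with (fun x => c * Derive_n f j x).
    intros y. symmetry; apply Derive_n_scal_l.
    apply (continuous_scal_r c (Derive_n f j)). apply Df; auto.
Qed.

Lemma Ck_per_zero k : Ck_per k (fun _ => 0).
Proof.
  split; auto. intros j _ x. destruct j; split; simpl; auto.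
  apply continuous_const. apply ex_derive_ext with (fun _ => 0); [|apply ex_derive_const].
  intros t. symmetry. destruct j; auto. apply (Derive_n_const j 0).
  apply continuous_ext with (fun _ => 0); [|apply continuous_const].
  intros t. symmetry. apply (Derive_n_const j 0).
Qed.

Lemma Ck_per_rsum k n (f : nat -> R -> R) : (forall j, (j < n)%nat -> Ck_per k (f j)) ->
  Ck_per k (fun x => rsum n (fun j => f j x)).
Proof.
  induction n; intros H; simpl. apply Ck_per_zero.
  apply (Ck_per_plus k (fun x => rsum n (fun j => f j x)) (f n)); auto.
Qed.

Lemma max1N_le N F B : (1 <= N)%nat -> (forall i, (1 <= i <= N)%nat -> F i <= B) -> max1N N F <= B.
Proof.
  intros HN H. unfold max1N.
  assert (Hin : In (MaxRlist (map F (seq 1 N))) (map F (seq 1 N))).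
  { apply MaxRlist_P2. exists (F 1%nat). apply in_map, in_seq. lia. }
  apply in_map_iff in Hin. destruct Hin as [i [<- Hi]]. apply H. apply in_seq in Hi; lia.
Qed.

Lemma max1N_ge N F i : (1 <= i <= N)%nat -> F i <= max1N N F.
Proof. intros H. apply MaxRlist_P1. apply in_map, in_seq. lia. Qed.

Section Spline.
Variable m : nat.
(** Writing r as m+3 builds in r at least 3: splines are continuously differentiable, their pieces
    have degree m+2, and a second derivative exists off the nodes. *)
Let r := S (S (S m)).

(** Coordinates are counted from 0 and basis functions from 1, hence [S k]. *)
Definition lc (phi : nat -> nat -> R -> R) (N : nat) (z : nat -> R) (x : R) : R :=
  rsum N (fun k => z k * phi N (S k) x).

Lemma lincomb_lc phi N c : lincomb phi N c = lc phi N (fun k => c (S k)).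
Proof. extensionality x. unfold lincomb, lc. apply sum_n_m_rsum. Qed.

Section One.
Variables (N : nat) (psi : R -> R).
Hypothesis HN : (1 <= N)%nat.
Hypothesis Hpsi : spline r N psi.

Lemma spl_per x : psi (x + 1) = psi x.
Proof. apply Hpsi. Qed.

Lemma spl_ex_derive x : ex_derive psi x.
Proof.
  destruct Hpsi as [[_ H] _]. destruct (H 1%nat ltac:(simpl; lia) x) as [H1 _]. exact H1.
Qed.

Lemma spl_is_derive x : is_derive psi x (Derive psi x).
Proof. apply Derive_correct, spl_ex_derive. Qed.

Lemma spl_cont : cont psi.
Proof. intros x. apply (ex_derive_continuous psi), spl_ex_derive. Qed.

Lemma spl_cont_D : cont (Derive psi).
Proof.
  destruct Hpsi as [[_ H] _]. intros x.
  destruct (H 1%nat ltac:(simpl; lia) x) as [_ H1]. exact H1.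
Qed.

Lemma spl_per_D x : Derive psi (x + 1) = Derive psi x.
Proof.
  apply is_derive_unique.
  apply is_derive_ext with (fun y => psi (y + - 1)).
  { intros t. rewrite <- (spl_per (t + - 1)). f_equal. ring. }
  replace (Derive psi x) with (1 * Derive psi (x + 1 + - 1)) by (rewrite Rmult_1_l; f_equal; ring).
  apply (is_derive_comp psi (fun y => y + - 1)). apply spl_is_derive.
  auto_derive; auto.
Qed.

Lemma spl_piece i : (i < N)%nat -> exists a,
  (forall x, node N i <= x <= node N (S i) -> psi x = pol (S (S m)) a x) /\
  (forall x, elt N i x -> Derive psi x = pol (S m) (dco a) x) /\
  (forall x, elt N i x -> Derive_n psi 2 x = pol m (dco (dco a)) x).
Proof.
  intros Hi. destruct Hpsi as [_ H]. destruct (H (S i) ltac:(lia)) as [a Ha].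
  replace (S i - 1)%nat with i in Ha by lia.
  assert (E0 : forall x, node N i <= x <= node N (S i) -> psi x = pol (S (S m)) a x).
  { intros x Hx. rewrite (Ha x Hx), sum_n_rsum. reflexivity. }
  assert (E1 : forall x, elt N i x -> Derive psi x = pol (S m) (dco a) x).
  { intros x Hx. apply is_derive_unique.
    apply is_derive_ext_loc with (pol (S (S m)) a); [|apply is_derive_pol].
    apply filter_imp with (2 := locally_elt N i x Hx).
    intros y Hy. unfold elt in Hy. rewrite E0; auto. lra. }
  exists a; repeat split; auto.
  intros x Hx. simpl. apply is_derive_unique.
  apply is_derive_ext_loc with (pol (S m) (dco a)); [|apply is_derive_pol].
  apply filter_imp with (2 := locally_elt N i x Hx).
  intros y Hy. rewrite E1; auto.
Qed.

Lemma spl_is_derive2 x : off N x -> is_derive (Derive psi) x (Derive_n psi 2 x).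
Proof.
  intros [i [Hi Hx]]. destruct (spl_piece i Hi) as [a [_ [E1 E2]]].
  apply (Derive_correct (Derive psi)). exists (pol m (dco (dco a)) x).
  apply is_derive_ext_loc with (pol (S m) (dco a)); [|apply is_derive_pol].
  apply filter_imp with (2 := locally_elt N i x Hx).
  intros y Hy. rewrite E1; auto.
Qed.

Lemma spl_pwc : pwc N psi.
Proof. apply cont_pwc, spl_cont. Qed.
Lemma spl_pwc_D : pwc N (Derive psi).
Proof. apply cont_pwc, spl_cont_D. Qed.
Lemma spl_pwc_D2 : pwc N (Derive_n psi 2).
Proof.
  intros i Hi. destruct (spl_piece i Hi) as [a [_ [_ E2]]].
  exists (pol m (dco (dco a))). split; auto. apply cont_pol.
Qed.

Lemma spl_zero : (forall x, 0 < x < 1 -> psi x = 0) -> forall x, psi x = 0.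
Proof.
  intros H x. destruct (periodic_repr psi x spl_per) as [y [Hy ->]].
  destruct (Req_dec y 0) as [->|]; [|apply H; lra].
  apply cont_zero_at0; auto. apply spl_cont.
Qed.

End One.

(** [pol_inverse] on the element containing [x], whose share of the norm is at most the whole. In
    maximum norm a spline costs h^(-1/2) and its derivative h^(-3/2); the constant does not depend
    on [N]. *)
Lemma spl_inverse : exists C, 0 <= C /\ forall N psi x, (1 <= N)%nat -> spline r N psi -> off N x ->
  Rabs (psi x) * sqrt (hstep N) <= C * L2norm psi /\
  Rabs (Derive psi x) * (hstep N * sqrt (hstep N)) <= C * L2norm psi.
Proof.
  destruct (pol_inverse m) as [C [HC H]]. exists C; split; auto.
  intros N psi x HN Hpsi [i [Hi Hx]].
  destruct (spl_piece N psi HN Hpsi i Hi) as [a [E0 [E1 _]]].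
  rewrite (E1 x Hx). rewrite E0 by (unfold elt in Hx; lra).
  destruct (H a (node N i) (hstep N) x (hstep_pos N HN)) as [H0 [H1 _]].
  { rewrite <- node_S. unfold elt in Hx; lra. }
  assert (Hle : sqrt (RInt (fun y => pol (S (S m)) a y ^ 2) (node N i) (node N i + hstep N)) <= L2norm psi).
  { rewrite L2norm_sqrt. apply sqrt_le_1_alt.
    assert (Hp : pwc N psi) by (apply spl_pwc; auto).
    rewrite (I_elt_sum N) by (auto; pw). rewrite <- node_S.
    rewrite (RInt_ext _ (fun x => psi x ^ 2)).
    - apply (rsum_term_le N (fun i => RInt (fun x => psi x ^ 2) (node N i) (node N (S i)))); auto.
      intros j Hj. apply RInt_ge_0. apply node_mono; auto. apply elt_ex_RInt; auto; pw.
      intros; apply pow2_ge_0.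
    - intros y Hy. rewrite Rmin_left, Rmax_right in Hy by (apply node_mono; auto).
      rewrite E0; auto. lra. }
  split; (eapply Rle_trans; [eassumption|]; apply Rmult_le_compat_l; auto).
Qed.

Section Basis.
Variables (K : nat) (phi : nat -> nat -> R -> R).
Hypothesis Q : quasi_interpolant_basis r K phi.

Lemma basis_spline N k : (k < N)%nat -> spline r N (phi N (S k)).
Proof. intros H. apply (qi_spline _ _ _ Q); lia. Qed.

Lemma lc_spline N z : (1 <= N)%nat -> spline r N (lc phi N z).
Proof.
  intros HN. split.
  - apply (Ck_per_rsum _ N (fun j x => z j * phi N (S j) x)). intros j Hj.
    apply Ck_per_scal. apply (basis_spline N j Hj).
  - intros i Hi.
    assert (Hp : forall j, exists a, (j < N)%nat -> forall x, Icc (node N (i - 1)) (node N i) x ->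
       phi N (S j) x = pol (S (S m)) a x).
    { intros j. destruct (classic (j < N)%nat) as [Hj|Hj]; [|exists (fun _ => 0); tauto].
      destruct (basis_spline N j Hj) as [_ H]. destruct (H i Hi) as [a Ha]. exists a.
      intros _ x Hx. rewrite Ha by auto. rewrite sum_n_rsum. reflexivity. }
    apply choice in Hp. destruct Hp as [a Ha].
    exists (fun k => rsum N (fun j => z j * a j k)). intros x Hx.
    rewrite sum_n_rsum. change (lc phi N z x = pol (S (S m)) (fun k => rsum N (fun j => z j * a j k)) x).
    rewrite (pol_rsum (S (S m)) N (fun j k => z j * a j k)). unfold lc. apply rsum_ext.
    intros j Hj. rewrite pol_scal, Ha; auto.
Qed.

Lemma spline_lc N psi : (1 <= N)%nat -> spline r N psi -> exists z, psi = lc phi N z.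
Proof.
  intros HN H. destruct (qi_span _ _ _ Q N psi HN H) as [c Hc].
  exists (fun k => c (S k)). extensionality x. rewrite Hc, lincomb_lc. auto.
Qed.

Lemma lc_zero N z : (1 <= N)%nat -> (forall x, lc phi N z x = 0) -> forall k, (k < N)%nat -> z k = 0.
Proof.
  intros HN H k Hk.
  apply (qi_free _ _ _ Q N (fun j => z (pred j)) HN) with (j := S k); [|lia].
  intros x. rewrite lincomb_lc. apply H.
Qed.

Lemma lc_plus N y z : lc phi N (fun k => y k + z k) = fun x => lc phi N y x + lc phi N z x.
Proof. extensionality x. unfold lc. rewrite <- rsum_plus. apply rsum_ext; intros; ring. Qed.
Lemma lc_minus N y z : lc phi N (fun k => y k - z k) = fun x => lc phi N y x - lc phi N z x.
Proof. extensionality x. unfold lc. rewrite <- rsum_minus. apply rsum_ext; intros; ring. Qed.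
Lemma lc_scal N c z : lc phi N (fun k => c * z k) = fun x => c * lc phi N z x.
Proof. extensionality x. unfold lc. rewrite <- rsum_scal. apply rsum_ext; intros; ring. Qed.

Lemma lc_is_derive N z x : (1 <= N)%nat ->
  is_derive (lc phi N z) x (rsum N (fun k => z k * Derive (phi N (S k)) x)).
Proof.
  intros HN. apply (is_derive_rsum N (fun k x => z k * phi N (S k) x)). intros k Hk.
  apply (is_derive_scal (phi N (S k))). apply (spl_is_derive N); auto. apply basis_spline; auto.
Qed.

Lemma lc_Derive N z x : (1 <= N)%nat ->
  Derive (lc phi N z) x = rsum N (fun k => z k * Derive (phi N (S k)) x).
Proof. intros HN. apply is_derive_unique, lc_is_derive; auto. Qed.

Lemma lc_Derive2 N z x : (1 <= N)%nat -> off N x ->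
  Derive_n (lc phi N z) 2 x = rsum N (fun k => z k * Derive_n (phi N (S k)) 2 x).
Proof.
  intros HN Hx. simpl.
  rewrite (Derive_ext _ (fun x => rsum N (fun k => z k * Derive (phi N (S k)) x))).
  2: intros; apply lc_Derive; auto.
  apply is_derive_unique.
  apply (is_derive_rsum N (fun k x => z k * Derive (phi N (S k)) x)). intros k Hk.
  apply (is_derive_scal (Derive (phi N (S k)))). apply (spl_is_derive2 N (phi N (S k))); auto. apply basis_spline; auto.
Qed.

Lemma I_lc_r N f z : (1 <= N)%nat -> pwc N f ->
  I (fun x => f x * lc phi N z x) = rsum N (fun k => z k * I (fun x => f x * phi N (S k) x)).
Proof.
  intros HN Hf.
  assert (Hb : forall k, (k < N)%nat -> pwc N (phi N (S k))).
  { intros; apply spl_pwc; auto. apply basis_spline; auto. }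
  transitivity (I (fun x => rsum N (fun k => z k * (f x * phi N (S k) x)))).
  - f_equal. extensionality x. unfold lc. rewrite <- rsum_scal. apply rsum_ext; intros; ring.
  - rewrite (I_rsum N) by (auto; intros; pw; auto). apply rsum_ext. intros k Hk.
    rewrite (I_scal N); auto. pw; auto.
Qed.

Lemma I_lc_D N f z : (1 <= N)%nat -> pwc N f ->
  I (fun x => f x * Derive (lc phi N z) x) = rsum N (fun k => z k * I (fun x => f x * Derive (phi N (S k)) x)).
Proof.
  intros HN Hf.
  assert (Hb : forall k, (k < N)%nat -> pwc N (Derive (phi N (S k)))).
  { intros; apply spl_pwc_D; auto. apply basis_spline; auto. }
  transitivity (I (fun x => rsum N (fun k => z k * (f x * Derive (phi N (S k)) x)))).
  - f_equal. extensionality x. rewrite lc_Derive, <- rsum_scal by auto. apply rsum_ext; intros; ring.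
  - rewrite (I_rsum N) by (auto; intros; pw; auto). apply rsum_ext. intros k Hk.
    rewrite (I_scal N); auto. pw; auto.
Qed.

Lemma lc_pwc N z : (1 <= N)%nat -> pwc N (lc phi N z).
Proof. intros. apply spl_pwc, lc_spline; auto. Qed.

(** The Gram matrix of the basis is positive definite: a nontrivial combination is nonzero somewhere
    in (0,1), by periodicity, continuity and linear independence. *)
Lemma gram N b : (1 <= N)%nat -> exists z, forall k, (k < N)%nat ->
  I (fun x => lc phi N z x * phi N (S k) x) = b k.
Proof.
  intros HN.
  destruct (pd_solve N (fun i j => I (fun x => phi N (S i) x * phi N (S j) x))) with (b := b) as [z Hz].
  - intros z Hz.
    assert (E : forall i, (i < N)%nat ->
      rsum N (fun j => I (fun x => phi N (S i) x * phi N (S j) x) * z j) =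
      I (fun x => lc phi N z x * phi N (S i) x)).
    { intros i Hi. replace (fun x => lc phi N z x * phi N (S i) x) with
        (fun x => phi N (S i) x * lc phi N z x) by (extensionality x; ring).
      rewrite I_lc_r; auto. apply rsum_ext; intros; ring.
      apply spl_pwc, basis_spline; auto. }
    rewrite (rsum_ext N _ (fun i => z i * I (fun x => lc phi N z x * phi N (S i) x)))
      by (intros; rewrite E; auto).
    rewrite <- I_lc_r by (auto; apply lc_pwc; auto).
    assert (Hs := lc_spline N z HN).
    assert (Hex : exists x, 0 < x < 1 /\ lc phi N z x <> 0).
    { apply NNPP. intros Hno. destruct Hz as [k [Hk Hz]]. apply Hz.
      apply (lc_zero N z HN); auto. apply (spl_zero N); auto.
      intros x Hx. apply NNPP. intros E'; apply Hno; exists x; auto. }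
    destruct Hex as [x [Hx Hnz]].
    replace (fun x => lc phi N z x * lc phi N z x) with (fun x => lc phi N z x ^ 2)
      by (extensionality y; ring).
    apply (cont_RInt_sq_pos _ 0 1 x); auto. apply (spl_cont N); auto.
  - exists z. intros k Hk. rewrite <- (Hz k Hk).
    replace (fun x => lc phi N z x * phi N (S k) x) with
        (fun x => phi N (S k) x * lc phi N z x) by (extensionality x; ring).
    rewrite I_lc_r; auto. apply rsum_ext; intros; ring.
    apply spl_pwc, basis_spline; auto.
Qed.

(* Riesz representation in the spline space turns bounds on basis functions into
   a bound of the functional in the L2 norm. *)
Lemma riesz_bound : exists C, 0 <= C /\ forall N b M, (1 <= N)%nat ->
  (forall k, (k < N)%nat -> Rabs (b k) <= M) ->
  forall w, Rabs (rsum N (fun k => w k * b k)) <= C / hstep N * M * L2norm (lc phi N w).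
Proof.
  destruct (qi_norm _ _ _ Q) as [C HC]. exists (Rmax C 0). split. apply Rmax_r.
  intros N b M HN HM w. destruct (gram N b HN) as [z Hz].
  assert (E : rsum N (fun k => w k * b k) = I (fun x => lc phi N z x * lc phi N w x)).
  { rewrite I_lc_r by (auto; apply lc_pwc; auto). apply rsum_ext. intros k Hk. rewrite Hz; auto. }
  rewrite E. eapply Rle_trans. apply (L2norm_CS N); auto; apply lc_pwc; auto.
  apply Rmult_le_compat_r. apply L2norm_pos.
  eapply Rle_trans. apply (HC N); auto. apply lc_spline; auto.
  assert (Hh := Rinv_0_lt_compat _ (hstep_pos N HN)).
  assert (Hm : max1N N (fun i => Rabs (L2ip (lc phi N z) (phi N i))) <= M).
  { apply max1N_le; auto. intros i Hi. replace i with (S (pred i)) by lia.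
    unfold L2ip. change (Rabs (I (fun x => lc phi N z x * phi N (S (pred i)) x)) <= M).
    rewrite Hz by lia. apply HM; lia. }
  set (mx := max1N _ _) in *.
  assert (Hm0 : 0 <= mx).
  { apply Rle_trans with (Rabs (L2ip (lc phi N z) (phi N 1%nat))). apply Rabs_pos.
    apply (max1N_ge N (fun i => Rabs (L2ip (lc phi N z) (phi N i))) 1%nat); lia. }
  apply Rle_trans with (Rmax C 0 * / hstep N * mx).
  - apply Rmult_le_compat_r; auto. apply Rmult_le_compat_r; [lra|apply Rmax_l].
  - apply Rmult_le_compat_l; auto. apply Rmult_le_pos; [apply Rmax_r|lra].
Qed.

(** Each coordinate is the inner product with a dual spline. The constant depends on [N], which is
    harmless: it serves only the differential equation for a fixed [N], never the error estimate. *)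
Lemma coord_bound N : (1 <= N)%nat -> exists C, 0 <= C /\ forall w k, (k < N)%nat ->
  Rabs (w k) <= C * L2norm (lc phi N w).
Proof.
  intros HN.
  assert (Hd : forall k, exists d, forall i, (i < N)%nat ->
    I (fun x => lc phi N d x * phi N (S i) x) = if Nat.eqb i k then 1 else 0).
  { intros k. destruct (gram N (fun i => if Nat.eqb i k then 1 else 0) HN) as [d Hd]. exists d; auto. }
  apply choice in Hd. destruct Hd as [d Hd].
  exists (rsum N (fun k => L2norm (lc phi N (d k)))). split.
  { apply rsum_nonneg; intros; apply L2norm_pos. }
  intros w k Hk.
  assert (E : w k = I (fun x => lc phi N (d k) x * lc phi N w x)).
  { rewrite I_lc_r by (auto; apply lc_pwc; auto). rewrite <- (rsum_delta N k w) by auto.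
    apply rsum_ext. intros i Hi. rewrite Hd by auto. ring. }
  rewrite E at 1. eapply Rle_trans. apply (L2norm_CS N); auto; apply lc_pwc; auto.
  apply Rmult_le_compat_r. apply L2norm_pos.
  apply (rsum_term_le N (fun k => L2norm (lc phi N (d k)))); auto. intros; apply L2norm_pos.
Qed.

(** Coordinates are fixed linear combinations of point values. A discrete solution is only known to
    be differentiable in time at each fixed x; this transfers the differentiability to its
    coordinates. *)
Lemma sampling N : (1 <= N)%nat -> exists n (x : nat -> R) (W : nat -> nat -> R),
  forall z j, (j < N)%nat -> rsum n (fun k => W j k * lc phi N z (x k)) = z j.
Proof.
  (* A piece of degree m+2 is determined by m+3 values: the points of each element sit at the
     fractions 0, 1/d, ..., (d-1)/d. *)
  intros HN. set (d := S (S (S m))).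
  set (x := fun k => node N (k / d) + INR (k mod d) / INR d * hstep N).
  exists (N * d)%nat, x.
  destruct (left_inverse N (N * d) (fun k j => phi N (S j) (x k))) as [W HW].
  2:{ exists W. intros z j Hj. rewrite <- (HW z j Hj). apply rsum_ext; intros k Hk. f_equal.
      unfold lc. apply rsum_ext; intros; ring. }
  intros z Hz. apply lc_zero; auto.
  assert (Hs := lc_spline N z HN).
  assert (Hd : 0 < INR d) by (apply lt_0_INR; unfold d; lia).
  assert (Hh := hstep_pos N HN).
  assert (He : forall i, (i < N)%nat -> forall y, node N i <= y <= node N (S i) -> lc phi N z y = 0).
  { intros i Hi y Hy. destruct (spl_piece N _ HN Hs i Hi) as [a [E0 _]].
    assert (Ha : forall k, (k <= S (S m))%nat -> a k = 0).
    { apply (pol_roots _ a (fun k => node N i + INR k / INR d * hstep N)).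
      - intros k Hk.
        assert (Hb : 0 <= INR k / INR d <= 1).
        { split. apply Rdiv_le_0_compat; auto; apply pos_INR.
          apply Rmult_le_reg_r with (INR d); auto. unfold Rdiv.
          rewrite Rmult_assoc, Rinv_l by lra. rewrite Rmult_1_l, Rmult_1_r.
          apply le_INR. unfold d; lia. }
        rewrite <- E0 by (rewrite node_S; nra).
        assert (Hk' : (i * d + k < N * d)%nat) by (unfold d in *; nia).
        assert (Ex : x (i * d + k)%nat = node N i + INR k / INR d * hstep N).
        { unfold x. replace ((i * d + k) / d)%nat with i.
          replace ((i * d + k) mod d)%nat with k; auto.
          - rewrite Nat.add_comm, Nat.Div0.mod_add. symmetry; apply Nat.mod_small. unfold d; lia.
          - rewrite Nat.add_comm, Nat.div_add by (unfold d; lia).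
            rewrite Nat.div_small; unfold d; lia. }
        rewrite <- Ex. unfold lc. rewrite <- (Hz _ Hk'). apply rsum_ext; intros; ring.
      - intros k Hk. apply Rplus_lt_compat_l. apply Rmult_lt_compat_r; auto.
        apply Rmult_lt_compat_r. apply Rinv_0_lt_compat; auto. apply lt_INR; lia. }
    rewrite E0 by auto. unfold pol. apply rsum_zero. intros k Hk. rewrite Ha by lia. ring. }
  apply (spl_zero N); auto. intros y Hy.
  destruct (elt_cover N y HN ltac:(lra)) as [i [Hi Hi']]. apply (He i Hi). lra.
Qed.

End Basis.
End Spline.

(** * Uniform boundedness *)

Lemma Derive_n_lin k f g c j y : Ck_per k f -> Ck_per k g -> (j <= k)%nat ->
  Derive_n (fun x => f x + c * g x) j y = Derive_n f j y + c * Derive_n g j y.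
Proof.
  intros Hf Hg Hj. rewrite (Derive_n_plus f (fun x => c * g x)).
  - rewrite Derive_n_scal_l. auto.
  - apply filter_forall. intros; apply Hf; lia.
  - apply filter_forall. intros z l Hl. apply ex_derive_n_scal_l. apply Hg; lia.
Qed.

Lemma Ck_per_lin k f g c : Ck_per k f -> Ck_per k g -> Ck_per k (fun x => f x + c * g x).
Proof.
  intros Hf Hg. apply (Ck_per_plus k f (fun x => c * g x)); auto. apply Ck_per_scal; auto.
Qed.

Lemma Derive_n_rsum k n (f : nat -> R -> R) j y :
  (forall i, (i < n)%nat -> Ck_per k (f i)) -> (j <= k)%nat ->
  Derive_n (fun x => rsum n (fun i => f i x)) j y = rsum n (fun i => Derive_n (f i) j y).
Proof.
  intros H Hj. induction n; simpl.
  - destruct j; auto. apply (Derive_n_const j 0).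
  - rewrite (Derive_n_plus (fun x => rsum n (fun i => f i x)) (f n)).
    rewrite IHn by auto. auto.
    apply filter_forall. intros; apply (Ck_per_rsum k n f); auto; lia.
    apply filter_forall. intros; apply (H n); lia.
Qed.

Lemma Ck_per_le k l f : (l <= k)%nat -> Ck_per k f -> Ck_per l f.
Proof. intros H [P D]; split; auto. intros j Hj; apply D; lia. Qed.

Lemma Ck_is_derive k f j y : Ck_per k f -> (j < k)%nat ->
  is_derive (Derive_n f j) y (Derive_n f (S j) y).
Proof.
  intros [_ H] Hj. apply (Derive_correct (Derive_n f j)).
  destruct (H (S j) ltac:(lia) y) as [H1 _]. exact H1.
Qed.

Lemma MVT_is_derive f df x y : (forall z, is_derive f z (df z)) ->
  exists c, Rmin x y <= c <= Rmax x y /\ f y - f x = df c * (y - x).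
Proof.
  intros H. apply MVT_gen; auto. intros z _.
  apply continuity_pt_filterlim. apply (ex_derive_continuous f). eexists; apply H.
Qed.

Lemma lipschitz_is_derive f df B x y : (forall z, is_derive f z (df z)) ->
  (forall z, Rabs (df z) <= B) -> Rabs (f y - f x) <= B * Rabs (y - x).
Proof.
  intros H HB. destruct (MVT_is_derive f df x y H) as [c [_ E]].
  rewrite E, Rabs_mult. apply Rmult_le_compat_r; auto. apply Rabs_pos.
Qed.

Lemma taylor1 f df ddf B x y : (forall z, is_derive f z (df z)) ->
  (forall z, is_derive df z (ddf z)) -> (forall z, Rabs (ddf z) <= B) ->
  Rabs (f y - f x - (y - x) * df x) <= B * (y - x) ^ 2.
Proof.
  intros H1 H2 HB. destruct (MVT_is_derive f df x y H1) as [c [Hc E]].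
  pose proof (lipschitz_is_derive df ddf B x c H2 HB) as L.
  replace (f y - f x - (y - x) * df x) with ((df c - df x) * (y - x)) by (rewrite E; ring).
  rewrite Rabs_mult, <- (pow2_abs (y - x)).
  replace (B * Rabs (y - x) ^ 2) with (B * Rabs (y - x) * Rabs (y - x)) by ring.
  apply Rmult_le_compat_r; [apply Rabs_pos|]. eapply Rle_trans; [exact L|].
  apply Rmult_le_compat_l. eapply Rle_trans; [apply Rabs_pos|apply (HB x)].
  unfold Rmin, Rmax in Hc. destruct (Rle_dec x y).
  rewrite !Rabs_pos_eq; lra. rewrite !Rabs_left1; lra.
Qed.

(** * Series of smooth functions with coefficients of size 3^-n *)

Section Series3.
Variable a : nat -> R.
Hypothesis Ha : forall n, Rabs (a n) <= (/ 3) ^ n.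

Lemma geom3 : ex_series (fun n => (/ 3) ^ n).
Proof. apply ex_series_geom. rewrite Rabs_pos_eq; lra. Qed.

Lemma ex_series3 b : (forall n, Rabs (b n) <= 1) -> ex_series (fun n => Rabs (a n * b n)).
Proof.
  intros Hb. apply (ex_series_le (fun n => Rabs (a n * b n)) (fun n => (/ 3) ^ n)).
  - intros n. unfold norm; simpl. unfold abs; simpl. rewrite Rabs_Rabsolu, Rabs_mult.
    specialize (Ha n). specialize (Hb n). pose proof (Rabs_pos (a n)). pose proof (Rabs_pos (b n)).
    assert (0 <= (/3)^n) by (apply pow_le; lra). nra.
  - apply geom3.
Qed.

Lemma tail3 b M : (forall n, Rabs (b n) <= 1) ->
  Rabs (Series (fun n => a n * b n) - rsum M (fun n => a n * b n)) <= 3 / 2 * (/ 3) ^ M.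
Proof.
  intros Hb.
  assert (E : Series (fun n => a n * b n) = rsum M (fun n => a n * b n) + Series (fun n => a (M + n)%nat * b (M + n)%nat)).
  { destruct M. simpl. rewrite Rplus_0_l. apply Series_ext; auto.
    rewrite (Series_incr_n _ (S M)); [|lia|apply ex_series_Rabs, ex_series3; auto].
    simpl pred. rewrite <- sum_n_Reals, sum_n_rsum. reflexivity. }
  rewrite E. replace (rsum M (fun n => a n * b n) + Series (fun n => a (M + n)%nat * b (M + n)%nat) - rsum M (fun n => a n * b n))
    with (Series (fun n => a (M + n)%nat * b (M + n)%nat)) by ring.
  assert (Hx := ex_series3 b Hb). apply (ex_series_incr_n (fun n => Rabs (a n * b n)) M) in Hx.
  eapply Rle_trans. apply Series_Rabs. exact Hx.
  eapply Rle_trans. apply (Series_le _ (fun n => (/3) ^ M * (/ 3) ^ n)).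
  - intros n; split. apply Rabs_pos. rewrite Rabs_mult, <- pow_add.
    specialize (Ha (M + n)%nat). specialize (Hb (M + n)%nat).
    pose proof (Rabs_pos (a (M + n)%nat)). pose proof (Rabs_pos (b (M + n)%nat)).
    assert (0 <= (/3)^(M + n)) by (apply pow_le; lra). nra.
  - apply (ex_series_scal_l ((/3) ^ M) (fun n => (/ 3) ^ n)). apply geom3.
  - rewrite (Series_scal_l ((/3) ^ M) (fun n => (/3) ^ n)). rewrite (Series_geom (/3)) by (rewrite Rabs_pos_eq; lra).
    right. field.
Qed.

Lemma series3_bound b B : (forall n, Rabs (b n) <= B) -> 0 <= B -> Rabs (Series (fun n => a n * b n)) <= 3 / 2 * B.
Proof.
  intros Hb HB. destruct (Req_dec B 0) as [->|HB0].
  - rewrite (Series_ext _ (fun n => 0 * 1)). rewrite Series_scal_l. rewrite Rmult_0_l, Rabs_R0; lra.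
    intros n. specialize (Hb n). pose proof (Rabs_pos (b n)). assert (b n = 0) as ->.
    { apply NNPP; intros E. apply Rabs_no_R0 in E. lra. } ring.
  - assert (HB1 : 0 < B) by lra.
    rewrite (Series_ext _ (fun n => B * (a n * (b n / B)))) by (intros; field; lra).
    rewrite Series_scal_l, Rabs_mult, (Rabs_pos_eq B), Rmult_comm by lra.
    apply Rmult_le_compat_r; auto.
    pose proof (tail3 (fun n => b n / B) 0) as T. simpl in T. rewrite Rminus_0_r, Rmult_1_r in T.
    apply T. intros n. unfold Rdiv. rewrite Rabs_mult, Rabs_inv, (Rabs_pos_eq B) by lra.
    apply Rmult_le_reg_r with B; auto. rewrite Rmult_assoc, Rinv_l by lra. specialize (Hb n); lra.
Qed.

(** The bound on the second derivatives makes the difference quotients of all terms converge at one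
    common rate, so the sum is differentiated with an error of order [d^2]. Used up to the order
    k+1, it accounts for the two extra derivatives assumed below. *)
Lemma series3_derive (f g h : nat -> R -> R) y :
  (forall n z, is_derive (f n) z (g n z)) -> (forall n z, is_derive (g n) z (h n z)) ->
  (forall n z, Rabs (f n z) <= 1) -> (forall n z, Rabs (g n z) <= 1) ->
  (forall n z, Rabs (h n z) <= 1) ->
  is_derive (fun z => Series (fun n => a n * f n z)) y (Series (fun n => a n * g n y)).
Proof.
  intros Df Dg Bf Bg Bh. apply is_derive_Reals. intros eps Heps.
  assert (Hd : 0 < eps / 2) by lra. exists (mkposreal _ Hd). intros d Hd0 Hd1. simpl in Hd1.
  assert (E : forall z, ex_series (fun n => a n * f n z)).
  { intros z; apply ex_series_Rabs, ex_series3; auto. }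
  assert (E' : forall z, ex_series (fun n => a n * g n z)).
  { intros z; apply ex_series_Rabs, ex_series3; auto. }
  replace ((Series (fun n => a n * f n (y + d)) - Series (fun n => a n * f n y)) / d - Series (fun n => a n * g n y))
    with (Series (fun n => a n * (f n (y + d) - f n y - d * g n y)) / d).
  - unfold Rdiv. rewrite Rabs_mult, Rabs_inv.
    assert (H : Rabs (Series (fun n => a n * (f n (y + d) - f n y - d * g n y))) <= 3 / 2 * d ^ 2).
    { apply series3_bound. 2: apply pow2_ge_0. intros n.
      pose proof (taylor1 (f n) (g n) (h n) 1 y (y + d) (Df n) (Dg n) (Bh n)) as T.
      replace (y + d - y) with d in T by ring. lra. }
    rewrite <- pow2_abs in H. pose proof (Rabs_pos_lt d Hd0).
    apply Rmult_lt_reg_r with (Rabs d); auto. rewrite Rmult_assoc, Rinv_l by lra. nra.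
  - rewrite (Series_ext _ (fun n => a n * f n (y + d) - (a n * f n y + d * (a n * g n y)))) by (intros; ring).
    rewrite Series_minus, Series_plus, Series_scal_l; auto. field; auto.
    apply (ex_series_scal_l d (fun n => a n * g n y)); auto.
    apply (ex_series_plus (fun n => a n * f n y)); auto. apply (ex_series_scal_l d (fun n => a n * g n y)); auto.
Qed.

Variables (k : nat) (v : nat -> R -> R).
Hypothesis Hv : forall n, Ck_per (S (S k)) (v n).
Hypothesis Hb : forall n j y, (j <= S (S k))%nat -> Rabs (Derive_n (v n) j y) <= 1.

Lemma series3_Derive_n j y : (j <= S k)%nat ->
  Derive_n (fun z => Series (fun n => a n * v n z)) j y = Series (fun n => a n * Derive_n (v n) j y).
Proof.
  revert y; induction j; intros y Hj; auto. simpl.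
  rewrite (Derive_ext _ (fun z => Series (fun n => a n * Derive_n (v n) j z))).
  2: intros; apply IHj; lia.
  apply is_derive_unique.
  apply (series3_derive (fun n => Derive_n (v n) j) (fun n => Derive_n (v n) (S j)) (fun n => Derive_n (v n) (S (S j)))).
  - intros n z. apply (Ck_is_derive (S (S k))); auto; lia.
  - intros n z. apply (Ck_is_derive (S (S k))); auto; lia.
  - intros; apply Hb; lia.
  - intros; apply Hb; lia.
  - intros; apply Hb; lia.
Qed.

(** Continuity of the k-th derivative is read off from its differentiability, which costs one more
    order than the conclusion shows. *)
Lemma series3_Ck : Ck_per k (fun z => Series (fun n => a n * v n z)).
Proof.
  assert (D : forall j y, (j <= k)%nat ->
    is_derive (Derive_n (fun z => Series (fun n => a n * v n z)) j) y (Series (fun n => a n * Derive_n (v n) (S j) y))).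
  { intros j y Hj. apply is_derive_ext with (fun z => Series (fun n => a n * Derive_n (v n) j z)).
    intros; symmetry; apply series3_Derive_n; lia.
    apply (series3_derive (fun n => Derive_n (v n) j) (fun n => Derive_n (v n) (S j)) (fun n => Derive_n (v n) (S (S j)))).
    - intros n z. apply (Ck_is_derive (S (S k))); auto; lia.
    - intros n z. apply (Ck_is_derive (S (S k))); auto; lia.
    - intros; apply Hb; lia.
    - intros; apply Hb; lia.
    - intros; apply Hb; lia. }
  split.
  - intros x. apply Series_ext. intros n. destruct (Hv n) as [P _]. rewrite P. auto.
  - intros j Hj x. split.
    + destruct j; simpl; auto. eexists. apply (D j); lia.
    + apply (ex_derive_continuous (Derive_n _ j)). eexists. apply D; auto.
Qed.

End Series3.

Definition unit_ball (k : nat) (v : R -> R) : Prop :=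
  Ck_per k v /\ forall j y, (j <= k)%nat -> Rabs (Derive_n v j y) <= 1.

(* Gliding hump: if the conclusion fails, signs can be chosen so that the series
   of [± 3^-n v n], with [v n] nearly extremal for functionals of norm at least
   [4 n 3^n], contradicts pointwise boundedness. *)
Lemma uniform_boundedness (A : Type) (P : A -> Prop) (k : nat) (l : A -> (R -> R) -> R) :
  (forall al v w c, P al -> Ck_per k v -> Ck_per k w ->
     l al (fun x => v x + c * w x) = l al v + c * l al w) ->
  (forall al, P al -> exists C, 0 <= C /\ forall v B, Ck_per k v ->
     (forall j y, (j <= k)%nat -> Rabs (Derive_n v j y) <= B) -> Rabs (l al v) <= C * B) ->
  (forall v, Ck_per k v -> exists C, forall al, P al -> Rabs (l al v) <= C) ->
  exists C, forall v al, unit_ball (S (S k)) v -> P al -> Rabs (l al v) <= C.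
Proof.
  intros Hlin Hbd Hpt. apply NNPP. intros Hno.
  assert (Hbig : forall C, exists v al, unit_ball (S (S k)) v /\ P al /\ C < Rabs (l al v)).
  { intros C. apply NNPP. intros H. apply Hno. exists C. intros v al Hv Hal.
    apply Rnot_lt_le. intros Hlt. apply H. exists v, al; auto. }
  (* [L] is the norm of the functional on the ball and [v] attains it up to the factor 3/4. After a
     tail of at most 1/2 is subtracted, 1/4 remains; the factor 4 in the lower bound for [L]
     compensates it. *)
  assert (Hsel : forall n : nat, exists p : (R -> R) * A * R,
    let '(v, al, L) := p in unit_ball (S (S k)) v /\ P al /\
      (forall w, unit_ball (S (S k)) w -> Rabs (l al w) <= L) /\
      3 / 4 * L <= Rabs (l al v) /\ 4 * INR n * 3 ^ n <= L).
  { intros n. destruct (Hbig (4 * INR n * 3 ^ n)) as [v0 [al [Hv0 [Hal Hlt]]]].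
    destruct (Hbd al Hal) as [C [HC Hb]].
    destruct (completeness (fun s => exists w, unit_ball (S (S k)) w /\ s = Rabs (l al w))) as [L [HL1 HL2]].
    - exists (C * 1). intros s [w [[Hw1 Hw2] ->]]. apply Hb. apply Ck_per_le with (S (S k)); auto.
      intros; apply Hw2; lia.
    - eexists; exists v0; split; eauto.
    - assert (HLv : Rabs (l al v0) <= L) by (apply HL1; exists v0; auto).
      assert (HL0 : 0 < L). { assert (0 <= 4 * INR n * 3 ^ n).
        { repeat apply Rmult_le_pos; try lra. apply pos_INR. apply pow_le; lra. } lra. }
      assert (Hex : exists w, unit_ball (S (S k)) w /\ 3 / 4 * L < Rabs (l al w)).
      { apply NNPP. intros H. assert (L <= 3 / 4 * L); [|lra]. apply HL2.
        intros s [w [Hw ->]]. apply Rnot_lt_le. intros Hw'. apply H. exists w; auto. }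
      destruct Hex as [w [Hw Hw']]. exists (w, al, L). split; [auto|]. split; [auto|].
      split; [intros w' Hw0; apply HL1; exists w'; auto|]. split; lra. }
  apply choice in Hsel. destruct Hsel as [p Hp].
  set (v := fun n => fst (fst (p n))). set (al := fun n => snd (fst (p n))). set (L := fun n => snd (p n)).
  assert (H : forall n, unit_ball (S (S k)) (v n) /\ P (al n) /\
      (forall w, unit_ball (S (S k)) w -> Rabs (l (al n) w) <= L n) /\
      3 / 4 * L n <= Rabs (l (al n) (v n)) /\ 4 * INR n * 3 ^ n <= L n).
  { intros n. specialize (Hp n). unfold v, al, L. destruct (p n) as [[? ?] ?]. exact Hp. }
  clear Hp.
  (* Since [|s + t| + |s - t|] is at least [2 |t|], one of the two signs makes the functional of the
     next partial sum at least [|t|] in size. Only the earlier terms enter the choice. *)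
  set (sg := fun n (f : R -> R) => let t := (/ 3) ^ n * l (al n) (v n) in
     if Rle_dec (Rabs (l (al n) f - t)) (Rabs (l (al n) f + t)) then 1 else -1).
  set (Sf := fix Sf n := match n with O => fun _ : R => 0 | S n' =>
     fun y => Sf n' y + sg n' (Sf n') * (/ 3) ^ n' * v n' y end).
  set (a := fun n => sg n (Sf n) * (/ 3) ^ n).
  assert (Ha : forall n, Rabs (a n) <= (/ 3) ^ n).
  { intros n. unfold a. rewrite Rabs_mult, (Rabs_pos_eq ((/ 3) ^ n)) by (apply pow_le; lra).
    unfold sg. destruct Rle_dec; [rewrite Rabs_R1|rewrite Rabs_left by lra]; lra. }
  assert (HvC : forall n, Ck_per k (v n)).
  { intros n. apply Ck_per_le with (S (S k)); auto. apply H. }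
  assert (HSf : forall n, Sf n = fun y => rsum n (fun i => a i * v i y)).
  { induction n; auto. extensionality y.
    change (Sf n y + a n * v n y = rsum n (fun i => a i * v i y) + a n * v n y).
    f_equal. exact (f_equal (fun f => f y) IHn). }
  assert (HSC : forall n, Ck_per k (Sf n)).
  { intros n. rewrite HSf. apply (Ck_per_rsum k n (fun i y => a i * v i y)). intros.
    apply Ck_per_scal; auto. }
  assert (HSl : forall n, l (al n) (Sf (S n)) = l (al n) (Sf n) + a n * l (al n) (v n)).
  { intros n. change (Sf (S n)) with (fun y => Sf n y + a n * v n y). apply Hlin; auto. apply H. }
  assert (Hgrow : forall n, (/ 3) ^ n * Rabs (l (al n) (v n)) <= Rabs (l (al n) (Sf (S n)))).
  { intros n. rewrite HSl. unfold a, sg.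
    set (s := l (al n) (Sf n)). set (t := (/ 3) ^ n * l (al n) (v n)).
    assert (Ht : (/ 3) ^ n * Rabs (l (al n) (v n)) = Rabs t).
    { unfold t. rewrite Rabs_mult, (Rabs_pos_eq ((/ 3) ^ n)) by (apply pow_le; lra). auto. }
    rewrite Ht. clear Ht. fold t.
    assert (Habs : 2 * Rabs t <= Rabs (s + t) + Rabs (s - t)).
    { replace (2 * Rabs t) with (Rabs ((s + t) - (s - t))).
      - eapply Rle_trans. apply Rabs_triang. rewrite Rabs_Ropp. lra.
      - replace (s + t - (s - t)) with (2 * t) by ring. rewrite Rabs_mult, Rabs_pos_eq; lra. }
    destruct Rle_dec as [Hle|Hle].
    - replace (s + 1 * (/ 3) ^ n * l (al n) (v n)) with (s + t) by (unfold t; ring). lra.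
    - replace (s + -1 * (/ 3) ^ n * l (al n) (v n)) with (s - t) by (unfold t; ring). lra. }
  set (x := fun z => Series (fun n => a n * v n z)).
  assert (HxC : Ck_per k x).
  { apply (series3_Ck a Ha k v). apply H. intros; apply H; auto. }
  assert (HxD : forall M j y, (j <= k)%nat ->
    Rabs (Derive_n (fun z => x z + -1 * Sf M z) j y) <= 3 / 2 * (/ 3) ^ M).
  { intros M j y Hj. rewrite (Derive_n_lin k) by auto. unfold x.
    rewrite (series3_Derive_n a Ha k v); [|apply H|intros; apply H; auto|lia].
    rewrite HSf. rewrite (Derive_n_rsum k M (fun i y => a i * v i y)) by (auto; intros; apply Ck_per_scal; auto).
    rewrite (rsum_ext M _ (fun i => a i * Derive_n (v i) j y)) by (intros; apply Derive_n_scal_l).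
    match goal with |- Rabs (?s + -1 * ?t) <= _ => replace (s + -1 * t) with (s - t) by ring end.
    apply (tail3 a Ha (fun n => Derive_n (v n) j y)). intros; apply H; lia. }
  (* All later terms lie in the unit ball, where the n-th functional is at most [L n]; the weights
     3^-i with i > n add up to half of 3^-n. *)
  assert (Htail : forall n d, Rabs (l (al n) (Sf (S n + d)%nat) - l (al n) (Sf (S n))) <=
     L n * (/ 3) ^ n * (1 - (/3) ^ d) / 2).
  { intros n d. destruct (H n) as [_ [HP [HLn _]]]. induction d.
    - rewrite Nat.add_0_r. replace (l (al n) (Sf (S n)) - l (al n) (Sf (S n))) with 0 by ring.
      rewrite Rabs_R0. simpl. lra.
    - replace (S n + S d)%nat with (S (S n + d)) by lia.
      change (Sf (S (S n + d))) with (fun y => Sf (S n + d)%nat y + a (S n + d)%nat * v (S n + d)%nat y).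
      rewrite (Hlin (al n)) by auto.
      match goal with |- Rabs (?s + ?t - ?u) <= _ => replace (s + t - u) with ((s - u) + t) by ring end.
      eapply Rle_trans. apply Rabs_triang.
      assert (Hl : Rabs (a (S n + d)%nat * l (al n) (v (S n + d)%nat)) <= (/ 3) ^ (S n + d) * L n).
      { rewrite Rabs_mult. apply Rmult_le_compat; auto using Rabs_pos. apply HLn. apply H. }
      replace (L n * (/ 3) ^ n * (1 - (/ 3) ^ S d) / 2) with
        (L n * (/ 3) ^ n * (1 - (/ 3) ^ d) / 2 + (/ 3) ^ (S n + d) * L n).
      lra. rewrite Nat.add_succ_l, <- !tech_pow_Rmult, pow_add. field. }
  destruct (Hpt x HxC) as [C HC].
  destruct (INR_unbounded C) as [n Hn].
  destruct (H n) as [_ [HP [HLn [Hn1 Hn2]]]].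
  destruct (Hbd _ HP) as [Cn [HCn Hb]].
  (* The remainder of the infinite series is handled by the continuity of this single functional,
     with its own constant [Cn]. *)
  assert (Hx : forall d, Rabs (l (al n) x - l (al n) (Sf (S n))) <=
     L n * (/ 3) ^ n / 2 + Cn * (3 / 2 * (/ 3) ^ (S n + d))).
  { intros d.
    assert (E : l (al n) (fun z => x z + -1 * Sf (S n + d)%nat z) = l (al n) x - l (al n) (Sf (S n + d)%nat)).
    { rewrite (Hlin (al n)) by auto. ring. }
    pose proof (Hb (fun z => x z + -1 * Sf (S n + d)%nat z) (3 / 2 * (/ 3) ^ (S n + d))
      ltac:(apply Ck_per_lin; auto) (HxD (S n + d)%nat)) as H1.
    rewrite E in H1. specialize (Htail n d).
    assert (H0 : 0 <= L n * (/ 3) ^ n).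
    { apply Rmult_le_pos. 2: apply pow_le; lra. eapply Rle_trans; [apply Rabs_pos|apply (HLn _ (proj1 (H n)))]. }
    assert (H3 : 0 <= (/3) ^ d) by (apply pow_le; lra).
    replace (l (al n) x - l (al n) (Sf (S n))) with
      ((l (al n) x - l (al n) (Sf (S n + d)%nat)) + (l (al n) (Sf (S n + d)%nat) - l (al n) (Sf (S n)))) by ring.
    eapply Rle_trans. apply Rabs_triang. nra. }
  (* [Hx] holds for every [d], and its last term tends to 0. *)
  assert (Hlim : Rabs (l (al n) x - l (al n) (Sf (S n))) <= L n * (/ 3) ^ n / 2).
  { apply Rnot_lt_le. intros Hlt.
    set (e := Rabs (l (al n) x - l (al n) (Sf (S n))) - L n * (/ 3) ^ n / 2) in *.
    assert (He : 0 < e) by (unfold e; lra).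
    assert (He' : 0 < e / (Cn * 3 / 2 + 1)) by (apply Rdiv_lt_0_compat; lra).
    destruct (pow_lt_1_zero (/3)) with (y := e / (Cn * 3 / 2 + 1)) as [d0 Hd0]; auto.
    { rewrite Rabs_pos_eq; lra. }
    specialize (Hd0 (S n + d0)%nat ltac:(lia)). specialize (Hx d0).
    assert (H3 : 0 <= (/3) ^ (S n + d0)) by (apply pow_le; lra).
    rewrite Rabs_pos_eq in Hd0 by auto.
    apply (Rmult_lt_compat_r (Cn * 3 / 2 + 1)) in Hd0; [|lra].
    unfold Rdiv in Hd0 at 2. rewrite Rmult_assoc, Rinv_l in Hd0 by lra.
    unfold e in *. nra. }
  specialize (HC (al n) HP). specialize (Hgrow n).
  assert (H3 : 0 < (/3) ^ n) by (apply pow_lt; lra).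
  assert (H33 : (/3) ^ n * 3 ^ n = 1).
  { rewrite <- Rpow_mult_distr. replace (/ 3 * 3) with 1 by field. apply pow1. }
  (* What remains is (3/4 - 1/2) [L n] 3^-n, at least [n], while [n] was chosen above the pointwise
     bound. *)
  assert (Hfin : INR n <= Rabs (l (al n) x)).
  { pose proof (Rabs_triang_inv (l (al n) (Sf (S n))) (l (al n) (Sf (S n)) - l (al n) x)) as T.
    rewrite (Rabs_minus_sym (l (al n) (Sf (S n))) (l (al n) x)) in T.
    replace (l (al n) (Sf (S n)) - (l (al n) (Sf (S n)) - l (al n) x)) with (l (al n) x) in T by ring.
    assert (INR n <= (/3)^n * L n / 4).
    { replace (INR n) with ((/3)^n * (4 * INR n * 3 ^ n) / 4).
      apply Rmult_le_compat_r; [lra|]. apply Rmult_le_compat_l; lra.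
      transitivity (INR n * ((/3)^n * 3 ^ n)). field. rewrite H33; ring. }
    assert ((/3)^n * (3/4 * L n) <= (/3)^n * Rabs (l (al n) (v n))) by (apply Rmult_le_compat_l; lra).
    lra. }
  lra.
Qed.

(** * Approximation by the quasi-interpolant *)

Definition CkB (k : nat) (B : R) (f : R -> R) : Prop :=
  Ck_per k f /\ forall j y, (j <= k)%nat -> Rabs (Derive_n f j y) <= B.

Lemma CkB_le k l B f : (l <= k)%nat -> CkB k B f -> CkB l B f.
Proof. intros H [H1 H2]. split. apply Ck_per_le with k; auto. intros; apply H2; lia. Qed.

Lemma CkB_pos k B f : CkB k B f -> 0 <= B.
Proof. intros [_ H]. eapply Rle_trans; [apply Rabs_pos|apply (H O 0); lia]. Qed.

Lemma Ck_cont_n k f j : Ck_per k f -> (j <= k)%nat -> cont (Derive_n f j).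
Proof. intros [_ H] Hj x. apply H; auto. Qed.

Lemma Ck_cont k f : Ck_per k f -> cont f.
Proof. intros H. apply (Ck_cont_n k f 0 H). lia. Qed.

(** Integrating an approximation of the derivative gains a factor [h]. Keeping [dco a = b] makes a
    single polynomial approximate a function and its derivatives at once, which the inverse
    inequality needs. *)
Lemma antiderivative_pol n f df b E c h : 0 <= h -> (forall y, is_derive f y (df y)) ->
  (forall x, c <= x <= c + h -> Rabs (df x - pol n b x) <= E) ->
  exists a, (forall k, dco a k = b k) /\
    forall x, c <= x <= c + h -> Rabs (f x - pol (S n) a x) <= E * h.
Proof.
  intros Hh Hf HE.
  (* [a0] is the primitive without constant term; it serves to choose the constant that makes the
     polynomial exact at [c]. *)
  set (a0 := fun k => match k with O => 0 | S j => b j / INR (S j) end).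
  set (a := fun k => match k with O => f c - pol (S n) a0 c | S j => b j / INR (S j) end).
  assert (Hd : forall k, dco a k = b k).
  { intros k. unfold dco, a. field. apply not_0_INR; lia. }
  exists a; split; auto. intros x Hx.
  assert (Hc : pol (S n) a c = f c).
  { unfold a. rewrite pol_S. rewrite (pol_S n a0). simpl. ring. }
  assert (Hder : forall y, is_derive (fun y => f y - pol (S n) a y) y (df y - pol n b y)).
  { intros y. apply (is_derive_minus f (pol (S n) a)); auto.
    replace (pol n b y) with (pol n (dco a) y). apply is_derive_pol.
    f_equal. extensionality k; auto. }
  destruct (MVT_is_derive _ _ c x Hder) as [z [Hz Ez]].
  rewrite Rmin_left, Rmax_right in Hz by lra.
  replace (f x - pol (S n) a x) with (f x - pol (S n) a x - (f c - pol (S n) a c)) by (rewrite Hc; ring).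
  rewrite Ez, Rabs_mult.
  apply Rmult_le_compat; auto using Rabs_pos. apply HE; lra. rewrite Rabs_pos_eq; lra.
Qed.

Lemma taylor_pol n : forall (D : nat -> R -> R) B c h, 0 <= h ->
  (forall j y, (j <= n)%nat -> is_derive (D j) y (D (S j) y)) ->
  (forall y, Rabs (D (S n) y) <= B) ->
  exists a, forall x, c <= x <= c + h -> Rabs (D O x - pol n a x) <= B * h ^ S n.
Proof.
  induction n; intros D B c h Hh HD HB.
  - exists (fun _ => D O c). intros x Hx. rewrite pol_0.
    eapply Rle_trans. apply (lipschitz_is_derive (D O) (D 1%nat) B); auto.
    rewrite Rabs_pos_eq by lra. simpl. rewrite Rmult_1_r.
    apply Rmult_le_compat_l; try lra. eapply Rle_trans; [apply Rabs_pos|apply (HB 0)].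
  - destruct (IHn (fun j => D (S j)) B c h Hh) as [b Hb]; auto.
    { intros; apply HD; lia. }
    destruct (antiderivative_pol n (D O) (D 1%nat) b (B * h ^ S n) c h Hh) as [a [_ Ha]]; auto.
    { intros; apply (HD O); lia. }
    exists a. intros x Hx. eapply Rle_trans. apply Ha; auto. right. simpl; ring.
Qed.

Lemma taylor_pol2 m v B c h : 0 <= h -> CkB (S (S (S m))) B v ->
  exists a, forall x, c <= x <= c + h ->
   Rabs (v x - pol (S (S m)) a x) <= B * h ^ S (S (S m)) /\
   Rabs (Derive v x - pol (S m) (dco a) x) <= B * h ^ S (S m) /\
   Rabs (Derive_n v 2 x - pol m (dco (dco a)) x) <= B * h ^ S m.
Proof.
  intros Hh [HC HB].
  assert (HD : forall j y, (j <= S (S m))%nat -> is_derive (Derive_n v j) y (Derive_n v (S j) y)).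
  { intros. apply (Ck_is_derive (S (S (S m)))); auto; lia. }
  destruct (taylor_pol m (fun j => Derive_n v (S (S j))) B c h Hh) as [a2 H2].
  { intros; apply HD; lia. } { intros; apply HB; lia. }
  destruct (antiderivative_pol m (Derive_n v 1) (Derive_n v 2) a2 (B * h ^ S m) c h Hh) as [a1 [D1 H1]]; auto.
  { intros; apply (HD 1%nat); lia. }
  destruct (antiderivative_pol (S m) v (Derive_n v 1) a1 (B * h ^ S m * h) c h Hh) as [a0 [D0 H0]]; auto.
  { intros; apply (HD O); lia. }
  exists a0. intros x Hx.
  assert (E1 : dco a0 = a1) by (extensionality k; auto). rewrite E1.
  assert (E2 : dco a1 = a2) by (extensionality k; auto). rewrite E2.
  repeat split.
  - eapply Rle_trans. apply H0; auto. right; simpl; ring.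
  - eapply Rle_trans. apply H1; auto. right; simpl; ring.
  - apply H2; auto.
Qed.

Lemma pow_le_1 h a b : 0 < h <= 1 -> (a <= b)%nat -> h ^ b <= h ^ a.
Proof.
  intros Hh H. replace b with (a + (b - a))%nat by lia. rewrite pow_add.
  assert (0 < h ^ a) by (apply pow_lt; lra).
  assert (h ^ (b - a) <= 1). { rewrite <- (pow1 (b - a)). apply pow_incr; lra. }
  assert (0 <= h ^ (b - a)) by (apply pow_le; lra). nra.
Qed.

Lemma L2norm_le_I_bound N f g B : (1 <= N)%nat -> pwc N f -> pwc N g -> 0 <= B ->
  (forall x, off N x -> Rabs (f x) <= B) -> Rabs (I (fun x => f x * g x)) <= B * L2norm g.
Proof.
  intros HN Hf Hg HB H. eapply Rle_trans. apply (L2norm_CS N); auto.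
  apply Rmult_le_compat_r. apply L2norm_pos. apply (L2norm_le_const N); auto.
Qed.

Section Approx.
Variable m : nat.
Let r := S (S (S m)).
Variables (K : nat) (phi : nat -> nat -> R -> R).
Hypothesis Q : quasi_interpolant_basis r K phi.

Lemma Qh_lc N v : Qh phi N v = lc phi N (fun k => v (node N (S k))).
Proof. unfold Qh. apply lincomb_lc. Qed.

Lemma Qh_spline N v : (1 <= N)%nat -> spline r N (Qh phi N v).
Proof. intros. rewrite Qh_lc. apply (lc_spline m K phi Q); auto. Qed.

(** The order [K + r] covers both the smoothness required by the approximation property and a bound
    for the r-th derivative in it, so the constant depends on [B] only. *)
Lemma Qh_approx B : exists C, 0 <= C /\ forall N v, (1 <= N)%nat -> CkB (K + r) B v ->
  L2norm (fun x => Qh phi N v x - v x) <= C * hstep N ^ r.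
Proof.
  destruct (qi_approx _ _ _ Q) as [C HC]. exists (Rmax C 0 * Rmax B 0). split.
  apply Rmult_le_pos; apply Rmax_r.
  intros N v HN [Hv HB]. eapply Rle_trans.
  apply HC; auto. apply Ck_per_le with (K + r)%nat; auto; lia.
  assert (Hh : 0 <= hstep N ^ r) by (apply pow_le; left; apply hstep_pos; auto).
  assert (HL : L2norm (Derive_n v r) <= Rmax B 0).
  { apply (L2norm_le_const N); auto. apply cont_pwc, (Ck_cont_n (K + r)); auto; lia. apply Rmax_r.
    intros x _. eapply Rle_trans; [apply HB; lia|apply Rmax_l]. }
  pose proof (L2norm_pos (Derive_n v r)). pose proof (Rmax_r C 0). pose proof (Rmax_l C 0).
  replace (Rmax C 0 * Rmax B 0 * hstep N ^ r) with (Rmax C 0 * hstep N ^ r * Rmax B 0) by ring.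
  apply Rle_trans with (Rmax C 0 * hstep N ^ r * L2norm (Derive_n v r)).
  - apply Rmult_le_compat_r; auto. apply Rmult_le_compat_r; auto.
  - apply Rmult_le_compat_l; auto. apply Rmult_le_pos; auto.
Qed.

(* Local inverse inequality for the polynomial [Qh v - p], [p] a Taylor polynomial. *)
Lemma Qh_sup B : exists C, 0 <= C /\ forall N v x, (1 <= N)%nat -> CkB (K + r) B v -> off N x ->
  let h := hstep N in
  Rabs (Qh phi N v x - v x) * sqrt h <= C * h ^ r /\
  Rabs (Derive (Qh phi N v) x - Derive v x) * (h * sqrt h) <= C * h ^ r /\
  Rabs (Derive_n (Qh phi N v) 2 x - Derive_n v 2 x) * (h ^ 2 * sqrt h) <= C * h ^ r.
Proof.
  destruct (Qh_approx B) as [C0 [HC0 H0]]. destruct (pol_inverse m) as [C1 [HC1 H1]].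
  exists (C1 * (2 * C0 + 2 * Rabs B) + Rabs B).
  assert (HBp := Rabs_pos B).
  assert (HC : 0 <= C1 * (2 * C0 + 2 * Rabs B)) by (apply Rmult_le_pos; lra).
  split. lra.
  intros N v x HN Hv [i [Hi Hx]] h.
  assert (HB : 0 <= B) by (eapply CkB_pos; eauto). rewrite (Rabs_pos_eq B HB) in *.
  assert (Hh : 0 < h) by (apply hstep_pos; auto).
  assert (Hh1 : h <= 1) by (apply hstep_le1; auto).
  set (s := sqrt h). assert (Hs : 0 < s) by (apply sqrt_lt_R0; auto).
  assert (Hs2 : s * s = h) by (apply sqrt_sqrt; lra).
  assert (Hs1 : s <= 1) by nra.
  assert (HvC : cont v) by (apply (Ck_cont (K + r)), Hv).
  assert (Hsp := Qh_spline N v HN).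
  destruct (spl_piece m N _ HN Hsp i Hi) as [b [E0 [E1 E2]]].
  destruct (taylor_pol2 m v B (node N i) h) as [a Ha]; [lra|apply CkB_le with (K + r)%nat; auto; lia|].
  rewrite (E1 x Hx), (E2 x Hx). rewrite E0 by (unfold elt in Hx; lra).
  assert (Hx' : node N i <= x <= node N i + h) by (unfold h; rewrite <- node_S; unfold elt in Hx; lra).
  destruct (Ha x Hx') as [T0 [T1 T2]].
  set (d := fun k => b k - a k).
  assert (Epol : forall n a b x, pol n (fun k => a k - b k) x = pol n a x - pol n b x).
  { intros. unfold pol. rewrite <- rsum_minus. apply rsum_ext; intros; ring. }
  assert (Ed1 : dco d = fun k => dco b k - dco a k) by (extensionality k; unfold d, dco; ring).
  assert (Ed2 : dco (dco d) = fun k => dco (dco b) k - dco (dco a) k).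
  { extensionality k. rewrite Ed1. unfold dco; ring. }
  destruct (H1 d (node N i) h x Hh Hx') as [I0 [I1 I2]].
  rewrite Ed2, Epol in I2. rewrite Ed1, Epol in I1. unfold d in I0 at 1; rewrite Epol in I0.
  fold s in I0, I1, I2. set (S2 := sqrt (RInt _ _ _)) in I0, I1, I2.
  (* Splitting at [v]: the global L2 error of [Q_h] bounds one part on the element, the Taylor error
     the other. *)
  assert (HS : S2 <= (2 * C0 + 2 * B) * h ^ r).
  { unfold S2. assert (Hhr : 0 <= h ^ r) by (apply pow_le; lra).
    rewrite <- (sqrt_pow2 ((2 * C0 + 2 * B) * h ^ r)) by (apply Rmult_le_pos; lra).
    apply sqrt_le_1_alt.
    assert (Hp : pwc N (fun y => Qh phi N v y - v y)).
    { apply pwc_minus. apply (spl_pwc m); auto. apply cont_pwc; auto. }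
    apply Rle_trans with (RInt (fun y => 2 * (Qh phi N v y - v y) ^ 2 + 2 * (B * h ^ r) ^ 2) (node N i) (node N i + h)).
    - apply RInt_le. lra.
      + apply (ex_RInt_continuous (fun y => pol (S (S m)) d y ^ 2)). intros; apply cont_pow, cont_pol.
      + unfold h; rewrite <- node_S. apply elt_ex_RInt; auto. pw.
      + intros y Hy. unfold d. rewrite Epol. destruct (Ha y ltac:(lra)) as [Ty _].
        rewrite <- E0 by (rewrite node_S; fold h; lra).
        apply pow_maj_Rabs with (n := 2%nat) in Ty. unfold r.
        set (u := Qh phi N v y) in *. set (w := pol (S (S m)) a y) in *.
        replace (u - w) with ((u - v y) + (v y - w)) by ring.
        set (p := u - v y) in *. set (q := v y - w) in *. set (X := (B * h ^ S (S (S m))) ^ 2) in *.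
        pose proof (pow2_ge_0 (p - q)). clearbody X p q. clear - Ty H. nra.
    - assert (Hel : RInt (fun y => (Qh phi N v y - v y) ^ 2) (node N i) (node N i + h) <= (C0 * h ^ r) ^ 2).
      { apply Rle_trans with (L2norm (fun x => Qh phi N v x - v x) ^ 2).
        - rewrite (L2norm_sq N) by auto. rewrite (I_elt_sum N) by (auto; pw).
          unfold h; rewrite <- node_S.
          apply (rsum_term_le N (fun i => RInt (fun y => (Qh phi N v y - v y) ^ 2) (node N i) (node N (S i)))); auto.
          intros j Hj. apply RInt_ge_0. apply node_mono; auto. apply elt_ex_RInt; auto; pw.
          intros; apply pow2_ge_0.
        - apply pow_incr. split. apply L2norm_pos. apply H0; auto. }
      assert (Eq : RInt (fun y => 2 * (Qh phi N v y - v y) ^ 2 + 2 * (B * h ^ r) ^ 2) (node N i) (node N i + h)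
         = 2 * RInt (fun y => (Qh phi N v y - v y) ^ 2) (node N i) (node N i + h) + h * (2 * (B * h ^ r) ^ 2)).
      { rewrite (RInt_plus (fun y => 2 * (Qh phi N v y - v y) ^ 2) (fun _ => 2 * (B * h ^ r) ^ 2)).
        - rewrite (RInt_scal (fun y => (Qh phi N v y - v y) ^ 2)), RInt_const.
          + unfold scal; simpl; unfold mult, plus; simpl. ring.
          + unfold h; rewrite <- node_S. apply elt_ex_RInt; auto. pw.
        - unfold h; rewrite <- node_S. apply elt_ex_RInt; auto. pw.
        - apply ex_RInt_const. }
      rewrite Eq.
      assert (0 <= (B * h ^ r) ^ 2) by apply pow2_ge_0.
      assert (h * (2 * (B * h ^ r) ^ 2) <= 2 * (B * h ^ r) ^ 2) by nra.
      replace (((2 * C0 + 2 * B) * h ^ r) ^ 2) with (4 * (C0 * h ^ r) ^ 2 + 4 * (B * h ^ r) ^ 2 + 8 * (C0 * h ^ r) * (B * h ^ r)) by ring.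
      assert (0 <= (C0 * h ^ r) * (B * h ^ r)) by (apply Rmult_le_pos; apply Rmult_le_pos; auto).
      pose proof (pow2_ge_0 (C0 * h ^ r)). nra. }
  assert (HI : C1 * S2 <= C1 * (2 * C0 + 2 * B) * h ^ r).
  { rewrite Rmult_assoc. apply Rmult_le_compat_l; auto. }
  assert (tri : forall p q w t E F, 0 <= t -> Rabs (p - w) * t <= E -> Rabs (q - w) * t <= F -> Rabs (p - q) * t <= E + F).
  { intros p q w t E F Ht A1 A2.
    assert (Rabs (p - q) <= Rabs (p - w) + Rabs (q - w)).
    { replace (p - q) with ((p - w) - (q - w)) by ring. eapply Rle_trans. apply Rabs_triang. rewrite Rabs_Ropp. lra. }
    nra. }
  assert (Hhr : 0 <= h ^ r) by (apply pow_le; lra).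
  rewrite Rmult_plus_distr_r.
  split; [|split].
  - apply tri with (pol (S (S m)) a x); [lra|lra|].
    apply Rle_trans with (Rabs (v x - pol (S (S m)) a x) * 1).
    apply Rmult_le_compat_l; auto using Rabs_pos. rewrite Rmult_1_r. exact T0.
  - apply tri with (pol (S m) (dco a) x); [apply Rmult_le_pos; lra|lra|].
    apply Rle_trans with (B * h ^ S (S m) * (h * 1)).
    + apply Rmult_le_compat; auto using Rabs_pos. apply Rmult_le_pos; lra. apply Rmult_le_compat_l; lra.
    + right. unfold r. simpl. ring.
  - apply tri with (pol m (dco (dco a)) x); [apply Rmult_le_pos; [apply pow2_ge_0|lra]|lra|].
    apply Rle_trans with (B * h ^ S m * (h ^ 2 * 1)).
    + apply Rmult_le_compat; auto using Rabs_pos. apply Rmult_le_pos; [apply pow2_ge_0|lra].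
      apply Rmult_le_compat_l; [apply pow2_ge_0|lra].
    + right. unfold r. simpl. ring.
Qed.

End Approx.

(** * Superconvergence *)

Lemma Derive_n_per k f j x : Ck_per k f -> Derive_n f j (x + 1) = Derive_n f j x.
Proof.
  intros [Hp _]. rewrite <- Derive_n_comp_trans. f_equal. extensionality y; auto.
Qed.

Lemma periodic_bounded f : cont f -> (forall x, f (x + 1) = f x) -> exists B, forall x, Rabs (f x) <= B.
Proof.
  intros Hf Hp.
  assert (Ha : forall x, continuity_pt (fun x => Rabs (f x)) x).
  { intros x. apply continuity_pt_filterlim. apply (continuous_comp f Rabs); auto. apply continuous_Rabs. }
  destruct (continuity_ab_maj (fun x => Rabs (f x)) 0 1) as [M [HM _]]; auto. lra.
  exists (Rabs (f M)). intros x. destruct (periodic_repr f x Hp) as [y [Hy ->]]. apply HM; lra.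
Qed.

Lemma Ck_per_bounded k f : Ck_per k f -> exists B, CkB k B f.
Proof.
  intros H.
  assert (Hj : forall j, exists B, (j <= k)%nat -> forall x, Rabs (Derive_n f j x) <= B).
  { intros j. destruct (classic (j <= k)%nat) as [Hj|Hj]; [|exists 0; tauto].
    destruct (periodic_bounded (Derive_n f j)) as [B HB]. apply (Ck_cont_n k); auto.
    intros; apply (Derive_n_per k); auto. exists B; auto. }
  apply choice in Hj. destruct Hj as [B HB].
  exists (rsum (S k) (fun j => Rabs (B j))). split; auto. intros j y Hj.
  eapply Rle_trans. apply (HB j Hj). eapply Rle_trans. apply RRle_abs.
  apply (rsum_term_le (S k) (fun j => Rabs (B j))). lia. intros; apply Rabs_pos.
Qed.

Section Super.
Variable m : nat.
Let r := S (S (S m)).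
Variables (K : nat) (phi : nat -> nat -> R -> R).
Hypothesis Q : quasi_interpolant_basis r K phi.

Lemma spl_pwc_n N psi nu : (1 <= N)%nat -> spline r N psi -> (nu <= 2)%nat -> pwc N (Derive_n psi nu).
Proof.
  intros HN Hs Hnu. destruct nu as [|[|[|]]]; try lia.
  apply (spl_pwc m); auto. apply (spl_pwc_D m N psi); auto. apply (spl_pwc_D2 m); auto.
Qed.

Lemma lc_Derive_n N z nu x : (1 <= N)%nat -> (nu <= 2)%nat -> off N x ->
  Derive_n (lc phi N z) nu x = rsum N (fun k => z k * Derive_n (phi N (S k)) nu x).
Proof.
  intros HN Hnu Hx. destruct nu as [|[|[|]]]; try lia.
  reflexivity. apply (lc_Derive m K phi Q); auto. apply (lc_Derive2 m K phi Q); auto.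
Qed.

(** The derivative of [f * g^(nu)], expanded by the product rule. *)
Definition prodD (nu : nat) (f g : R -> R) (x : R) : R :=
  Derive f x * Derive_n g nu x + f x * Derive_n g (S nu) x.

(* The left-hand side of the product estimate for [kappa = 1], written so that its
   bilinearity in (f, g) is visible. *)
Definition defect (nu N i : nat) (f g : R -> R) : R :=
  rsum N (fun j => g (node N (S j)) *
    I (fun x => f x * (Derive_n (phi N (S j)) nu x * Derive (phi N (S i)) x)))
  + rsum N (fun j => prodD nu f g (node N (S j)) * I (fun x => phi N (S j) x * phi N (S i) x)).

Lemma defect_eq nu N i f g k : (1 <= N)%nat -> (i < N)%nat -> (nu <= 2)%nat -> (3 <= k)%nat ->
  Ck_per k f -> Ck_per k g ->
  defect nu N i f g =
  L2ip (fun x => f x * Derive_n (Qh phi N g) nu x) (Derive_n (phi N (S i)) 1)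
         - (-1) ^ 1 *
           L2ip (Qh phi N (Derive_n (fun x => f x * Derive_n g nu x) 1)) (phi N (S i)).
Proof.
  intros HN Hi Hnu Hk Hf Hg.
  assert (Hb : forall j, (j < N)%nat -> spline r N (phi N (S j))) by (intros; apply (basis_spline m K phi Q); auto).
  assert (Hfc : pwc N f) by (apply cont_pwc, (Ck_cont k); auto).
  assert (Hbd : forall j, (j < N)%nat -> pwc N (Derive_n (phi N (S j)) nu)).
  { intros; apply spl_pwc_n; auto. }
  assert (Hbi : pwc N (Derive (phi N (S i)))) by (apply (spl_pwc_D m); auto).
  assert (Hb0 : forall j, (j < N)%nat -> pwc N (phi N (S j))) by (intros; apply (spl_pwc m); auto).
  unfold defect, L2ip.
  match goal with |- ?a + ?b = ?c - _ * ?d => assert (E1 : c = a); [|assert (E2 : d = b)] end.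
  - symmetry. rewrite (rsum_ext N _ (fun j => I (fun x => g (node N (S j)) * (f x * (Derive_n (phi N (S j)) nu x * Derive (phi N (S i)) x))))).
    2:{ intros j Hj. rewrite (I_scal N) by (auto; pw; auto). auto. }
    rewrite <- (I_rsum N N (fun j x => g (node N (S j)) * (f x * (Derive_n (phi N (S j)) nu x * Derive (phi N (S i)) x))))
      by (auto; intros; pw; auto).
    apply (I_ext N); auto.
    { apply (pwc_rsum N N (fun j x => g (node N (S j)) * (f x * (Derive_n (phi N (S j)) nu x * Derive (phi N (S i)) x)))). intros; pw; auto. }
    intros x Hx. rewrite Qh_lc, lc_Derive_n, <- rsum_scal by auto.
    change (Derive_n (phi N (S i)) 1 x) with (Derive (phi N (S i)) x).
    rewrite <- rsum_scal_r. apply rsum_ext; intros; ring.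
  - assert (ED : forall x, Derive_n (fun x => f x * Derive_n g nu x) 1 x = prodD nu f g x).
    { intros x. apply is_derive_unique.
      replace (prodD nu f g x) with (Derive f x * Derive_n g nu x + f x * Derive_n g (S nu) x) by reflexivity.
      apply (is_derive_mult f (Derive_n g nu)).
      apply (Ck_is_derive k f 0); auto; lia. apply (Ck_is_derive k g nu); auto; lia. intros; apply Rmult_comm. }
    symmetry. rewrite (rsum_ext N _ (fun j => I (fun x => prodD nu f g (node N (S j)) * (phi N (S j) x * phi N (S i) x)))).
    2:{ intros j Hj. rewrite (I_scal N); auto. pw; auto. }
    rewrite <- (I_rsum N N (fun j x => prodD nu f g (node N (S j)) * (phi N (S j) x * phi N (S i) x)))
      by (auto; intros; pw; auto).
    unfold I. f_equal. extensionality x. rewrite Qh_lc. unfold lc.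
    rewrite <- rsum_scal_r. apply rsum_ext; intros. rewrite ED. ring.
  - rewrite E1, E2. ring.
Qed.

Lemma prodD_lin_l nu k f1 f2 g c x : Ck_per k f1 -> Ck_per k f2 -> (1 <= k)%nat ->
  prodD nu (fun x => f1 x + c * f2 x) g x = prodD nu f1 g x + c * prodD nu f2 g x.
Proof.
  intros H1 H2 Hk. unfold prodD.
  pose proof (Derive_n_lin k f1 f2 c 1 x H1 H2 Hk) as E. simpl in E. rewrite E.
  change (Derive (fun x0 => f1 x0)) with (Derive f1). change (Derive (fun x0 => f2 x0)) with (Derive f2).
  ring.
Qed.

Lemma prodD_lin_r nu k f g1 g2 c x : Ck_per k g1 -> Ck_per k g2 -> (S nu <= k)%nat ->
  prodD nu f (fun x => g1 x + c * g2 x) x = prodD nu f g1 x + c * prodD nu f g2 x.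
Proof.
  intros H1 H2 Hk. unfold prodD.
  rewrite !(Derive_n_lin k g1 g2 c) by (auto; lia). ring.
Qed.

Lemma defect_lin_l nu N i k f1 f2 g c : (1 <= N)%nat -> (i < N)%nat -> (nu <= 2)%nat -> (1 <= k)%nat ->
  Ck_per k f1 -> Ck_per k f2 ->
  defect nu N i (fun x => f1 x + c * f2 x) g = defect nu N i f1 g + c * defect nu N i f2 g.
Proof.
  intros HN Hi Hnu Hk H1 H2. unfold defect.
  rewrite (Rmult_plus_distr_l c).
  rewrite <- !(rsum_scal N c).
  match goal with |- ?A + ?B = ?C + ?D + (?E + ?F) =>
    assert (A = C + E); [|assert (B = D + F); [|lra]] end.
  - rewrite <- rsum_plus. apply rsum_ext. intros j Hj.
    assert (P1 : pwc N f1) by (apply cont_pwc, (Ck_cont k); auto).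
    assert (P2 : pwc N f2) by (apply cont_pwc, (Ck_cont k); auto).
    assert (P3 : pwc N (Derive_n (phi N (S j)) nu)) by (apply spl_pwc_n; auto; apply (basis_spline m K phi Q); auto).
    assert (P4 : pwc N (Derive (phi N (S i)))) by (apply (spl_pwc_D m); auto; apply (basis_spline m K phi Q); auto).
    set (w := fun x => Derive_n (phi N (S j)) nu x * Derive (phi N (S i)) x).
    change (g (node N (S j)) * I (fun x => (f1 x + c * f2 x) * w x) =
      g (node N (S j)) * I (fun x => f1 x * w x) + c * (g (node N (S j)) * I (fun x => f2 x * w x))).
    assert (P5 : pwc N w) by (unfold w; pw).
    replace (fun x => (f1 x + c * f2 x) * w x) with (fun x => f1 x * w x + c * (f2 x * w x)) by (extensionality x; ring).
    rewrite (I_plus N), (I_scal N) by (auto; pw). ring.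
  - rewrite <- rsum_plus. apply rsum_ext. intros j Hj. rewrite (prodD_lin_l nu k) by auto. ring.
Qed.

Lemma defect_lin_r nu N i k f g1 g2 c : (S nu <= k)%nat -> Ck_per k g1 -> Ck_per k g2 ->
  defect nu N i f (fun x => g1 x + c * g2 x) = defect nu N i f g1 + c * defect nu N i f g2.
Proof.
  intros Hk H1 H2. unfold defect.
  rewrite (Rmult_plus_distr_l c).
  rewrite <- !(rsum_scal N c).
  match goal with |- ?A + ?B = ?C + ?D + (?E + ?F) =>
    assert (A = C + E); [|assert (B = D + F); [|lra]] end.
  - rewrite <- rsum_plus. apply rsum_ext. intros j Hj. ring.
  - rewrite <- rsum_plus. apply rsum_ext. intros j Hj. rewrite (prodD_lin_r nu k) by auto. ring.
Qed.

(** The constant depends on [N] and [i]: this is only the continuity of each individual functional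
    that uniform boundedness asks for. *)
Lemma defect_bound nu N i k f g Bf Bg : (1 <= N)%nat -> (i < N)%nat -> (nu <= 2)%nat -> (3 <= k)%nat ->
  CkB k Bf f -> CkB k Bg g ->
  Rabs (defect nu N i f g) <= Bf * Bg *
    (rsum N (fun j => L2norm (fun x => Derive_n (phi N (S j)) nu x * Derive (phi N (S i)) x)) +
     2 * rsum N (fun j => Rabs (I (fun x => phi N (S j) x * phi N (S i) x)))).
Proof.
  intros HN Hi Hnu Hk Hf Hg. assert (HBf := CkB_pos _ _ _ Hf). assert (HBg := CkB_pos _ _ _ Hg).
  unfold defect. eapply Rle_trans. apply Rabs_triang. rewrite Rmult_plus_distr_l.
  apply Rplus_le_compat.
  - eapply Rle_trans. apply rsum_abs. rewrite <- rsum_scal. apply rsum_le. intros j Hj.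
    rewrite Rabs_mult, (Rmult_comm Bf), Rmult_assoc.
    apply Rmult_le_compat; auto using Rabs_pos. apply (proj2 Hg O); lia.
    apply (L2norm_le_I_bound N); auto. apply cont_pwc, (Ck_cont k), Hf.
    apply pwc_mult. apply spl_pwc_n; auto. apply (basis_spline m K phi Q); auto.
    apply (spl_pwc_D m); auto. apply (basis_spline m K phi Q); auto.
    intros x _. apply (proj2 Hf O); lia.
  - eapply Rle_trans. apply rsum_abs. rewrite <- Rmult_assoc, <- rsum_scal. apply rsum_le. intros j Hj.
    rewrite Rabs_mult. apply Rmult_le_compat_r. apply Rabs_pos.
    unfold prodD. eapply Rle_trans. apply Rabs_triang. rewrite !Rabs_mult.
    pose proof (proj2 Hf O (node N (S j)) ltac:(lia)) as A1. simpl in A1.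
    pose proof (proj2 Hf 1%nat (node N (S j)) ltac:(lia)) as A2.
    change (Derive_n f 1) with (Derive f) in A2.
    pose proof (proj2 Hg nu (node N (S j)) ltac:(lia)) as A3.
    pose proof (proj2 Hg (S nu) (node N (S j)) ltac:(lia)) as A4.
    replace (Bf * Bg * 2) with (Bf * Bg + Bf * Bg) by ring.
    apply Rplus_le_compat; apply Rmult_le_compat; auto using Rabs_pos.
Qed.

(** For nu = 0, 1, 2 and kappa = 1 the exponent of the product estimate is 2r+1, 2r-1, 2r-1, in each
    case at least r+1. The constant still depends on [f] and [g]. *)
Lemma defect_pointwise nu k f g : (nu <= 2)%nat -> (3 <= k)%nat -> (K <= k)%nat ->
  Ck_per k f -> Ck_per k g -> exists C, forall N i, (1 <= N)%nat -> (i < N)%nat ->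
  Rabs (defect nu N i f g / hstep N ^ (r + 1)) <= C.
Proof.
  intros Hnu Hk HK Hf Hg.
  destruct (qi_product _ _ _ Q f g nu 1) as [C HC].
  { apply Ck_per_le with k; auto. } { apply Ck_per_le with k; auto. }
  { unfold r; lia. } { unfold r; lia. }
  exists (Rmax C 0). intros N i HN Hi.
  assert (Hh := hstep_pos N HN). assert (Hh1 := hstep_le1 N HN).
  specialize (HC N HN).
  assert (Hd : Rabs (defect nu N i f g) <= C * hstep N ^ (2 * r + jpar (nu + 1) - nu - 1)).
  { rewrite (defect_eq nu N i f g k) by auto. eapply Rle_trans; [|exact HC].
    apply (max1N_ge N (fun i => Rabs
        (L2ip (fun x => f x * Derive_n (Qh phi N g) nu x) (Derive_n (phi N i) 1)
         - (-1) ^ 1 *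
           L2ip (Qh phi N (Derive_n (fun x => f x * Derive_n g nu x) 1)) (phi N i))) (S i)). lia. }
  assert (Hp : 0 < hstep N ^ (r + 1)) by (apply pow_lt; auto).
  unfold Rdiv. rewrite Rabs_mult, Rabs_inv, (Rabs_pos_eq (_ ^ _)) by lra.
  apply Rmult_le_reg_r with (hstep N ^ (r + 1)); auto. rewrite Rmult_assoc, Rinv_l by lra. rewrite Rmult_1_r.
  eapply Rle_trans. exact Hd.
  assert (Hp' : 0 <= hstep N ^ (2 * r + jpar (nu + 1) - nu - 1)) by (apply pow_le; lra).
  apply Rle_trans with (Rmax C 0 * hstep N ^ (2 * r + jpar (nu + 1) - nu - 1)).
  - apply Rmult_le_compat_r; auto. apply Rmax_l.
  - apply Rmult_le_compat_l. apply Rmax_r. apply pow_le_1. lra.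
    destruct nu as [|[|[|]]]; unfold jpar; simpl Nat.even; cbn iota; unfold r; lia.
Qed.

(** The defect is bilinear, so uniform boundedness is applied once in [g] for fixed [f], over the
    indices (N, i), and once in [f], with [g] in the unit ball made part of the index. The result of
    the former is the pointwise bound of the latter. *)
Lemma defect_uniform nu k : (nu <= 2)%nat -> (3 <= k)%nat -> (K <= k)%nat ->
  exists C, forall f g N i, unit_ball (S (S k)) f -> unit_ball (S (S k)) g ->
    (1 <= N)%nat -> (i < N)%nat -> Rabs (defect nu N i f g / hstep N ^ (r + 1)) <= C.
Proof.
  intros Hnu Hk HK.
  assert (bd : forall N i f g Bf Bg, (1 <= N)%nat -> (i < N)%nat -> CkB k Bf f -> CkB k Bg g ->
     Rabs (defect nu N i f g / hstep N ^ (r + 1)) <=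
    (rsum N (fun j => L2norm (fun x => Derive_n (phi N (S j)) nu x * Derive (phi N (S i)) x)) +
     2 * rsum N (fun j => Rabs (I (fun x => phi N (S j) x * phi N (S i) x)))) / hstep N ^ (r + 1) * (Bf * Bg)).
  { intros N i f g Bf Bg HN Hi Hf Hg.
    assert (Hp : 0 < hstep N ^ (r + 1)) by (apply pow_lt, hstep_pos; auto).
    unfold Rdiv. rewrite Rabs_mult, Rabs_inv, (Rabs_pos_eq (_ ^ _)) by lra.
    rewrite (Rmult_comm _ (Bf * Bg)), <- Rmult_assoc. apply Rmult_le_compat_r.
    left; apply Rinv_0_lt_compat; auto. apply (defect_bound nu N i k); auto. }
  assert (bd0 : forall N i, (1 <= N)%nat -> 0 <=
    (rsum N (fun j => L2norm (fun x => Derive_n (phi N (S j)) nu x * Derive (phi N (S i)) x)) +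
     2 * rsum N (fun j => Rabs (I (fun x => phi N (S j) x * phi N (S i) x)))) / hstep N ^ (r + 1)).
  { intros N i HN. apply Rdiv_le_0_compat. 2: apply pow_lt, hstep_pos; auto.
    apply Rplus_le_le_0_compat. apply rsum_nonneg; intros; apply L2norm_pos.
    apply Rmult_le_pos; [lra|]. apply rsum_nonneg; intros; apply Rabs_pos. }
  assert (CkB_ex : forall g, Ck_per k g -> unit_ball (S (S k)) g -> CkB k 1 g).
  { intros g Hg [_ Hb]. split; auto. }
  assert (step1 : forall f Bf, CkB k Bf f -> exists C, forall g (al : nat * nat), unit_ball (S (S k)) g ->
     ((1 <= fst al)%nat /\ (snd al < fst al)%nat) -> Rabs (defect nu (fst al) (snd al) f g / hstep (fst al) ^ (r + 1)) <= C).
  { intros f Bf Hf. apply (uniform_boundedness (nat * nat) (fun al => (1 <= fst al)%nat /\ (snd al < fst al)%nat) k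
      (fun al g => defect nu (fst al) (snd al) f g / hstep (fst al) ^ (r + 1))).
    - intros [N i] v w c [HN Hi] Hv Hw. simpl fst in *; simpl snd in *.
      rewrite (defect_lin_r nu N i k) by (auto; lia). unfold Rdiv; ring.
    - intros [N i] [HN Hi]. simpl fst in *; simpl snd in *.
      eexists. split; [|intros v B Hv HB; eapply Rle_trans; [apply (bd N i f v Bf B); auto; split; auto|]].
      2: rewrite <- Rmult_assoc; apply Rle_refl.
      apply Rmult_le_pos; [apply bd0; auto|apply (CkB_pos _ _ _ Hf)].
    - intros v Hv. destruct (defect_pointwise nu k f v Hnu Hk HK (proj1 Hf) Hv) as [C HC].
      exists C. intros [N i] [HN Hi]. apply HC; auto. }
  assert (step2 : exists C, forall f (al : nat * nat * (R -> R)), unit_ball (S (S k)) f ->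
     ((1 <= fst (fst al))%nat /\ (snd (fst al) < fst (fst al))%nat /\ unit_ball (S (S k)) (snd al)) ->
     Rabs (defect nu (fst (fst al)) (snd (fst al)) f (snd al) / hstep (fst (fst al)) ^ (r + 1)) <= C).
  { apply (uniform_boundedness (nat * nat * (R -> R)) (fun al => (1 <= fst (fst al))%nat /\ (snd (fst al) < fst (fst al))%nat /\ unit_ball (S (S k)) (snd al)) k
      (fun al f => defect nu (fst (fst al)) (snd (fst al)) f (snd al) / hstep (fst (fst al)) ^ (r + 1))).
    - intros [[N i] g] v w c [HN [Hi Hg]] Hv Hw. simpl fst in *; simpl snd in *.
      rewrite (defect_lin_l nu N i k) by (auto; lia). unfold Rdiv; ring.
    - intros [[N i] g] [HN [Hi Hg]]. simpl fst in *; simpl snd in *.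
      assert (Hg1 : CkB k 1 g) by (apply CkB_ex; auto; apply Ck_per_le with (S (S k)); auto; apply Hg).
      eexists. split; [apply (bd0 N i); auto|]. intros v B Hv HB. rewrite <- (Rmult_1_r B).
      apply (bd N i v g B 1); auto. split; auto.
    - intros v Hv. destruct (Ck_per_bounded k v Hv) as [Bv HBv].
      destruct (step1 v Bv HBv) as [C HC].
      exists C. intros [[N i] g] [HN [Hi Hg]]. simpl fst in *; simpl snd in *. apply (HC g (N, i)); auto. }
  destruct step2 as [C HC]. exists C. intros f g N i Hf Hg HN Hi. apply (HC f (N, i, g)); auto.
Qed.

Lemma defect_uniform_B nu k B : (nu <= 2)%nat -> (3 <= k)%nat -> (K <= k)%nat ->
  exists C, 0 <= C /\ forall f g N i, CkB (S (S k)) B f -> CkB (S (S k)) B g ->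
    (1 <= N)%nat -> (i < N)%nat -> Rabs (defect nu N i f g) <= C * hstep N ^ (r + 1).
Proof.
  intros Hnu Hk HK. destruct (defect_uniform nu k Hnu Hk HK) as [C HC].
  set (A := Rmax B 1). assert (HA : 1 <= A) by apply Rmax_r. assert (HBA : B <= A) by apply Rmax_l.
  exists (Rmax C 0 * (A * A)). split. apply Rmult_le_pos; [apply Rmax_r|nra].
  intros f g N i Hf Hg HN Hi.
  assert (sc : forall f, CkB (S (S k)) B f -> unit_ball (S (S k)) (fun x => / A * f x)).
  { intros f0 [H1 H2]. split. apply Ck_per_scal; auto. intros j y Hj. rewrite Derive_n_scal_l, Rabs_mult.
    rewrite Rabs_inv, Rabs_pos_eq by lra. apply Rmult_le_reg_l with A; [lra|].
    rewrite <- Rmult_assoc, Rinv_r, Rmult_1_l, Rmult_1_r by lra. eapply Rle_trans; [apply H2; auto|auto]. }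
  assert (Hf' := sc f Hf). assert (Hg' := sc g Hg).
  (* Homogeneity is extracted from linearity by writing [f] as [f/A] plus [A - 1] times [f/A]. *)
  assert (Ef : defect nu N i f g = A * defect nu N i (fun x => / A * f x) g).
  { pose proof (defect_lin_l nu N i (S (S k)) (fun x => / A * f x) (fun x => / A * f x) g (A - 1)
      HN Hi Hnu ltac:(lia) (proj1 Hf') (proj1 Hf')) as E.
    cbv beta in E. replace (fun x => / A * f x + (A - 1) * (/ A * f x)) with f in E by (extensionality x; field; lra).
    rewrite E. ring. }
  assert (Eg : defect nu N i (fun x => / A * f x) g = A * defect nu N i (fun x => / A * f x) (fun x => / A * g x)).
  { pose proof (defect_lin_r nu N i (S (S k)) (fun x => / A * f x) (fun x => / A * g x) (fun x => / A * g x) (A - 1)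
      ltac:(lia) (proj1 Hg') (proj1 Hg')) as E.
    cbv beta in E. replace (fun x => / A * g x + (A - 1) * (/ A * g x)) with g in E by (extensionality x; field; lra).
    rewrite E. ring. }
  specialize (HC _ _ N i Hf' Hg' HN Hi).
  assert (Hp : 0 < hstep N ^ (r + 1)) by (apply pow_lt, hstep_pos; auto).
  set (dd := defect nu N i (fun x => / A * f x) (fun x => / A * g x)) in *.
  unfold Rdiv in HC. rewrite Rabs_mult, Rabs_inv, (Rabs_pos_eq (_ ^ _)) in HC by lra.
  apply (Rmult_le_compat_r (hstep N ^ (r + 1))) in HC; [|lra]. rewrite Rmult_assoc, Rinv_l, Rmult_1_r in HC by lra.
  rewrite Ef, Eg, !Rabs_mult, (Rabs_pos_eq A) by lra.
  replace (Rmax C 0 * (A * A) * hstep N ^ (r + 1)) with (A * (A * (Rmax C 0 * hstep N ^ (r + 1)))) by ring.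
  apply Rmult_le_compat_l; [lra|]. apply Rmult_le_compat_l; [lra|].
  eapply Rle_trans; [exact HC|]. apply Rmult_le_compat_r; [lra|apply Rmax_l].
Qed.

(* The defect on basis functions is carried over to all test splines by
   [riesz_bound]; the rest is the quasi-interpolation error of [prodD nu f g]. *)
Lemma superconv nu B : (nu <= 2)%nat ->
  exists C, 0 <= C /\ forall f g N w, CkB (K + 6) B f -> CkB (K + 6) B g ->
    CkB (K + r) B (prodD nu f g) -> (1 <= N)%nat ->
    Rabs (I (fun x => f x * (Derive_n (Qh phi N g) nu x - Derive_n g nu x) * Derive (lc phi N w) x))
      <= C * hstep N ^ r * L2norm (lc phi N w).
Proof.
  (* [K + 4] is at least both 3 and [K]; uniform boundedness adds two orders, which makes
     [K + 6]. *)
  intros Hnu. destruct (defect_uniform_B nu (K + 4) B Hnu ltac:(lia) ltac:(lia)) as [C1 [HC1 H1]].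
  replace (S (S (K + 4))) with (K + 6)%nat in H1 by lia.
  destruct (riesz_bound m K phi Q) as [C2 [HC2 H2]]. destruct (Qh_approx m K phi Q B) as [C3 [HC3 H3]].
  exists (C2 * C1 + C3). split. { apply Rplus_le_le_0_compat; auto. apply Rmult_le_pos; auto. }
  intros f g N w Hf Hg HG HN.
  assert (Hw := lc_spline m K phi Q N w HN).
  set (chi := lc phi N w) in *. set (G := prodD nu f g) in *.
  assert (P1 : pwc N f) by (apply cont_pwc, (Ck_cont (K + 6)), Hf).
  assert (P2 : pwc N (Derive_n g nu)) by (apply cont_pwc, (Ck_cont_n (K + 6)); [apply Hg|lia]).
  assert (P3 : pwc N (Derive_n (Qh phi N g) nu)) by (apply spl_pwc_n; auto; apply (Qh_spline m K); auto).
  assert (P4 : pwc N (Derive chi)) by (apply (spl_pwc_D m); auto).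
  assert (P5 : pwc N chi) by (apply (spl_pwc m); auto).
  assert (P6 : pwc N G) by (apply cont_pwc, (Ck_cont (K + r)), HG).
  assert (P7 : pwc N (Qh phi N G)) by (apply (spl_pwc m); auto; apply (Qh_spline m K); auto).
  (* The integrand is the derivative of the periodic function [f * g^(nu) * chi]; thus the exact
     part tested with [chi'] becomes [-G] tested with [chi]. *)
  assert (Eibp : I (fun x => G x * chi x + f x * Derive_n g nu x * Derive chi x) = 0).
  { rewrite (I_FTC N (fun x => f x * Derive_n g nu x * chi x)); auto.
    - pose proof (Derive_n_per _ f O 0 (proj1 Hf)) as F1. simpl in F1. pose proof (Derive_n_per _ g nu 0 (proj1 Hg)) as F2.
      pose proof (spl_per m N chi Hw 0) as F3. rewrite Rplus_0_l in *. rewrite F1, F2, F3. ring.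
    - pw.
    - apply cont_mult. apply cont_mult. apply (Ck_cont (K + 6)), Hf. apply (Ck_cont_n (K + 6)); [apply Hg|lia].
      apply (spl_cont m N); auto.
    - intros x _.
      apply (is_derive_mult (fun x => f x * Derive_n g nu x) chi). 3: intros; apply Rmult_comm.
      apply (is_derive_mult f (Derive_n g nu)).
      apply (Ck_is_derive (K + 6) f 0); [apply Hf|lia]. apply (Ck_is_derive (K + 6) g nu); [apply Hg|lia]. intros; apply Rmult_comm.
      apply (spl_is_derive m N); auto. }
  assert (E : I (fun x => f x * (Derive_n (Qh phi N g) nu x - Derive_n g nu x) * Derive chi x) =
     rsum N (fun i => w i * defect nu N i f g) - I (fun x => (Qh phi N G x - G x) * chi x)).
  { transitivity (rsum N (fun i => w i * I (fun x => f x * Derive_n (Qh phi N g) nu x * Derive (phi N (S i)) x))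
      + rsum N (fun i => w i * I (fun x => Qh phi N G x * phi N (S i) x)) - I (fun x => (Qh phi N G x - G x) * chi x)).
    - rewrite <- (I_lc_D m K phi Q N (fun x => f x * Derive_n (Qh phi N g) nu x)) by (auto; pw).
      rewrite <- (I_lc_r m K phi Q N (fun x => Qh phi N G x)) by (auto; pw). fold chi.
      rewrite <- (Rminus_0_r (_ + _ - _)), <- Eibp.
      rewrite <- (I_plus N), <- !(I_minus N) by (auto; pw).
      f_equal. extensionality x. ring.
    - f_equal. rewrite <- rsum_plus. apply rsum_ext. intros i Hi.
      rewrite (defect_eq nu N i f g (K + 6)) by (auto; first [apply Hf | apply Hg | lia]).
      unfold L2ip, I. change (Derive_n (phi N (S i)) 1) with (Derive (phi N (S i))).
      replace (Derive_n (fun x => f x * Derive_n g nu x) 1) with G. ring.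
      extensionality x. symmetry. apply is_derive_unique.
      apply (is_derive_mult f (Derive_n g nu)).
      apply (Ck_is_derive (K + 6) f 0); [apply Hf|lia]. apply (Ck_is_derive (K + 6) g nu); [apply Hg|lia]. intros; apply Rmult_comm. }
  rewrite E. unfold Rminus. eapply Rle_trans. apply Rabs_triang. rewrite Rabs_Ropp.
  rewrite !Rmult_plus_distr_r. apply Rplus_le_compat.
  - eapply Rle_trans. apply (H2 N _ (C1 * hstep N ^ (r + 1))); auto.
    assert (Hh := hstep_pos N HN). right. rewrite pow_add. fold chi. field. lra.
  - eapply Rle_trans. apply (L2norm_CS N); auto. pw. apply Rmult_le_compat_r. apply L2norm_pos. apply H3; auto.
Qed.

End Super.

(** * Differentiation on a closed interval *)

(** The nearest point of [0,T]. Composition with it extends a function continuous on [0,T] to the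
    whole line. *)
Definition clamp (T t : R) : R := Rmax 0 (Rmin T t).

Lemma clamp_in T t : 0 <= T -> Icc 0 T (clamp T t).
Proof. intros HT. unfold clamp, Icc, Rmax, Rmin. destruct (Rle_dec T t); destruct Rle_dec; lra. Qed.
Lemma clamp_id T t : Icc 0 T t -> clamp T t = t.
Proof. unfold clamp, Icc, Rmax, Rmin. intros H. destruct (Rle_dec T t); destruct Rle_dec; lra. Qed.
Lemma clamp_lip T s t : 0 <= T -> Rabs (clamp T s - clamp T t) <= Rabs (s - t).
Proof.
  intros HT. unfold clamp, Rmax, Rmin.
  destruct (Rle_dec T s); destruct (Rle_dec T t); repeat destruct Rle_dec;
  unfold Rabs; repeat destruct Rcase_abs; lra.
Qed.

(* One-sided at the endpoints of [0,T], since only [s] in [0,T] is compared. *)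
Definition hasd (T : R) (f : R -> R) (t l : R) : Prop :=
  forall eps, 0 < eps -> exists d, 0 < d /\ forall s, Icc 0 T s -> Rabs (s - t) < d ->
    Rabs (f s - f t - (s - t) * l) <= eps * Rabs (s - t).

Lemma hasd_is_derive_on T f t l : hasd T f t l <-> is_derive_on (Icc 0 T) f t l.
Proof.
  split.
  - intros H. apply filterlim_locally. intros eps.
    destruct (H (eps / 2)) as [d [Hd Hs]]. { pose proof (cond_pos eps); lra. }
    exists (mkposreal d Hd). intros s Hb Hne Hin.
    unfold ball in *; simpl in *; unfold AbsRing_ball, abs, minus, plus, opp in *; simpl in *.
    specialize (Hs s Hin Hb).
    assert (Hp : 0 < Rabs (s - t)) by (apply Rabs_pos_lt; lra).
    replace ((f s - f t) / (s - t) + - l) with ((f s - f t - (s - t) * l) / (s - t)) by (field; lra).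
    unfold Rdiv. rewrite Rabs_mult, Rabs_inv. apply Rmult_lt_reg_r with (Rabs (s - t)); auto.
    rewrite Rmult_assoc, Rinv_l by lra. pose proof (cond_pos eps). nra.
  - intros H eps Heps.
    destruct (proj1 (filterlim_locally _ _) H (mkposreal eps Heps)) as [d Hd].
    exists d. split. apply cond_pos. intros s Hs Hst.
    destruct (Req_dec s t) as [->|Hne].
    { replace (f t - f t - (t - t) * l) with 0 by ring. rewrite Rminus_diag, Rabs_R0. lra. }
    specialize (Hd s Hst Hne Hs).
    unfold ball in *; simpl in *; unfold AbsRing_ball, abs, minus, plus, opp in *; simpl in *.
    assert (Hp : 0 < Rabs (s - t)) by (apply Rabs_pos_lt; lra).
    replace (f s - f t - (s - t) * l) with (((f s - f t) / (s - t) + - l) * (s - t)) by (field; lra).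
    rewrite Rabs_mult. apply Rmult_le_compat_r; lra.
Qed.

Lemma hasd_unique T f t l1 l2 : 0 < T -> Icc 0 T t -> hasd T f t l1 -> hasd T f t l2 -> l1 = l2.
Proof.
  intros HT Ht H1 H2. apply NNPP. intros Hne.
  assert (He : 0 < Rabs (l1 - l2) / 4) by (pose proof (Rabs_pos_lt (l1 - l2)); lra).
  destruct (H1 _ He) as [d1 [Hd1 A1]]. destruct (H2 _ He) as [d2 [Hd2 A2]].
  (* A step towards the farther endpoint stays in the interval; this is where [T > 0] enters. *)
  assert (Hs : exists s, Icc 0 T s /\ 0 < Rabs (s - t) /\ Rabs (s - t) < d1 /\ Rabs (s - t) < d2).
  { set (d := Rmin (Rmin d1 d2) T / 2).
    assert (Hd : 0 < d /\ d < d1 /\ d < d2 /\ d <= T / 2).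
    { unfold d, Rmin. repeat destruct Rle_dec; lra. }
    unfold Icc in *. destruct (Rle_dec t (T / 2)).
    - exists (t + d). replace (t + d - t) with d by ring. rewrite Rabs_pos_eq; lra.
    - exists (t - d). replace (t - d - t) with (- d) by ring. rewrite Rabs_Ropp, Rabs_pos_eq; lra. }
  destruct Hs as [s [Hs [Hs0 [Hs1 Hs2]]]].
  specialize (A1 s Hs Hs1). specialize (A2 s Hs Hs2).
  assert (E : (s - t) * (l1 - l2) = (f s - f t - (s - t) * l2) - (f s - f t - (s - t) * l1)) by ring.
  apply (f_equal Rabs) in E. rewrite Rabs_mult in E.
  pose proof (Rabs_triang (f s - f t - (s - t) * l2) (- (f s - f t - (s - t) * l1))) as Tr.
  rewrite Rabs_Ropp in Tr. unfold Rminus at 3 in E. rewrite <- E in Tr. nra.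
Qed.

Lemma Derive_on_hasd T f t l : 0 < T -> Icc 0 T t -> hasd T f t l -> Derive_on (Icc 0 T) f t = l.
Proof.
  intros HT Ht H. apply (iota_unique (V := R_CompleteNormedModule)).
  - intros y Hy. apply hasd_is_derive_on in Hy. eapply hasd_unique; eauto.
  - apply hasd_is_derive_on; auto.
Qed.

Lemma is_derive_hasd T f t l : is_derive f t l -> hasd T f t l.
Proof.
  intros H eps Heps. apply is_derive_Reals in H. destruct (H eps Heps) as [d Hd].
  exists d. split. apply cond_pos. intros s _ Hst.
  destruct (Req_dec s t) as [->|Hne].
  { replace (f t - f t - (t - t) * l) with 0 by ring. rewrite Rminus_diag, Rabs_R0. lra. }
  specialize (Hd (s - t) ltac:(lra) Hst). replace (t + (s - t)) with s in Hd by ring.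
  assert (Hp : 0 < Rabs (s - t)) by (apply Rabs_pos_lt; lra).
  replace (f s - f t - (s - t) * l) with (((f s - f t) / (s - t) - l) * (s - t)) by (field; lra).
  rewrite Rabs_mult. apply Rmult_le_compat_r; lra.
Qed.

Lemma hasd_sub T T' f t l : T' <= T -> hasd T f t l -> hasd T' f t l.
Proof.
  intros HT H eps Heps. destruct (H eps Heps) as [d [Hd A]]. exists d; split; auto.
  intros s Hs. apply A. unfold Icc in *; lra.
Qed.

Lemma hasd_ext T f g t l : Icc 0 T t -> (forall s, Icc 0 T s -> f s = g s) -> hasd T f t l -> hasd T g t l.
Proof.
  intros Ht E H eps Heps. destruct (H eps Heps) as [d [Hd A]]. exists d; split; auto.
  intros s Hs Hst. rewrite <- !E by auto. auto.
Qed.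

Lemma hasd_cont T f t l : hasd T f t l -> forall eps, 0 < eps -> exists d, 0 < d /\
  forall s, Icc 0 T s -> Rabs (s - t) < d -> Rabs (f s - f t) < eps.
Proof.
  intros H eps Heps. destruct (H 1 Rlt_0_1) as [d [Hd A]].
  assert (Hl := Rabs_pos l).
  exists (Rmin d (eps / (Rabs l + 2))). split.
  { apply Rmin_glb_lt; auto. apply Rdiv_lt_0_compat; lra. }
  intros s Hs Hst. specialize (A s Hs (Rlt_le_trans _ _ _ Hst (Rmin_l _ _))).
  assert (Hst2 := Rlt_le_trans _ _ _ Hst (Rmin_r _ _)).
  assert (Hq : Rabs (s - t) * (Rabs l + 2) < eps).
  { apply Rmult_lt_compat_r with (r := Rabs l + 2) in Hst2; [|lra]. unfold Rdiv in Hst2.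
    rewrite Rmult_assoc, Rinv_l, Rmult_1_r in Hst2 by lra. auto. }
  replace (f s - f t) with ((f s - f t - (s - t) * l) + (s - t) * l) by ring.
  eapply Rle_lt_trans. apply Rabs_triang. rewrite Rabs_mult.
  pose proof (Rabs_pos (s - t)). nra.
Qed.

Lemma hasd_clamp_cont T f df : 0 <= T -> (forall t, Icc 0 T t -> hasd T f t (df t)) ->
  cont (fun t => f (clamp T t)).
Proof.
  intros HT H t. apply filterlim_locally. intros eps.
  destruct (hasd_cont T f (clamp T t) _ (H _ (clamp_in T t HT)) eps (cond_pos eps)) as [d [Hd A]].
  exists (mkposreal d Hd). intros s Hs.
  unfold ball in *; simpl in *; unfold AbsRing_ball, abs, minus, plus, opp in *; simpl in *.
  apply A. apply clamp_in; auto. eapply Rle_lt_trans; [apply clamp_lip; auto|exact Hs].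
Qed.

Lemma hasd_interior T f t l : 0 < t < T -> hasd T f t l -> is_derive f t l.
Proof.
  intros Ht H. apply is_derive_Reals. intros eps Heps.
  destruct (H (eps / 2)) as [d [Hd A]]; [lra|].
  assert (Hd' : 0 < Rmin d (Rmin t (T - t))) by (repeat apply Rmin_glb_lt; lra).
  exists (mkposreal _ Hd'). intros h Hh0 Hh. simpl in Hh.
  assert (Hh1 : Rabs h < d /\ Rabs h < t /\ Rabs h < T - t).
  { unfold Rmin in Hh. repeat destruct Rle_dec; lra. }
  specialize (A (t + h)). replace (t + h - t) with h in A by ring.
  assert (Hp : 0 < Rabs h) by (apply Rabs_pos_lt; auto).
  assert (Hin : Icc 0 T (t + h)).
  { destruct Hh1 as [_ [B1 B2]]. apply Rabs_def2 in B1. apply Rabs_def2 in B2. unfold Icc; lra. }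
  specialize (A Hin ltac:(lra)).
  replace ((f (t + h) - f t) / h - l) with ((f (t + h) - f t - h * l) / h) by (field; auto).
  unfold Rdiv. rewrite Rabs_mult, Rabs_inv. apply Rmult_lt_reg_r with (Rabs h); auto.
  rewrite Rmult_assoc, Rinv_l by lra. nra.
Qed.

(** Inside the interval the derivative is two-sided, and [clamp] supplies the continuity at the
    endpoints. *)
Lemma hasd_MVT T f df a b : (forall t, Icc 0 T t -> hasd T f t (df t)) -> 0 <= a -> a < b -> b <= T ->
  exists c, a <= c <= b /\ f b - f a = df c * (b - a).
Proof.
  intros H Ha Hab Hb.
  destruct (MVT_gen (fun t => f (clamp T t)) a b df) as [c [Hc E]].
  - intros x Hx. rewrite Rmin_left, Rmax_right in Hx by lra.
    apply is_derive_ext_loc with f.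
    + apply (locally_interval _ x a b); simpl; try lra. intros y Hy1 Hy2. simpl in *.
      rewrite clamp_id; auto. unfold Icc; lra.
    + apply (hasd_interior T). lra. apply H. unfold Icc; lra.
  - intros x Hx. apply continuity_pt_filterlim. apply (hasd_clamp_cont T f df); auto; lra.
  - rewrite Rmin_left, Rmax_right in Hc by lra. exists c; split; auto.
    rewrite !clamp_id in E by (unfold Icc; lra). exact E.
Qed.

(** Differentiability in t, uniformly for x in [D]. Uniformity lets the derivative pass under the
    integral, and the bounds make the notion stable under products. With [D] the points off the
    nodes, spline derivatives qualify. *)
Definition uhasd (D : R -> Prop) (T : R) (F : R -> R -> R) (t : R) (F' : R -> R) : Prop :=
  (exists B, 0 <= B /\ forall x, D x -> Rabs (F t x) <= B /\ Rabs (F' x) <= B) /\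
  forall eps, 0 < eps -> exists d, 0 < d /\ forall s, Icc 0 T s -> Rabs (s - t) < d ->
    forall x, D x -> Rabs (F s x - F t x - (s - t) * F' x) <= eps * Rabs (s - t).

Lemma uhasd_plus D T F F' G G' t : uhasd D T F t F' -> uhasd D T G t G' ->
  uhasd D T (fun s x => F s x + G s x) t (fun x => F' x + G' x).
Proof.
  intros [[A [HA BA]] HF] [[B [HB BB]] HG]. split.
  - exists (A + B). split. lra. intros x Hx. destruct (BA x Hx), (BB x Hx).
    split; (eapply Rle_trans; [apply Rabs_triang|lra]).
  - intros eps Heps. destruct (HF (eps / 2)) as [d1 [Hd1 A1]]; [lra|]. destruct (HG (eps / 2)) as [d2 [Hd2 A2]]; [lra|].
    exists (Rmin d1 d2). split. apply Rmin_glb_lt; auto. intros s Hs Hst x Hx.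
    specialize (A1 s Hs (Rlt_le_trans _ _ _ Hst (Rmin_l _ _)) x Hx).
    specialize (A2 s Hs (Rlt_le_trans _ _ _ Hst (Rmin_r _ _)) x Hx).
    replace (F s x + G s x - (F t x + G t x) - (s - t) * (F' x + G' x)) with
      ((F s x - F t x - (s - t) * F' x) + (G s x - G t x - (s - t) * G' x)) by ring.
    eapply Rle_trans. apply Rabs_triang. lra.
Qed.

Lemma uhasd_mult D T F F' G G' t : uhasd D T F t F' -> uhasd D T G t G' ->
  uhasd D T (fun s x => F s x * G s x) t (fun x => F' x * G t x + F t x * G' x).
Proof.
  intros [[A [HA BA]] HF] [[A2 [HA2 BA2]] HG]. set (B := A + A2).
  assert (HB : 0 <= B) by (unfold B; lra). assert (A <= B /\ A2 <= B) as [LA LA2] by (unfold B; lra).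
  split.
  - exists (B * B + B * B). split. nra. intros x Hx. destruct (BA x Hx) as [P1 P2], (BA2 x Hx) as [P3 P4].
    assert (M : forall p q, Rabs p <= B -> Rabs q <= B -> Rabs (p * q) <= B * B).
    { intros. rewrite Rabs_mult. apply Rmult_le_compat; auto using Rabs_pos. }
    split. pose proof (M (F t x) (G t x) ltac:(lra) ltac:(lra)). nra.
    eapply Rle_trans. apply Rabs_triang. apply Rplus_le_compat; apply M; lra.
  (* [C] dominates the sum of the coefficients of the remainders estimated in [T1] and [T2]. *)
  - intros eps Heps. set (C := 3 * B + 1 + (B + 1) * B + 1).
    assert (HC : 0 < C) by (unfold C; nra).
    set (e := Rmin 1 (eps / C)).
    assert (He : 0 < e). { apply Rmin_glb_lt. lra. apply Rdiv_lt_0_compat; lra. }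
    assert (He1 : e <= 1) by apply Rmin_l.
    assert (HeC : e * C <= eps).
    { assert (e <= eps / C) by apply Rmin_r. apply Rmult_le_compat_r with (r := C) in H; [|lra].
      unfold Rdiv in H. rewrite Rmult_assoc, Rinv_l, Rmult_1_r in H by lra. auto. }
    destruct (HF e He) as [d1 [Hd1 A1]]. destruct (HG e He) as [d2 [Hd2 B1]].
    exists (Rmin e (Rmin d1 d2)). split. apply Rmin_glb_lt; auto. apply Rmin_glb_lt; auto. intros s Hs Hst x Hx.
    assert (Hst0 : Rabs (s - t) < e /\ Rabs (s - t) < d1 /\ Rabs (s - t) < d2).
    { unfold Rmin in Hst. repeat destruct Rle_dec; lra. }
    destruct Hst0 as [S0 [S1 S2]].
    specialize (A1 s Hs S1 x Hx). specialize (B1 s Hs S2 x Hx).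
    destruct (BA x Hx) as [P1 P2], (BA2 x Hx) as [P3 P4].
    set (st := Rabs (s - t)) in *. assert (Hst0 : 0 <= st) by apply Rabs_pos.
    assert (FD : Rabs (F s x - F t x) <= (B + 1) * st).
    { replace (F s x - F t x) with ((F s x - F t x - (s - t) * F' x) + (s - t) * F' x) by ring.
      eapply Rle_trans. apply Rabs_triang. rewrite Rabs_mult. fold st. nra. }
    assert (FS : Rabs (F s x) <= 2 * B + 1).
    { replace (F s x) with ((F s x - F t x) + F t x) by ring.
      eapply Rle_trans. apply Rabs_triang. nra. }
    replace (F s x * G s x - F t x * G t x - (s - t) * (F' x * G t x + F t x * G' x)) with
     ((F s x - F t x - (s - t) * F' x) * G t x + F s x * (G s x - G t x - (s - t) * G' x)
      + (F s x - F t x) * ((s - t) * G' x)) by ring.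
    eapply Rle_trans. apply Rabs_triang.
    assert (T1 : Rabs ((F s x - F t x - (s - t) * F' x) * G t x + F s x * (G s x - G t x - (s - t) * G' x))
      <= (e * st) * B + (2 * B + 1) * (e * st)).
    { eapply Rle_trans. apply Rabs_triang. rewrite !Rabs_mult.
      apply Rplus_le_compat; apply Rmult_le_compat; auto using Rabs_pos; lra. }
    assert (T2 : Rabs ((F s x - F t x) * ((s - t) * G' x)) <= (B + 1) * st * (e * B)).
    { rewrite !Rabs_mult. fold st. apply Rmult_le_compat; auto using Rabs_pos.
      apply Rmult_le_pos; auto using Rabs_pos. apply Rmult_le_compat; auto using Rabs_pos; lra. }
    assert (e * C * st <= eps * st) by (apply Rmult_le_compat_r; auto). unfold C in *. nra.
Qed.

Lemma uhasd_sep D T a da phi B t : hasd T a t da -> (forall x, D x -> Rabs (phi x) <= B) -> 0 <= B ->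
  uhasd D T (fun s x => a s * phi x) t (fun x => da * phi x).
Proof.
  intros Ha Hphi HB. split.
  - exists ((Rabs (a t) + Rabs da) * B). pose proof (Rabs_pos (a t)). pose proof (Rabs_pos da).
    split. apply Rmult_le_pos; lra. intros x Hx. specialize (Hphi x Hx). rewrite !Rabs_mult.
    split; apply Rmult_le_compat; auto using Rabs_pos; lra.
  - intros eps Heps. destruct (Ha (eps / (B + 1))) as [d [Hd A]]. apply Rdiv_lt_0_compat; lra.
    exists d; split; auto. intros s Hs Hst x Hx. specialize (A s Hs Hst). specialize (Hphi x Hx).
    replace (a s * phi x - a t * phi x - (s - t) * (da * phi x)) with ((a s - a t - (s - t) * da) * phi x) by ring.
    rewrite Rabs_mult.
    apply Rle_trans with (eps / (B + 1) * Rabs (s - t) * (B + 1)).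
    + apply Rmult_le_compat; auto using Rabs_pos; lra.
    + right. field. lra.
Qed.

Lemma uhasd_rsum D T n (F : nat -> R -> R -> R) (F' : nat -> R -> R) t :
  (forall k, (k < n)%nat -> uhasd D T (F k) t (F' k)) ->
  uhasd D T (fun s x => rsum n (fun k => F k s x)) t (fun x => rsum n (fun k => F' k x)).
Proof.
  induction n; intros H; simpl.
  - split. exists 0. split. lra. intros; rewrite Rabs_R0; lra.
    intros eps Heps. exists 1. split. lra. intros s _ _ x _.
    replace (0 - 0 - (s - t) * 0) with 0 by ring. rewrite Rabs_R0. apply Rmult_le_pos; [lra|apply Rabs_pos].
  - apply (uhasd_plus D T (fun s x => rsum n (fun k => F k s x)) (fun x => rsum n (fun k => F' k x)) (F n)); auto.
Qed.

Lemma uhasd_ext D T F F' G G' t : Icc 0 T t -> (forall s x, Icc 0 T s -> D x -> F s x = G s x) ->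
  (forall x, D x -> F' x = G' x) -> uhasd D T F t F' -> uhasd D T G t G'.
Proof.
  intros Ht E E' [[B [HB H0]] H]. split.
  - exists B. split; auto. intros x Hx. rewrite <- E, <- E'; auto.
  - intros eps Heps. destruct (H eps Heps) as [d [Hd A]]. exists d; split; auto.
    intros s Hs Hst x Hx. rewrite <- !E, <- E' by auto. auto.
Qed.

Lemma uhasd_I N T F F' t : (1 <= N)%nat -> Icc 0 T t -> (forall s, Icc 0 T s -> pwc N (F s)) -> pwc N F' ->
  uhasd (off N) T F t F' -> hasd T (fun s => I (F s)) t (I F').
Proof.
  intros HN Ht HF HF' [_ H] eps Heps. destruct (H eps Heps) as [d [Hd A]].
  exists d; split; auto. intros s Hs Hst. specialize (A s Hs Hst).
  rewrite <- (I_scal N), <- !(I_minus N) by (auto; pw; auto).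
  assert (P : pwc N (fun x => F s x - F t x - (s - t) * F' x)) by (pw; auto).
  apply Rabs_le_between. split.
  - assert (L : - I (fun x => F s x - F t x - (s - t) * F' x) <= eps * Rabs (s - t)); [|lra].
    replace (- I (fun x => F s x - F t x - (s - t) * F' x)) with (-1 * I (fun x => F s x - F t x - (s - t) * F' x)) by ring.
    rewrite <- (I_scal N) by auto. apply (I_le_const N); auto. pw; auto.
    intros x Hx. specialize (A x Hx). apply Rabs_le_between in A. lra.
  - apply (I_le_const N); auto. intros x Hx. specialize (A x Hx). apply Rabs_le_between in A. lra.
Qed.

Lemma hasd_mult T f g t df dg : hasd T f t df -> hasd T g t dg ->
  hasd T (fun s => f s * g s) t (df * g t + f t * dg).
Proof.
  intros Hf Hg.
  assert (U : forall f df, hasd T f t df -> uhasd (fun _ => True) T (fun s _ => f s) t (fun _ => df)).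
  { intros a da H. split; [|intros eps Heps; destruct (H eps Heps) as [d [Hd A]]; exists d; split; auto].
    exists (Rabs (a t) + Rabs da). pose proof (Rabs_pos (a t)). pose proof (Rabs_pos da). split; [lra|]. intros; lra. }
  destruct (uhasd_mult _ _ _ _ _ _ _ (U f df Hf) (U g dg Hg)) as [_ H].
  intros eps Heps. destruct (H eps Heps) as [d [Hd A]]. exists d; split; auto.
Qed.

Lemma hasd_plus T f g t df dg : hasd T f t df -> hasd T g t dg ->
  hasd T (fun s => f s + g s) t (df + dg).
Proof.
  intros HF HG eps Heps. destruct (HF (eps / 2)) as [d1 [Hd1 A1]]; [lra|]. destruct (HG (eps / 2)) as [d2 [Hd2 A2]]; [lra|].
  exists (Rmin d1 d2). split. apply Rmin_glb_lt; auto. intros s Hs Hst.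
  specialize (A1 s Hs (Rlt_le_trans _ _ _ Hst (Rmin_l _ _))).
  specialize (A2 s Hs (Rlt_le_trans _ _ _ Hst (Rmin_r _ _))).
  replace (f s + g s - (f t + g t) - (s - t) * (df + dg)) with
    ((f s - f t - (s - t) * df) + (g s - g t - (s - t) * dg)) by ring.
  eapply Rle_trans. apply Rabs_triang. lra.
Qed.

Lemma hasd_const T c t : hasd T (fun _ => c) t 0.
Proof. apply is_derive_hasd. apply (is_derive_const c t). Qed.

Lemma hasd_scal T c f t l : hasd T f t l -> hasd T (fun s => c * f s) t (c * l).
Proof.
  intros H. replace (c * l) with (0 * f t + c * l) by ring. apply (hasd_mult T (fun _ => c)); auto. apply hasd_const.
Qed.

Lemma hasd_rsum T n (f : nat -> R -> R) (d : nat -> R) t :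
  (forall k, (k < n)%nat -> hasd T (f k) t (d k)) ->
  hasd T (fun s => rsum n (fun k => f k s)) t (rsum n d).
Proof.
  induction n; intros H; simpl. apply hasd_const. apply hasd_plus; auto.
Qed.

(** Adding [B / K] turns the inequality into a homogeneous one, and the product with [exp (- K t)]
    has nonpositive derivative. *)
Lemma gronwall T E dE K B : 0 < T -> 0 < K -> (forall t, Icc 0 T t -> hasd T E t (dE t)) ->
  (forall t, Icc 0 T t -> dE t <= K * E t + B) ->
  forall t, Icc 0 T t -> E t + B / K <= (E 0 + B / K) * exp (K * t).
Proof.
  intros HT HK HE HdE t Ht.
  destruct (Req_dec t 0) as [->|Ht0]. { rewrite Rmult_0_r, exp_0. lra. }
  unfold Icc in *.
  assert (HG : forall s, Icc 0 T s -> hasd T (fun s => (E s + B / K) * exp (- K * s)) s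
     (dE s * exp (- K * s) + (E s + B / K) * (- K * exp (- K * s)))).
  { intros s Hs. apply (hasd_mult T (fun s => E s + B / K) (fun s => exp (- K * s))).
    - replace (dE s) with (dE s + 0) by ring. apply (hasd_plus T E (fun _ => B / K)). auto. apply hasd_const.
    - apply is_derive_hasd. auto_derive; auto. ring. }
  destruct (hasd_MVT T _ _ 0 t HG) as [c [Hc Ec]]; try lra.
  assert (Hneg : dE c * exp (- K * c) + (E c + B / K) * (- K * exp (- K * c)) <= 0).
  { pose proof (exp_pos (- K * c)). specialize (HdE c ltac:(lra)).
    replace (dE c * exp (- K * c) + (E c + B / K) * (- K * exp (- K * c))) with
      ((dE c - (K * E c + B)) * exp (- K * c)) by (field; lra). nra. }
  rewrite Rmult_0_r, exp_0 in Ec.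
  assert (Hle : (E t + B / K) * exp (- K * t) <= E 0 + B / K) by nra.
  assert (Hee : exp (- K * t) * exp (K * t) = 1).
  { rewrite <- exp_plus. replace (- K * t + K * t) with 0 by ring. apply exp_0. }
  apply Rmult_le_compat_r with (r := exp (K * t)) in Hle; [|left; apply exp_pos].
  rewrite Rmult_assoc, Hee in Hle. lra.
Qed.

(** Let tau be the supremum of the times up to which [n] stays below [rho]. Continuity gives the
    weak bound at tau, the hypothesis makes it strict, and continuity pushes it past tau unless tau
    = [T]. *)
Lemma bootstrap T n rho : 0 <= T ->
  (forall t, Icc 0 T t -> forall eps, 0 < eps -> exists d, 0 < d /\
     forall s, Icc 0 T s -> Rabs (s - t) < d -> Rabs (n s - n t) < eps) ->
  n 0 < rho ->
  (forall t, Icc 0 T t -> (forall s, Icc 0 t s -> n s <= rho) -> n t < rho) ->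
  forall t, Icc 0 T t -> n t < rho.
Proof.
  intros HT Hc H0 Hb.
  set (A := fun t => Icc 0 T t /\ forall s, Icc 0 t s -> n s < rho).
  destruct (completeness A) as [tau [Hub Hlub]].
  { exists T. intros t [Ht _]. apply Ht. }
  { exists 0. split. unfold Icc; lra. intros s Hs. unfold Icc in Hs. replace s with 0 by lra. auto. }
  assert (Htau : Icc 0 T tau).
  { split. apply Hub. split. unfold Icc; lra. intros s Hs. unfold Icc in Hs. replace s with 0 by lra. auto.
    apply Hlub. intros t [Ht _]. apply Ht. }
  assert (Hlt : forall s, 0 <= s < tau -> n s < rho).
  { intros s Hs. apply NNPP. intros Hn. assert (tau <= s); [|lra]. apply Hlub.
    intros t [Ht HA]. apply Rnot_lt_le. intros Hst. apply Hn. apply HA. unfold Icc; lra. }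
  assert (Htau_lt : n tau < rho).
  { apply Hb; auto. intros s Hs. unfold Icc in Hs. destruct (Req_dec s tau) as [->|]; [|left; apply Hlt; lra].
    apply Rnot_lt_le. intros Hgt. destruct (Hc tau Htau (n tau - rho)) as [d [Hd Hd']]; [lra|].
    destruct (Req_dec tau 0) as [E0|E0]; [rewrite E0 in *; lra|]. unfold Icc in Htau.
    set (s := Rmax 0 (tau - d / 2)).
    assert (Hs0 : 0 <= s < tau /\ tau - s <= d / 2) by (unfold s, Rmax; destruct Rle_dec; lra).
    specialize (Hd' s ltac:(unfold Icc; lra)). rewrite Rabs_left in Hd' by lra.
    specialize (Hd' ltac:(lra)). apply Rabs_def2 in Hd'. specialize (Hlt s ltac:(lra)). lra. }
  assert (HtT : tau = T).
  { apply NNPP. intros Hne. unfold Icc in Htau.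
    destruct (Hc tau Htau (rho - n tau)) as [d [Hd Hd']]; [lra|].
    set (t := Rmin T (tau + d / 2)).
    assert (Ht : tau < t <= T /\ t <= tau + d / 2) by (unfold t, Rmin; destruct Rle_dec; lra).
    assert (t <= tau); [|lra]. apply Hub. split. unfold Icc; lra.
    intros s Hs. unfold Icc in Hs. destruct (Rle_dec s tau).
    - destruct (Req_dec s tau) as [->|]; auto. apply Hlt; lra.
    - specialize (Hd' s ltac:(unfold Icc; lra)). rewrite Rabs_pos_eq in Hd' by lra.
      specialize (Hd' ltac:(lra)). apply Rabs_def2 in Hd'. lra. }
  intros t Ht. unfold Icc in Ht. destruct (Req_dec t tau) as [->|]; auto. apply Hlt. lra.
Qed.

(** * Smooth functions on a strip *)

(** Smoothness in x with bounds uniform in t; regularity in time is deliberately left out. The class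
    is closed under products and x-derivatives, which is all that the uniform bounds on slices
    require. *)
Fixpoint sfam (T : R) (k : nat) (F : R -> R -> R) : Prop :=
  (exists B, forall t x, Icc 0 T t -> Rabs (F t x) <= B) /\
  match k with
  | O => True
  | S k' => exists G, (forall t x, Icc 0 T t -> is_derive (F t) x (G t x)) /\ sfam T k' G
  end.

Lemma sfam_le T k : forall l F, (l <= k)%nat -> sfam T k F -> sfam T l F.
Proof.
  induction k; intros l F Hl H. replace l with O by lia; auto.
  destruct l. split; auto. apply H.
  destruct H as [HB [G [HG HS]]]. split; auto. exists G; split; auto. apply IHk; auto; lia.
Qed.

Lemma sfam_ext T k F F' : (forall t, Icc 0 T t -> F t = F' t) -> sfam T k F -> sfam T k F'.
Proof.
  intros E. destruct k; intros [[B HB] H]; split; try (exists B; intros; rewrite <- E; auto); auto.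
  destruct H as [G [HG HS]]. exists G; split; auto. intros; rewrite <- E; auto.
Qed.

Lemma sfam_plus T k : forall F F', sfam T k F -> sfam T k F' -> sfam T k (fun t x => F t x + F' t x).
Proof.
  induction k; intros F F' [[B HB] H] [[B' HB'] H']; split; auto;
   try (exists (B + B'); intros t x Ht; eapply Rle_trans; [apply Rabs_triang|];
        specialize (HB t x Ht); specialize (HB' t x Ht); lra).
  destruct H as [G [HG HS]], H' as [G' [HG' HS']].
  exists (fun t x => G t x + G' t x). split; auto. intros t x Ht.
  apply (is_derive_plus (F t) (F' t)); auto.
Qed.

Lemma sfam_mult T k : forall F F', sfam T k F -> sfam T k F' -> sfam T k (fun t x => F t x * F' t x).
Proof.
  induction k; intros F F' H0 H0'; assert (L := H0); assert (L' := H0');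
   destruct H0 as [[B HB] H]; destruct H0' as [[B' HB'] H']; split; auto;
   try (exists (B * B'); intros t x Ht; rewrite Rabs_mult; apply Rmult_le_compat; auto using Rabs_pos).
  destruct H as [G [HG HS]], H' as [G' [HG' HS']].
  exists (fun t x => G t x * F' t x + F t x * G' t x). split.
  - intros t x Ht. apply (is_derive_mult (F t) (F' t)); auto. intros; apply Rmult_comm.
  - apply sfam_plus; apply IHk; auto; apply sfam_le with (S k); auto.
Qed.

Lemma sfam_D T k F : sfam T (S k) F -> sfam T k (fun t => Derive (F t)).
Proof.
  intros [_ [G [HG HS]]]. apply sfam_ext with G; auto. intros t Ht. extensionality x.
  symmetry. apply is_derive_unique; auto.
Qed.

Lemma sfam_Dn T j : forall k F, sfam T (j + k) F -> sfam T k (fun t => Derive_n (F t) j).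
Proof.
  induction j; intros k F H; auto. simpl. apply (sfam_D T k (fun t => Derive_n (F t) j)).
  apply IHj. replace (j + S k)%nat with (S j + k)%nat by lia. auto.
Qed.

Lemma sfam_derive T k F t x : Icc 0 T t -> sfam T (S k) F -> is_derive (F t) x (Derive (F t) x).
Proof. intros Ht [_ [G [HG HS]]]. apply Derive_correct. exists (G t x); auto. Qed.

Lemma sfam_prodD T nu k f g : sfam T (S nu + k) f -> sfam T (S nu + k) g ->
  sfam T k (fun t => prodD nu (f t) (g t)).
Proof.
  intros Hf Hg. unfold prodD.
  apply (sfam_plus T k (fun t x => Derive (f t) x * Derive_n (g t) nu x)
    (fun t x => f t x * Derive_n (g t) (S nu) x)); apply sfam_mult.
  - apply (sfam_D T k f). apply sfam_le with (S nu + k)%nat; auto; lia.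
  - apply (sfam_Dn T nu). apply sfam_le with (S nu + k)%nat; auto; lia.
  - apply sfam_le with (S nu + k)%nat; auto; lia.
  - apply (sfam_Dn T (S nu)). auto.
Qed.

(** One order is lost because continuity of the k-th derivative is deduced from its
    differentiability. *)
Lemma sfam_CkB T k F : sfam T (S k) F -> (forall t x, Icc 0 T t -> F t (x + 1) = F t x) ->
  exists B, forall t, Icc 0 T t -> CkB k B (F t).
Proof.
  intros H Hp.
  assert (Hj : forall j, exists B, (j <= S k)%nat -> forall t x, Icc 0 T t -> Rabs (Derive_n (F t) j x) <= B).
  { intros j. destruct (classic (j <= S k)%nat) as [Hj|Hj]; [|exists 0; tauto].
    assert (HS : sfam T (S k - j) (fun t => Derive_n (F t) j)).
    { apply (sfam_Dn T j). replace (j + (S k - j))%nat with (S k) by lia. auto. }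
    destruct (S k - j)%nat; destruct HS as [[B HB] _]; exists B; auto. }
  apply choice in Hj. destruct Hj as [B HB].
  assert (Hd : forall j t x, (j <= k)%nat -> Icc 0 T t -> ex_derive (Derive_n (F t) j) x).
  { intros j t x Hj Ht.
    assert (HS : sfam T (S (k - j)) (fun t => Derive_n (F t) j)).
    { apply (sfam_Dn T j). replace (j + S (k - j))%nat with (S k) by lia. auto. }
    destruct HS as [_ [G [HG _]]]. exists (G t x). apply HG; auto. }
  exists (rsum (S (S k)) (fun j => Rabs (B j))). intros t Ht. split. split; auto.
  - intros j Hj x. split. destruct j; simpl; auto. apply Hd; auto; lia.
    apply (ex_derive_continuous (Derive_n (F t) j)). auto.
  - intros j y Hj. eapply Rle_trans. apply HB; auto. eapply Rle_trans. apply RRle_abs.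
    apply (rsum_term_le (S (S k)) (fun j => Rabs (B j))). lia. intros; apply Rabs_pos.
Qed.

Lemma strip_eps T f t0 x0 eps : continuous_on (fun p : R * R => Icc 0 T (fst p)) (fun p => f (fst p) (snd p)) ->
  Icc 0 T t0 -> 0 < eps -> exists d, 0 < d /\ forall t x, Icc 0 T t -> Rabs (t - t0) < d -> Rabs (x - x0) < d ->
  Rabs (f t x - f t0 x0) < eps.
Proof.
  intros H Ht Heps. specialize (H (t0, x0) Ht).
  destruct (proj1 (filterlim_locally _ _) H (mkposreal eps Heps)) as [d Hd].
  exists d. split. apply cond_pos. intros t x Hin H1 H2. simpl in Hd.
  specialize (Hd (t, x)). apply Hd; auto. split; auto.
Qed.

(** Periodicity reduces x to [0,1]. The segment from the origin to (t, x) is cut into [n] pieces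
    shorter than the modulus of uniform continuity for the tolerance 1, so [f] changes by at most 1
    on each. *)
Lemma strip_bounded T f : 0 <= T ->
  continuous_on (fun p : R * R => Icc 0 T (fst p)) (fun p => f (fst p) (snd p)) ->
  (forall t x, Icc 0 T t -> f t (x + 1) = f t x) -> exists B, forall t x, Icc 0 T t -> Rabs (f t x) <= B.
Proof.
  intros HT Hc Hp.
  destruct (uniform_continuity_2d (fun t x => f (clamp T t) x) 0 T 0 1) with (eps := mkposreal 1 Rlt_0_1) as [d Hd].
  { intros t0 x0 _ _ eps.
    destruct (strip_eps T f (clamp T t0) x0 eps Hc (clamp_in T t0 HT) (cond_pos eps)) as [d [Hd A]].
    exists (mkposreal d Hd). intros t x H1 H2. apply A; auto. apply clamp_in; auto.
    eapply Rle_lt_trans; [apply clamp_lip; auto|auto]. }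
  simpl in Hd. destruct (INR_unbounded ((T + 1) / d)) as [n Hn].
  assert (Hd0 := cond_pos d).
  assert (Hn0 : 0 < INR n). { eapply Rle_lt_trans; [|exact Hn]. apply Rdiv_le_0_compat; lra. }
  assert (Hnd : (T + 1) / INR n < d).
  { apply Rmult_lt_reg_r with (INR n); auto. unfold Rdiv. rewrite Rmult_assoc, Rinv_l, Rmult_1_r by lra.
    apply Rmult_lt_compat_r with (r := d) in Hn; auto. unfold Rdiv in Hn.
    rewrite Rmult_assoc, Rinv_l, Rmult_1_r in Hn by lra. lra. }
  exists (Rabs (f 0 0) + INR n). intros t x Ht.
  destruct (periodic_repr (f t) x) as [y [Hy ->]]; auto.
  assert (Hk : forall k, (k <= n)%nat -> Rabs (f (clamp T (INR k / INR n * t)) (INR k / INR n * y)) <= Rabs (f 0 0) + INR k).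
  { induction k; intros Hk.
    - simpl. unfold Rdiv. rewrite !Rmult_0_l. rewrite clamp_id by (unfold Icc; lra). lra.
    - specialize (IHk ltac:(lia)). rewrite S_INR.
      assert (Hfr : forall j, (j <= n)%nat -> 0 <= INR j / INR n <= 1).
      { intros j Hj. split. apply Rdiv_le_0_compat; auto. apply pos_INR.
        apply Rmult_le_reg_r with (INR n); auto. unfold Rdiv. rewrite Rmult_assoc, Rinv_l by lra.
        rewrite Rmult_1_l, Rmult_1_r. apply le_INR; auto. }
      pose proof (Hfr k ltac:(lia)). pose proof (Hfr (S k) Hk) as Hf2. rewrite S_INR in Hf2. unfold Icc in Ht.
      assert (Hinv : 0 < / INR n) by (apply Rinv_0_lt_compat; auto).
      assert (A : Rabs (f (clamp T ((INR k + 1) / INR n * t)) ((INR k + 1) / INR n * y)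
                 - f (clamp T (INR k / INR n * t)) (INR k / INR n * y)) < 1).
      { apply Hd; try nra.
        - replace ((INR k + 1) / INR n * t - INR k / INR n * t) with (/ INR n * t) by (field; lra).
          rewrite Rabs_pos_eq by (apply Rmult_le_pos; lra). unfold Rdiv in Hnd. nra.
        - replace ((INR k + 1) / INR n * y - INR k / INR n * y) with (/ INR n * y) by (field; lra).
          rewrite Rabs_pos_eq by (apply Rmult_le_pos; lra). unfold Rdiv in Hnd. nra. }
      replace (f (clamp T ((INR k + 1) / INR n * t)) ((INR k + 1) / INR n * y)) with
       ((f (clamp T ((INR k + 1) / INR n * t)) ((INR k + 1) / INR n * y)
                 - f (clamp T (INR k / INR n * t)) (INR k / INR n * y)) + f (clamp T (INR k / INR n * t)) (INR k / INR n * y)) by ring.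
      eapply Rle_trans. apply Rabs_triang. lra. }
  specialize (Hk n (le_n n)). replace (INR n / INR n) with 1 in Hk by (field; lra).
  rewrite !Rmult_1_l, clamp_id in Hk by auto. exact Hk.
Qed.

Lemma Derive_shift f x : (forall y, f (y + 1) = f y) -> Derive f (x + 1) = Derive f x.
Proof.
  intros H. pose proof (Derive_n_comp_trans f 1 x 1) as E. simpl in E.
  change (Derive (fun x0 => f x0)) with (Derive f) in E. rewrite <- E. apply Derive_ext. auto.
Qed.

Lemma Ck_strip_sfam T k : 0 <= T -> forall f, Ck_strip T k f ->
  (forall t x, Icc 0 T t -> f t (x + 1) = f t x) -> sfam T k f.
Proof.
  intros HT. induction k; intros f [Hc H] Hp; split; auto; try (apply strip_bounded; auto).
  destruct H as [Hd [Hx _]]. exists (dx f). split.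
  - intros t x Ht. apply Derive_correct. apply Hd; auto.
  - apply IHk; auto. intros t x Ht. apply Derive_shift. auto.
Qed.

Lemma Ck_strip_hasd T k f t x : 0 < T -> Ck_strip T (S k) f -> Icc 0 T t ->
  hasd T (fun s => f s x) t (dt T f t x).
Proof.
  intros HT [_ [Hd _]] Ht. destruct (Hd t x Ht) as [_ [l Hl]].
  apply hasd_is_derive_on in Hl. unfold dt. rewrite (Derive_on_hasd T _ t l); auto.
Qed.

Lemma dt_per T f t x : (forall t x, Icc 0 T t -> f t (x + 1) = f t x) -> 0 < T -> Icc 0 T t ->
  (forall x, ex_derive_on (Icc 0 T) (fun s => f s x) t) -> dt T f t (x + 1) = dt T f t x.
Proof.
  intros Hp HT Ht He. destruct (He x) as [l Hl]. apply hasd_is_derive_on in Hl. unfold dt.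
  rewrite (Derive_on_hasd T _ t l HT Ht Hl). apply Derive_on_hasd; auto.
  apply hasd_ext with (fun s => f s x); auto. intros; symmetry; auto.
Qed.

(* Equality of the mixed derivatives, from the mean value theorem in x, then in t. *)
Lemma dx_dt_comm T f t x : 0 < T -> Ck_strip T 2 f -> Icc 0 T t ->
  is_derive (dt T f t) x (dt T (dx f) t x).
Proof.
  intros HT H Ht.
  assert (Hw : forall y, hasd T (fun s => f s y) t (dt T f t y)) by (intros; apply (Ck_strip_hasd T 1); auto).
  destruct H as [_ [Hd [Hx _]]].
  assert (Hv : forall s y, Icc 0 T s -> hasd T (fun s => dx f s y) s (dt T (dx f) s y)) by (intros; apply (Ck_strip_hasd T 0); auto).
  destruct Hx as [_ [_ [_ Hvc]]]. destruct Hvc as [Hvc _].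
  apply is_derive_Reals. intros eps Heps.
  destruct (strip_eps T (dt T (dx f)) t x (eps / 2) Hvc Ht ltac:(lra)) as [d [Hd0 A]].
  exists (mkposreal d Hd0). intros h Hh0 Hh. simpl in Hh.
  set (v := dt T (dx f) t x).
  assert (Habs : 0 < Rabs h) by (apply Rabs_pos_lt; auto).
  (* the increment of [dt f] is approximated by difference quotients in t *)
  assert (Hq : forall e, 0 < e -> Rabs (dt T f t (x + h) - dt T f t x - h * v) <= eps / 2 * Rabs h + 2 * e).
  { intros e He. destruct (Hw (x + h) e He) as [d1 [Hd1 A1]]. destruct (Hw x e He) as [d2 [Hd2 A2]].
    assert (Hs : exists s, Icc 0 T s /\ 0 < Rabs (s - t) /\ Rabs (s - t) < d1 /\ Rabs (s - t) < d2 /\ Rabs (s - t) < d).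
    { set (dd := Rmin (Rmin (Rmin d1 d2) d) T / 2).
      assert (Hdd : 0 < dd /\ dd < d1 /\ dd < d2 /\ dd < d /\ dd <= T / 2).
      { unfold dd, Rmin. repeat destruct Rle_dec; lra. }
      unfold Icc in *. destruct (Rle_dec t (T / 2)).
      - exists (t + dd). replace (t + dd - t) with dd by ring. rewrite Rabs_pos_eq; lra.
      - exists (t - dd). replace (t - dd - t) with (- dd) by ring. rewrite Rabs_Ropp, Rabs_pos_eq; lra. }
    destruct Hs as [s [Hs [S0 [S1 [S2 S3]]]]].
    specialize (A1 s Hs S1). specialize (A2 s Hs S2).
    destruct (MVT_is_derive (fun y => f s y - f t y) (fun y => dx f s y - dx f t y) x (x + h)) as [z [Hz Ez]].
    { intros y. apply (is_derive_minus (f s) (f t)); apply Derive_correct; apply Hd; auto. }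
    assert (Hzx : Rabs (z - x) < d).
    { eapply Rle_lt_trans; [|exact Hh]. unfold Rmin, Rmax in Hz. destruct (Rle_dec x (x + h)).
      rewrite !Rabs_pos_eq; lra. rewrite !Rabs_left1; lra. }
    assert (Htau : exists tau, Icc 0 T tau /\ Rabs (tau - t) < d /\ dx f s z - dx f t z = dt T (dx f) tau z * (s - t)).
    { unfold Icc in *. destruct (Rlt_dec s t).
      - destruct (hasd_MVT T (fun s => dx f s z) (fun s => dt T (dx f) s z) s t) as [c [Hc Ec]]; try lra.
        { intros; apply Hv; auto. }
        exists c. split; [lra|]. split. { rewrite Rabs_left1 in S3 by lra. rewrite Rabs_left1; lra. } lra.
      - assert (Hst : s <> t). { intros ->. rewrite Rminus_diag, Rabs_R0 in S0. lra. }
        destruct (hasd_MVT T (fun s => dx f s z) (fun s => dt T (dx f) s z) t s) as [c [Hc Ec]]; try lra.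
        { intros; apply Hv; auto. }
        exists c. split; [lra|]. split. { rewrite Rabs_pos_eq in S3 by lra. rewrite Rabs_pos_eq; lra. } lra. }
    destruct Htau as [tau [Htau [Htt Etau]]].
    specialize (A tau z Htau Htt Hzx). fold v in A.
    assert (E : (s - t) * (dt T f t (x + h) - dt T f t x - h * v) =
      (s - t) * h * (dt T (dx f) tau z - v) - ((f s (x + h) - f t (x + h) - (s - t) * dt T f t (x + h))
        - (f s x - f t x - (s - t) * dt T f t x))).
    { rewrite Etau in Ez. replace (x + h - x) with h in Ez by ring.
      replace (f s (x + h) - f t (x + h) - (s - t) * dt T f t (x + h) - (f s x - f t x - (s - t) * dt T f t x)) with
        ((f s (x + h) - f t (x + h) - (f s x - f t x)) - (s - t) * (dt T f t (x + h) - dt T f t x)) by ring.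
      rewrite Ez. ring. }
    apply (f_equal Rabs) in E. rewrite Rabs_mult in E.
    apply Rmult_le_reg_l with (Rabs (s - t)); auto. rewrite E.
    unfold Rminus at 1. eapply Rle_trans. apply Rabs_triang. rewrite Rabs_Ropp.
    assert (T1 : Rabs ((s - t) * h * (dt T (dx f) tau z - v)) <= Rabs (s - t) * (eps / 2 * Rabs h)).
    { rewrite !Rabs_mult, Rmult_assoc. apply Rmult_le_compat_l; [lra|]. rewrite Rmult_comm.
      apply Rmult_le_compat_r; lra. }
    assert (T2 : Rabs (f s (x + h) - f t (x + h) - (s - t) * dt T f t (x + h) - (f s x - f t x - (s - t) * dt T f t x)) <= 2 * e * Rabs (s - t)).
    { eapply Rle_trans. apply Rabs_triang. rewrite Rabs_Ropp. lra. }
    lra. }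
  assert (Hq2 : Rabs (dt T f t (x + h) - dt T f t x - h * v) <= eps / 2 * Rabs h).
  { apply Rnot_lt_le. intros Hlt.
    specialize (Hq ((Rabs (dt T f t (x + h) - dt T f t x - h * v) - eps / 2 * Rabs h) / 4) ltac:(lra)). lra. }
  replace ((dt T f t (x + h) - dt T f t x) / h - v) with ((dt T f t (x + h) - dt T f t x - h * v) / h) by (field; auto).
  unfold Rdiv. rewrite Rabs_mult, Rabs_inv. apply Rmult_lt_reg_r with (Rabs h); auto.
  rewrite Rmult_assoc, Rinv_l by lra. nra.
Qed.

(** * The exact solution *)

(* [e, v, et, vt] stand for eta, u and their time derivatives at a fixed time; the
   products are those to which the superconvergence estimate is applied. *)
Record slice (m L : nat) (B c0 : R) (e v et vt : R -> R) : Prop := {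
  sl_e : CkB L B e; sl_v : CkB L B v; sl_et : CkB L B et; sl_vt : CkB L B vt;
  sl_e3 : CkB L B (fun x => e x ^ 3);
  sl_e3v : CkB L B (fun x => e x ^ 3 * v x);
  sl_e3dv : CkB L B (fun x => e x ^ 3 * Derive v x);
  sl_p1 : CkB L B (prodD 0 e v); sl_p2 : CkB L B (prodD 0 v e);
  sl_p3 : CkB L B (prodD 1 (fun x => e x ^ 3) vt);
  sl_p4 : CkB L B (prodD 1 (fun x => e x ^ 3 * Derive v x) v);
  sl_p5 : CkB L B (prodD 2 (fun x => e x ^ 3 * v x) v);
  sl_lower : forall x, c0 <= e x;
  sl_pde1 : forall x, et x + (Derive e x * v x + e x * Derive v x) = 0;
  sl_pde2 : forall N chi, (1 <= N)%nat -> spline (S (S (S m))) N chi ->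
    I (fun x => e x * vt x * chi x + 1 / 3 * (e x ^ 3 * Derive vt x) * Derive chi x
      + e x * Derive e x * chi x + e x * v x * Derive v x * chi x
      + 1 / 3 * (e x ^ 3 * (v x * Derive_n v 2 x - Derive v x ^ 2)) * Derive chi x) = 0
}.

Lemma CkB_mono k B B' f : B <= B' -> CkB k B f -> CkB k B' f.
Proof. intros H [H1 H2]; split; auto. intros j y Hj; eapply Rle_trans; [apply H2; auto|auto]. Qed.

Lemma periodic_ext f g x : (forall x, f (x + 1) = f x) -> (forall x, g (x + 1) = g x) ->
  (forall x, 0 <= x <= 1 -> f x = g x :> R) -> f x = g x.
Proof.
  intros Hf Hg H. apply Rminus_diag_uniq.
  destruct (periodic_repr (fun x => f x - g x) x) as [y [Hy ->]]. intros; rewrite Hf, Hg; auto.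
  rewrite H; lra.
Qed.

Lemma Ck_strip_le T k : forall l f, (l <= k)%nat -> Ck_strip T k f -> Ck_strip T l f.
Proof.
  induction k; intros l f Hl [Hc H]. replace l with O by lia; split; auto.
  destruct l. split; auto. destruct H as [H1 [H2 H3]]. split; auto. split; auto.
  split; apply IHk; auto; lia.
Qed.

Section Exact.
Variables (m L M : nat) (T c0 : R) (eta0 u0 : R -> R) (eta u : R -> R -> R).
Hypothesis HM : (L + 6 <= M)%nat.
Hypothesis HT : 0 < T.
Hypothesis Hsol : serre_solution M T eta0 u0 eta u.
Hypothesis Hlow : forall t x, Icc 0 T t -> Icc 0 1 x -> c0 <= eta t x.

Lemma exact_hasd_eta t x : Icc 0 T t -> hasd T (fun s => eta s x) t (dt T eta t x).
Proof. apply (Ck_strip_hasd T 0); auto. destruct Hsol as [[H _] _]. apply Ck_strip_le with M; auto; lia. Qed.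
Lemma exact_hasd_u t x : Icc 0 T t -> hasd T (fun s => u s x) t (dt T u t x).
Proof. apply (Ck_strip_hasd T 0); auto. destruct Hsol as [_ [[H _] _]]. apply Ck_strip_le with M; auto; lia. Qed.

(** The six extra orders cover one time derivative, the at most three space derivatives inside
    [prodD], and the order lost in [sfam_CkB]. The strong momentum equation is converted here to the
    weak form in which it is compared with the scheme. *)
Lemma exact_slice : exists B, forall t, Icc 0 T t ->
  slice m L B c0 (eta t) (u t) (dt T eta t) (dt T u t).
Proof.
  destruct Hsol as [[Se Pe] [[Su Pu] [Heq _]]].
  assert (He : sfam T (L + 5) eta).
  { apply Ck_strip_sfam; auto. lra. apply Ck_strip_le with M; auto; lia. }
  assert (Hu : sfam T (L + 5) u).
  { apply Ck_strip_sfam; auto. lra. apply Ck_strip_le with M; auto; lia. }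
  assert (Hper : forall f, Ck_strip T (S (L + 5)) f -> (forall t x, Icc 0 T t -> f t (x + 1) = f t x) ->
    forall t x, Icc 0 T t -> dt T f t (x + 1) = dt T f t x).
  { intros f [_ [Hf _]] Hp t x Ht. apply dt_per; auto. intros y. apply Hf; auto. }
  assert (Se6 : Ck_strip T (S (L + 5)) eta) by (apply Ck_strip_le with M; auto; lia).
  assert (Su6 : Ck_strip T (S (L + 5)) u) by (apply Ck_strip_le with M; auto; lia).
  assert (Pet := Hper eta Se6 Pe). assert (Put := Hper u Su6 Pu).
  assert (Het : sfam T (L + 5) (dt T eta)) by (apply Ck_strip_sfam; auto; [lra|apply Se6]).
  assert (Hut : sfam T (L + 5) (dt T u)) by (apply Ck_strip_sfam; auto; [lra|apply Su6]).
  assert (H3 : sfam T (L + 5) (fun t x => eta t x ^ 3)).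
  { apply sfam_ext with (fun t x => eta t x * (eta t x * eta t x)).
    intros; extensionality x; ring. repeat apply (sfam_mult T (L + 5)); auto. }
  assert (H3v : sfam T (L + 5) (fun t x => eta t x ^ 3 * u t x)) by (apply (sfam_mult T (L + 5) (fun t x => eta t x ^ 3) u); auto).
  assert (Hdu : sfam T (L + 4) (fun t => Derive (u t))).
  { apply (sfam_D T (L + 4) u). replace (S (L + 4)) with (L + 5)%nat by lia. auto. }
  assert (H3dv : sfam T (L + 4) (fun t x => eta t x ^ 3 * Derive (u t) x)).
  { apply (sfam_mult T (L + 4) (fun t x => eta t x ^ 3) (fun t => Derive (u t))); auto. apply sfam_le with (L + 5)%nat; auto; lia. }
  assert (Pdu : forall t x, Icc 0 T t -> Derive (u t) (x + 1) = Derive (u t) x) by (intros; apply Derive_shift; auto).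
  assert (Pp : forall nu f g, (forall t x, Icc 0 T t -> f t (x + 1) = f t x) -> (forall t x, Icc 0 T t -> g t (x + 1) = g t x) ->
    forall t x, Icc 0 T t -> prodD nu (f t) (g t) (x + 1) = prodD nu (f t) (g t) x).
  { intros nu f g Hf Hg t x Ht. unfold prodD. rewrite Derive_shift by auto. rewrite Hf by auto.
    rewrite <- !Derive_n_comp_trans.
    replace (fun y => g t (y + 1)) with (g t) by (extensionality y; symmetry; auto). auto. }
  assert (S1 : sfam T (S L) (fun t => prodD 0 (eta t) (u t))).
  { apply sfam_prodD; apply sfam_le with (L + 5)%nat; auto; lia. }
  assert (S2 : sfam T (S L) (fun t => prodD 0 (u t) (eta t))).
  { apply sfam_prodD; apply sfam_le with (L + 5)%nat; auto; lia. }
  assert (S3 : sfam T (S L) (fun t => prodD 1 (fun x => eta t x ^ 3) (dt T u t))).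
  { apply (sfam_prodD T 1 (S L) (fun t x => eta t x ^ 3)); apply sfam_le with (L + 5)%nat; auto; lia. }
  assert (S4 : sfam T (S L) (fun t => prodD 1 (fun x => eta t x ^ 3 * Derive (u t) x) (u t))).
  { apply (sfam_prodD T 1 (S L) (fun t x => eta t x ^ 3 * Derive (u t) x)); [apply sfam_le with (L + 4)%nat|apply sfam_le with (L + 5)%nat]; auto; lia. }
  assert (S5 : sfam T (S L) (fun t => prodD 2 (fun x => eta t x ^ 3 * u t x) (u t))).
  { apply (sfam_prodD T 2 (S L) (fun t x => eta t x ^ 3 * u t x)); apply sfam_le with (L + 5)%nat; auto; lia. }
  assert (P3 : forall t x, Icc 0 T t -> eta t (x + 1) ^ 3 = eta t x ^ 3) by (intros; rewrite Pe; auto).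
  assert (P3v : forall t x, Icc 0 T t -> eta t (x + 1) ^ 3 * u t (x + 1) = eta t x ^ 3 * u t x) by (intros; rewrite Pe, Pu; auto).
  assert (P3dv : forall t x, Icc 0 T t -> eta t (x + 1) ^ 3 * Derive (u t) (x + 1) = eta t x ^ 3 * Derive (u t) x) by (intros; rewrite Pe, Pdu; auto).
  assert (get : forall k F, (L + 1 <= k)%nat -> sfam T k F -> (forall t x, Icc 0 T t -> F t (x + 1) = F t x) ->
     exists B, forall t, Icc 0 T t -> CkB L B (F t)).
  { intros k F Hk HF HP. apply (sfam_CkB T L F); auto. apply sfam_le with k; auto; lia. }
  destruct (get (L + 5)%nat eta ltac:(lia) He Pe) as [B1 G1].
  destruct (get (L + 5)%nat u ltac:(lia) Hu Pu) as [B2 G2].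
  destruct (get (L + 5)%nat (dt T eta) ltac:(lia) Het Pet) as [B3 G3].
  destruct (get (L + 5)%nat (dt T u) ltac:(lia) Hut Put) as [B4 G4].
  destruct (get (L + 5)%nat (fun t x => eta t x ^ 3) ltac:(lia) H3 P3) as [B5 G5].
  destruct (get (L + 5)%nat (fun t x => eta t x ^ 3 * u t x) ltac:(lia) H3v P3v) as [B6 G6].
  destruct (get (L + 4)%nat (fun t x => eta t x ^ 3 * Derive (u t) x) ltac:(lia) H3dv P3dv) as [B7 G7].
  destruct (get (S L) (fun t => prodD 0 (eta t) (u t)) ltac:(lia) S1 (Pp 0%nat eta u Pe Pu)) as [B8 G8].
  destruct (get (S L) (fun t => prodD 0 (u t) (eta t)) ltac:(lia) S2 (Pp 0%nat u eta Pu Pe)) as [B9 G9].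
  destruct (get (S L) (fun t => prodD 1 (fun x => eta t x ^ 3) (dt T u t)) ltac:(lia) S3 (Pp 1%nat (fun t x => eta t x ^ 3) (dt T u) P3 Put)) as [B10 G10].
  destruct (get (S L) (fun t => prodD 1 (fun x => eta t x ^ 3 * Derive (u t) x) (u t)) ltac:(lia) S4 (Pp 1%nat (fun t x => eta t x ^ 3 * Derive (u t) x) u P3dv Pu)) as [B11 G11].
  destruct (get (S L) (fun t => prodD 2 (fun x => eta t x ^ 3 * u t x) (u t)) ltac:(lia) S5 (Pp 2%nat (fun t x => eta t x ^ 3 * u t x) u P3v Pu)) as [B12 G12].
  set (B := Rabs B1 + Rabs B2 + Rabs B3 + Rabs B4 + Rabs B5 + Rabs B6 + Rabs B7 + Rabs B8 + Rabs B9 + Rabs B10 + Rabs B11 + Rabs B12).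
  exists B. intros t Ht.
  assert (HB : B1 <= B /\ B2 <= B /\ B3 <= B /\ B4 <= B /\ B5 <= B /\ B6 <= B /\ B7 <= B /\ B8 <= B /\ B9 <= B /\ B10 <= B /\ B11 <= B /\ B12 <= B).
  { unfold B.
    pose proof (Rabs_pos B1); pose proof (Rabs_pos B2); pose proof (Rabs_pos B3); pose proof (Rabs_pos B4);
    pose proof (Rabs_pos B5); pose proof (Rabs_pos B6); pose proof (Rabs_pos B7); pose proof (Rabs_pos B8);
    pose proof (Rabs_pos B9); pose proof (Rabs_pos B10); pose proof (Rabs_pos B11); pose proof (Rabs_pos B12).
    pose proof (RRle_abs B1); pose proof (RRle_abs B2); pose proof (RRle_abs B3); pose proof (RRle_abs B4);
    pose proof (RRle_abs B5); pose proof (RRle_abs B6); pose proof (RRle_abs B7); pose proof (RRle_abs B8);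
    pose proof (RRle_abs B9); pose proof (RRle_abs B10); pose proof (RRle_abs B11); pose proof (RRle_abs B12).
    repeat split; lra. }
  clearbody B. destruct HB as [? [? [? [? [? [? [? [? [? [? [? ?]]]]]]]]]]].
  assert (De : forall x, is_derive (eta t) x (Derive (eta t) x)).
  { intros x. apply (sfam_derive T (L + 4)); auto. replace (S (L + 4)) with (L + 5)%nat by lia; auto. }
  assert (Du : forall x, is_derive (u t) x (Derive (u t) x)).
  { intros x. apply (sfam_derive T (L + 4)); auto. replace (S (L + 4)) with (L + 5)%nat by lia; auto. }
  split; try (eapply CkB_mono; [|first [apply G1|apply G2|apply G3|apply G4|apply G5|apply G6|apply G7|apply G8|apply G9|apply G10|apply G11|apply G12]; auto]; assumption).
  - intros x. destruct (periodic_repr (eta t) x) as [y [Hy ->]]; auto. apply Hlow; auto. unfold Icc; lra.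
  - intros x. apply (periodic_ext (fun x => dt T eta t x + (Derive (eta t) x * u t x + eta t x * Derive (u t) x)) (fun _ => 0)); auto.
    { intros y. rewrite Pet, Pu, Pe, Pdu, Derive_shift; auto. }
    intros y Hy. rewrite <- (proj1 (Heq t y Ht Hy)). f_equal. symmetry. apply is_derive_unique.
    apply (is_derive_mult (eta t) (u t)); auto. intros; apply Rmult_comm.
  - intros N chi HN Hchi.
    set (ut := dt T u) in *.
    (* The dispersive flux; its weak form is the mean of the derivative of the periodic function
       [W * chi]. *)
    set (W := fun t x => eta t x ^ 3 * (Derive (ut t) x + (u t x * Derive_n (u t) 2 x + -1 * (Derive (u t) x * Derive (u t) x)))).
    assert (Hd2u : sfam T 2 (fun t => Derive_n (u t) 2)).
    { apply (sfam_Dn T 2). apply sfam_le with (L + 5)%nat; auto; lia. }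
    assert (Hc : forall c, sfam T 2 (fun _ _ => c)).
    { assert (Hck : forall k c, sfam T k (fun _ _ => c)).
      { induction k; intros c; split; auto; try (exists (Rabs c); intros; lra).
        exists (fun _ _ => 0). split; auto. intros; apply (is_derive_const c). }
      intros; apply Hck. }
    assert (HW : sfam T 2 W).
    { apply (sfam_mult T 2 (fun t x => eta t x ^ 3)). apply sfam_le with (L + 5)%nat; auto; lia.
      apply (sfam_plus T 2 (fun t => Derive (ut t)) (fun t x => u t x * Derive_n (u t) 2 x + -1 * (Derive (u t) x * Derive (u t) x))).
      apply (sfam_D T 2 ut). apply sfam_le with (L + 5)%nat; auto; lia.
      apply (sfam_plus T 2 (fun t x => u t x * Derive_n (u t) 2 x) (fun t x => -1 * (Derive (u t) x * Derive (u t) x))).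
      apply (sfam_mult T 2 u); auto. apply sfam_le with (L + 5)%nat; auto; lia.
      apply (sfam_mult T 2 (fun _ _ => -1) (fun t x => Derive (u t) x * Derive (u t) x)); auto.
      assert (Hdu2 : sfam T 2 (fun t => Derive (u t))) by (apply sfam_le with (L + 4)%nat; auto; lia).
      apply (sfam_mult T 2 (fun t => Derive (u t)) (fun t => Derive (u t))); auto. }
    assert (DW : forall x, is_derive (W t) x (Derive (W t) x)) by (intros; apply (sfam_derive T 1); auto).
    assert (CW : cont (W t)) by (intros x; apply (ex_derive_continuous (W t)); eexists; apply DW).
    assert (CDW : cont (Derive (W t))).
    { intros x. apply (ex_derive_continuous (Derive (W t))). eexists.
      apply (sfam_derive T 0 (fun t => Derive (W t))); auto. apply (sfam_D T 1 W); auto. }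
    assert (Put2 : forall x, Derive (ut t) (x + 1) = Derive (ut t) x) by (intros; apply Derive_shift; intros; apply Put; auto).
    assert (Pu2 : forall x, Derive_n (u t) 2 (x + 1) = Derive_n (u t) 2 x) by (intros; apply Derive_shift; intros; apply Pdu; auto).
    assert (PW : forall x, W t (x + 1) = W t x).
    { intros x. unfold W. rewrite Put2, Pu2, Pe, Pu, Pdu; auto. }
    (* The differential equation differentiates u in x before t, the scheme in t before x; the two
       mixed derivatives must be identified. *)
    assert (Eut : forall y, dt T (dx u) t y = Derive (ut t) y).
    { intros y. symmetry. apply is_derive_unique. apply dx_dt_comm; auto. apply Ck_strip_le with M; auto; lia. }
    assert (pde : forall x, 0 <= x <= 1 -> eta t x * ut t x + eta t x * Derive (eta t) x + eta t x * u t x * Derive (u t) x = 1 / 3 * Derive (W t) x).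
    { intros x Hx. destruct (Heq t x Ht Hx) as [_ E].
      replace (fun y => eta t y ^ 3 * (dt T (dx u) t y + u t y * dx (dx u) t y - dx u t y ^ 2)) with (W t) in E.
      change (dx eta t x) with (Derive (eta t) x) in E. change (dx u t x) with (Derive (u t) x) in E. change (dt T u t x) with (ut t x) in E. cbv beta in E. change (fun y => W t y) with (W t) in E. lra.
      extensionality y. rewrite Eut. unfold W.
      change (dx (dx u) t y) with (Derive_n (u t) 2 y). change (dx u t y) with (Derive (u t) y). ring. }
    assert (Pchi : pwc N chi) by (apply (spl_pwc m); auto).
    assert (Pdchi : pwc N (Derive chi)) by (apply (spl_pwc_D m); auto).
    rewrite (I_ext N _ (fun x => 1 / 3 * (Derive (W t) x * chi x + W t x * Derive chi x))); auto.
    + rewrite (I_scal N); auto.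
      2: { apply pwc_plus; apply pwc_mult; auto; apply cont_pwc; auto. }
      rewrite (I_FTC N (fun x => W t x * chi x)); auto.
      * pose proof (PW 0) as E1. pose proof (spl_per m N chi Hchi 0) as E2. rewrite Rplus_0_l in *. rewrite E1, E2. ring.
      * apply pwc_plus; apply pwc_mult; auto; apply cont_pwc; auto.
      * apply cont_mult; auto. apply (spl_cont m N); auto.
      * intros x _. apply (is_derive_mult (W t) chi). apply DW. apply (spl_is_derive m N); auto. intros; apply Rmult_comm.
    + assert (C1 : cont (eta t)) by (apply (Ck_cont L); apply G1; auto).
      assert (C2 : cont (u t)) by (apply (Ck_cont L); apply G2; auto).
      assert (C3 : cont (ut t)) by (apply (Ck_cont L); apply G4; auto).
      assert (C4 : cont (Derive (u t))).
      { intros x. apply (ex_derive_continuous (Derive (u t))). eexists.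
        apply (sfam_derive T (L + 3) (fun t => Derive (u t))); auto. replace (S (L + 3)) with (L + 4)%nat by lia; auto. }
      assert (C5 : cont (Derive_n (u t) 2)).
      { intros x. apply (ex_derive_continuous (Derive_n (u t) 2)). eexists.
        apply (sfam_derive T 1 (fun t => Derive_n (u t) 2)); auto. }
      assert (C6 : cont (Derive (ut t))).
      { intros x. apply (ex_derive_continuous (Derive (ut t))). eexists.
        apply (sfam_derive T (L + 3) (fun t => Derive (ut t))); auto. apply (sfam_D T (S (L + 3)) ut). replace (S (S (L + 3))) with (L + 5)%nat by lia; auto. }
      assert (C7 : cont (Derive (eta t))).
      { intros x. apply (ex_derive_continuous (Derive (eta t))). eexists.
        apply (sfam_derive T (L + 3) (fun t => Derive (eta t))); auto. apply (sfam_D T (S (L + 3)) eta). replace (S (S (L + 3))) with (L + 5)%nat by lia; auto. }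
      pw.
    + intros x Hx. assert (Hx01 := off_01 N x HN Hx).
      replace (1 / 3 * (Derive (W t) x * chi x + W t x * Derive chi x)) with
        ((1 / 3 * Derive (W t) x) * chi x + 1 / 3 * W t x * Derive chi x) by ring.
      rewrite <- pde by lra. unfold W. ring.
Qed.
End Exact.

(** * Consistency *)

Lemma Rabs_mult_le a b A B : Rabs a <= A -> Rabs b <= B -> Rabs (a * b) <= A * B.
Proof. intros. rewrite Rabs_mult. apply Rmult_le_compat; auto using Rabs_pos. Qed.

Lemma Rabs_plus_le a b A B : Rabs a <= A -> Rabs b <= B -> Rabs (a + b) <= A + B.
Proof. intros. eapply Rle_trans. apply Rabs_triang. lra. Qed.

Lemma Rabs_minus_le a b A B : Rabs a <= A -> Rabs b <= B -> Rabs (a - b) <= A + B.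
Proof. intros. unfold Rminus. apply Rabs_plus_le; auto. rewrite Rabs_Ropp; auto. Qed.

Lemma Rabs_pow_le a A n : Rabs a <= A -> Rabs (a ^ n) <= A ^ n.
Proof. intros. rewrite <- RPow_abs. apply pow_incr. split; auto. apply Rabs_pos. Qed.

Lemma Rabs_opp_le a A : Rabs a <= A -> Rabs (- a) <= A.
Proof. rewrite Rabs_Ropp; auto. Qed.

Lemma Rabs_const_le c : Rabs c <= Rabs c.
Proof. lra. Qed.

Ltac bnd := eapply Rle_trans;
  [ repeat first [ eassumption | apply Rabs_minus_le | apply Rabs_plus_le | apply Rabs_pow_le | apply Rabs_mult_le
      | apply Rabs_opp_le | apply Rabs_const_le ] | ].

Lemma L2norm_plus_le N f g A B : (1 <= N)%nat -> pwc N f -> pwc N g ->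
  L2norm f <= A -> L2norm g <= B -> L2norm (fun x => f x + g x) <= A + B.
Proof. intros HN Hf Hg HA HB. eapply Rle_trans. apply (L2norm_triang N); auto. lra. Qed.

Lemma L2norm_mult_le N f g A B : (1 <= N)%nat -> pwc N f -> pwc N g -> 0 <= B ->
  L2norm f <= A -> (forall x, off N x -> Rabs (g x) <= B) -> L2norm (fun x => f x * g x) <= B * A.
Proof.
  intros HN Hf Hg HB HA Hb. rewrite (L2norm_ext N _ (fun x => g x * f x)); auto.
  - eapply Rle_trans. apply (L2norm_mult N g f B); auto. apply Rmult_le_compat_l; auto.
  - pw.
  - intros; ring.
Qed.

Section Consistency.
Variable m : nat.
Let r := S (S (S m)).
Variables (K : nat) (phi : nat -> nat -> R -> R).
Hypothesis Q : quasi_interpolant_basis r K phi.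
Let L := (K + r + 6)%nat.

(** The second derivative loses h^(5/2) from h^r; since r is at least 3, a factor h^(1/2) survives.
    Hence the interpolants and their derivatives stay bounded independently of [h]. *)
Lemma Qh_sup2 B : exists C, 0 <= C /\ forall N v x, (1 <= N)%nat -> CkB L B v -> off N x ->
  let h := hstep N in
  (Rabs (Qh phi N v x - v x) * sqrt h <= C * h ^ r /\
   Rabs (Derive (Qh phi N v) x - Derive v x) * (h * sqrt h) <= C * h ^ r) /\
  Rabs (Qh phi N v x - v x) <= C * sqrt h /\
  Rabs (Derive (Qh phi N v) x - Derive v x) <= C * sqrt h /\
  Rabs (Derive_n (Qh phi N v) 2 x - Derive_n v 2 x) <= C * sqrt h.
Proof.
  destruct (Qh_sup m K phi Q B) as [C [HC H]]. exists C; split; auto.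
  intros N v x HN Hv Hx h. destruct (H N v x HN) as [H0 [H1 H2]]; auto.
  { apply CkB_le with L; auto. unfold L; lia. }
  fold h in H0, H1, H2. split; auto.
  assert (Hh : 0 < h <= 1) by (split; [apply hstep_pos|apply hstep_le1]; auto).
  set (s := sqrt h) in *. assert (Hs : 0 < s) by (apply sqrt_lt_R0; lra).
  assert (Hs2 : s * s = h) by (apply sqrt_sqrt; lra).
  assert (Hm : 0 < h ^ m <= 1).
  { split. apply pow_lt; lra. rewrite <- (pow1 m). apply pow_incr; lra. }
  assert (Er : h ^ r = (h ^ 2 * s) * s * h ^ m).
  { unfold r. replace (S (S (S m))) with (3 + m)%nat by lia. rewrite pow_add, <- Hs2. ring. }
  assert (key : forall d p, 0 < p -> h ^ 2 * s <= p -> d * p <= C * h ^ r -> d <= C * s).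
  { intros d p Hp Hle Hd. rewrite Er in Hd.
    apply Rmult_le_reg_r with p; auto. eapply Rle_trans; [exact Hd|].
    replace (C * (h ^ 2 * s * s * h ^ m)) with (C * s * ((h ^ 2 * s) * h ^ m)) by ring.
    apply Rmult_le_compat_l. apply Rmult_le_pos; lra.
    assert (0 <= h ^ 2 * s) by (apply Rmult_le_pos; [apply pow2_ge_0|lra]). nra. }
  assert (h ^ 2 <= h) by nra. assert (0 < h ^ 2) by (apply pow_lt; lra).
  split; [|split].
  - apply key with s; auto. nra.
  - apply key with (h * s); auto. apply Rmult_lt_0_compat; lra. apply Rmult_le_compat_r; lra.
  - apply key with (h ^ 2 * s); auto. apply Rmult_lt_0_compat; lra. lra.
Qed.

(** Subtracting the exact equations leaves interpolation errors. Terms linear in differentiated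
    errors go to [superconv], if necessary after integration by parts; undifferentiated errors are
    bounded in L2, quadratic ones in maximum norm. *)
Lemma consistency B c0 : exists C, 1 <= C /\ forall N e v et vt, (1 <= N)%nat -> slice m L B c0 e v et vt ->
  let h := hstep N in
  let H := Qh phi N e in let U := Qh phi N v in let Ht := Qh phi N et in let Ut := Qh phi N vt in
  (forall x, off N x -> Rabs (H x - e x) <= C * sqrt h) /\
  (forall x, off N x -> Rabs (H x) <= C /\ Rabs (Derive H x) <= C /\ Rabs (U x) <= C /\
     Rabs (Derive U x) <= C /\ Rabs (Derive_n U 2 x) <= C /\ Rabs (Ht x) <= C /\ Rabs (Ut x) <= C /\
     Rabs (Derive Ut x) <= C) /\
  (L2norm (fun x => H x - e x) <= C * h ^ r) /\ (L2norm (fun x => U x - v x) <= C * h ^ r) /\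
  (forall w, let chi := lc phi N w in
    Rabs (I (fun x => (Ht x + (Derive H x * U x + H x * Derive U x)) * chi x)) <= C * h ^ r * L2norm chi) /\
  (forall w, let chi := lc phi N w in
    Rabs (I (fun x => H x * Ut x * chi x + 1 / 3 * (H x ^ 3 * Derive Ut x) * Derive chi x
      + H x * Derive H x * chi x + H x * U x * Derive U x * chi x
      + 1 / 3 * (H x ^ 3 * (U x * Derive_n U 2 x - Derive U x ^ 2)) * Derive chi x))
      <= C * h ^ r * (L2norm chi + L2norm (Derive chi))).
Proof.
  destruct (Qh_sup2 B) as [Cs [HCs Hsup]].
  destruct (Qh_approx m K phi Q B) as [Ca [HCa Happ]].
  destruct (superconv m K phi Q 0 B) as [D0 [HD0 Sup0]]; [lia|].
  destruct (superconv m K phi Q 1 B) as [D1 [HD1 Sup1]]; [lia|].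
  destruct (superconv m K phi Q 2 B) as [D2 [HD2 Sup2]]; [lia|].
  set (G := Rabs B + Cs).
  assert (HG : 0 <= G) by (unfold G; pose proof (Rabs_pos B); lra).
  set (C1 := Ca + 2 * D0 + 2 * (Cs * Cs)).
  set (CA := (Ca * G + Ca * G + Ca * (G * G) + Ca * (G * G) + Ca * (2 * (G * G)))).
  set (CB := Ca * (2 * G) + Ca * (G * G) + Ca * (3 * G ^ 2 * (3 * (G + 2 * G ^ 2))) + Ca * (G ^ 3 * G) + G ^ 3 * (Cs * Cs)).
  set (C2 := D1 + D2 + D1).
  assert (HCA : 0 <= CA). { unfold CA. repeat apply Rplus_le_le_0_compat; repeat apply Rmult_le_pos; lra. }
  assert (HGp : forall n, 0 <= G ^ n) by (intros; apply pow_le; auto).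
  assert (HCB : 0 <= CB). { unfold CB. pose proof (HGp 2%nat). pose proof (HGp 3%nat).
    repeat apply Rplus_le_le_0_compat; repeat apply Rmult_le_pos; try lra; auto. }
  assert (HC1 : 0 <= C1) by (unfold C1; nra). assert (HC2 : 0 <= C2) by (unfold C2; lra).
  exists (1 + Cs + Ca + G + C1 + CA + CB + C2). split. lra.
  set (CC := 1 + Cs + Ca + G + C1 + CA + CB + C2).
  intros N e v et vt HN Hsl h H U Ht Ut.
  assert (Hh : 0 < h <= 1) by (split; [apply hstep_pos|apply hstep_le1]; auto).
  assert (Hhr : 0 <= h ^ r) by (apply pow_le; lra).
  assert (Hs : 0 < sqrt h) by (apply sqrt_lt_R0; lra).
  assert (Hs2 : sqrt h * sqrt h = h) by (apply sqrt_sqrt; lra).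
  assert (Hs1 : sqrt h <= 1) by nra.
  assert (HB : 0 <= B) by (eapply CkB_pos, sl_e; eauto).
  assert (HGB : G = B + Cs) by (unfold G; rewrite Rabs_pos_eq; auto).
  assert (Le := sl_e _ _ _ _ _ _ _ _ Hsl). assert (Lv := sl_v _ _ _ _ _ _ _ _ Hsl).
  assert (Let := sl_et _ _ _ _ _ _ _ _ Hsl). assert (Lvt := sl_vt _ _ _ _ _ _ _ _ Hsl).
  assert (SH := Qh_spline m K phi Q N e HN). assert (SU := Qh_spline m K phi Q N v HN).
  assert (SHt := Qh_spline m K phi Q N et HN). assert (SUt := Qh_spline m K phi Q N vt HN).
  fold H in SH. fold U in SU. fold Ht in SHt. fold Ut in SUt.
  assert (pH : pwc N H) by (apply (spl_pwc m); auto). assert (pDH : pwc N (Derive H)) by (apply (spl_pwc_D m); auto).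
  assert (pU : pwc N U) by (apply (spl_pwc m); auto). assert (pDU : pwc N (Derive U)) by (apply (spl_pwc_D m); auto).
  assert (pD2U : pwc N (Derive_n U 2)) by (apply (spl_pwc_D2 m); auto).
  assert (pHt : pwc N Ht) by (apply (spl_pwc m); auto).
  assert (pUt : pwc N Ut) by (apply (spl_pwc m); auto). assert (pDUt : pwc N (Derive Ut)) by (apply (spl_pwc_D m); auto).
  assert (pe : pwc N e) by (apply cont_pwc, (Ck_cont L), Le).
  assert (pv : pwc N v) by (apply cont_pwc, (Ck_cont L), Lv).
  assert (pet : pwc N et) by (apply cont_pwc, (Ck_cont L), Let).
  assert (pvt : pwc N vt) by (apply cont_pwc, (Ck_cont L), Lvt).
  assert (pDe : pwc N (Derive e)) by (apply cont_pwc, (Ck_cont_n L e 1); [apply Le|unfold L; lia]).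
  assert (pDv : pwc N (Derive v)) by (apply cont_pwc, (Ck_cont_n L v 1); [apply Lv|unfold L; lia]).
  assert (pDvt : pwc N (Derive vt)) by (apply cont_pwc, (Ck_cont_n L vt 1); [apply Lvt|unfold L; lia]).
  assert (pD2v : pwc N (Derive_n v 2)) by (apply cont_pwc, (Ck_cont_n L v 2); [apply Lv|unfold L; lia]).
  assert (b0 : forall f j x, CkB L B f -> (j <= 2)%nat -> Rabs (Derive_n f j x) <= B).
  { intros f j x [_ Hf] Hj. apply Hf. unfold L; lia. }
  assert (near : forall a b, Rabs (a - b) <= Cs * sqrt h -> Rabs b <= B -> Rabs a <= G).
  { intros a b H1 H2. replace a with ((a - b) + b) by ring. rewrite HGB, Rplus_comm.
    assert (Cs * sqrt h <= Cs) by nra. eapply Rle_trans. apply Rabs_triang. lra. }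
  assert (bH : forall x, off N x -> Rabs (H x) <= G).
  { intros x Hx. apply near with (e x). apply (Hsup N e x); auto. apply (b0 e O); auto. }
  assert (bDH : forall x, off N x -> Rabs (Derive H x) <= G).
  { intros x Hx. apply near with (Derive e x). apply (Hsup N e x); auto. apply (b0 e 1%nat); auto. }
  assert (bU : forall x, off N x -> Rabs (U x) <= G).
  { intros x Hx. apply near with (v x). apply (Hsup N v x); auto. apply (b0 v O); auto. }
  assert (bDU : forall x, off N x -> Rabs (Derive U x) <= G).
  { intros x Hx. apply near with (Derive v x). apply (Hsup N v x); auto. apply (b0 v 1%nat); auto. }
  assert (bD2U : forall x, off N x -> Rabs (Derive_n U 2 x) <= G).
  { intros x Hx. apply near with (Derive_n v 2 x). apply (Hsup N v x); auto. apply (b0 v 2%nat); auto. }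
  assert (bHt : forall x, off N x -> Rabs (Ht x) <= G).
  { intros x Hx. apply near with (et x). apply (Hsup N et x); auto. apply (b0 et O); auto. }
  assert (bUt : forall x, off N x -> Rabs (Ut x) <= G).
  { intros x Hx. apply near with (vt x). apply (Hsup N vt x); auto. apply (b0 vt O); auto. }
  assert (bDUt : forall x, off N x -> Rabs (Derive Ut x) <= G).
  { intros x Hx. apply near with (Derive vt x). apply (Hsup N vt x); auto. apply (b0 vt 1%nat); auto. }
  assert (LG : B <= G) by lra.
  assert (be : forall x, Rabs (e x) <= G) by (intros x; eapply Rle_trans; [apply (b0 e O x); auto|auto]).
  assert (bv : forall x, Rabs (v x) <= G) by (intros x; eapply Rle_trans; [apply (b0 v O x); auto|auto]).
  assert (bDe : forall x, Rabs (Derive e x) <= G) by (intros x; eapply Rle_trans; [apply (b0 e 1%nat x); auto|auto]).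
  assert (bDv : forall x, Rabs (Derive v x) <= G) by (intros x; eapply Rle_trans; [apply (b0 v 1%nat x); auto|auto]).
  (* Product of a derivative error and a function error: the weights amount to [h^2], and
     [(h^r)^2 / h^2] is at most [h^r]. *)
  assert (Hq : forall a b, 0 <= a -> 0 <= b -> a * (h * sqrt h) <= Cs * h ^ r -> b * sqrt h <= Cs * h ^ r -> a * b <= Cs * Cs * h ^ r).
  { intros a b Ha0 Hb0 Ha Hb.
    assert (P : (a * (h * sqrt h)) * (b * sqrt h) <= (Cs * h ^ r) * (Cs * h ^ r)).
    { apply Rmult_le_compat; auto; repeat apply Rmult_le_pos; lra. }
    replace (a * (h * sqrt h) * (b * sqrt h)) with (a * b * (h * (sqrt h * sqrt h))) in P by ring. rewrite Hs2 in P.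
    assert (Hr2 : h ^ r <= h * h). { replace (h * h) with (h ^ 2) by ring. apply pow_le_1; auto. unfold r; lia. }
    assert (0 < h * h) by nra. apply Rmult_le_reg_r with (h * h); auto. eapply Rle_trans; [exact P|].
    replace (Cs * h ^ r * (Cs * h ^ r)) with (Cs * Cs * h ^ r * h ^ r) by ring.
    apply Rmult_le_compat_l; auto. apply Rmult_le_pos; auto. apply Rmult_le_pos; auto. }
  (* Square of a derivative error: the weights amount to [h^3], so r at least 3 is used. *)
  assert (Hq2 : forall a, 0 <= a -> a * (h * sqrt h) <= Cs * h ^ r -> a * a <= Cs * Cs * h ^ r).
  { intros a Ha0 Ha.
    assert (P : (a * (h * sqrt h)) * (a * (h * sqrt h)) <= (Cs * h ^ r) * (Cs * h ^ r)).
    { apply Rmult_le_compat; auto; repeat apply Rmult_le_pos; lra. }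
    replace (a * (h * sqrt h) * (a * (h * sqrt h))) with (a * a * h ^ 3) in P.
    2:{ replace (h ^ 3) with (h * h * (sqrt h * sqrt h)) by (rewrite Hs2; ring). ring. }
    assert (Hr2 : h ^ r <= h ^ 3) by (apply pow_le_1; auto; unfold r; lia).
    assert (0 < h ^ 3) by (apply pow_lt; lra). apply Rmult_le_reg_r with (h ^ 3); auto. eapply Rle_trans; [exact P|].
    replace (Cs * h ^ r * (Cs * h ^ r)) with (Cs * Cs * h ^ r * h ^ r) by ring.
    apply Rmult_le_compat_l; auto. apply Rmult_le_pos; auto. apply Rmult_le_pos; auto. }
  assert (app : forall f, CkB L B f -> L2norm (fun x => Qh phi N f x - f x) <= Ca * h ^ r).
  { intros f Hf. apply Happ; auto. apply CkB_le with L; auto. unfold L; lia. }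
  assert (nd := app e Le). assert (ne := app v Lv). assert (nt := app vt Lvt). assert (net := app et Let).
  fold H in nd. fold U in ne. fold Ut in nt. fold Ht in net.
  assert (HCC : forall a X, 0 <= X -> a <= CC -> a * X <= CC * X) by (intros; apply Rmult_le_compat_r; auto).
  split; [intros x Hx; eapply Rle_trans; [apply (Hsup N e x); auto|]; apply Rmult_le_compat_r; unfold CC; lra|].
  split.
  { intros x Hx. assert (G <= CC) by (unfold CC; lra).
    repeat split; (eapply Rle_trans; [|eassumption]); auto. }
  split. { eapply Rle_trans; [exact nd|]. apply HCC; auto. unfold CC; lra. }
  split. { eapply Rle_trans; [exact ne|]. apply HCC; auto. unfold CC; lra. }
  assert (CkL : forall f j, CkB L B f -> (j < 3)%nat -> forall x, is_derive (Derive_n f j) x (Derive_n f (S j) x)).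
  { intros f j Hf Hj x. apply (Ck_is_derive L). apply Hf. unfold L; lia. }
  assert (Ck1 : forall f, CkB L B f -> CkB (K + 6) B f) by (intros; apply CkB_le with L; auto; unfold L; lia).
  assert (Ck2 : forall f, CkB L B f -> CkB (K + r) B f) by (intros; apply CkB_le with L; auto; unfold L; lia).
  split.
  - intros w chi. assert (Schi := lc_spline m K phi Q N w HN). fold chi in Schi.
    assert (pchi : pwc N chi) by (apply (spl_pwc m); auto). assert (pDchi : pwc N (Derive chi)) by (apply (spl_pwc_D m); auto).
    assert (HX := L2norm_pos chi).
    assert (S1 := Sup0 e v N w (Ck1 _ Le) (Ck1 _ Lv) (Ck2 _ (sl_p1 _ _ _ _ _ _ _ _ Hsl)) HN).
    assert (S2 := Sup0 v e N w (Ck1 _ Lv) (Ck1 _ Le) (Ck2 _ (sl_p2 _ _ _ _ _ _ _ _ Hsl)) HN).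
    fold chi in S1, S2. simpl Derive_n in S1, S2. fold U in S1. fold H in S2. fold h in S1, S2.
    (* Derivative of the linearised mass flux error times [chi]. Its zero mean moves the derivative
       from the errors to [chi], where [superconv] with nu = 0 gives a bound by the norm of [chi]
       alone. *)
    set (fE := fun x => (e x * (Derive U x - Derive v x) + Derive e x * (U x - v x)
         + (v x * (Derive H x - Derive e x) + Derive v x * (H x - e x))) * chi x
         + (e x * (U x - v x) + v x * (H x - e x)) * Derive chi x).
    assert (pE : pwc N fE) by (unfold fE; pw).
    assert (E0 : I fE = 0).
    { rewrite (I_FTC N (fun x => (e x * (U x - v x) + v x * (H x - e x)) * chi x)); auto.
      - pose proof (Derive_n_per L e O 0 (proj1 Le)) as F1. pose proof (Derive_n_per L v O 0 (proj1 Lv)) as F2.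
        simpl in F1, F2. pose proof (spl_per m N _ Schi 0) as F3. pose proof (spl_per m N _ SH 0) as F4.
        pose proof (spl_per m N _ SU 0) as F5. rewrite Rplus_0_l in *. rewrite F1, F2, F3, F4, F5. ring.
      - pw.
      - assert (cont e) by (apply (Ck_cont L), Le). assert (cont v) by (apply (Ck_cont L), Lv).
        assert (cont H) by (apply (spl_cont m N); auto). assert (cont U) by (apply (spl_cont m N); auto).
        assert (cont chi) by (apply (spl_cont m N); auto).
        apply cont_mult; auto. apply cont_plus; apply cont_mult; auto; apply cont_minus; auto.
      - intros x _.
        pose proof (CkL e O Le ltac:(lia) x) as De. pose proof (CkL v O Lv ltac:(lia) x) as Dv.
        pose proof (spl_is_derive m N _ HN SH x) as DH. pose proof (spl_is_derive m N _ HN SU x) as DU.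
        pose proof (spl_is_derive m N _ HN Schi x) as Dc.
        auto_derive. { repeat split; eexists; eassumption. }
        change (Derive_n e 1 x) with (Derive e x) in De. change (Derive_n v 1 x) with (Derive v x) in Dv.
        change (fun x0 => H x0) with H. change (fun x0 => U x0) with U. change (fun x0 => e x0) with e.
        change (fun x0 => v x0) with v. change (fun x0 => chi x0) with chi. unfold fE. ring. }
    rewrite (I_ext N _ (fun x => (Ht x - et x) * chi x + (((Derive H x - Derive e x) * (U x - v x) + (H x - e x) * (Derive U x - Derive v x)) * chi x)
       + fE x
       - e x * (U x - v x) * Derive chi x - v x * (H x - e x) * Derive chi x)); auto; [|pw|].
    2:{ intros x _. pose proof (sl_pde1 _ _ _ _ _ _ _ _ Hsl x) as P.
        assert (P' : et x = - (Derive e x * v x + e x * Derive v x)) by lra. rewrite P'. unfold fE. ring. }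
    rewrite !(I_minus N), !(I_plus N) by (auto; pw). rewrite E0.
    assert (T1 : Rabs (I (fun x => (Ht x - et x) * chi x)) <= Ca * h ^ r * L2norm chi).
    { eapply Rle_trans. apply (L2norm_CS N); auto; pw. apply Rmult_le_compat_r; auto. }
    assert (T2 : Rabs (I (fun x => ((Derive H x - Derive e x) * (U x - v x) + (H x - e x) * (Derive U x - Derive v x)) * chi x)) <= 2 * (Cs * Cs) * h ^ r * L2norm chi).
    { apply (L2norm_le_I_bound N); auto; [pw| |].
      { apply Rmult_le_pos; auto. nra. }
      intros x Hx. destruct (Hsup N e x HN Le Hx) as [[A1 A2] _]. destruct (Hsup N v x HN Lv Hx) as [[A3 A4] _].
      eapply Rle_trans. apply Rabs_triang. rewrite !Rabs_mult, (Rmult_comm (Rabs (H x - e x))).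
      replace (2 * (Cs * Cs) * h ^ r) with (Cs * Cs * h ^ r + Cs * Cs * h ^ r) by ring.
      apply Rplus_le_compat; apply Hq; auto using Rabs_pos. }
    match goal with |- Rabs ?X <= _ => assert (TT : Rabs X <= Ca * h ^ r * L2norm chi + 2 * (Cs * Cs) * h ^ r * L2norm chi + 0
       + D0 * h ^ r * L2norm chi + D0 * h ^ r * L2norm chi) end.
    { apply Rabs_minus_le; auto. apply Rabs_minus_le; auto. apply Rabs_plus_le; [|rewrite Rabs_R0; lra]. apply Rabs_plus_le; auto. }
    eapply Rle_trans; [exact TT|].
    assert (HY : 0 <= h ^ r * L2norm chi) by (apply Rmult_le_pos; auto).
    replace (_ + _ + _ + _ + _) with (C1 * (h ^ r * L2norm chi)) by (unfold C1; ring).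
    rewrite (Rmult_assoc CC). apply HCC; auto. unfold CC; lra.
  - intros w chi. assert (Schi := lc_spline m K phi Q N w HN). fold chi in Schi.
    assert (pchi : pwc N chi) by (apply (spl_pwc m); auto). assert (pDchi : pwc N (Derive chi)) by (apply (spl_pwc_D m); auto).
    assert (HX := L2norm_pos chi). assert (HX' := L2norm_pos (Derive chi)).
    assert (S1 := Sup1 _ vt N w (Ck1 _ (sl_e3 _ _ _ _ _ _ _ _ Hsl)) (Ck1 _ Lvt) (Ck2 _ (sl_p3 _ _ _ _ _ _ _ _ Hsl)) HN).
    assert (S2 := Sup1 _ v N w (Ck1 _ (sl_e3dv _ _ _ _ _ _ _ _ Hsl)) (Ck1 _ Lv) (Ck2 _ (sl_p4 _ _ _ _ _ _ _ _ Hsl)) HN).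
    assert (S3 := Sup2 _ v N w (Ck1 _ (sl_e3v _ _ _ _ _ _ _ _ Hsl)) (Ck1 _ Lv) (Ck2 _ (sl_p5 _ _ _ _ _ _ _ _ Hsl)) HN).
    fold chi U Ut h in S1, S2, S3.
    change (Derive_n Ut 1) with (Derive Ut) in S1. change (Derive_n vt 1) with (Derive vt) in S1.
    change (Derive_n U 1) with (Derive U) in S2. change (Derive_n v 1) with (Derive v) in S2.
    (* Derivative of [(H^2 - e^2) / 2 + e v (U - v)] times [chi]: it removes the differentiated
       errors from the pressure and convection terms. *)
    set (fE := fun x => (1 / 2 * (2 * H x * Derive H x - 2 * e x * Derive e x) + (Derive e x * v x + e x * Derive v x) * (U x - v x) + e x * v x * (Derive U x - Derive v x)) * chi x
         + (1 / 2 * (H x ^ 2 - e x ^ 2) + e x * v x * (U x - v x)) * Derive chi x).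
    assert (pE : pwc N fE) by (unfold fE; pw).
    assert (E0 : I fE = 0).
    { rewrite (I_FTC N (fun x => (1 / 2 * (H x ^ 2 - e x ^ 2) + e x * v x * (U x - v x)) * chi x)); auto.
      - pose proof (Derive_n_per L e O 0 (proj1 Le)) as F1. pose proof (Derive_n_per L v O 0 (proj1 Lv)) as F2.
        simpl in F1, F2. pose proof (spl_per m N _ Schi 0) as F3. pose proof (spl_per m N _ SH 0) as F4.
        pose proof (spl_per m N _ SU 0) as F5. rewrite Rplus_0_l in *. rewrite F1, F2, F3, F4, F5. ring.
      - pw.
      - assert (cont e) by (apply (Ck_cont L), Le). assert (cont v) by (apply (Ck_cont L), Lv).
        assert (cont H) by (apply (spl_cont m N); auto). assert (cont U) by (apply (spl_cont m N); auto).
        assert (cont chi) by (apply (spl_cont m N); auto).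
        apply cont_mult; auto. apply cont_plus; repeat apply cont_mult; auto; try apply cont_minus; auto; try apply cont_const; apply cont_pow; auto.
      - intros x _.
        pose proof (CkL e O Le ltac:(lia) x) as De. pose proof (CkL v O Lv ltac:(lia) x) as Dv.
        pose proof (spl_is_derive m N _ HN SH x) as DH. pose proof (spl_is_derive m N _ HN SU x) as DU.
        pose proof (spl_is_derive m N _ HN Schi x) as Dc.
        auto_derive. { repeat split; eexists; eassumption. }
        change (fun x0 => H x0) with H. change (fun x0 => U x0) with U. change (fun x0 => e x0) with e.
        change (fun x0 => v x0) with v. change (fun x0 => chi x0) with chi. unfold fE. field. }
    (* [fA] and [fB] collect what is O(h^r) in L2: undifferentiated errors with bounded factors, and
       the square of [U' - v']. *)
    set (fA := fun x => (H x - e x) * (Ut x + U x * Derive U x) + (Ut x - vt x) * e x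
        + (U x - v x) * (e x * Derive U x - (Derive e x * v x + e x * Derive v x))).
    set (fB := fun x => (H x - e x) * (- (1 / 2) * (H x + e x) + 1 / 3 * (H x * H x + H x * e x + e x * e x) * (Derive Ut x + U x * Derive_n U 2 x - Derive U x ^ 2))
        + (U x - v x) * (- (e x * v x) + 1 / 3 * e x ^ 3 * Derive_n U 2 x) + - (1 / 3) * e x ^ 3 * ((Derive U x - Derive v x) * (Derive U x - Derive v x))).
    assert (pA : pwc N fA) by (unfold fA; pw). assert (pB : pwc N fB) by (unfold fB; pw).
    assert (Epde := sl_pde2 _ _ _ _ _ _ _ _ Hsl N chi HN Schi).
    (* Three terms keep a differentiated error against [chi'], with weights [e^3], [e^3 v] and
       [e^3 v']; they are the instances nu = 1, 2, 1 of [superconv]. The weight [e^3 v'] arises by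
       linearising the square of [U'] at [v']. *)
    rewrite (I_ext N _ (fun x => fA x * chi x + fB x * Derive chi x
      + 1 / 3 * (e x ^ 3 * (Derive Ut x - Derive vt x) * Derive chi x)
      + 1 / 3 * (e x ^ 3 * v x * (Derive_n U 2 x - Derive_n v 2 x) * Derive chi x)
      - 2 / 3 * (e x ^ 3 * Derive v x * (Derive U x - Derive v x) * Derive chi x)
      + fE x
      + (e x * vt x * chi x + 1 / 3 * (e x ^ 3 * Derive vt x) * Derive chi x
      + e x * Derive e x * chi x + e x * v x * Derive v x * chi x
      + 1 / 3 * (e x ^ 3 * (v x * Derive_n v 2 x - Derive v x ^ 2)) * Derive chi x))); auto; [|pw|].
    2:{ intros x _. unfold fA, fB, fE. field. }
    rewrite (I_plus N) by (auto; pw). rewrite Epde.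
    rewrite (I_plus N) by (auto; pw). rewrite E0.
    rewrite (I_minus N), !(I_plus N) by (auto; pw). rewrite !(I_scal N) by (auto; pw).
    assert (TA : Rabs (I (fun x => fA x * chi x)) <= CA * h ^ r * L2norm chi).
    { eapply Rle_trans. apply (L2norm_CS N); auto. apply Rmult_le_compat_r; auto.
      apply Rle_trans with ((G + G * G) * (Ca * h ^ r) + G * (Ca * h ^ r) + (G * G + (G * G + G * G)) * (Ca * h ^ r)).
      2:{ right. unfold CA. ring. }
      unfold fA. apply (L2norm_plus_le N); [exact HN|pw|pw|apply (L2norm_plus_le N); [exact HN|pw|pw| |]|];
        (apply (L2norm_mult_le N); [exact HN|pw|pw|nra|assumption|intros x Hx]).
      - specialize (bUt x Hx); specialize (bU x Hx); specialize (bDU x Hx). bnd. lra.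
      - auto.
      - specialize (be x); specialize (bv x); specialize (bDe x); specialize (bDv x); specialize (bDU x Hx). bnd. lra. }
    assert (TB : Rabs (I (fun x => fB x * Derive chi x)) <= CB * h ^ r * L2norm (Derive chi)).
    { eapply Rle_trans. apply (L2norm_CS N); auto. apply Rmult_le_compat_r; auto.
      apply Rle_trans with ((2 * G + 3 * G ^ 2 * (3 * (G + 2 * G ^ 2))) * (Ca * h ^ r) + (G * G + G ^ 3 * G) * (Ca * h ^ r) + G ^ 3 * (Cs * Cs * h ^ r)).
      2:{ right. unfold CB. ring. }
      assert (A13 : Rabs (1 / 3) <= 1) by (rewrite Rabs_pos_eq; lra).
      assert (A13' : Rabs (- (1 / 3)) <= 1) by (rewrite Rabs_Ropp, Rabs_pos_eq; lra).
      assert (A12 : Rabs (- (1 / 2)) <= 1) by (rewrite Rabs_Ropp, Rabs_pos_eq; lra).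
      pose proof (HGp 2%nat). pose proof (HGp 3%nat).
      unfold fB. apply (L2norm_plus_le N); [exact HN|pw|pw|apply (L2norm_plus_le N); [exact HN|pw|pw| |]|].
      - apply (L2norm_mult_le N); [exact HN|pw|pw| |assumption|intros x Hx].
        + assert (0 <= G ^ 2 * (G + 2 * G ^ 2)) by (apply Rmult_le_pos; lra). nra.
        + specialize (bH x Hx); specialize (be x); specialize (bU x Hx); specialize (bDU x Hx); specialize (bD2U x Hx); specialize (bDUt x Hx).
          bnd. assert (0 <= G ^ 2 * (G + 2 * G ^ 2)) by (apply Rmult_le_pos; lra). nra.
      - apply (L2norm_mult_le N); [exact HN|pw|pw| |assumption|intros x Hx].
        + assert (0 <= G ^ 3 * G) by (apply Rmult_le_pos; lra). nra.
        + specialize (be x); specialize (bv x); specialize (bD2U x Hx). bnd. nra.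
      - apply (L2norm_le_const N); [exact HN|pw| |intros x Hx].
        + apply Rmult_le_pos; auto. apply Rmult_le_pos; auto. apply Rmult_le_pos; auto.
        + specialize (be x). assert (Aq : Rabs ((Derive U x - Derive v x) * (Derive U x - Derive v x)) <= Cs * Cs * h ^ r).
          { rewrite Rabs_mult. apply Hq2. apply Rabs_pos. apply (Hsup N v x HN Lv Hx). }
          bnd. right; ring. }
    match goal with |- Rabs ?X <= _ => assert (TT : Rabs X <= CA * h ^ r * L2norm chi + CB * h ^ r * L2norm (Derive chi)
      + 1 * (D1 * h ^ r * L2norm chi) + 1 * (D2 * h ^ r * L2norm chi) + 1 * (D1 * h ^ r * L2norm chi) + 0 + 0) end.
    { apply Rabs_plus_le; [|rewrite Rabs_R0; lra]. apply Rabs_plus_le; [|rewrite Rabs_R0; lra].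
      apply Rabs_minus_le; [|apply Rabs_mult_le; auto; rewrite Rabs_pos_eq; lra].
      apply Rabs_plus_le; [|apply Rabs_mult_le; auto; rewrite Rabs_pos_eq; lra].
      apply Rabs_plus_le; [|apply Rabs_mult_le; auto; rewrite Rabs_pos_eq; lra].
      apply Rabs_plus_le; auto. }
    eapply Rle_trans; [exact TT|].
    assert (HY : 0 <= h ^ r * L2norm chi) by (apply Rmult_le_pos; auto).
    assert (HY' : 0 <= h ^ r * L2norm (Derive chi)) by (apply Rmult_le_pos; auto).
    replace (_ + _ + _ + _ + _ + 0 + 0) with ((CA + C2) * (h ^ r * L2norm chi) + CB * (h ^ r * L2norm (Derive chi))) by (unfold C2; ring).
    replace (CC * h ^ r * (L2norm chi + L2norm (Derive chi))) with (CC * (h ^ r * L2norm chi) + CC * (h ^ r * L2norm (Derive chi))) by ring.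
    apply Rplus_le_compat; apply HCC; auto; unfold CC; lra.
Qed.
End Consistency.

(** * The energy inequality *)

Lemma quad_form_bound a b c k1 k2 k3 k4 k5 k6 C :
  Rabs k1 <= C -> Rabs k2 <= C -> Rabs k3 <= C -> Rabs k4 <= C -> Rabs k5 <= C -> Rabs k6 <= C ->
  k1 * a ^ 2 + k2 * (a * b) + k3 * (a * c) + k4 * b ^ 2 + k5 * (b * c) + k6 * c ^ 2
   <= 2 * C * (a ^ 2 + b ^ 2 + c ^ 2).
Proof.
  intros H1 H2 H3 H4 H5 H6.
  assert (sq : forall k x, Rabs k <= C -> k * x ^ 2 <= C * x ^ 2).
  { intros k x Hk. apply Rabs_le_between in Hk. apply Rmult_le_compat_r. apply pow2_ge_0. lra. }
  assert (cr : forall k x y, Rabs k <= C -> k * (x * y) <= C * (x ^ 2 + y ^ 2) / 2).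
  { intros k x y Hk. assert (HC : 0 <= C) by (eapply Rle_trans; [apply Rabs_pos|exact Hk]).
    apply Rle_trans with (C * Rabs (x * y)).
    - eapply Rle_trans. apply RRle_abs. rewrite Rabs_mult. apply Rmult_le_compat_r; auto. apply Rabs_pos.
    - unfold Rdiv. rewrite Rmult_assoc. apply Rmult_le_compat_l; auto.
      pose proof (pow2_ge_0 (x + y)). pose proof (pow2_ge_0 (x - y)). apply Rabs_le. nra. }
  pose proof (sq k1 a H1). pose proof (sq k4 b H4). pose proof (sq k6 c H6).
  pose proof (cr k2 a b H2). pose proof (cr k3 a c H3). pose proof (cr k5 b c H5).
  lra.
Qed.

Section Energy.
Variable m : nat.
Let r := S (S (S m)).
Variables (K : nat) (phi : nat -> nat -> R -> R).
Hypothesis Q : quasi_interpolant_basis r K phi.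
Let L := (K + r + 6)%nat.

(** The energy inequality at a frozen time: the time derivatives enter as unrelated splines [tht]
    and [xit], tied to the rest only by the two discrete equations. The mass equation is assumed for
    every test spline, since besides [th] it is also tested with [tht]. *)
Lemma energy_static B c0 : 0 < c0 -> exists C h0, 0 < C /\ 0 < h0 /\
  forall N e v et vt p q p' q', (1 <= N)%nat -> hstep N <= h0 -> slice m L B c0 e v et vt ->
  let h := hstep N in
  let H := Qh phi N e in let U := Qh phi N v in let Ht := Qh phi N et in let Ut := Qh phi N vt in
  let th := lc phi N p in let xi := lc phi N q in let tht := lc phi N p' in let xit := lc phi N q' in
  let eh := fun x => H x - th x in let ehx := fun x => Derive H x - Derive th x in
  let uh := fun x => U x - xi x in let uhx := fun x => Derive U x - Derive xi x in
  let uhxx := fun x => Derive_n U 2 x - Derive_n xi 2 x in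
  let eht := fun x => Ht x - tht x in let uht := fun x => Ut x - xit x in
  let uhtx := fun x => Derive Ut x - Derive xit x in
  L2norm th + L2norm xi + L2norm (Derive xi) <= h ^ 2 ->
  (forall x, off N x -> c0 / 2 <= eh x <= C) /\
  ((forall w, I (fun x => (eht x + (ehx x * uh x + eh x * uhx x)) * lc phi N w x) = 0) ->
  I (fun x => eh x * uht x * xi x + 1 / 3 * (eh x ^ 3 * uhtx x) * Derive xi x
      + eh x * ehx x * xi x + eh x * uh x * uhx x * xi x
      + 1 / 3 * (eh x ^ 3 * (uh x * uhxx x - uhx x ^ 2)) * Derive xi x) = 0 ->
  I (fun x => 2 * th x * tht x + (eht x * xi x ^ 2 + eh x * (2 * xi x * xit x))
      + 1 / 3 * (3 * eh x ^ 2 * eht x * Derive xi x ^ 2 + eh x ^ 3 * (2 * Derive xi x * Derive xit x)))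
    <= C * (L2norm th ^ 2 + L2norm xi ^ 2 + L2norm (Derive xi) ^ 2 + (h ^ r) ^ 2)).
Proof.
  intros Hc0.
  destruct (consistency m K phi Q B c0) as [A [HA Hcons]].
  destruct (spl_inverse m) as [Ci [HCi Hinv]].
  (* [G] dominates the maximum norms of all coefficients: [A] those of the interpolants, [A + Ci]
     those of the discrete functions, the last bracket that of [eht]. *)
  set (G := A + Ci + (A + Ci * (A + 4 * ((A + Ci) * Ci)))).
  assert (HACi : 0 <= (A + Ci) * Ci) by (apply Rmult_le_pos; lra).
  assert (HAC2 : 0 <= Ci * (A + 4 * ((A + Ci) * Ci))) by (apply Rmult_le_pos; lra).
  assert (HG1 : 1 <= G) by (unfold G; lra).
  set (CZ := G + (2 * G + 2 * G + 2 * (G * G)) + (2 * G + 2 * (3 * (G * G) * G) + 2 * G + 2 * (3 * (G * G) * (G * G + G ^ 2)))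
     + (2 * (G * G) + G) + (2 * (G * G) + 2 * (G ^ 3 * G)) + (2 * (G ^ 3 * (G + G)) + (3 * G ^ 2 * G * G + G ^ 3 * G) + G ^ 2 * G)).
  assert (P : forall n, 0 <= G ^ n) by (intros; apply pow_le; lra).
  assert (P2 := P 2%nat). assert (P3 := P 3%nat).
  assert (PGG : 0 <= G * G) by (apply Rmult_le_pos; lra).
  assert (t1 : 0 <= G * G * G) by (apply Rmult_le_pos; lra).
  assert (t2 : 0 <= G * G * (G * G + G ^ 2)) by (apply Rmult_le_pos; lra).
  assert (t3 : 0 <= G ^ 3 * G) by (apply Rmult_le_pos; lra).
  assert (t4 : 0 <= G ^ 3 * (G + G)) by (apply Rmult_le_pos; lra).
  assert (t5 : 0 <= G ^ 2 * G) by (apply Rmult_le_pos; lra).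
  assert (t6 : 0 <= G ^ 2 * G * G) by (apply Rmult_le_pos; lra).
  set (C := 2 * CZ + 3 * A + G).
  assert (HCZ : 0 <= CZ) by (unfold CZ; lra).
  (* With [sqrt h] at most [s0], the interpolation error and the discrete error together take away
     at most half of the lower bound [c0]. *)
  set (s0 := c0 / (2 * (A + Ci))).
  assert (Hs0 : 0 < s0) by (apply Rdiv_lt_0_compat; lra).
  exists C, (s0 ^ 2). split. unfold C; lra. split. apply pow_lt; auto.
  intros N e v et vt p q p' q' HN Hh0 Hsl h H U Ht Ut th xi tht xit eh ehx uh uhx uhxx eht uht uhtx Hsm.
  destruct (Hcons N e v et vt HN Hsl) as [Hnear [Hbd [_ [_ [HR1 HR2]]]]].
  fold H U Ht Ut h in Hnear, Hbd, HR1, HR2. change (S (S (S m))) with r in HR1, HR2.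
  assert (Hh : 0 < h <= 1) by (split; [apply hstep_pos|apply hstep_le1]; auto).
  set (s := sqrt h) in *. assert (Hs : 0 < s) by (apply sqrt_lt_R0; lra).
  assert (Hs2 : s * s = h) by (apply sqrt_sqrt; lra).
  assert (Hs1 : s <= 1) by nra.
  assert (Hss0 : s <= s0). { unfold s. rewrite <- (sqrt_pow2 s0) by lra. apply sqrt_le_1_alt. auto. }
  assert (HAs : (A + Ci) * s <= c0 / 2).
  { apply Rle_trans with ((A + Ci) * s0). apply Rmult_le_compat_l; lra. unfold s0. right. field. lra. }
  assert (Hhr : 0 <= h ^ r <= s).
  { split. apply pow_le; lra. apply Rle_trans with (h ^ 1). apply pow_le_1; auto. unfold r; lia. rewrite pow_1. nra. }
  assert (SH := Qh_spline m K phi Q N e HN). assert (SU := Qh_spline m K phi Q N v HN).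
  assert (SHt := Qh_spline m K phi Q N et HN). assert (SUt := Qh_spline m K phi Q N vt HN).
  fold H in SH. fold U in SU. fold Ht in SHt. fold Ut in SUt.
  assert (Sth : spline (S (S (S m))) N th) by (apply (lc_spline m K phi Q); auto).
  assert (Sxi : spline (S (S (S m))) N xi) by (apply (lc_spline m K phi Q); auto).
  assert (Stht : spline (S (S (S m))) N tht) by (apply (lc_spline m K phi Q); auto).
  assert (Sxit : spline (S (S (S m))) N xit) by (apply (lc_spline m K phi Q); auto).
  assert (pH : pwc N H) by (apply (spl_pwc m); auto). assert (pDH : pwc N (Derive H)) by (apply (spl_pwc_D m); auto).
  assert (pU : pwc N U) by (apply (spl_pwc m); auto). assert (pDU : pwc N (Derive U)) by (apply (spl_pwc_D m); auto).
  assert (pD2U : pwc N (Derive_n U 2)) by (apply (spl_pwc_D2 m); auto).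
  assert (pHt : pwc N Ht) by (apply (spl_pwc m); auto).
  assert (pUt : pwc N Ut) by (apply (spl_pwc m); auto). assert (pDUt : pwc N (Derive Ut)) by (apply (spl_pwc_D m); auto).
  assert (pth : pwc N th) by (apply (spl_pwc m); auto). assert (pDth : pwc N (Derive th)) by (apply (spl_pwc_D m); auto).
  assert (pxi : pwc N xi) by (apply (spl_pwc m); auto). assert (pDxi : pwc N (Derive xi)) by (apply (spl_pwc_D m); auto).
  assert (pD2xi : pwc N (Derive_n xi 2)) by (apply (spl_pwc_D2 m); auto).
  assert (ptht : pwc N tht) by (apply (spl_pwc m); auto).
  assert (pxit : pwc N xit) by (apply (spl_pwc m); auto). assert (pDxit : pwc N (Derive xit)) by (apply (spl_pwc_D m); auto).
  assert (peh : pwc N eh) by (unfold eh; pw). assert (pehx : pwc N ehx) by (unfold ehx; pw).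
  assert (puh : pwc N uh) by (unfold uh; pw). assert (puhx : pwc N uhx) by (unfold uhx; pw).
  assert (puhxx : pwc N uhxx) by (unfold uhxx; pw). assert (peht : pwc N eht) by (unfold eht; pw).
  assert (puht : pwc N uht) by (unfold uht; pw). assert (puhtx : pwc N uhtx) by (unfold uhtx; pw).
  assert (nth0 := L2norm_pos th). assert (nxi0 := L2norm_pos xi). assert (nDxi0 := L2norm_pos (Derive xi)).
  (* The threshold [h^2] divided by the h^(3/2) of the inverse inequality leaves [sqrt h], even for
     the first derivative. *)
  assert (small : forall psi x, spline (S (S (S m))) N psi -> L2norm psi <= h ^ 2 -> off N x ->
     Rabs (psi x) <= Ci * s /\ Rabs (Derive psi x) <= Ci * s).
  { intros psi x Hpsi Hn Hx. destruct (Hinv N psi x HN Hpsi Hx) as [I0 I1]. fold h s in I0, I1.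
    assert (Hhs : 0 < h * s) by (apply Rmult_lt_0_compat; lra).
    assert (HCn : Ci * L2norm psi <= Ci * s * (h * s)).
    { replace (Ci * s * (h * s)) with (Ci * (h * (s * s))) by ring. rewrite Hs2.
      apply Rmult_le_compat_l; auto. replace (h * h) with (h ^ 2) by ring. auto. }
    split.
    - apply Rmult_le_reg_r with (h * s); auto. eapply Rle_trans; [|exact HCn].
      eapply Rle_trans; [|exact I0]. apply Rmult_le_compat_l. apply Rabs_pos. nra.
    - apply Rmult_le_reg_r with (h * s); auto. lra. }
  assert (sth : forall x, off N x -> Rabs (th x) <= Ci * s /\ Rabs (Derive th x) <= Ci * s) by (intros; apply small; auto; lra).
  assert (sxi : forall x, off N x -> Rabs (xi x) <= Ci * s /\ Rabs (Derive xi x) <= Ci * s) by (intros; apply small; auto; lra).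
  assert (Cs1 : Ci * s <= Ci) by nra.
  assert (bA : forall x, off N x -> Rabs (eh x) <= A + Ci /\ Rabs (ehx x) <= A + Ci /\ Rabs (uh x) <= A + Ci /\ Rabs (uhx x) <= A + Ci).
  { intros x Hx. destruct (Hbd x Hx) as [h1 [h2 [h3 [h4 _]]]]. destruct (sth x Hx) as [h5 h6]. destruct (sxi x Hx) as [h7 h8].
    unfold eh, ehx, uh, uhx. repeat split; apply Rabs_minus_le; auto; lra. }
  split.
  { intros x Hx. split.
    - specialize (Hnear x Hx). destruct (sth x Hx) as [h5 _]. pose proof (sl_lower _ _ _ _ _ _ _ _ Hsl x) as hl.
      apply Rabs_le_between in Hnear. apply Rabs_le_between in h5. unfold eh. lra.
    - destruct (bA x Hx) as [h1 _]. apply Rabs_le_between in h1. unfold C, G. lra. }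
  intros Eq1 Eq2.
  (* Differentiating the weight in the energy produces [eht], on which no bound is assumed. Testing
     the mass equation with [tht] itself bounds its L2 norm by a multiple of [sqrt h], exactly what
     the inverse inequality then costs. *)
  assert (bt : forall x, off N x -> Rabs (eht x) <= A + Ci * (A + 4 * ((A + Ci) * Ci))).
  { set (br := fun x => Derive H x * xi x + Derive th x * uh x + H x * Derive xi x + th x * uhx x).
    assert (pbr : pwc N br) by (unfold br; pw).
    assert (Hid : L2norm tht ^ 2 = I (fun x => (Ht x + (Derive H x * U x + H x * Derive U x)) * tht x) - I (fun x => br x * tht x)).
    { rewrite (L2norm_sq N) by auto. rewrite <- (Rminus_0_r (I _ - I _)), <- (Eq1 p'). fold tht.
      rewrite <- !(I_minus N) by (auto; pw). f_equal. extensionality x. unfold br, eht, ehx, uh, eh, uhx. ring. }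
    assert (Hbr : Rabs (I (fun x => br x * tht x)) <= 4 * ((A + Ci) * Ci) * s * L2norm tht).
    { apply (L2norm_le_I_bound N); auto. apply Rmult_le_pos; lra.
      intros x Hx. destruct (bA x Hx) as [h1 [h2 [h3 h4]]]. destruct (Hbd x Hx) as [g1 [g2 _]].
      destruct (sth x Hx) as [h5 h6]. destruct (sxi x Hx) as [h7 h8]. unfold br. bnd.
      assert (0 <= Ci * s) by (apply Rmult_le_pos; lra). nra. }
    pose proof (HR1 p') as R1. cbv zeta in R1. fold tht in R1.
    assert (Hn : L2norm tht <= (A + 4 * ((A + Ci) * Ci)) * s).
    { assert (Hx0 := L2norm_pos tht). destruct (Req_dec (L2norm tht) 0) as [E0|E0].
      - rewrite E0. apply Rmult_le_pos; lra.
      - apply Rmult_le_reg_r with (L2norm tht); [lra|].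
        replace (L2norm tht * L2norm tht) with (L2norm tht ^ 2) by ring. rewrite Hid.
        apply Rabs_le_between in Hbr. apply Rabs_le_between in R1.
        assert (A * h ^ r * L2norm tht <= A * s * L2norm tht).
        { apply Rmult_le_compat_r; auto. apply Rmult_le_compat_l; lra. }
        lra. }
    intros x Hx. unfold eht. apply Rabs_minus_le. apply (Hbd x Hx).
    destruct (Hinv N tht x HN Stht Hx) as [I0 _]. fold h s in I0.
    apply Rmult_le_reg_r with s; auto. eapply Rle_trans; [exact I0|].
    rewrite Rmult_assoc. apply Rmult_le_compat_l; auto. }
  assert (lG : A + Ci <= G /\ A <= G /\ Ci <= G /\ A + Ci * (A + 4 * ((A + Ci) * Ci)) <= G) by (unfold G; lra).
  destruct lG as [lG1 [lG2 [lG3 lG4]]].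
  (* All terms quadratic in [th], [xi], [xi'] with bounded coefficients; they are admissible for
     Gronwall. *)
  set (Z := fun x => (- uhx x) * th x ^ 2 + (- (2 * Derive H x) - 2 * Ut x - 2 * (U x * Derive U x)) * (th x * xi x)
      + (- (2 * H x) - 2 / 3 * ((H x * H x + H x * eh x + eh x * eh x) * Derive Ut x) + (H x + eh x)
          - 2 / 3 * ((H x * H x + H x * eh x + eh x * eh x) * (U x * Derive_n U 2 x - Derive U x ^ 2))) * (th x * Derive xi x)
      + (- (2 * (eh x * Derive U x)) + eht x) * xi x ^ 2
      + (- (2 * (eh x * uh x)) - 2 / 3 * (eh x ^ 3 * Derive_n U 2 x)) * (xi x * Derive xi x)
      + (2 / 3 * (eh x ^ 3 * (Derive U x + uhx x)) + 1 / 3 * (3 * eh x ^ 2 * ehx x * uh x + eh x ^ 3 * uhx x) + eh x ^ 2 * eht x) * Derive xi x ^ 2).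
  assert (pZ : pwc N Z) by (unfold Z; pw).
  assert (HZ : I Z <= 2 * CZ * (L2norm th ^ 2 + L2norm xi ^ 2 + L2norm (Derive xi) ^ 2)).
  { rewrite !(L2norm_sq N) by auto. rewrite <- !(I_plus N), <- (I_scal N) by (auto; pw).
    apply (I_le N); auto. pw. intros x Hx. unfold Z.
    destruct (bA x Hx) as [h1 [h2 [h3 h4]]]. destruct (Hbd x Hx) as [g1 [g2 [g3 [g4 [g5 [g6 [g7 g8]]]]]]].
    specialize (bt x Hx).
    assert (c23 : Rabs (2 / 3) <= 2) by (rewrite Rabs_pos_eq; lra). assert (c2 : Rabs 2 <= 2) by (rewrite Rabs_pos_eq; lra).
    assert (c13 : Rabs (1 / 3) <= 1) by (rewrite Rabs_pos_eq; lra). assert (c3 : Rabs 3 <= 3) by (rewrite Rabs_pos_eq; lra).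
    assert (k1 : Rabs (eh x) <= G) by lra. assert (k2 : Rabs (ehx x) <= G) by lra. assert (k3 : Rabs (uh x) <= G) by lra.
    assert (k4 : Rabs (uhx x) <= G) by lra. assert (k5 : Rabs (eht x) <= G) by lra.
    assert (k6 : Rabs (H x) <= G) by lra. assert (k7 : Rabs (Derive H x) <= G) by lra. assert (k8 : Rabs (U x) <= G) by lra.
    assert (k9 : Rabs (Derive U x) <= G) by lra. assert (k10 : Rabs (Derive_n U 2 x) <= G) by lra.
    assert (k11 : Rabs (Ut x) <= G) by lra. assert (k12 : Rabs (Derive Ut x) <= G) by lra.
    clear h1 h2 h3 h4 g1 g2 g3 g4 g5 g6 g7 g8 bt.
    apply quad_form_bound; bnd; unfold CZ; lra. }
  assert (cH : cont H) by (apply (spl_cont m N); auto). assert (cU : cont U) by (apply (spl_cont m N); auto).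
  assert (cth : cont th) by (apply (spl_cont m N); auto). assert (cxi : cont xi) by (apply (spl_cont m N); auto).
  assert (cDxi : cont (Derive xi)) by (apply (spl_cont_D m N); auto).
  pose proof (spl_per m N _ SH 0) as FH. pose proof (spl_per m N _ SU 0) as FU.
  pose proof (spl_per m N _ Sth 0) as Fth. pose proof (spl_per m N _ Sxi 0) as Fxi.
  pose proof (spl_per_D m N _ HN Sxi 0) as FDxi. rewrite Rplus_0_l in *.
  assert (dd : forall x, is_derive H x (Derive H x) /\ is_derive U x (Derive U x) /\ is_derive th x (Derive th x) /\ is_derive xi x (Derive xi x)).
  { intros x. repeat split; apply (spl_is_derive m N); auto. }
  (* Derivative of [uh th^2 / 2]: trades the uncontrolled [uh th' th] of the mass equation for a
     term without [th']. *)
  set (fE1 := fun x => uh x * Derive th x * th x + 1 / 2 * uhx x * th x ^ 2).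
  assert (pE1 : pwc N fE1) by (unfold fE1; pw).
  assert (E1 : I fE1 = 0).
  { rewrite (I_FTC N (fun x => 1 / 2 * ((U x - xi x) * th x ^ 2))); auto.
    - rewrite FU, Fxi, Fth. ring.
    - apply cont_mult. apply cont_const. apply cont_mult. apply cont_minus; auto. apply cont_pow; auto.
    - intros x _. destruct (dd x) as [d1 [d2 [d3 d4]]]. auto_derive. { repeat split; eexists; eassumption. }
      change (fun x0 => U x0) with U. change (fun x0 => xi x0) with xi. change (fun x0 => th x0) with th.
      unfold fE1, uh, uhx. field. }
  (* Derivative of [(H^2 - eh^2) xi / 2], with the difference of squares factored by [th]: the
     derivative of the depth error passes to [xi]. *)
  set (fE2 := fun x => (H x * Derive H x - eh x * ehx x) * xi x + 1 / 2 * (th x * (H x + eh x)) * Derive xi x).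
  assert (pE2 : pwc N fE2) by (unfold fE2; pw).
  assert (E2 : I fE2 = 0).
  { rewrite (I_FTC N (fun x => 1 / 2 * (th x * (2 * H x - th x)) * xi x)); auto.
    - rewrite FH, Fxi, Fth. ring.
    - apply cont_mult; auto. apply cont_mult. apply cont_const. apply cont_mult; auto. apply cont_minus; auto.
      apply cont_mult; auto. apply cont_const.
    - intros x _. destruct (dd x) as [d1 [d2 [d3 d4]]]. auto_derive. { repeat split; eexists; eassumption. }
      change (fun x0 => H x0) with H. change (fun x0 => xi x0) with xi. change (fun x0 => th x0) with th.
      unfold fE2, eh, ehx. field. }
  (* Derivative of [eh^3 uh (xi')^2 / 2]: removes [xi''], which the energy does not control. *)
  set (fE3 := fun x => 1 / 2 * (3 * eh x ^ 2 * ehx x * uh x + eh x ^ 3 * uhx x) * Derive xi x ^ 2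
      + eh x ^ 3 * uh x * Derive_n xi 2 x * Derive xi x).
  assert (pE3 : pwc N fE3) by (unfold fE3; pw).
  assert (E3 : I fE3 = 0).
  { rewrite (I_FTC N (fun x => 1 / 2 * ((H x - th x) ^ 3 * (U x - xi x) * Derive xi x ^ 2))); auto.
    - rewrite FH, FU, Fxi, Fth, FDxi. ring.
    - apply cont_mult; [apply cont_const|]. apply cont_mult; [|apply cont_pow; auto].
      apply cont_mult; [apply cont_pow, cont_minus; auto | apply cont_minus; auto].
    - intros x Hx. destruct (dd x) as [d1 [d2 [d3 d4]]].
      pose proof (spl_is_derive2 m N _ HN Sxi x Hx) as d5. set (dxi := Derive xi) in *.
      auto_derive. { repeat split; eexists; eassumption. }
      change (fun x0 => H x0) with H. change (fun x0 => U x0) with U. change (fun x0 => xi x0) with xi. change (fun x0 => th x0) with th.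
      change (fun x0 => dxi x0) with dxi. change (Derive dxi x) with (Derive_n xi 2 x).
      unfold fE3, eh, ehx, uh, uhx. change (Derive xi) with dxi. field. }
  pose proof (Eq1 p) as Eth. fold th in Eth.
  pose proof (HR1 p) as R1. cbv zeta in R1. fold th in R1.
  pose proof (HR2 q) as R2. cbv zeta in R2. fold xi in R2.
  set (f1 := fun x => (Ht x + (Derive H x * U x + H x * Derive U x)) * th x) in *.
  set (g1 := fun x => (eht x + (ehx x * uh x + eh x * uhx x)) * th x) in *.
  set (f2 := fun x => H x * Ut x * xi x + 1 / 3 * (H x ^ 3 * Derive Ut x) * Derive xi x
      + H x * Derive H x * xi x + H x * U x * Derive U x * xi x
      + 1 / 3 * (H x ^ 3 * (U x * Derive_n U 2 x - Derive U x ^ 2)) * Derive xi x) in *.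
  set (g2 := fun x => eh x * uht x * xi x + 1 / 3 * (eh x ^ 3 * uhtx x) * Derive xi x
      + eh x * ehx x * xi x + eh x * uh x * uhx x * xi x
      + 1 / 3 * (eh x ^ 3 * (uh x * uhxx x - uhx x ^ 2)) * Derive xi x) in *.
  assert (pf1 : pwc N f1) by (unfold f1; pw). assert (pg1 : pwc N g1) by (unfold g1; pw).
  assert (pf2 : pwc N f2) by (unfold f2; pw). assert (pg2 : pwc N g2) by (unfold g2; pw).
  (* The energy rate is twice the defects of the interpolants, minus twice the discrete equations,
     plus [Z], minus the exact derivatives. All but the defects and [Z] vanish. *)
  assert (EE : I (fun x => 2 * th x * tht x + (eht x * xi x ^ 2 + eh x * (2 * xi x * xit x))
      + 1 / 3 * (3 * eh x ^ 2 * eht x * Derive xi x ^ 2 + eh x ^ 3 * (2 * Derive xi x * Derive xit x)))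
     = 2 * I f1 - 2 * I g1 + 2 * I f2 - 2 * I g2 + I Z - 2 * I fE1 - 2 * I fE2 - 2 / 3 * I fE3).
  { rewrite <- !(I_scal N) by auto. repeat first [(rewrite <- (I_plus N) by (auto; pw)) | (rewrite <- (I_minus N) by (auto; pw))].
    f_equal. extensionality x. unfold f1, g1, f2, g2, Z, fE1, fE2, fE3.
    unfold eht, uht, uhtx, uhxx, eh, ehx, uh, uhx. field. }
  rewrite EE, Eth, Eq2, E1, E2, E3.
  apply Rabs_le_between in R1. apply Rabs_le_between in R2.
  set (X := h ^ r) in *. set (a := L2norm th) in *. set (b := L2norm xi) in *. set (c := L2norm (Derive xi)) in *.
  assert (AM : forall z, 2 * (A * X * z) <= A * (X ^ 2 + z ^ 2)).
  { intros z. pose proof (pow2_ge_0 (X - z)). nra. }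
  pose proof (AM a). pose proof (AM b). pose proof (AM c).
  assert (0 <= X ^ 2) by apply pow2_ge_0. assert (0 <= a ^ 2) by apply pow2_ge_0.
  assert (0 <= b ^ 2) by apply pow2_ge_0. assert (0 <= c ^ 2) by apply pow2_ge_0.
  apply Rle_trans with (2 * CZ * (a ^ 2 + b ^ 2 + c ^ 2) + 3 * A * (a ^ 2 + b ^ 2 + c ^ 2 + X ^ 2)).
  - assert (0 <= A * a ^ 2) by (apply Rmult_le_pos; lra). assert (0 <= A * b ^ 2) by (apply Rmult_le_pos; lra).
    assert (0 <= A * c ^ 2) by (apply Rmult_le_pos; lra). lra.
  - unfold C. assert (0 <= G * (a ^ 2 + b ^ 2 + c ^ 2 + X ^ 2)) by (apply Rmult_le_pos; lra).
    assert (0 <= CZ * X ^ 2) by (apply Rmult_le_pos; lra). lra.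
Qed.
End Energy.

(** * Lipschitz differential equations *)

Definition dist (n : nat) (y z : nat -> R) : R := rsum n (fun k => Rabs (y k - z k)).

Lemma dist_pos n y z : 0 <= dist n y z.
Proof. apply rsum_nonneg; intros; apply Rabs_pos. Qed.

Lemma dist_coord n y z k : (k < n)%nat -> Rabs (y k - z k) <= dist n y z.
Proof. intros H. apply (rsum_term_le n (fun k => Rabs (y k - z k))); auto. intros; apply Rabs_pos. Qed.

Lemma cont_of_bound (f : R -> R) n (g : nat -> R -> R) C : 0 <= C ->
  (forall k, (k < n)%nat -> cont (g k)) ->
  (forall s t, Rabs (f s - f t) <= C * rsum n (fun k => Rabs (g k s - g k t))) -> cont f.
Proof.
  intros HC Hg Hf t.
  assert (Hc : cont (fun s => C * rsum n (fun k => Rabs (g k s - g k t)))).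
  { apply cont_mult. apply cont_const. apply (cont_rsum n (fun k s => Rabs (g k s - g k t))).
    intros k Hk x. apply (continuous_comp (fun s => g k s - g k t) Rabs).
    apply (cont_minus (g k) (fun _ => g k t)); auto. apply cont_const. apply continuous_Rabs. }
  apply filterlim_locally. intros eps.
  destruct (proj1 (filterlim_locally _ _) (Hc t) eps) as [d Hd]. exists d. intros s Hs. specialize (Hd s Hs).
  unfold ball in *; simpl in *; unfold AbsRing_ball, abs, minus, plus, opp in *; simpl in *.
  rewrite (rsum_zero n (fun k => Rabs (g k t - g k t))), Rmult_0_r, Ropp_0, Rplus_0_r in Hd.
  2: intros; rewrite Rminus_diag, Rabs_R0; auto.
  eapply Rle_lt_trans; [apply Hf|]. eapply Rle_lt_trans; [apply RRle_abs|exact Hd].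
Qed.

(** The increments form a series dominated by powers of 1/3; the limit is its sum, with [M + 1] in
    place of [M] to permit normalisation. *)
Lemma geom_limit u M : 0 <= M -> (forall k, Rabs (u (S k) - u k) <= M * (/ 3) ^ k) ->
  exists l, forall k, Rabs (l - u k) <= 3 / 2 * (M + 1) * (/ 3) ^ k.
Proof.
  intros HM H. set (a := fun k => (u (S k) - u k) / (M + 1)).
  assert (Ha : forall n, Rabs (a n) <= (/ 3) ^ n).
  { intros n. unfold a, Rdiv. rewrite Rabs_mult, Rabs_inv, (Rabs_pos_eq (M + 1)) by lra.
    apply Rmult_le_reg_r with (M + 1); [lra|]. rewrite Rmult_assoc, Rinv_l by lra.
    specialize (H n). assert (0 <= (/3)^n) by (apply pow_le; lra). nra. }
  exists (u O + (M + 1) * Series (fun n => a n * 1)). intros k.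
  assert (Hb : forall n : nat, Rabs ((fun _ => 1) n) <= 1) by (intros; rewrite Rabs_R1; lra).
  pose proof (tail3 a Ha (fun _ => 1) k Hb) as Tl. cbv beta in Tl.
  assert (E : u k = u O + (M + 1) * rsum k (fun n => a n * 1)).
  { rewrite <- rsum_scal. rewrite (rsum_ext k _ (fun n => u (S n) - u n)).
    rewrite (rsum_telescope k u). ring. intros; unfold a; field; lra. }
  rewrite E. replace (u O + (M + 1) * Series (fun n => a n * 1) - (u O + (M + 1) * rsum k (fun n => a n * 1)))
    with ((M + 1) * (Series (fun n => a n * 1) - rsum k (fun n => a n * 1))) by ring.
  rewrite Rabs_mult, Rabs_pos_eq by lra. nra.
Qed.

Lemma RInt_cont_bound (f : R -> R) g t : 0 <= t -> cont f -> cont g ->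
  (forall s, 0 <= s <= t -> Rabs (f s) <= g s) -> Rabs (RInt f 0 t) <= RInt g 0 t.
Proof.
  intros Ht Hf Hg H.
  assert (Hex : forall f a b, cont f -> ex_RInt f a b).
  { intros f0 a b Hc. apply (ex_RInt_continuous f0). intros; apply Hc. }
  eapply Rle_trans. apply abs_RInt_le; auto.
  apply RInt_le; auto.
  - apply (Hex (fun t => Rabs (f t))). intros x. apply (continuous_comp f Rabs); auto. apply continuous_Rabs.
  - intros x Hx. apply H; lra.
Qed.

Lemma is_derive_RInt_cont f a t : cont f -> is_derive (fun s => RInt f a s) t (f t).
Proof.
  intros Hf. apply (is_derive_RInt f _ a t); auto.
  exists (mkposreal 1 Rlt_0_1). intros y _. apply (RInt_correct f). apply (ex_RInt_continuous f). intros; apply Hf.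
Qed.

(* Picard iteration; the iterates contract by 1/3 in the norm weighted by [exp (- lam t)]. *)
Lemma picard n T Lc (F : R -> (nat -> R) -> nat -> R) (y0 : nat -> R) : 0 < T -> 0 <= Lc ->
  (forall t y z j, Icc 0 T t -> (j < n)%nat -> Rabs (F t y j - F t z j) <= Lc * dist n y z) ->
  (forall y : R -> nat -> R, (forall k, (k < n)%nat -> cont (fun t => y t k)) ->
     forall j, (j < n)%nat -> cont (fun t => F (clamp T t) (y t) j)) ->
  exists y : R -> nat -> R, (forall j, (j < n)%nat -> y 0 j = y0 j) /\
    forall t j, Icc 0 T t -> (j < n)%nat -> is_derive (fun s => y s j) t (F t (y t) j).
Proof.
  intros HT HL Hlip Hcont.
  assert (Hck : cont (clamp T)).
  { apply (cont_of_bound _ 1 (fun _ t => t) 1). lra. intros k _ x; apply continuous_id.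
    intros s t. simpl. rewrite Rplus_0_l, Rmult_1_l. apply clamp_lip; lra. }
  assert (Hcc : forall f, cont f -> cont (fun t => f (clamp T t))).
  { intros f Hf t. apply (continuous_comp (clamp T) f); auto. }
  set (op := fun (y : R -> nat -> R) t j => y0 j + RInt (fun s => F (clamp T s) (y (clamp T s)) j) 0 t).
  set (X := fix X k := match k with O => fun (_ : R) j => y0 j | S k' => op (X k') end).
  assert (Hg : forall y : R -> nat -> R, (forall k, (k < n)%nat -> cont (fun t => y t k)) -> forall j, (j < n)%nat ->
     cont (fun s => F (clamp T s) (y (clamp T s)) j)).
  { intros y Hy j Hj. apply (Hcont (fun s => y (clamp T s))); auto. intros k Hk. apply (Hcc (fun t => y t k)); auto. }
  assert (Hop : forall y : R -> nat -> R, (forall k, (k < n)%nat -> cont (fun t => y t k)) -> forall j t, (j < n)%nat ->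
     is_derive (fun t => op y t j) t (F (clamp T t) (y (clamp T t)) j)).
  { intros y Hy j t Hj. unfold op. rewrite <- (Rplus_0_l (F _ _ j)).
    apply (is_derive_plus (fun _ => y0 j) (fun t => RInt (fun s => F (clamp T s) (y (clamp T s)) j) 0 t)).
    apply (is_derive_const (y0 j)).
    apply (is_derive_RInt_cont (fun s => F (clamp T s) (y (clamp T s)) j)). auto. }
  assert (HX : forall k j, (j < n)%nat -> cont (fun t => X k t j)).
  { induction k; intros j Hj. apply (cont_const (y0 j)). intros t. simpl.
    apply (ex_derive_continuous (fun t => op (X k) t j)). eexists. apply Hop; auto. }
  (* The rate makes [n * Lc / lam] at most 1/3; the factor [n] comes from summing coordinates in
     [dist]. *)
  set (lam := 3 * (INR n * Lc) + 1).
  assert (Hn0 := pos_INR n). assert (HnL : 0 <= INR n * Lc) by (apply Rmult_le_pos; auto).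
  assert (Hlam : 0 < lam) by (unfold lam; lra).
  set (ex := fun t => exp (lam * t)).
  assert (Hex : cont ex). { intros t. apply (ex_derive_continuous ex). unfold ex. auto_derive; auto. }
  assert (Iex : forall a t, 0 <= a -> 0 <= t -> RInt (fun s => a * ex s) 0 t <= a / lam * ex t).
  { intros a t Ha Ht. rewrite (is_RInt_unique (fun s => a * ex s) 0 t (a / lam * ex t - a / lam * ex 0)).
    - assert (0 <= a / lam * ex 0). { apply Rmult_le_pos. apply Rdiv_le_0_compat; auto. left; apply exp_pos. } lra.
    - apply (is_RInt_derive (fun s => a / lam * ex s)).
      + intros x _. unfold ex. auto_derive; auto. field. lra.
      + intros x _. apply (cont_mult (fun _ => a) ex); auto. apply cont_const. }
  set (D := fun k t => dist n (X (S k) t) (X k t)).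
  assert (HD : forall k, cont (D k)).
  { intros k. unfold D, dist. apply (cont_rsum n (fun j t => Rabs (X (S k) t j - X k t j))). intros j Hj t.
    apply (continuous_comp (fun t => X (S k) t j - X k t j) Rabs). apply (cont_minus (fun t => X (S k) t j)); auto. apply continuous_Rabs. }
  destruct (continuity_ab_maj (D O) 0 T) as [tm [Htm _]]. lra.
  { intros c _. apply continuity_pt_filterlim. apply HD. }
  set (A := D O tm). assert (HA : 0 <= A) by apply dist_pos.
  assert (Hex1 : forall t, 0 <= t -> 1 <= ex t).
  { intros t Ht. unfold ex. rewrite <- exp_0. destruct (Req_dec t 0) as [->|]. rewrite Rmult_0_r; lra.
    left. apply exp_increasing. apply Rmult_lt_0_compat; lra. }
  assert (Hstep : forall (y z : R -> nat -> R) a, (forall k, (k < n)%nat -> cont (fun t => y t k)) -> (forall k, (k < n)%nat -> cont (fun t => z t k)) ->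
     0 <= a -> (forall t, Icc 0 T t -> dist n (y t) (z t) <= a * ex t) ->
     forall t j, Icc 0 T t -> (j < n)%nat -> Rabs (op y t j - op z t j) <= Lc * a / lam * ex t).
  { intros y z a Hy Hz Ha Hd t j Ht Hj.
    assert (Cy := Hg y Hy j Hj). assert (Cz := Hg z Hz j Hj).
    assert (E : op y t j - op z t j = RInt (fun s => F (clamp T s) (y (clamp T s)) j - F (clamp T s) (z (clamp T s)) j) 0 t).
    { rewrite (RInt_minus (fun s => F (clamp T s) (y (clamp T s)) j) (fun s => F (clamp T s) (z (clamp T s)) j)).
      unfold op, minus, plus, opp; simpl. ring.
      apply (ex_RInt_continuous (fun s => F (clamp T s) (y (clamp T s)) j)); intros; apply Cy.
      apply (ex_RInt_continuous (fun s => F (clamp T s) (z (clamp T s)) j)); intros; apply Cz. }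
    rewrite E. eapply Rle_trans; [|apply (Iex (Lc * a) t)]. 2: apply Rmult_le_pos; auto. 2: apply Ht.
    apply RInt_cont_bound. apply Ht. apply cont_minus; auto. apply cont_mult; auto. apply cont_const.
    intros s Hs. assert (Hs' : Icc 0 T s) by (unfold Icc in *; lra).
    rewrite clamp_id by auto. eapply Rle_trans. apply Hlip; auto.
    rewrite Rmult_assoc. apply Rmult_le_compat_l; auto. }
  assert (HDk : forall k t, Icc 0 T t -> D k t <= A * (/ 3) ^ k * ex t).
  { induction k; intros t Ht.
    - simpl. rewrite Rmult_1_r. apply Rle_trans with (A * 1). rewrite Rmult_1_r. apply Htm. apply Ht.
      apply Rmult_le_compat_l; auto. apply Hex1, Ht.
    - assert (Hp : 0 <= (/3) ^ k) by (apply pow_le; lra).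
      assert (HAk : 0 <= A * (/ 3) ^ k) by (apply Rmult_le_pos; auto).
      unfold D, dist. apply Rle_trans with (rsum n (fun _ => Lc * (A * (/ 3) ^ k) / lam * ex t)).
      + apply rsum_le. intros j Hj. change (X (S (S k)) t j) with (op (X (S k)) t j). change (X (S k) t j) with (op (X k) t j).
        apply Hstep; auto.
      + rewrite rsum_const. assert (He := Hex1 t (proj1 Ht)).
        replace (INR n * (Lc * (A * (/ 3) ^ k) / lam * ex t)) with ((INR n * Lc) / lam * (A * (/ 3) ^ k * ex t)) by (field; lra).
        replace (A * (/ 3) ^ S k * ex t) with (/ 3 * (A * (/ 3) ^ k * ex t)) by (simpl; ring).
        apply Rmult_le_compat_r. apply Rmult_le_pos; auto; lra.
        apply Rmult_le_reg_r with lam; auto. unfold Rdiv. rewrite Rmult_assoc, Rinv_l by lra. unfold lam. lra. }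
  set (M := A * ex T).
  assert (HexT : forall t, Icc 0 T t -> ex t <= ex T).
  { intros t Ht. unfold ex. destruct (Req_dec t T) as [->|]; [lra|]. left. apply exp_increasing.
    apply Rmult_lt_compat_l; auto. unfold Icc in Ht; lra. }
  assert (HM : 0 <= M) by (apply Rmult_le_pos; auto; left; apply exp_pos).
  assert (HMk : forall k t j, Icc 0 T t -> (j < n)%nat -> Rabs (X (S k) t j - X k t j) <= M * (/ 3) ^ k).
  { intros k t j Ht Hj. eapply Rle_trans. apply (dist_coord n _ _ j Hj). eapply Rle_trans. apply (HDk k t Ht).
    unfold M. rewrite Rmult_assoc, (Rmult_comm _ (ex t)), <- Rmult_assoc.
    apply Rmult_le_compat_r. apply pow_le; lra. apply Rmult_le_compat_l; auto. }
  assert (Hlim : forall tj : R * nat, exists l, Icc 0 T (fst tj) -> (snd tj < n)%nat ->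
     forall k, Rabs (l - X k (fst tj) (snd tj)) <= 3 / 2 * (M + 1) * (/ 3) ^ k).
  { intros [t j]. simpl. destruct (classic (Icc 0 T t /\ (j < n)%nat)) as [[Ht Hj]|Hn].
    - destruct (geom_limit (fun k => X k t j) M HM) as [l Hl]; auto. exists l; auto.
    - exists 0. intros; exfalso; auto. }
  apply choice in Hlim. destruct Hlim as [lf Hlf].
  (* The limit curve, frozen outside [0,T] so that it is continuous on the whole line. *)
  set (c := fun t j => lf (clamp T t, j)).
  assert (Hc : forall k t j, (j < n)%nat -> Rabs (c t j - X k (clamp T t) j) <= 3 / 2 * (M + 1) * (/ 3) ^ k).
  { intros k t j Hj. apply (Hlf (clamp T t, j)); auto. apply clamp_in; lra. }
  assert (geo0 : forall e, 0 < e -> exists k, 3 / 2 * (M + 1) * (/ 3) ^ k < e).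
  { intros e He. destruct (pow_lt_1_zero (/3)) with (y := e / (3 / 2 * (M + 1))) as [k Hk].
    rewrite Rabs_pos_eq; lra. apply Rdiv_lt_0_compat; lra.
    exists k. specialize (Hk k (le_n k)). rewrite Rabs_pos_eq in Hk by (apply pow_le; lra).
    apply Rmult_lt_compat_r with (r := 3 / 2 * (M + 1)) in Hk; [|lra]. unfold Rdiv in Hk at 2.
    rewrite Rmult_assoc, Rinv_l in Hk by lra. lra. }
  assert (Cc : forall j, (j < n)%nat -> cont (fun t => c t j)).
  { intros j Hj t. apply filterlim_locally. intros eps.
    destruct (geo0 (eps / 3)) as [k Hk]. { pose proof (cond_pos eps); lra. }
    assert (He : 0 < eps / 3) by (pose proof (cond_pos eps); lra).
    destruct (proj1 (filterlim_locally _ _) (Hcc (fun t => X k t j) (HX k j Hj) t) (mkposreal _ He)) as [d Hd].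
    exists d. intros s Hs. specialize (Hd s Hs).
    unfold ball in *; simpl in *; unfold AbsRing_ball, abs, minus, plus, opp in *; simpl in *.
    pose proof (Hc k s j Hj) as H1. pose proof (Hc k t j Hj) as H2. rewrite Rabs_minus_sym in H2.
    replace (c s j + - c t j) with ((c s j - X k (clamp T s) j) + (X k (clamp T t) j - c t j) + (X k (clamp T s) j + - X k (clamp T t) j)) by ring.
    eapply Rle_lt_trans; [apply Rabs_triang|].
    pose proof (Rabs_triang (c s j - X k (clamp T s) j) (X k (clamp T t) j - c t j)). lra. }
  assert (Heq : forall t j, Icc 0 T t -> (j < n)%nat -> op c t j = c t j).
  { intros t j Ht Hj. apply cond_eq. intros e He.
    set (q := 1 + INR n * Lc / lam * ex t).
    assert (Hq : 1 <= q). { unfold q. assert (0 <= INR n * Lc / lam * ex t); [|lra]. apply Rmult_le_pos. apply Rdiv_le_0_compat; auto. left; apply exp_pos. }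
    destruct (geo0 (e / q)) as [k Hk]. { apply Rdiv_lt_0_compat; lra. }
    set (w := 3 / 2 * (M + 1) * (/ 3) ^ k) in *.
    assert (Hw : 0 <= w). { unfold w. apply Rmult_le_pos. lra. apply pow_le; lra. }
    assert (H1 : Rabs (op c t j - op (X k) t j) <= Lc * (INR n * w) / lam * ex t).
    { apply Hstep; auto. apply Rmult_le_pos; auto. intros s Hs. unfold dist.
      apply Rle_trans with (INR n * w).
      - rewrite <- rsum_const. apply rsum_le. intros i Hi. pose proof (Hc k s i Hi) as H2. rewrite clamp_id in H2 by auto. exact H2.
      - assert (0 <= INR n * w) by (apply Rmult_le_pos; auto). pose proof (Hex1 s (proj1 Hs)). nra. }
    pose proof (Hc (S k) t j Hj) as H2. rewrite clamp_id in H2 by auto. change (X (S k) t j) with (op (X k) t j) in H2.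
    assert (H3 : 3 / 2 * (M + 1) * (/ 3) ^ S k <= w).
    { unfold w. simpl. assert (0 <= (M + 1) * (/3) ^ k). { apply Rmult_le_pos. lra. apply pow_le; lra. } lra. }
    rewrite Rabs_minus_sym in H2.
    replace (op c t j - c t j) with ((op c t j - op (X k) t j) + (op (X k) t j - c t j)) by ring.
    eapply Rle_lt_trans; [apply Rabs_triang|]. apply Rle_lt_trans with (w * q).
    - unfold q. replace (w * (1 + INR n * Lc / lam * ex t)) with (Lc * (INR n * w) / lam * ex t + w) by (field; lra). lra.
    - apply Rmult_lt_compat_r with (r := q) in Hk; [|lra]. unfold Rdiv in Hk. rewrite Rmult_assoc, Rinv_l, Rmult_1_r in Hk by lra. auto. }
  (* [op c] agrees with [c] on [0,T] but, as an integral, has two-sided derivatives even at the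
     endpoints. *)
  exists (op c). split.
  - intros j Hj. unfold op. rewrite (RInt_point 0). unfold zero; simpl. ring.
  - intros t j Ht Hj.
    replace (F t (op c t) j) with (F (clamp T t) (c (clamp T t)) j). apply Hop; auto.
    rewrite clamp_id by auto. apply Rminus_diag_uniq. apply NNPP. intros Hne. apply Rabs_no_R0 in Hne.
    apply Hne. apply Rle_antisym; [|apply Rabs_pos]. eapply Rle_trans. apply (Hlip t (c t) (op c t) j); auto.
    unfold dist. rewrite rsum_zero. lra. intros i Hi. rewrite Heq by auto. rewrite Rminus_diag, Rabs_R0. auto.
Qed.

(** * Radial retraction onto a ball of a seminorm *)

Section Radial.
Variables (n : nat) (nu : (nat -> R) -> R) (rho : R).
Hypothesis nu_pos : forall a, 0 <= nu a.
Hypothesis nu_scal : forall c a, nu (fun k => c * a k) = Rabs c * nu a.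
Hypothesis nu_triang : forall a b, nu (fun k => a k + b k) <= nu a + nu b.
Hypothesis rho_pos : 0 < rho.

Definition radial_factor (a : nat -> R) : R := if Rle_dec (nu a) rho then 1 else rho / nu a.
Definition radial (a : nat -> R) : nat -> R := fun k => radial_factor a * a k.

Lemma nu_sub a b : nu b - nu a <= nu (fun k => a k - b k) /\ nu a - nu b <= nu (fun k => a k - b k).
Proof.
  split.
  - pose proof (nu_triang a (fun k => -1 * (a k - b k))) as H. rewrite nu_scal in H.
    replace (fun k => a k + -1 * (a k - b k)) with b in H by (extensionality k; ring).
    rewrite Rabs_left in H by lra. lra.
  - pose proof (nu_triang b (fun k => a k - b k)) as H. cbv beta in H.
    replace (fun k => b k + (a k - b k)) with a in H by (extensionality k; ring). lra.
Qed.

Lemma radial_inside a : nu a <= rho -> radial a = a.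
Proof. intros H. unfold radial, radial_factor. destruct Rle_dec; [|lra]. extensionality k; ring. Qed.

Lemma radial_le a : nu (radial a) <= rho.
Proof.
  unfold radial. rewrite nu_scal. unfold radial_factor. destruct Rle_dec. rewrite Rabs_R1; lra.
  rewrite Rabs_pos_eq. right. field. lra. apply Rdiv_le_0_compat; lra.
Qed.

Lemma radial_factor_01 a : 0 <= radial_factor a <= 1.
Proof.
  unfold radial_factor. destruct Rle_dec; [lra|]. split. apply Rdiv_le_0_compat; lra.
  apply Rmult_le_reg_r with (nu a); [lra|]. unfold Rdiv. rewrite Rmult_assoc, Rinv_l by lra. lra.
Qed.

Lemma radial_split a b : (radial_factor a - radial_factor b) * nu b <= nu (fun k => a k - b k) ->
  radial_factor b <= radial_factor a -> nu (fun k => radial a k - radial b k) <= 2 * nu (fun k => a k - b k).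
Proof.
  intros H Hf. destruct (radial_factor_01 a).
  replace (fun k => radial a k - radial b k) with (fun k => radial_factor a * (a k - b k) + (radial_factor a - radial_factor b) * b k)
    by (extensionality k; unfold radial; ring).
  eapply Rle_trans. apply (nu_triang (fun k => radial_factor a * (a k - b k))).
  rewrite !nu_scal, !Rabs_pos_eq by lra. pose proof (nu_pos (fun k => a k - b k)). nra.
Qed.

(** By symmetry let [nu a] be at most [nu b], so the factor of [a] is the larger one. One part of
    the difference comes from [a - b]; the other, the change of the factor times [nu b], is at most
    [nu b - nu a] or [nu b - rho]. *)
Lemma radial_lip a b : nu (fun k => radial a k - radial b k) <= 2 * nu (fun k => a k - b k).
Proof.
  assert (W : forall a b, nu a <= nu b -> nu (fun k => radial a k - radial b k) <= 2 * nu (fun k => a k - b k)).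
  { clear a b. intros a b Hab. destruct (nu_sub a b) as [H1 H2].
    assert (Hp := nu_pos a). assert (Hpb := nu_pos b).
    apply radial_split; unfold radial_factor; destruct (Rle_dec (nu a) rho); destruct (Rle_dec (nu b) rho); try lra.
    - replace ((1 - rho / nu b) * nu b) with (nu b - rho) by (field; lra). lra.
    - replace ((rho / nu a - rho / nu b) * nu b) with (rho / nu a * (nu b - nu a)) by (field; lra).
      assert (rho / nu a <= 1). { apply Rmult_le_reg_r with (nu a); [lra|]. unfold Rdiv. rewrite Rmult_assoc, Rinv_l by lra. lra. }
      nra.
    - apply Rmult_le_reg_r with (nu b); [lra|]. unfold Rdiv. rewrite Rmult_assoc, Rinv_l by lra. lra.
    - unfold Rdiv. apply Rmult_le_compat_l; [lra|]. apply Rinv_le_contravar; lra. }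
  destruct (Rle_dec (nu a) (nu b)). auto.
  assert (S : forall f g : nat -> R, nu (fun k => f k - g k) = nu (fun k => g k - f k)).
  { intros f g. rewrite <- (Rmult_1_l (nu (fun k => g k - f k))). rewrite <- (Rabs_R1), <- Rabs_Ropp, <- nu_scal.
    f_equal. extensionality k. ring. }
  rewrite (S (radial a)), (S a). apply W. lra.
Qed.
End Radial.

(** * Bounded Lipschitz functions of the state *)

Section LB.
Variables (n : nat) (G : (nat -> R) -> Prop).

(** Bound and Lipschitz estimate are required together because a product of Lipschitz functions is
    Lipschitz only if the factors are bounded. The constants are uniform in x, so that x can be
    integrated out. *)
Definition uLb (D : R -> Prop) (F : (nat -> R) -> R -> R) : Prop := exists B, 0 <= B /\
  (forall y x, G y -> D x -> Rabs (F y x) <= B) /\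
  (forall y z x, G y -> G z -> D x -> Rabs (F y x - F z x) <= B * dist n y z).
Definition Lb (f : (nat -> R) -> R) : Prop := uLb (fun _ => True) (fun y _ => f y).

Lemma uLb_plus D F F' : uLb D F -> uLb D F' -> uLb D (fun y x => F y x + F' y x).
Proof.
  intros [B [HB [H1 H2]]] [B' [HB' [H1' H2']]]. exists (B + B'). split; [lra|]. split.
  - intros y x Hy Hx. eapply Rle_trans. apply Rabs_triang. specialize (H1 y x Hy Hx). specialize (H1' y x Hy Hx). lra.
  - intros y z x Hy Hz Hx. replace (F y x + F' y x - (F z x + F' z x)) with ((F y x - F z x) + (F' y x - F' z x)) by ring.
    eapply Rle_trans. apply Rabs_triang. specialize (H2 y z x Hy Hz Hx). specialize (H2' y z x Hy Hz Hx). lra.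
Qed.

Lemma uLb_mult D F F' : uLb D F -> uLb D F' -> uLb D (fun y x => F y x * F' y x).
Proof.
  intros [B [HB [H1 H2]]] [B' [HB' [H1' H2']]]. exists (2 * (B * B')).
  assert (HBB : 0 <= B * B') by (apply Rmult_le_pos; auto). split; [lra|]. split.
  - intros y x Hy Hx. rewrite Rabs_mult. apply Rle_trans with (B * B'); [|lra]. apply Rmult_le_compat; auto using Rabs_pos.
  - intros y z x Hy Hz Hx. replace (F y x * F' y x - F z x * F' z x) with ((F y x - F z x) * F' y x + F z x * (F' y x - F' z x)) by ring.
    eapply Rle_trans. apply Rabs_triang. rewrite !Rabs_mult.
    assert (Rabs (F y x - F z x) * Rabs (F' y x) <= B * dist n y z * B') by (apply Rmult_le_compat; auto using Rabs_pos).
    assert (Rabs (F z x) * Rabs (F' y x - F' z x) <= B * (B' * dist n y z)) by (apply Rmult_le_compat; auto using Rabs_pos).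
    lra.
Qed.

Lemma uLb_fun D (f : R -> R) B : (forall x, D x -> Rabs (f x) <= B) -> uLb D (fun _ x => f x).
Proof.
  intros H. exists (Rabs B). split. apply Rabs_pos. split.
  - intros y x _ Hx. eapply Rle_trans. apply H; auto. apply RRle_abs.
  - intros y z x _ _ _. rewrite Rminus_diag, Rabs_R0. apply Rmult_le_pos. apply Rabs_pos. apply dist_pos.
Qed.

Lemma uLb_const D c : uLb D (fun _ _ => c).
Proof. apply (uLb_fun D (fun _ => c) (Rabs c)). intros; lra. Qed.

Lemma uLb_scal D c F : uLb D F -> uLb D (fun y x => c * F y x).
Proof. apply (uLb_mult D (fun _ _ => c)). apply uLb_const. Qed.

Lemma uLb_minus D F F' : uLb D F -> uLb D F' -> uLb D (fun y x => F y x - F' y x).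
Proof.
  intros H H'. replace (fun y x => F y x - F' y x) with (fun y x => F y x + -1 * F' y x).
  apply uLb_plus; auto. apply uLb_scal; auto. extensionality y; extensionality x; ring.
Qed.

Lemma uLb_pow D F k : uLb D F -> uLb D (fun y x => F y x ^ k).
Proof. intros H. induction k; simpl. apply uLb_const. apply uLb_mult; auto. Qed.

Lemma uLb_rsum D k (F : nat -> (nat -> R) -> R -> R) : (forall i, (i < k)%nat -> uLb D (F i)) ->
  uLb D (fun y x => rsum k (fun i => F i y x)).
Proof.
  induction k; intros H; simpl. apply uLb_const.
  apply (uLb_plus D (fun y x => rsum k (fun i => F i y x)) (F k)); auto.
Qed.

Lemma uLb_ext D F F' : (forall y x, D x -> F y x = F' y x) -> uLb D F -> uLb D F'.
Proof.
  intros E [B [HB [H1 H2]]]. exists B. split; auto. split; intros; rewrite <- !E; auto.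
Qed.

Lemma Lb_weaken D f : Lb f -> uLb D (fun y _ => f y).
Proof. intros [B [HB [H1 H2]]]. exists B. split; auto. Qed.

Lemma Lb_I N F : (1 <= N)%nat -> (forall y, pwc N (F y)) -> uLb (off N) F -> Lb (fun y => I (F y)).
Proof.
  intros HN HF [B [HB [H1 H2]]].
  assert (bd : forall f c, pwc N f -> (forall x, off N x -> Rabs (f x) <= c) -> Rabs (I f) <= c).
  { intros f c Hf Hc. apply Rabs_le_between. split.
    - assert (-1 * I f <= c); [|lra]. rewrite <- (I_scal N) by auto. apply (I_le_const N); auto. pw.
      intros x Hx. specialize (Hc x Hx). apply Rabs_le_between in Hc. lra.
    - apply (I_le_const N); auto. intros x Hx. specialize (Hc x Hx). apply Rabs_le_between in Hc. lra. }
  exists B. split; auto. split.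
  - intros y _ Hy _. apply bd; auto.
  - intros y z _ Hy Hz _. rewrite <- (I_minus N) by auto. apply bd; auto. pw; auto.
Qed.

Lemma coercive_bound N (A : nat -> nat -> R) kap w b E : 0 < kap -> 0 <= E ->
  kap * rsum N (fun i => w i * w i) <= rsum N (fun i => w i * rsum N (fun j => A i j * w j)) ->
  (forall i, (i < N)%nat -> rsum N (fun j => A i j * w j) = b i) ->
  (forall i, (i < N)%nat -> Rabs (b i) <= E) -> forall j, (j < N)%nat -> Rabs (w j) <= INR N * (E / kap).
Proof.
  intros Hk HE Hc Hs Hb j Hj.
  set (S := rsum N (fun i => w i * w i)) in *.
  rewrite (rsum_ext N _ (fun i => w i * b i)) in Hc by (intros; rewrite Hs; auto).
  assert (H1 : rsum N (fun i => w i * b i) <= kap / 2 * S + INR N * (E * E / (2 * kap))).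
  { unfold S. rewrite <- rsum_scal, <- rsum_const, <- rsum_plus. apply rsum_le. intros i Hi.
    specialize (Hb i Hi). assert (Hbb : b i * b i <= E * E).
    { apply Rabs_le_between in Hb. nra. }
    apply Rle_trans with (kap / 2 * (w i * w i) + b i * b i / (2 * kap)).
    - apply Rmult_le_reg_r with (2 * kap); [lra|].
      replace ((kap / 2 * (w i * w i) + b i * b i / (2 * kap)) * (2 * kap)) with ((kap * w i) ^ 2 + b i ^ 2) by (field; lra).
      pose proof (pow2_ge_0 (kap * w i - b i)). nra.
    - apply Rplus_le_compat_l. unfold Rdiv. apply Rmult_le_compat_r; auto. left; apply Rinv_0_lt_compat; lra. }
  assert (HS : S <= INR N * (E / kap) ^ 2).
  { apply Rmult_le_reg_l with (kap / 2); [lra|].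
    replace (kap / 2 * (INR N * (E / kap) ^ 2)) with (INR N * (E * E / (2 * kap))) by (field; lra). lra. }
  assert (Hj2 : w j * w j <= S) by (apply (rsum_term_le N (fun i => w i * w i)); auto; intros; nra).
  assert (HN : 1 <= INR N) by (replace 1 with (INR 1) by reflexivity; apply le_INR; lia).
  assert (HEk : 0 <= E / kap) by (apply Rdiv_le_0_compat; auto).
  rewrite <- (Rabs_pos_eq (INR N * (E / kap))) by (apply Rmult_le_pos; lra).
  apply Rsqr_le_abs_0. unfold Rsqr.
  assert (INR N * (E / kap) ^ 2 <= INR N * INR N * (E / kap) ^ 2).
  { apply Rmult_le_compat_r. apply pow2_ge_0. nra. }
  nra.
Qed.

(** Coercivity gives solvability and a bound. The difference of the solutions for two states solves
    the system of the first state with right-hand side [b y - b z - (A y - A z) Phi z], so the same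
    bound yields the Lipschitz estimate. *)
Lemma solve_Lb N (A : nat -> nat -> (nat -> R) -> R) (b : nat -> (nat -> R) -> R) kap : 0 < kap ->
  (forall i j, (i < N)%nat -> (j < N)%nat -> Lb (A i j)) -> (forall i, (i < N)%nat -> Lb (b i)) ->
  (forall y w, G y -> kap * rsum N (fun i => w i * w i) <= rsum N (fun i => w i * rsum N (fun j => A i j y * w j))) ->
  exists Phi : (nat -> R) -> nat -> R,
   (forall y i, G y -> (i < N)%nat -> rsum N (fun j => A i j y * Phi y j) = b i y) /\
   (forall j, (j < N)%nat -> Lb (fun y => Phi y j)).
Proof.
  intros Hk HA Hb Hc.
  assert (Hex : forall y, exists w, G y -> forall i, (i < N)%nat -> rsum N (fun j => A i j y * w j) = b i y).
  { intros y. destruct (classic (G y)) as [Hy|Hy]; [|exists (fun _ => 0); tauto].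
    destruct (pd_solve N (fun i j => A i j y)) with (b := fun i => b i y) as [w Hw]; [|exists w; auto].
    intros z Hz. apply Rlt_le_trans with (kap * rsum N (fun i => z i * z i)); auto.
    apply Rmult_lt_0_compat; auto. apply rsum_sq_pos; auto. }
  apply choice in Hex. destruct Hex as [Phi HPhi].
  assert (HAc : forall ij : nat * nat, exists B, 0 <= B /\ ((fst ij < N)%nat -> (snd ij < N)%nat ->
     forall y z, G y -> G z -> Rabs (A (fst ij) (snd ij) y - A (fst ij) (snd ij) z) <= B * dist n y z)).
  { intros [i j]. simpl. destruct (classic ((i < N)%nat /\ (j < N)%nat)) as [[Hi Hj]|Hn].
    - destruct (HA i j Hi Hj) as [B [HB [_ H2]]]. exists B. split; [auto|]. intros _ _ y z Hy Hz. apply (H2 y z 0); auto.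
    - exists 0. split; [lra|]. intros; exfalso; auto. }
  assert (Hbc : forall i, exists B, 0 <= B /\ ((i < N)%nat -> (forall y, G y -> Rabs (b i y) <= B) /\
     forall y z, G y -> G z -> Rabs (b i y - b i z) <= B * dist n y z)).
  { intros i. destruct (classic (i < N)%nat) as [Hi|Hn].
    - destruct (Hb i Hi) as [B [HB [H1 H2]]]. exists B. split; [auto|]. intros _. split. intros y Hy; apply (H1 y 0); auto.
      intros y z Hy Hz. apply (H2 y z 0); auto.
    - exists 0. split; [lra|]. intros; exfalso; auto. }
  apply choice in HAc. destruct HAc as [BA HBA]. apply choice in Hbc. destruct Hbc as [Bb HBb].
  set (MA := rsum N (fun i => rsum N (fun j => BA (i, j)))).
  set (Mb := rsum N Bb).
  assert (HMA : forall i j, (i < N)%nat -> (j < N)%nat -> BA (i, j) <= MA).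
  { intros i j Hi Hj. apply Rle_trans with (rsum N (fun j => BA (i, j))).
    apply (rsum_term_le N (fun j => BA (i, j))); auto. intros; apply HBA.
    apply (rsum_term_le N (fun i => rsum N (fun j => BA (i, j)))); auto. intros; apply rsum_nonneg; intros; apply HBA. }
  assert (HMb : forall i, (i < N)%nat -> Bb i <= Mb).
  { intros i Hi. apply (rsum_term_le N Bb); auto. intros; apply HBb. }
  assert (HMA0 : 0 <= MA) by (apply rsum_nonneg; intros; apply rsum_nonneg; intros; apply HBA).
  assert (HMb0 : 0 <= Mb) by (apply rsum_nonneg; intros; apply HBb).
  assert (HN0 := pos_INR N).
  set (MP := INR N * (Mb / kap)).
  assert (HMP : 0 <= MP) by (apply Rmult_le_pos; auto; apply Rdiv_le_0_compat; auto).
  assert (HPb : forall y j, G y -> (j < N)%nat -> Rabs (Phi y j) <= MP).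
  { intros y j Hy Hj. apply (coercive_bound N (fun i j => A i j y) kap (Phi y) (fun i => b i y) Mb); auto.
    intros i Hi. destruct (HBb i) as [_ H]. destruct (H Hi) as [H1 _]. eapply Rle_trans; [apply H1; auto|auto]. }
  exists Phi. split. { intros y i Hy Hi. apply HPhi; auto. }
  intros j Hj. set (ML := INR N * ((Mb + INR N * (MA * MP)) / kap)).
  assert (HMAP : 0 <= INR N * (MA * MP)) by (apply Rmult_le_pos; auto; apply Rmult_le_pos; auto).
  assert (HML : 0 <= ML) by (apply Rmult_le_pos; auto; apply Rdiv_le_0_compat; lra).
  exists (MP + ML). split. lra. split.
  - intros y _ Hy _. specialize (HPb y j Hy Hj). lra.
  - intros y z _ Hy Hz _. assert (Hd := dist_pos n y z).
    apply Rle_trans with (ML * dist n y z). 2: apply Rmult_le_compat_r; lra.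
    replace (ML * dist n y z) with (INR N * ((Mb + INR N * (MA * MP)) * dist n y z / kap)) by (unfold ML; field; lra).
    apply (coercive_bound N (fun i j => A i j y) kap (fun k => Phi y k - Phi z k)
       (fun i => b i y - b i z - rsum N (fun j => (A i j y - A i j z) * Phi z j))); auto.
    + apply Rmult_le_pos; lra.
    + intros i Hi. rewrite <- (HPhi y Hy i Hi), <- (HPhi z Hz i Hi). rewrite <- !rsum_minus. apply rsum_ext; intros; ring.
    + intros i Hi. unfold Rminus at 1. eapply Rle_trans. apply Rabs_triang. rewrite Rabs_Ropp, Rmult_plus_distr_r.
      apply Rplus_le_compat.
      * destruct (HBb i) as [_ H]. destruct (H Hi) as [_ H2]. eapply Rle_trans; [apply H2; auto|]. apply Rmult_le_compat_r; auto.
      * eapply Rle_trans. apply rsum_abs. rewrite Rmult_assoc, <- rsum_const. apply rsum_le. intros k Hk'.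
        rewrite Rabs_mult. replace (MA * MP * dist n y z) with (MA * dist n y z * MP) by ring.
        apply Rmult_le_compat; auto using Rabs_pos. destruct (HBA (i, k)) as [_ H]. eapply Rle_trans; [apply (H Hi Hk'); auto|].
        apply Rmult_le_compat_r; auto.
Qed.
End LB.

(** * The semidiscrete problem as a differential equation *)

(* A state y in R^(2N) holds the coordinates of eta_h (indices below N), then of u_h. *)
Definition ucoord (N : nat) (y : nat -> R) : nat -> R := fun k => y (N + k)%nat.

Section Discrete.
Variable m : nat.
Let r := S (S (S m)).
Variables (K : nat) (phi : nat -> nat -> R -> R).
Hypothesis Q : quasi_interpolant_basis r K phi.
Variable N : nat.
Hypothesis HN : (1 <= N)%nat.

(** [y'] is an arbitrary vector: the equations are stated pointwise in time, apart from any
    curve. *)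
Definition weak1 (y y' : nat -> R) : Prop := forall w,
  I (fun x => (lc phi N y' x + (Derive (lc phi N y) x * lc phi N (ucoord N y) x
     + lc phi N y x * Derive (lc phi N (ucoord N y)) x)) * lc phi N w x) = 0.

Definition weak2 (y y' : nat -> R) : Prop := forall w,
  let eh := lc phi N y in let uh := lc phi N (ucoord N y) in
  let uht := lc phi N (ucoord N y') in let chi := lc phi N w in
  I (fun x => eh x * uht x * chi x + 1 / 3 * (eh x ^ 3 * Derive uht x) * Derive chi x
      + eh x * Derive eh x * chi x + eh x * uh x * Derive uh x * chi x
      + 1 / 3 * (eh x ^ 3 * (uh x * Derive_n uh 2 x - Derive uh x ^ 2)) * Derive chi x) = 0.

(** Bounded coordinates make the right-hand side Lipschitz; the lower bound for the depth makes the
    momentum mass matrix coercive. *)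
Definition good (c R0 : R) (y : nat -> R) : Prop :=
  (forall k, (k < N + N)%nat -> Rabs (y k) <= R0) /\ forall x, off N x -> c <= lc phi N y x.

Lemma basis_bounded : exists B, 0 <= B /\ forall k x, (k < N)%nat -> off N x ->
  Rabs (phi N (S k) x) <= B /\ Rabs (Derive (phi N (S k)) x) <= B /\ Rabs (Derive_n (phi N (S k)) 2 x) <= B.
Proof.
  assert (H : forall k, exists B, (k < N)%nat -> 0 <= B /\ forall x, off N x ->
    Rabs (phi N (S k) x) <= B /\ Rabs (Derive (phi N (S k)) x) <= B /\ Rabs (Derive_n (phi N (S k)) 2 x) <= B).
  { intros k. destruct (classic (k < N)%nat) as [Hk|Hk]; [|exists 0; tauto].
    assert (Hs : spline (S (S (S m))) N (phi N (S k))) by (apply (basis_spline m K phi Q); auto).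
    destruct (periodic_bounded (phi N (S k))) as [B1 H1]. apply (spl_cont m N); auto. apply (spl_per m N); auto.
    destruct (periodic_bounded (Derive (phi N (S k)))) as [B2 H2]. apply (spl_cont_D m N); auto. apply (spl_per_D m N); auto.
    assert (H3 : forall i, exists B, (i < N)%nat -> forall x, elt N i x -> Rabs (Derive_n (phi N (S k)) 2 x) <= B).
    { intros i. destruct (classic (i < N)%nat) as [Hi|Hi]; [|exists 0; tauto].
      destruct (spl_piece m N _ HN Hs i Hi) as [a [_ [_ E]]].
      destruct (continuity_ab_maj (fun x => Rabs (pol m (dco (dco a)) x)) (node N i) (node N (S i))) as [M [HM _]].
      apply node_mono; auto. intros c _. apply continuity_pt_filterlim.
      apply (continuous_comp (pol m (dco (dco a))) Rabs). apply cont_pol. apply continuous_Rabs.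
      exists (Rabs (pol m (dco (dco a)) M)). intros _ x Hx. rewrite E by auto. apply HM. unfold elt in Hx; lra. }
    apply choice in H3. destruct H3 as [B3 H3].
    exists (Rabs B1 + Rabs B2 + rsum N (fun i => Rabs (B3 i))). intros _.
    assert (P1 := Rabs_pos B1). assert (P2 := Rabs_pos B2).
    assert (P3 : 0 <= rsum N (fun i => Rabs (B3 i))) by (apply rsum_nonneg; intros; apply Rabs_pos).
    pose proof (RRle_abs B1). pose proof (RRle_abs B2).
    split; [lra|]. intros x [i [Hi Hx]]. specialize (H1 x). specialize (H2 x). specialize (H3 i Hi x Hx).
    pose proof (RRle_abs (B3 i)).
    assert (Rabs (B3 i) <= rsum N (fun i => Rabs (B3 i))) by (apply (rsum_term_le N (fun i => Rabs (B3 i))); auto; intros; apply Rabs_pos).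
    repeat split; lra. }
  apply choice in H. destruct H as [B H].
  exists (rsum N (fun k => Rabs (B k))). split. apply rsum_nonneg; intros; apply Rabs_pos.
  intros k x Hk Hx. destruct (H k Hk) as [H0 H1]. specialize (H1 x Hx).
  assert (Rabs (B k) <= rsum N (fun i => Rabs (B i))) by (apply (rsum_term_le N (fun i => Rabs (B i))); auto; intros; apply Rabs_pos).
  pose proof (RRle_abs (B k)). repeat split; lra.
Qed.

Lemma weak1_basis y y' : (forall i, (i < N)%nat -> I (fun x => lc phi N y' x * phi N (S i) x) =
   - I (fun x => (Derive (lc phi N y) x * lc phi N (ucoord N y) x + lc phi N y x * Derive (lc phi N (ucoord N y)) x) * phi N (S i) x))
  <-> weak1 y y'.
Proof.
  assert (p1 : pwc N (lc phi N y)) by (apply (lc_pwc m K phi Q); auto).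
  assert (p2 : pwc N (lc phi N (ucoord N y))) by (apply (lc_pwc m K phi Q); auto).
  assert (p3 : pwc N (lc phi N y')) by (apply (lc_pwc m K phi Q); auto).
  assert (p4 : pwc N (Derive (lc phi N y))) by (apply (spl_pwc_D m); auto; apply (lc_spline m K phi Q); auto).
  assert (p5 : pwc N (Derive (lc phi N (ucoord N y)))) by (apply (spl_pwc_D m); auto; apply (lc_spline m K phi Q); auto).
  assert (E : forall i, (i < N)%nat -> I (fun x => (lc phi N y' x + (Derive (lc phi N y) x * lc phi N (ucoord N y) x
     + lc phi N y x * Derive (lc phi N (ucoord N y)) x)) * phi N (S i) x) = I (fun x => lc phi N y' x * phi N (S i) x) +
      I (fun x => (Derive (lc phi N y) x * lc phi N (ucoord N y) x + lc phi N y x * Derive (lc phi N (ucoord N y)) x) * phi N (S i) x)).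
  { intros i Hi. assert (p6 : pwc N (phi N (S i))) by (apply (spl_pwc m); auto; apply (basis_spline m K phi Q); auto).
    rewrite <- (I_plus N) by (auto; pw). f_equal. extensionality x. ring. }
  split.
  - intros H w. rewrite (I_lc_r m K phi Q) by (auto; pw). apply rsum_zero. intros i Hi.
    rewrite E, H by auto. ring.
  - intros H i Hi. specialize (H (fun j => if Nat.eqb j i then 1 else 0)).
    rewrite (I_lc_r m K phi Q) in H by (auto; pw).
    rewrite (rsum_delta N i (fun k => I (fun x => (lc phi N y' x + (Derive (lc phi N y) x * lc phi N (ucoord N y) x
     + lc phi N y x * Derive (lc phi N (ucoord N y)) x)) * phi N (S k) x))) in H by auto.
    rewrite E in H by auto. lra.
Qed.

Lemma weak2_basis y y' : (forall i, (i < N)%nat ->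
   I (fun x => lc phi N y x * lc phi N (ucoord N y') x * phi N (S i) x
      + 1 / 3 * (lc phi N y x ^ 3 * Derive (lc phi N (ucoord N y')) x) * Derive (phi N (S i)) x) =
   - I (fun x => (lc phi N y x * Derive (lc phi N y) x + lc phi N y x * lc phi N (ucoord N y) x * Derive (lc phi N (ucoord N y)) x) * phi N (S i) x
      + 1 / 3 * (lc phi N y x ^ 3 * (lc phi N (ucoord N y) x * Derive_n (lc phi N (ucoord N y)) 2 x - Derive (lc phi N (ucoord N y)) x ^ 2)) * Derive (phi N (S i)) x))
  <-> weak2 y y'.
Proof.
  assert (S1 := lc_spline m K phi Q N y HN). assert (S2 := lc_spline m K phi Q N (ucoord N y) HN).
  assert (S3 := lc_spline m K phi Q N (ucoord N y') HN). unfold weak2.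
  set (eh := lc phi N y) in *. set (uh := lc phi N (ucoord N y)) in *. set (uht := lc phi N (ucoord N y')) in *.
  assert (p1 : pwc N eh) by (apply (spl_pwc m); auto). assert (p2 : pwc N uh) by (apply (spl_pwc m); auto).
  assert (p3 : pwc N uht) by (apply (spl_pwc m); auto). assert (p4 : pwc N (Derive eh)) by (apply (spl_pwc_D m); auto).
  assert (p5 : pwc N (Derive uh)) by (apply (spl_pwc_D m); auto). assert (p6 : pwc N (Derive uht)) by (apply (spl_pwc_D m); auto).
  assert (p7 : pwc N (Derive_n uh 2)) by (apply (spl_pwc_D2 m); auto).
  set (f := fun x => eh x * uht x + eh x * Derive eh x + eh x * uh x * Derive uh x).
  set (g := fun x => 1 / 3 * (eh x ^ 3 * Derive uht x) + 1 / 3 * (eh x ^ 3 * (uh x * Derive_n uh 2 x - Derive uh x ^ 2))).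
  assert (pf : pwc N f) by (unfold f; pw). assert (pg : pwc N g) by (unfold g; pw).
  assert (Ew : forall w, I (fun x => eh x * uht x * lc phi N w x + 1 / 3 * (eh x ^ 3 * Derive uht x) * Derive (lc phi N w) x
      + eh x * Derive eh x * lc phi N w x + eh x * uh x * Derive uh x * lc phi N w x
      + 1 / 3 * (eh x ^ 3 * (uh x * Derive_n uh 2 x - Derive uh x ^ 2)) * Derive (lc phi N w) x) =
     rsum N (fun i => w i * (I (fun x => f x * phi N (S i) x) + I (fun x => g x * Derive (phi N (S i)) x)))).
  { intros w. assert (Sw := lc_spline m K phi Q N w HN).
    assert (p8 : pwc N (lc phi N w)) by (apply (spl_pwc m); auto). assert (p9 : pwc N (Derive (lc phi N w))) by (apply (spl_pwc_D m); auto).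
    transitivity (I (fun x => f x * lc phi N w x) + I (fun x => g x * Derive (lc phi N w) x)).
    - rewrite <- (I_plus N) by (auto; pw). f_equal. extensionality x. unfold f, g. ring.
    - rewrite (I_lc_r m K phi Q), (I_lc_D m K phi Q) by auto. rewrite <- rsum_plus. apply rsum_ext; intros; ring. }
  assert (Ei : forall i, (i < N)%nat -> I (fun x => f x * phi N (S i) x) + I (fun x => g x * Derive (phi N (S i)) x) =
     I (fun x => eh x * uht x * phi N (S i) x + 1 / 3 * (eh x ^ 3 * Derive uht x) * Derive (phi N (S i)) x) +
     I (fun x => (eh x * Derive eh x + eh x * uh x * Derive uh x) * phi N (S i) x
      + 1 / 3 * (eh x ^ 3 * (uh x * Derive_n uh 2 x - Derive uh x ^ 2)) * Derive (phi N (S i)) x)).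
  { intros i Hi. assert (Si := basis_spline m K phi Q N i Hi).
    assert (p8 : pwc N (phi N (S i))) by (apply (spl_pwc m); auto). assert (p9 : pwc N (Derive (phi N (S i)))) by (apply (spl_pwc_D m); auto).
    rewrite <- !(I_plus N) by (auto; pw). f_equal. extensionality x. unfold f, g. ring. }
  split.
  - intros H w. cbv zeta. rewrite Ew. apply rsum_zero. intros i Hi. rewrite Ei, H by auto. ring.
  - intros H i Hi. specialize (H (fun j => if Nat.eqb j i then 1 else 0)). cbv zeta in H. rewrite Ew in H.
    rewrite (rsum_delta N i (fun i => I (fun x => f x * phi N (S i) x) + I (fun x => g x * Derive (phi N (S i)) x))) in H by auto.
    rewrite Ei in H by auto. lra.
Qed.

(** The time derivatives decouple: the mass equation determines that of the depth through the
    constant Gram matrix, the momentum equation that of the velocity through a matrix depending on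
    the depth. Coercivity of both also gives uniqueness of [y'], needed to recognise any discrete
    solution as a solution of the differential equation. *)
Lemma rhs_exists c R0 : 0 < c -> exists Phi : (nat -> R) -> nat -> R,
  (forall y, good c R0 y -> weak1 y (Phi y) /\ weak2 y (Phi y)) /\
  (forall y y', good c R0 y -> weak1 y y' -> weak2 y y' -> forall k, (k < N + N)%nat -> y' k = Phi y k) /\
  (forall k, (k < N + N)%nat -> Lb (N + N) (good c R0) (fun y => Phi y k)).
Proof.
  intros Hc. set (G := good c R0). set (n := (N + N)%nat).
  destruct basis_bounded as [Bb [HBb Hb]].
  assert (Sb : forall k, (k < N)%nat -> spline (S (S (S m))) N (phi N (S k))) by (intros; apply (basis_spline m K phi Q); auto).
  assert (pb : forall k, (k < N)%nat -> pwc N (phi N (S k))) by (intros; apply (spl_pwc m); auto).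
  assert (pbD : forall k, (k < N)%nat -> pwc N (Derive (phi N (S k)))) by (intros; apply (spl_pwc_D m); auto).
  assert (Sl : forall y, spline (S (S (S m))) N (lc phi N y)) by (intros; apply (lc_spline m K phi Q); auto).
  assert (pl : forall y, pwc N (lc phi N y)) by (intros; apply (spl_pwc m); auto).
  assert (plD : forall y, pwc N (Derive (lc phi N y))) by (intros; apply (spl_pwc_D m); auto).
  assert (plD2 : forall y, pwc N (Derive_n (lc phi N y) 2)) by (intros; apply (spl_pwc_D2 m); auto).
  assert (Lk : forall k, (k < n)%nat -> Lb n G (fun y => y k)).
  { intros k Hk. exists (Rabs R0 + 1). pose proof (Rabs_pos R0). split; [lra|]. split.
    - intros y _ [Hy _] _. specialize (Hy k Hk). pose proof (RRle_abs R0). lra.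
    - intros y z _ _ _ _. pose proof (dist_coord n y z k Hk). pose proof (dist_pos n y z). nra. }
  assert (Lfun : forall j nu, (j = 0 \/ j = N)%nat -> (nu <= 2)%nat -> uLb n G (off N) (fun y x => Derive_n (lc phi N (fun k => y (j + k)%nat)) nu x)).
  { intros j nu Hj Hnu. apply uLb_ext with (fun y x => rsum N (fun k => y (j + k)%nat * Derive_n (phi N (S k)) nu x)).
    { intros y x Hx. symmetry. apply (lc_Derive_n m K phi Q); auto. }
    apply (uLb_rsum n G (off N) N (fun k y x => y (j + k)%nat * Derive_n (phi N (S k)) nu x)). intros k Hk.
    apply uLb_mult. apply (Lb_weaken n G (off N) (fun y => y (j + k)%nat)). apply Lk. unfold n; lia.
    apply (uLb_fun n G (off N) (Derive_n (phi N (S k)) nu) Bb). intros x Hx. specialize (Hb k x Hk Hx).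
    destruct nu as [|[|[|]]]; try lia; apply Hb. }
  assert (Le : uLb n G (off N) (fun y x => lc phi N y x)) by (apply (Lfun 0%nat 0%nat); auto).
  assert (Lu : uLb n G (off N) (fun y x => lc phi N (ucoord N y) x)) by (apply (Lfun N 0%nat); auto).
  assert (LDe : uLb n G (off N) (fun y x => Derive (lc phi N y) x)) by (apply (Lfun 0%nat 1%nat); auto).
  assert (LDu : uLb n G (off N) (fun y x => Derive (lc phi N (ucoord N y)) x)) by (apply (Lfun N 1%nat); auto).
  assert (LD2u : uLb n G (off N) (fun y x => Derive_n (lc phi N (ucoord N y)) 2 x)) by (apply (Lfun N 2%nat); auto).
  assert (Lb0 : forall k, (k < N)%nat -> uLb n G (off N) (fun _ x => phi N (S k) x)).
  { intros k Hk. apply (uLb_fun n G (off N) (phi N (S k)) Bb). intros; apply Hb; auto. }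
  assert (Lb1 : forall k, (k < N)%nat -> uLb n G (off N) (fun _ x => Derive (phi N (S k)) x)).
  { intros k Hk. apply (uLb_fun n G (off N) (Derive (phi N (S k))) Bb). intros; apply Hb; auto. }
  destruct (coord_bound m K phi Q N HN) as [Cc [HCc Hcc]].
  assert (Hsq : forall w, rsum N (fun i => w i * w i) <= INR N * Cc ^ 2 * I (fun x => lc phi N w x ^ 2)).
  { intros w. rewrite <- (L2norm_sq N) by auto. rewrite Rmult_assoc, <- Rpow_mult_distr, <- rsum_const. apply rsum_le.
    intros k Hk. specialize (Hcc w k Hk). replace (w k * w k) with (w k ^ 2) by ring. apply pow_maj_Rabs; auto. }
  assert (HN1 : 1 <= INR N) by (replace 1 with (INR 1) by reflexivity; apply le_INR; lia).
  assert (HCp : 0 <= INR N * Cc ^ 2) by (apply Rmult_le_pos; [lra|apply pow2_ge_0]).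
  (* [N Cc^2] compares the squared coordinates with the squared L2 norm; the added 1 keeps the
     inverse meaningful when that constant is 0. *)
  set (kap := / (INR N * Cc ^ 2 + 1)).
  assert (Hkap : 0 < kap) by (apply Rinv_0_lt_compat; lra).
  assert (Hkapw : forall w, kap * rsum N (fun i => w i * w i) <= I (fun x => lc phi N w x ^ 2)).
  { intros w. assert (0 <= I (fun x => lc phi N w x ^ 2)). { apply (I_ge0 N); auto. pw; auto. intros; apply pow2_ge_0. }
    apply Rmult_le_reg_l with (INR N * Cc ^ 2 + 1); [lra|]. unfold kap. rewrite <- Rmult_assoc, Rinv_r by lra.
    specialize (Hsq w). lra. }
  set (A1 := fun (i j : nat) (_ : nat -> R) => I (fun x => phi N (S i) x * phi N (S j) x)).
  set (b1 := fun i y => -1 * I (fun x => (Derive (lc phi N y) x * lc phi N (ucoord N y) x + lc phi N y x * Derive (lc phi N (ucoord N y)) x) * phi N (S i) x)).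
  set (A2 := fun (i j : nat) y => I (fun x => lc phi N y x * (phi N (S i) x * phi N (S j) x) + 1 / 3 * (lc phi N y x ^ 3 * (Derive (phi N (S i)) x * Derive (phi N (S j)) x)))).
  set (b2 := fun i y => -1 * I (fun x => (lc phi N y x * Derive (lc phi N y) x + lc phi N y x * lc phi N (ucoord N y) x * Derive (lc phi N (ucoord N y)) x) * phi N (S i) x
      + 1 / 3 * (lc phi N y x ^ 3 * (lc phi N (ucoord N y) x * Derive_n (lc phi N (ucoord N y)) 2 x - Derive (lc phi N (ucoord N y)) x ^ 2)) * Derive (phi N (S i)) x)).
  assert (E1 : forall y w i, (i < N)%nat -> rsum N (fun j => A1 i j y * w j) = I (fun x => lc phi N w x * phi N (S i) x)).
  { intros y w i Hi. rewrite (rsum_ext N _ (fun j => w j * I (fun x => phi N (S i) x * phi N (S j) x))) by (intros; unfold A1; ring).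
    rewrite <- (I_lc_r m K phi Q N (phi N (S i)) w) by auto. f_equal. extensionality x; ring. }
  assert (E2 : forall y w i, (i < N)%nat -> rsum N (fun j => A2 i j y * w j) = I (fun x => lc phi N y x * lc phi N w x * phi N (S i) x
      + 1 / 3 * (lc phi N y x ^ 3 * Derive (lc phi N w) x) * Derive (phi N (S i)) x)).
  { intros y w i Hi. assert (pbi := pb i Hi). assert (pbDi := pbD i Hi). assert (ply := pl y). assert (plw := pl w). assert (plDw := plD w).
    transitivity (I (fun x => (lc phi N y x * phi N (S i) x) * lc phi N w x) + I (fun x => (1 / 3 * (lc phi N y x ^ 3 * Derive (phi N (S i)) x)) * Derive (lc phi N w) x)).
    - rewrite (I_lc_r m K phi Q), (I_lc_D m K phi Q) by (auto; pw). rewrite <- rsum_plus. apply rsum_ext. intros j Hj.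
      assert (pbj := pb j Hj). assert (pbDj := pbD j Hj). unfold A2.
      rewrite <- !(I_scal N) by (auto; pw). rewrite Rmult_comm, <- (I_scal N), <- (I_plus N) by (auto; pw). f_equal. extensionality x. ring.
    - rewrite <- (I_plus N) by (auto; pw). f_equal. extensionality x. ring. }
  destruct (solve_Lb n G N A1 b1 kap Hkap) as [P1 [HP1 LP1]].
  { intros i j Hi Hj. apply (Lb_I n G N (fun _ x => phi N (S i) x * phi N (S j) x)); auto. intros; apply pwc_mult; auto. apply uLb_mult; auto. }
  { intros i Hi. apply (uLb_scal n G (fun _ => True) (-1) (fun y _ => I (fun x => (Derive (lc phi N y) x * lc phi N (ucoord N y) x + lc phi N y x * Derive (lc phi N (ucoord N y)) x) * phi N (S i) x))).
    apply (Lb_I n G N (fun y x => (Derive (lc phi N y) x * lc phi N (ucoord N y) x + lc phi N y x * Derive (lc phi N (ucoord N y)) x) * phi N (S i) x)); auto.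
    intros; pw; auto. repeat first [apply uLb_mult | apply uLb_plus]; auto. }
  { intros y w _. rewrite (rsum_ext N (fun i => w i * rsum N (fun j => A1 i j y * w j)) (fun i => w i * I (fun x => lc phi N w x * phi N (S i) x))) by (intros; rewrite E1; auto).
    rewrite <- (I_lc_r m K phi Q) by auto. eapply Rle_trans. apply Hkapw. right. f_equal. extensionality x; ring. }
  destruct (solve_Lb n G N A2 b2 (c * kap)) as [P2 [HP2 LP2]].
  { apply Rmult_lt_0_compat; auto. }
  { intros i j Hi Hj. apply (Lb_I n G N (fun y x => lc phi N y x * (phi N (S i) x * phi N (S j) x) + 1 / 3 * (lc phi N y x ^ 3 * (Derive (phi N (S i)) x * Derive (phi N (S j)) x)))); auto.
    intros; pw; auto. repeat first [apply uLb_plus | apply uLb_scal | apply uLb_pow | apply uLb_mult]; auto. }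
  { intros i Hi. apply (uLb_scal n G (fun _ => True) (-1) (fun y _ => I (fun x => (lc phi N y x * Derive (lc phi N y) x + lc phi N y x * lc phi N (ucoord N y) x * Derive (lc phi N (ucoord N y)) x) * phi N (S i) x
      + 1 / 3 * (lc phi N y x ^ 3 * (lc phi N (ucoord N y) x * Derive_n (lc phi N (ucoord N y)) 2 x - Derive (lc phi N (ucoord N y)) x ^ 2)) * Derive (phi N (S i)) x))).
    apply (Lb_I n G N (fun y x => (lc phi N y x * Derive (lc phi N y) x + lc phi N y x * lc phi N (ucoord N y) x * Derive (lc phi N (ucoord N y)) x) * phi N (S i) x
      + 1 / 3 * (lc phi N y x ^ 3 * (lc phi N (ucoord N y) x * Derive_n (lc phi N (ucoord N y)) 2 x - Derive (lc phi N (ucoord N y)) x ^ 2)) * Derive (phi N (S i)) x)); auto.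
    { intros y. assert (q1 := pbD i Hi). assert (q2 := pb i Hi). assert (q3 := pl y). assert (q4 := plD y).
      assert (q5 := pl (ucoord N y)). assert (q6 := plD (ucoord N y)). assert (q7 := plD2 (ucoord N y)). pw. }
    assert (l1 := Lb1 i Hi). assert (l0 := Lb0 i Hi).
    apply uLb_plus. apply uLb_mult; auto. apply uLb_plus. apply uLb_mult; auto. apply uLb_mult; auto. apply uLb_mult; auto.
    apply uLb_mult; auto. apply uLb_scal. apply uLb_mult. apply uLb_pow; auto. apply uLb_minus. apply uLb_mult; auto. apply uLb_pow; auto. }
  { intros y w [_ Hy]. assert (ply := pl y). assert (plw := pl w). assert (plDw := plD w).
    rewrite (rsum_ext N (fun i => w i * rsum N (fun j => A2 i j y * w j)) (fun i => w i * I (fun x => (lc phi N y x * lc phi N w x) * phi N (S i) x) + w i * I (fun x => (1 / 3 * (lc phi N y x ^ 3 * Derive (lc phi N w) x)) * Derive (phi N (S i)) x))).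
    2:{ intros i Hi. rewrite E2 by auto. assert (q1 := pbD i Hi). assert (q2 := pb i Hi). rewrite (I_plus N) by (auto; pw). ring. }
    rewrite rsum_plus, <- (I_lc_r m K phi Q), <- (I_lc_D m K phi Q), <- (I_plus N) by (auto; pw).
    rewrite Rmult_assoc. apply Rle_trans with (c * I (fun x => lc phi N w x ^ 2)). apply Rmult_le_compat_l; auto; lra.
    rewrite <- (I_scal N) by (auto; pw). apply (I_le N); auto; pw. intros x Hx. specialize (Hy x Hx).
    assert (0 <= lc phi N y x ^ 3) by (apply pow_le; lra).
    assert (H1 : 0 <= lc phi N y x ^ 3 * Derive (lc phi N w) x ^ 2) by (apply Rmult_le_pos; auto; apply pow2_ge_0).
    pose proof (pow2_ge_0 (lc phi N w x)). nra. }
  assert (HQ1 : forall y y', (forall i, (i < N)%nat -> rsum N (fun j => A1 i j y * y' j) = b1 i y) <-> weak1 y y').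
  { intros y y'. rewrite <- weak1_basis. split; intros H i Hi; specialize (H i Hi).
    - rewrite E1 in H by auto. rewrite H. unfold b1. ring.
    - rewrite E1, H by auto. unfold b1. ring. }
  assert (HQ2 : forall y y', (forall i, (i < N)%nat -> rsum N (fun j => A2 i j y * ucoord N y' j) = b2 i y) <-> weak2 y y').
  { intros y y'. rewrite <- weak2_basis. split; intros H i Hi; specialize (H i Hi).
    - rewrite E2 in H by auto. rewrite H. unfold b2. ring.
    - rewrite E2, H by auto. unfold b2. ring. }
  set (Phi := fun y k => if Nat.ltb k N then P1 y k else P2 y (k - N)%nat).
  assert (HPa : forall y k, (k < N)%nat -> Phi y k = P1 y k).
  { intros y k Hk. unfold Phi. apply Nat.ltb_lt in Hk. rewrite Hk. auto. }
  assert (HPb : forall y k, Phi y (N + k)%nat = P2 y k).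
  { intros y k. unfold Phi. replace (Nat.ltb (N + k) N) with false by (symmetry; apply Nat.ltb_ge; lia). f_equal. lia. }
  exists Phi. split; [|split].
  - intros y Hy. split.
    + apply HQ1. intros i Hi. rewrite <- (HP1 y i Hy Hi). apply rsum_ext. intros j Hj. rewrite HPa; auto.
    + apply HQ2. intros i Hi. rewrite <- (HP2 y i Hy Hi). apply rsum_ext. intros j Hj. unfold ucoord. rewrite HPb; auto.
  - intros y y' Hy H1 H2. rewrite <- HQ1 in H1. rewrite <- HQ2 in H2.
    assert (U : forall (A : nat -> nat -> R) kp w, 0 < kp -> kp * rsum N (fun i => w i * w i) <= rsum N (fun i => w i * rsum N (fun j => A i j * w j)) ->
       (forall i, (i < N)%nat -> rsum N (fun j => A i j * w j) = 0) -> forall j, (j < N)%nat -> w j = 0).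
    { intros A kp w Hkp Hco H0 j Hj. apply NNPP. intros Hne. apply Rabs_no_R0 in Hne. apply Hne.
      apply Rle_antisym; [|apply Rabs_pos]. replace 0 with (INR N * (0 / kp)) by (field; lra).
      apply (coercive_bound N A kp w (fun _ => 0) 0); auto; try lra. intros; rewrite Rabs_R0; lra. }
    assert (V1 : forall j, (j < N)%nat -> y' j - P1 y j = 0).
    { apply (U (fun i j => A1 i j y) kap (fun j => y' j - P1 y j) Hkap).
      - rewrite (rsum_ext N (fun i => (y' i - P1 y i) * rsum N (fun j => A1 i j y * (y' j - P1 y j))) (fun i => (y' i - P1 y i) * I (fun x => lc phi N (fun j => y' j - P1 y j) x * phi N (S i) x))) by (intros; rewrite E1; auto).
        rewrite <- (I_lc_r m K phi Q) by auto. eapply Rle_trans. apply (Hkapw (fun j => y' j - P1 y j)). right. f_equal. extensionality x; ring.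
      - intros i Hi. rewrite (rsum_ext N _ (fun j => A1 i j y * y' j - A1 i j y * P1 y j)) by (intros; ring).
        rewrite rsum_minus, H1, HP1 by auto. ring. }
    assert (V2 : forall j, (j < N)%nat -> ucoord N y' j - P2 y j = 0).
    { apply (U (fun i j => A2 i j y) (c * kap) (fun j => ucoord N y' j - P2 y j)). apply Rmult_lt_0_compat; auto.
      - set (w := fun j => ucoord N y' j - P2 y j). change (c * kap * rsum N (fun i => w i * w i) <= rsum N (fun i => w i * rsum N (fun j => A2 i j y * w j))).
        destruct Hy as [_ Hy]. assert (ply := pl y). assert (plw := pl w). assert (plDw := plD w).
        rewrite (rsum_ext N (fun i => w i * rsum N (fun j => A2 i j y * w j)) (fun i => w i * I (fun x => (lc phi N y x * lc phi N w x) * phi N (S i) x) + w i * I (fun x => (1 / 3 * (lc phi N y x ^ 3 * Derive (lc phi N w) x)) * Derive (phi N (S i)) x))).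
        2:{ intros i Hi. rewrite E2 by auto. assert (q1 := pbD i Hi). assert (q2 := pb i Hi). rewrite (I_plus N) by (auto; pw). ring. }
        rewrite rsum_plus, <- (I_lc_r m K phi Q), <- (I_lc_D m K phi Q), <- (I_plus N) by (auto; pw).
        rewrite Rmult_assoc. apply Rle_trans with (c * I (fun x => lc phi N w x ^ 2)). apply Rmult_le_compat_l; auto; lra.
        rewrite <- (I_scal N) by (auto; pw). apply (I_le N); auto; pw. intros x Hx. specialize (Hy x Hx).
        assert (0 <= lc phi N y x ^ 3) by (apply pow_le; lra).
        assert (H3 : 0 <= lc phi N y x ^ 3 * Derive (lc phi N w) x ^ 2) by (apply Rmult_le_pos; auto; apply pow2_ge_0).
        pose proof (pow2_ge_0 (lc phi N w x)). nra.
      - intros i Hi. rewrite (rsum_ext N _ (fun j => A2 i j y * ucoord N y' j - A2 i j y * P2 y j)) by (intros; ring).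
        rewrite rsum_minus, H2, HP2 by auto. ring. }
    intros k Hk. destruct (Nat.lt_ge_cases k N) as [Hlt|Hge].
    + rewrite HPa by auto. specialize (V1 k Hlt). lra.
    + replace k with (N + (k - N))%nat by lia. rewrite HPb. specialize (V2 (k - N)%nat ltac:(lia)). unfold ucoord in V2. lra.
  - intros k Hk. destruct (Nat.lt_ge_cases k N) as [Hlt|Hge].
    + replace (fun y => Phi y k) with (fun y => P1 y k) by (extensionality y; rewrite HPa; auto). auto.
    + replace (fun y => Phi y k) with (fun y => P2 y (k - N)%nat). apply LP2; lia.
      extensionality y. rewrite <- HPb. f_equal. lia.
Qed.
End Discrete.

(** * The error along a discrete solution *)

Section Curve.
Variable m : nat.
Let r := S (S (S m)).
Variables (K : nat) (phi : nat -> nat -> R -> R).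
Hypothesis Q : quasi_interpolant_basis r K phi.
Let L := (K + r + 6)%nat.

(** The energy norm up to constants, as a sum of norms instead of a root of squares: the triangle
    inequality, needed for the retraction, is then immediate. *)
Definition state_norm (N : nat) (e : nat -> R) : R :=
  L2norm (lc phi N e) + L2norm (lc phi N (ucoord N e)) + L2norm (Derive (lc phi N (ucoord N e))).

Lemma state_norm_pos N e : 0 <= state_norm N e.
Proof. unfold state_norm. repeat apply Rplus_le_le_0_compat; apply L2norm_pos. Qed.

Lemma Derive_lc_plus N y z x : (1 <= N)%nat ->
  Derive (lc phi N (fun k => y k + z k)) x = Derive (lc phi N y) x + Derive (lc phi N z) x.
Proof.
  intros HN. rewrite !(lc_Derive m K phi Q) by auto. rewrite <- rsum_plus. apply rsum_ext; intros; ring.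
Qed.

Lemma Derive_lc_minus N y z x : (1 <= N)%nat ->
  Derive (lc phi N (fun k => y k - z k)) x = Derive (lc phi N y) x - Derive (lc phi N z) x.
Proof.
  intros HN. rewrite !(lc_Derive m K phi Q) by auto. rewrite <- rsum_minus. apply rsum_ext; intros; ring.
Qed.

Lemma Derive2_lc_minus N y z x : (1 <= N)%nat -> off N x ->
  Derive_n (lc phi N (fun k => y k - z k)) 2 x = Derive_n (lc phi N y) 2 x - Derive_n (lc phi N z) 2 x.
Proof.
  intros HN Hx. rewrite !(lc_Derive2 m K phi Q) by auto. rewrite <- rsum_minus. apply rsum_ext; intros; ring.
Qed.

Lemma lc_pwc_D N z : (1 <= N)%nat -> pwc N (Derive (lc phi N z)).
Proof. intros; apply (spl_pwc_D m); auto; apply (lc_spline m K phi Q); auto. Qed.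

Lemma lc_pwc_D2 N z : (1 <= N)%nat -> pwc N (Derive_n (lc phi N z) 2).
Proof. intros; apply (spl_pwc_D2 m); auto; apply (lc_spline m K phi Q); auto. Qed.

Lemma state_norm_triang N a b : (1 <= N)%nat ->
  state_norm N (fun k => a k + b k) <= state_norm N a + state_norm N b.
Proof.
  intros HN. unfold state_norm.
  assert (H : forall a b, L2norm (lc phi N (fun k => a k + b k)) <= L2norm (lc phi N a) + L2norm (lc phi N b)).
  { intros. rewrite lc_plus. apply (L2norm_triang N); auto; apply (lc_pwc m K phi Q); auto. }
  assert (H' : forall a b, L2norm (Derive (lc phi N (fun k => a k + b k))) <= L2norm (Derive (lc phi N a)) + L2norm (Derive (lc phi N b))).
  { intros a0 b0. replace (Derive (lc phi N (fun k => a0 k + b0 k))) with (fun x => Derive (lc phi N a0) x + Derive (lc phi N b0) x).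
    apply (L2norm_triang N); auto; apply lc_pwc_D; auto. extensionality x. symmetry. apply Derive_lc_plus; auto. }
  pose proof (H a b). pose proof (H (ucoord N a) (ucoord N b)). pose proof (H' (ucoord N a) (ucoord N b)).
  change (ucoord N (fun k => a k + b k)) with (fun k => ucoord N a k + ucoord N b k). lra.
Qed.

Lemma state_norm_scal N c a : (1 <= N)%nat -> state_norm N (fun k => c * a k) = Rabs c * state_norm N a.
Proof.
  intros HN. unfold state_norm.
  change (ucoord N (fun k => c * a k)) with (fun k => c * ucoord N a k).
  rewrite !lc_scal.
  replace (Derive (fun x => c * lc phi N (ucoord N a) x)) with (fun x => c * Derive (lc phi N (ucoord N a)) x).
  rewrite !(L2norm_scal N) by (auto; first [apply (lc_pwc m K phi Q); auto | apply lc_pwc_D; auto]). ring.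
  extensionality x. symmetry. apply Derive_scal.
Qed.

(** Equivalence with the coordinate norm, in both directions below, has constants depending on [N];
    it supports only continuity and Lipschitz arguments for fixed [N]. *)
Lemma state_norm_ge N : (1 <= N)%nat -> exists C, 0 <= C /\ forall e, dist (N + N) e (fun _ => 0) <= C * state_norm N e.
Proof.
  intros HN. destruct (coord_bound m K phi Q N HN) as [C [HC H]].
  exists (INR (N + N) * C). split. apply Rmult_le_pos; auto. apply pos_INR. intros e. unfold dist.
  rewrite Rmult_assoc, <- rsum_const. apply rsum_le. intros k Hk. rewrite Rminus_0_r.
  pose proof (L2norm_pos (lc phi N e)). pose proof (L2norm_pos (lc phi N (ucoord N e))).
  pose proof (L2norm_pos (Derive (lc phi N (ucoord N e)))).
  destruct (Nat.lt_ge_cases k N) as [Hlt|Hge].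
  - eapply Rle_trans. apply (H e k Hlt). apply Rmult_le_compat_l; auto. unfold state_norm. lra.
  - replace (e k) with (ucoord N e (k - N)%nat) by (unfold ucoord; f_equal; lia).
    eapply Rle_trans. apply (H (ucoord N e) (k - N)%nat); lia. apply Rmult_le_compat_l; auto. unfold state_norm. lra.
Qed.

Lemma L2norm_rsum N n (f : nat -> R -> R) : (1 <= N)%nat -> (forall k, (k < n)%nat -> pwc N (f k)) ->
  L2norm (fun x => rsum n (fun k => f k x)) <= rsum n (fun k => L2norm (f k)).
Proof.
  intros HN. induction n; intros H; simpl.
  - apply (L2norm_le_const N); auto. apply pwc_const. lra. intros; rewrite Rabs_R0; lra.
  - eapply Rle_trans. apply (L2norm_triang N (fun x => rsum n (fun k => f k x)) (f n)); auto. apply pwc_rsum; auto.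
    specialize (IHn ltac:(auto)). lra.
Qed.

Lemma state_norm_le N : (1 <= N)%nat -> exists C, 0 <= C /\ forall e, state_norm N e <= C * dist (N + N) e (fun _ => 0).
Proof.
  intros HN. set (M := rsum N (fun k => L2norm (phi N (S k)) + L2norm (Derive (phi N (S k))))).
  assert (HM : forall k, (k < N)%nat -> L2norm (phi N (S k)) + L2norm (Derive (phi N (S k))) <= M).
  { intros k Hk. apply (rsum_term_le N (fun k => L2norm (phi N (S k)) + L2norm (Derive (phi N (S k))))); auto.
    intros; apply Rplus_le_le_0_compat; apply L2norm_pos. }
  assert (HM0 : 0 <= M) by (apply rsum_nonneg; intros; apply Rplus_le_le_0_compat; apply L2norm_pos).
  assert (Hs : forall k, (k < N)%nat -> spline (S (S (S m))) N (phi N (S k))) by (intros; apply (basis_spline m K phi Q); auto).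
  assert (H : forall a D, (forall k, (k < N)%nat -> Rabs (a k) <= D) -> L2norm (lc phi N a) <= INR N * (D * M)).
  { intros a D Ha. eapply Rle_trans. apply (L2norm_rsum N N (fun k x => a k * phi N (S k) x)); auto.
    intros k Hk. apply pwc_mult. apply pwc_const. apply (spl_pwc m); auto.
    rewrite <- rsum_const. apply rsum_le. intros k Hk. rewrite (L2norm_scal N) by (auto; apply (spl_pwc m); auto).
    specialize (HM k Hk). pose proof (L2norm_pos (Derive (phi N (S k)))).
    apply Rmult_le_compat; auto using Rabs_pos, L2norm_pos. lra. }
  assert (H' : forall a D, (forall k, (k < N)%nat -> Rabs (a k) <= D) -> L2norm (Derive (lc phi N a)) <= INR N * (D * M)).
  { intros a D Ha. replace (Derive (lc phi N a)) with (fun x => rsum N (fun k => a k * Derive (phi N (S k)) x))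
      by (extensionality x; symmetry; apply (lc_Derive m K phi Q); auto).
    eapply Rle_trans. apply (L2norm_rsum N N (fun k x => a k * Derive (phi N (S k)) x)); auto.
    intros k Hk. apply pwc_mult. apply pwc_const. apply (spl_pwc_D m); auto.
    rewrite <- rsum_const. apply rsum_le. intros k Hk. rewrite (L2norm_scal N) by (auto; apply (spl_pwc_D m); auto).
    specialize (HM k Hk). pose proof (L2norm_pos (phi N (S k))).
    apply Rmult_le_compat; auto using Rabs_pos, L2norm_pos. lra. }
  exists (3 * (INR N * M)). split. { pose proof (pos_INR N). apply Rmult_le_pos; [lra|]. apply Rmult_le_pos; auto. }
  intros e. set (D := dist (N + N) e (fun _ => 0)).
  assert (Hk : forall k, (k < N + N)%nat -> Rabs (e k) <= D).
  { intros k Hk. rewrite <- (Rminus_0_r (e k)). apply (dist_coord (N + N) e (fun _ => 0) k Hk). }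
  unfold state_norm.
  pose proof (H e D ltac:(intros; apply Hk; lia)).
  pose proof (H (ucoord N e) D ltac:(intros; apply Hk; lia)). pose proof (H' (ucoord N e) D ltac:(intros; apply Hk; lia)).
  lra.
Qed.

Lemma uhasd_lc N T c dc t : (1 <= N)%nat -> (forall k, (k < N)%nat -> hasd T (fun s => c s k) t (dc k)) ->
  uhasd (off N) T (fun s => lc phi N (c s)) t (lc phi N dc).
Proof.
  intros HN H. destruct (basis_bounded m K phi Q N HN) as [B [HB Hb]].
  apply (uhasd_rsum (off N) T N (fun k s x => c s k * phi N (S k) x) (fun k x => dc k * phi N (S k) x)).
  intros k Hk. apply uhasd_sep with B; auto. intros x Hx. apply (Hb k x Hk Hx).
Qed.

Lemma uhasd_lc_D N T c dc t : (1 <= N)%nat -> Icc 0 T t -> (forall k, (k < N)%nat -> hasd T (fun s => c s k) t (dc k)) ->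
  uhasd (off N) T (fun s => Derive (lc phi N (c s))) t (Derive (lc phi N dc)).
Proof.
  intros HN Ht H. destruct (basis_bounded m K phi Q N HN) as [B [HB Hb]].
  apply uhasd_ext with (fun s x => rsum N (fun k => c s k * Derive (phi N (S k)) x)) (fun x => rsum N (fun k => dc k * Derive (phi N (S k)) x)); auto.
  intros; symmetry; apply (lc_Derive m K phi Q); auto. intros; symmetry; apply (lc_Derive m K phi Q); auto.
  apply (uhasd_rsum (off N) T N (fun k s x => c s k * Derive (phi N (S k)) x) (fun k x => dc k * Derive (phi N (S k)) x)).
  intros k Hk. apply uhasd_sep with B; auto. intros x Hx. apply (Hb k x Hk Hx).
Qed.

Variables (T c0 B : R) (eta u etat ut : R -> R -> R).
Hypothesis HT : 0 < T.
Hypothesis Hc0 : 0 < c0.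
Hypothesis Hsl : forall t, Icc 0 T t -> slice m L B c0 (eta t) (u t) (etat t) (ut t).
Hypothesis Hdeta : forall t x, Icc 0 T t -> hasd T (fun s => eta s x) t (etat t x).
Hypothesis Hdu : forall t x, Icc 0 T t -> hasd T (fun s => u s x) t (ut t x).

Definition interp (N : nat) (f g : R -> R) (k : nat) : R :=
  if Nat.ltb k N then f (node N (S k)) else g (node N (S (k - N))).

Lemma interp_lc N f g : lc phi N (interp N f g) = Qh phi N f.
Proof.
  rewrite Qh_lc. extensionality x. unfold lc. apply rsum_ext. intros k Hk. unfold interp.
  apply Nat.ltb_lt in Hk. rewrite Hk. auto.
Qed.

Lemma interp_ucoord N f g : lc phi N (ucoord N (interp N f g)) = Qh phi N g.
Proof.
  rewrite Qh_lc. extensionality x. unfold lc. apply rsum_ext. intros k Hk. unfold interp, ucoord.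
  replace (Nat.ltb (N + k) N) with false by (symmetry; apply Nat.ltb_ge; clear; lia). do 3 f_equal. f_equal. clear; lia.
Qed.

Lemma interp_hasd N t k : Icc 0 T t -> hasd T (fun s => interp N (eta s) (u s) k) t (interp N (etat t) (ut t) k).
Proof. intros Ht. unfold interp. destruct (Nat.ltb k N); auto. Qed.

(** The weak equations are required only while the error is at most [h^2]. Hence the lemma covers
    solutions of the retracted equation, which satisfy them only there, as well as given discrete
    solutions. *)
Lemma energy_curve : exists C h0, 0 < C /\ 0 < h0 /\ forall N y dy, (1 <= N)%nat -> hstep N <= h0 ->
  (forall t k, Icc 0 T t -> (k < N + N)%nat -> hasd T (fun s => y s k) t (dy t k)) ->
  (forall k, (k < N + N)%nat -> y 0 k = interp N (eta 0) (u 0) k) ->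
  (forall t, Icc 0 T t -> state_norm N (fun k => interp N (eta t) (u t) k - y t k) <= hstep N ^ 2 ->
     weak1 phi N (y t) (dy t) /\ weak2 phi N (y t) (dy t)) ->
  forall t, Icc 0 T t -> state_norm N (fun k => interp N (eta t) (u t) k - y t k) <= C * hstep N ^ r /\
     state_norm N (fun k => interp N (eta t) (u t) k - y t k) < hstep N ^ 2.
Proof.
  destruct (energy_static m K phi Q B c0 Hc0) as [C1 [h1 [HC1 [Hh1 Hst]]]].
  (* Lower bounds for the three weights of the energy when the depth is at least [c0 / 2]. *)
  set (kap := Rmin 1 (Rmin (c0 / 2) (1 / 3 * (c0 / 2) ^ 3))).
  assert (Hkap : 0 < kap /\ kap <= 1 /\ kap <= c0 / 2 /\ kap <= 1 / 3 * (c0 / 2) ^ 3).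
  { assert (0 < (c0 / 2) ^ 3) by (apply pow_lt; lra).
    unfold kap, Rmin. repeat destruct Rle_dec; repeat split; lra. }
  destruct Hkap as [Hk0 [Hk1 [Hk2 Hk3]]].
  set (Kg := C1 / kap). assert (HKg : 0 < Kg) by (apply Rdiv_lt_0_compat; auto).
  (* Each of the three norms in [state_norm] will be at most [exp (Kg * T) * h^r]. *)
  set (C := 3 * exp (Kg * T)).
  assert (HeT : 1 <= exp (Kg * T)).
  { rewrite <- exp_0. left. apply exp_increasing. apply Rmult_lt_0_compat; auto. }
  (* The second restriction gives [C * h < 1], hence [C * h^r < h^2] because r is at least 3: the
     strict improvement that the continuity argument needs. *)
  exists C, (Rmin h1 (/ (C + 1))). split. unfold C; lra. split.
  { apply Rmin_glb_lt; auto. apply Rinv_0_lt_compat. unfold C; lra. }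
  intros N y dy HN Hh Hy Hy0 Hweak.
  assert (Hhh1 : hstep N <= h1) by (eapply Rle_trans; [exact Hh|apply Rmin_l]).
  assert (HhC : hstep N * (C + 1) <= 1).
  { assert (H : hstep N <= / (C + 1)) by (eapply Rle_trans; [exact Hh|apply Rmin_r]).
    apply Rmult_le_compat_r with (r := C + 1) in H; [|unfold C; lra]. rewrite Rinv_l in H; [auto|unfold C; lra]. }
  assert (Hh0 := hstep_pos N HN). assert (Hhle := hstep_le1 N HN).
  set (h := hstep N) in *.
  set (e := fun t k => interp N (eta t) (u t) k - y t k).
  set (de := fun t k => interp N (etat t) (ut t) k - dy t k).
  set (nn := fun t => state_norm N (e t)).
  assert (Hde : forall t k, Icc 0 T t -> (k < N + N)%nat -> hasd T (fun s => e s k) t (de t k)).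
  { intros t k Ht Hk. unfold e, de.
    replace (fun s => interp N (eta s) (u s) k - y s k) with (fun s => interp N (eta s) (u s) k + -1 * y s k) by (extensionality s; ring).
    replace (interp N (etat t) (ut t) k - dy t k) with (interp N (etat t) (ut t) k + -1 * dy t k) by ring.
    apply hasd_plus. apply interp_hasd; auto. apply hasd_scal. auto. }
  set (E := fun t => I (fun x => lc phi N (e t) x ^ 2 + lc phi N (y t) x * lc phi N (ucoord N (e t)) x ^ 2
      + 1 / 3 * (lc phi N (y t) x ^ 3 * Derive (lc phi N (ucoord N (e t))) x ^ 2))).
  set (dE := fun t => I (fun x => 2 * lc phi N (e t) x * lc phi N (de t) x
      + (lc phi N (dy t) x * lc phi N (ucoord N (e t)) x ^ 2 + lc phi N (y t) x * (2 * lc phi N (ucoord N (e t)) x * lc phi N (ucoord N (de t)) x))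
      + 1 / 3 * (3 * lc phi N (y t) x ^ 2 * lc phi N (dy t) x * Derive (lc phi N (ucoord N (e t))) x ^ 2
         + lc phi N (y t) x ^ 3 * (2 * Derive (lc phi N (ucoord N (e t))) x * Derive (lc phi N (ucoord N (de t))) x)))).
  assert (pl : forall z, pwc N (lc phi N z)) by (intros; apply (lc_pwc m K phi Q); auto).
  assert (plD : forall z, pwc N (Derive (lc phi N z))) by (intros; apply lc_pwc_D; auto).
  assert (HE : forall t, Icc 0 T t -> hasd T E t (dE t)).
  { intros t Ht. unfold E, dE.
    apply (uhasd_I N T (fun t x => lc phi N (e t) x ^ 2 + lc phi N (y t) x * lc phi N (ucoord N (e t)) x ^ 2
      + 1 / 3 * (lc phi N (y t) x ^ 3 * Derive (lc phi N (ucoord N (e t))) x ^ 2))); auto.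
    { intros; pw; auto. } { pw; auto. }
    assert (U1 : uhasd (off N) T (fun s => lc phi N (e s)) t (lc phi N (de t))).
    { apply uhasd_lc; auto. intros; apply Hde; auto; lia. }
    assert (U2 : uhasd (off N) T (fun s => lc phi N (y s)) t (lc phi N (dy t))).
    { apply uhasd_lc; auto. intros; apply Hy; auto; lia. }
    assert (U3 : uhasd (off N) T (fun s => lc phi N (ucoord N (e s))) t (lc phi N (ucoord N (de t)))).
    { apply (uhasd_lc N T (fun s => ucoord N (e s))); auto. intros; apply (Hde t (N + k)%nat); auto; lia. }
    assert (U4 : uhasd (off N) T (fun s => Derive (lc phi N (ucoord N (e s)))) t (Derive (lc phi N (ucoord N (de t))))).
    { apply (uhasd_lc_D N T (fun s => ucoord N (e s))); auto. intros; apply (Hde t (N + k)%nat); auto; lia. }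
    assert (U5 : uhasd (off N) T (fun _ x => 1 / 3 * 1) t (fun x => 0 * 1)).
    { apply (uhasd_sep (off N) T (fun _ => 1 / 3) 0 (fun _ => 1) 1). apply hasd_const. intros; rewrite Rabs_R1; lra. lra. }
    pose proof (uhasd_mult _ _ _ _ _ _ _ U1 U1) as V1.
    pose proof (uhasd_mult _ _ _ _ _ _ _ U2 (uhasd_mult _ _ _ _ _ _ _ U3 U3)) as V2.
    pose proof (uhasd_mult _ _ _ _ _ _ _ U5 (uhasd_mult _ _ _ _ _ _ _ (uhasd_mult _ _ _ _ _ _ _ U2 (uhasd_mult _ _ _ _ _ _ _ U2 U2)) (uhasd_mult _ _ _ _ _ _ _ U4 U4))) as V3.
    pose proof (uhasd_plus _ _ _ _ _ _ _ (uhasd_plus _ _ _ _ _ _ _ V1 V2) V3) as V.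
    refine (uhasd_ext _ _ _ _ _ _ _ Ht _ _ V); intros; cbv beta; field. }
  assert (HS : forall t, Icc 0 T t -> nn t <= h ^ 2 ->
     kap * (L2norm (lc phi N (e t)) ^ 2 + L2norm (lc phi N (ucoord N (e t))) ^ 2 + L2norm (Derive (lc phi N (ucoord N (e t)))) ^ 2) <= E t /\
     dE t <= Kg * E t + C1 * (h ^ r) ^ 2).
  { intros t Ht Hn. destruct (Hweak t Ht Hn) as [W1 W2].
    destruct (Hst N (eta t) (u t) (etat t) (ut t) (e t) (ucoord N (e t)) (de t) (ucoord N (de t)) HN Hhh1 (Hsl t Ht) Hn) as [Hpos Hen].
    assert (X1 : forall x, Qh phi N (eta t) x - lc phi N (e t) x = lc phi N (y t) x).
    { intros x. rewrite <- (interp_lc N (eta t) (u t)). unfold e. rewrite lc_minus. ring. }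
    assert (X2 : forall x, Derive (Qh phi N (eta t)) x - Derive (lc phi N (e t)) x = Derive (lc phi N (y t)) x).
    { intros x. rewrite <- (interp_lc N (eta t) (u t)). unfold e. rewrite Derive_lc_minus by auto.
      change (fun k => interp N (eta t) (u t) k) with (interp N (eta t) (u t)). change (fun k => y t k) with (y t). ring. }
    assert (X3 : forall x, Qh phi N (u t) x - lc phi N (ucoord N (e t)) x = lc phi N (ucoord N (y t)) x).
    { intros x. rewrite <- (interp_ucoord N (eta t) (u t)).
      change (ucoord N (e t)) with (fun k => ucoord N (interp N (eta t) (u t)) k - ucoord N (y t) k). rewrite lc_minus. ring. }
    assert (X4 : forall x, Derive (Qh phi N (u t)) x - Derive (lc phi N (ucoord N (e t))) x = Derive (lc phi N (ucoord N (y t))) x).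
    { intros x. rewrite <- (interp_ucoord N (eta t) (u t)).
      change (ucoord N (e t)) with (fun k => ucoord N (interp N (eta t) (u t)) k - ucoord N (y t) k). rewrite Derive_lc_minus by auto.
      change (fun k => ucoord N (interp N (eta t) (u t)) k) with (ucoord N (interp N (eta t) (u t))). change (fun k => ucoord N (y t) k) with (ucoord N (y t)). ring. }
    assert (X5 : forall x, off N x -> Derive_n (Qh phi N (u t)) 2 x - Derive_n (lc phi N (ucoord N (e t))) 2 x = Derive_n (lc phi N (ucoord N (y t))) 2 x).
    { intros x Hx. rewrite <- (interp_ucoord N (eta t) (u t)).
      change (ucoord N (e t)) with (fun k => ucoord N (interp N (eta t) (u t)) k - ucoord N (y t) k). rewrite Derive2_lc_minus by auto.
      change (fun k => ucoord N (interp N (eta t) (u t)) k) with (ucoord N (interp N (eta t) (u t))). change (fun k => ucoord N (y t) k) with (ucoord N (y t)). ring. }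
    assert (X6 : forall x, Qh phi N (etat t) x - lc phi N (de t) x = lc phi N (dy t) x).
    { intros x. rewrite <- (interp_lc N (etat t) (ut t)). unfold de. rewrite lc_minus. ring. }
    assert (X7 : forall x, Qh phi N (ut t) x - lc phi N (ucoord N (de t)) x = lc phi N (ucoord N (dy t)) x).
    { intros x. rewrite <- (interp_ucoord N (etat t) (ut t)).
      change (ucoord N (de t)) with (fun k => ucoord N (interp N (etat t) (ut t)) k - ucoord N (dy t) k). rewrite lc_minus. ring. }
    assert (X8 : forall x, Derive (Qh phi N (ut t)) x - Derive (lc phi N (ucoord N (de t))) x = Derive (lc phi N (ucoord N (dy t))) x).
    { intros x. rewrite <- (interp_ucoord N (etat t) (ut t)).
      change (ucoord N (de t)) with (fun k => ucoord N (interp N (etat t) (ut t)) k - ucoord N (dy t) k). rewrite Derive_lc_minus by auto.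
      change (fun k => ucoord N (interp N (etat t) (ut t)) k) with (ucoord N (interp N (etat t) (ut t))). change (fun k => ucoord N (dy t) k) with (ucoord N (dy t)). ring. }
    assert (q0 := pl (y t)). assert (q1 := pl (e t)). assert (q2 := pl (ucoord N (e t))). assert (q3 := plD (ucoord N (e t))).
    assert (HEl : kap * (L2norm (lc phi N (e t)) ^ 2 + L2norm (lc phi N (ucoord N (e t))) ^ 2 + L2norm (Derive (lc phi N (ucoord N (e t)))) ^ 2) <= E t).
    { rewrite !(L2norm_sq N) by auto. rewrite <- !(I_plus N), <- (I_scal N) by (auto; pw). unfold E.
      apply (I_le N); auto; [pw|pw|]. intros x Hx. destruct (Hpos x Hx) as [Hl _]. rewrite X1 in Hl.
      assert (Hl3 : (c0 / 2) ^ 3 <= lc phi N (y t) x ^ 3) by (apply pow_incr; lra).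
      pose proof (pow2_ge_0 (lc phi N (e t) x)). pose proof (pow2_ge_0 (lc phi N (ucoord N (e t)) x)). pose proof (pow2_ge_0 (Derive (lc phi N (ucoord N (e t))) x)).
      rewrite !Rmult_plus_distr_l. rewrite <- (Rmult_assoc (1 / 3)). repeat apply Rplus_le_compat.
      - rewrite <- (Rmult_1_l (lc phi N (e t) x ^ 2)) at 2. apply Rmult_le_compat_r; auto.
      - apply Rmult_le_compat_r; auto; lra.
      - apply Rmult_le_compat_r; auto; lra. }
    split; auto.
    assert (H1 : dE t <= C1 * (L2norm (lc phi N (e t)) ^ 2 + L2norm (lc phi N (ucoord N (e t))) ^ 2 + L2norm (Derive (lc phi N (ucoord N (e t)))) ^ 2 + (h ^ r) ^ 2)).
    { unfold dE. eapply Rle_trans; [|apply Hen].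
      - right. f_equal. extensionality x. rewrite X1, X6. reflexivity.
      - intros w. rewrite <- (W1 w). f_equal. extensionality x. rewrite X1, X2, X3, X4, X6. reflexivity.
      - rewrite <- (W2 (ucoord N (e t))). cbv zeta.
        assert (q4 := pl (ucoord N (dy t))). assert (q5 := plD (ucoord N (dy t))). assert (q6 := pl (ucoord N (y t))). assert (q7 := plD (ucoord N (y t))).
        assert (q8 := plD (y t)). assert (q9 : pwc N (Derive_n (lc phi N (ucoord N (y t))) 2)) by (apply lc_pwc_D2; auto).
        symmetry. apply (I_ext N); auto; [pw|]. intros x Hx. rewrite X1, X2, X3, X4, X5, X7, X8 by auto. reflexivity. }
    eapply Rle_trans; [exact H1|]. rewrite Rmult_plus_distr_l. apply Rplus_le_compat_r.
    unfold Kg. apply Rmult_le_compat_l with (r := Kg) in HEl; [|lra]. unfold Kg in HEl.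
    rewrite <- Rmult_assoc in HEl. unfold Rdiv in HEl at 1. rewrite (Rmult_assoc C1), Rinv_l, Rmult_1_r in HEl by lra. exact HEl. }
  assert (e0 : forall k, (k < N + N)%nat -> e 0 k = 0) by (intros k Hk; unfold e; rewrite Hy0 by auto; ring).
  assert (z0 : forall x, lc phi N (e 0) x = 0) by (intros x; apply rsum_zero; intros k Hk; rewrite e0 by lia; ring).
  assert (z1 : forall x, lc phi N (ucoord N (e 0)) x = 0) by (intros x; apply rsum_zero; intros k Hk; unfold ucoord; rewrite e0 by lia; ring).
  assert (z2 : forall x, Derive (lc phi N (ucoord N (e 0))) x = 0).
  { intros x. rewrite (lc_Derive m K phi Q) by auto. apply rsum_zero; intros k Hk; unfold ucoord; rewrite e0 by lia; ring. }
  assert (HE0 : E 0 = 0).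
  { unfold E. transitivity (I (fun _ => 0)); [|apply I_const]. f_equal. extensionality x. rewrite z0, z1, z2. ring. }
  assert (Hn0 : nn 0 = 0).
  { unfold nn, state_norm. assert (Z : forall f, (forall x, f x = 0) -> L2norm f = 0).
    { intros f Hf. rewrite L2norm_sqrt. rewrite <- sqrt_0. f_equal. rewrite <- (I_const 0). f_equal. extensionality x. rewrite Hf. ring. }
    rewrite !Z by auto. ring. }
  assert (Hhr : 0 < h ^ r) by (apply pow_lt; auto).
  assert (Hbound : forall t, Icc 0 T t -> (forall s, Icc 0 t s -> nn s <= h ^ 2) -> nn t <= C * h ^ r).
  { intros t Ht Hs. destruct (Req_dec t 0) as [->|Ht0].
    { rewrite Hn0. apply Rmult_le_pos; [unfold C|]; lra. }
    assert (Htp : 0 < t) by (unfold Icc in Ht; lra).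
    assert (sub : forall s, Icc 0 t s -> Icc 0 T s) by (unfold Icc in *; intros; lra).
    pose proof (gronwall t E dE Kg (C1 * (h ^ r) ^ 2) Htp HKg) as G.
    assert (G1 : E t + C1 * (h ^ r) ^ 2 / Kg <= (E 0 + C1 * (h ^ r) ^ 2 / Kg) * exp (Kg * t)).
    { apply G.
      - intros s Hs'. apply hasd_sub with T; [unfold Icc in Ht; lra|]. apply HE; auto.
      - intros s Hs'. apply HS; auto.
      - unfold Icc; lra. }
    rewrite HE0, Rplus_0_l in G1.
    replace (C1 * (h ^ r) ^ 2 / Kg) with (kap * (h ^ r) ^ 2) in G1 by (unfold Kg; field; lra).
    assert (Hexp : exp (Kg * t) <= exp (Kg * T)).
    { destruct (Req_dec t T) as [->|]; [lra|]. left. apply exp_increasing. apply Rmult_lt_compat_l; auto. unfold Icc in Ht; lra. }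
    destruct (HS t Ht) as [HEl _]. { apply Hs. unfold Icc; lra. }
    assert (Hhr2 : 0 <= (h ^ r) ^ 2) by apply pow2_ge_0.
    set (a := L2norm (lc phi N (e t))) in *. set (b := L2norm (lc phi N (ucoord N (e t)))) in *.
    set (c := L2norm (Derive (lc phi N (ucoord N (e t))))) in *.
    assert (Hsum : a ^ 2 + b ^ 2 + c ^ 2 <= (h ^ r) ^ 2 * exp (Kg * T) ^ 2).
    { apply Rmult_le_reg_l with kap; auto.
      assert (kap * (h ^ r) ^ 2 * exp (Kg * t) <= kap * (h ^ r) ^ 2 * (exp (Kg * T) ^ 2)).
      { apply Rmult_le_compat_l. apply Rmult_le_pos; lra. eapply Rle_trans; [exact Hexp|]. nra. }
      assert (0 <= kap * (h ^ r) ^ 2) by (apply Rmult_le_pos; lra). lra. }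
    assert (one : forall z, 0 <= z -> z ^ 2 <= a ^ 2 + b ^ 2 + c ^ 2 -> z <= exp (Kg * T) * h ^ r).
    { intros z Hz Hz2. assert (Hp : 0 <= exp (Kg * T) * h ^ r) by (apply Rmult_le_pos; lra).
      assert (Hz3 : z ^ 2 <= (exp (Kg * T) * h ^ r) ^ 2) by (rewrite Rpow_mult_distr; lra).
      apply Rnot_lt_le. intros Hlt. nra. }
    pose proof (pow2_ge_0 a). pose proof (pow2_ge_0 b). pose proof (pow2_ge_0 c).
    assert (a <= exp (Kg * T) * h ^ r) by (apply one; [apply L2norm_pos|lra]).
    assert (b <= exp (Kg * T) * h ^ r) by (apply one; [apply L2norm_pos|lra]).
    assert (c <= exp (Kg * T) * h ^ r) by (apply one; [apply L2norm_pos|lra]).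
    unfold nn, state_norm. fold a b c. unfold C. lra. }
  assert (Hlt : C * h ^ r < h ^ 2).
  { apply Rle_lt_trans with (C * h ^ 3).
    - apply Rmult_le_compat_l. unfold C; lra. apply pow_le_1. lra. unfold r; lia.
    - replace (C * h ^ 3) with (C * h * h ^ 2) by ring. rewrite <- (Rmult_1_l (h ^ 2)) at 2.
      apply Rmult_lt_compat_r. apply pow_lt; auto. lra. }
  assert (Hall : forall t, Icc 0 T t -> nn t < h ^ 2).
  { apply bootstrap. lra.
    - intros t Ht eps Heps. destruct (state_norm_le N HN) as [Cn [HCn Hnle]].
      (* Continuity of the norm in time is reduced to that of the coordinates, added one at a time
         with equal shares of the tolerance. *)
      assert (Hck : forall n, (n <= N + N)%nat -> exists d, 0 < d /\ forall s, Icc 0 T s -> Rabs (s - t) < d -> (Cn + 1) * rsum n (fun k => Rabs (e s k - e t k)) < eps / 2 + eps / 2 * (INR n / INR (N + N + 1))).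
      { assert (Hnn : 0 < INR (N + N + 1)) by (apply lt_0_INR; lia).
        induction n; intros Hn.
        - exists 1. split. lra. intros. simpl. unfold Rdiv. rewrite Rmult_0_l, !Rmult_0_r. lra.
        - destruct (IHn ltac:(lia)) as [d1 [Hd1 A1]].
          destruct (hasd_cont T (fun s => e s n) t (de t n)) with (eps := eps / 2 / INR (N + N + 1) / (Cn + 1)) as [d2 [Hd2 A2]].
          { apply Hde; auto. } { repeat apply Rdiv_lt_0_compat; lra. }
          exists (Rmin d1 d2). split. apply Rmin_glb_lt; auto. intros s Hs Hst'.
          specialize (A1 s Hs (Rlt_le_trans _ _ _ Hst' (Rmin_l _ _))). specialize (A2 s Hs (Rlt_le_trans _ _ _ Hst' (Rmin_r _ _))).
          rewrite S_INR. simpl rsum. apply Rmult_lt_compat_l with (r := Cn + 1) in A2; [|lra].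
          replace ((Cn + 1) * (eps / 2 / INR (N + N + 1) / (Cn + 1))) with (eps / 2 / INR (N + N + 1)) in A2 by (field; lra).
          replace (eps / 2 + eps / 2 * ((INR n + 1) / INR (N + N + 1))) with (eps / 2 + eps / 2 * (INR n / INR (N + N + 1)) + eps / 2 / INR (N + N + 1)) by (field; lra).
          lra. }
      destruct (Hck (N + N)%nat (le_n _)) as [d [Hd A]]. exists d. split; auto. intros s Hs Hst'. specialize (A s Hs Hst').
      assert (Hdn : Rabs (nn s - nn t) <= state_norm N (fun k => e s k - e t k)).
      { destruct (nu_sub (state_norm N) (fun c a => state_norm_scal N c a HN) (fun a b => state_norm_triang N a b HN) (e s) (e t)) as [D1 D2].
        apply Rabs_le. unfold nn. lra. }
      specialize (Hnle (fun k => e s k - e t k)). unfold dist in Hnle.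
      rewrite (rsum_ext (N + N) _ (fun k => Rabs (e s k - e t k))) in Hnle by (intros; rewrite Rminus_0_r; auto).
      assert (Hr : 0 <= rsum (N + N) (fun k => Rabs (e s k - e t k))) by (apply rsum_nonneg; intros; apply Rabs_pos).
      assert (Hq : INR (N + N) / INR (N + N + 1) <= 1).
      { assert (0 < INR (N + N + 1)) by (apply lt_0_INR; lia). apply Rmult_le_reg_r with (INR (N + N + 1)); auto.
        unfold Rdiv. rewrite Rmult_assoc, Rinv_l by lra. rewrite Rmult_1_l, Rmult_1_r. apply le_INR; lia. }
      nra.
    - rewrite Hn0. apply pow_lt; auto.
    - intros t Ht Hs. eapply Rle_lt_trans; [apply Hbound; auto|auto]. }
  intros t Ht. split; [|apply Hall; auto].
  apply Hbound; auto. intros s Hs. left. apply Hall. unfold Icc in *; lra.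
Qed.
End Curve.

(** * Existence, uniqueness and convergence *)

Lemma rsum_app n k f : rsum (n + k) f = rsum n f + rsum k (fun i => f (n + i)%nat).
Proof.
  induction k; simpl. rewrite Nat.add_0_r; ring.
  rewrite Nat.add_succ_r. simpl. rewrite IHk. ring.
Qed.

(** Gronwall is applied to the sum of squared differences, which is differentiable where [dist] is
    not. *)
Lemma lipschitz_ode_unique n T Lc (F : R -> (nat -> R) -> nat -> R) (y z : R -> nat -> R) : 0 < T -> 0 <= Lc ->
  (forall t a b j, Icc 0 T t -> (j < n)%nat -> Rabs (F t a j - F t b j) <= Lc * dist n a b) ->
  (forall t j, Icc 0 T t -> (j < n)%nat -> hasd T (fun s => y s j) t (F t (y t) j)) ->
  (forall t j, Icc 0 T t -> (j < n)%nat -> hasd T (fun s => z s j) t (F t (z t) j)) ->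
  (forall j, (j < n)%nat -> y 0 j = z 0 j) ->
  forall t j, Icc 0 T t -> (j < n)%nat -> y t j = z t j.
Proof.
  intros HT HL Hlip Hy Hz H0.
  set (w := fun t j => y t j + -1 * z t j).
  set (D := fun t => rsum n (fun j => w t j * w t j)).
  set (dw := fun t j => F t (y t) j + -1 * F t (z t) j).
  assert (HD : forall t, Icc 0 T t -> hasd T D t (rsum n (fun j => dw t j * w t j + w t j * dw t j))).
  { intros t Ht. apply (hasd_rsum T n (fun j s => w s j * w s j) (fun j => dw t j * w t j + w t j * dw t j)). intros j Hj.
    assert (Hw : hasd T (fun s => w s j) t (dw t j)) by (apply hasd_plus; [|apply hasd_scal]; auto).
    apply (hasd_mult T (fun s => w s j) (fun s => w s j)); auto. }
  assert (Hn := pos_INR n). set (Kg := 2 * Lc * INR n + 1).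
  assert (HKg : 0 < Kg) by (unfold Kg; assert (0 <= Lc * INR n) by (apply Rmult_le_pos; auto); lra).
  assert (HDp : forall t, 0 <= D t) by (intros; apply rsum_nonneg; intros; nra).
  assert (Hd : forall t, Icc 0 T t -> rsum n (fun j => dw t j * w t j + w t j * dw t j) <= Kg * D t + 0).
  { intros t Ht.
    assert (E : dist n (y t) (z t) = rsum n (fun k => Rabs (w t k))).
    { unfold dist, w. apply rsum_ext; intros; f_equal; ring. }
    apply Rle_trans with (rsum n (fun j => 2 * (Rabs (w t j) * (Lc * rsum n (fun k => Rabs (w t k)))))).
    - apply rsum_le. intros j Hj. specialize (Hlip t (y t) (z t) j Ht Hj). rewrite E in Hlip.
      replace (dw t j * w t j + w t j * dw t j) with (2 * (w t j * dw t j)) by ring. apply Rmult_le_compat_l; [lra|].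
      eapply Rle_trans. apply RRle_abs. rewrite Rabs_mult. apply Rmult_le_compat_l. apply Rabs_pos.
      unfold dw. replace (F t (y t) j + -1 * F t (z t) j) with (F t (y t) j - F t (z t) j) by ring. auto.
    - rewrite rsum_scal.
      assert (HS : rsum n (fun j => Rabs (w t j) * (Lc * rsum n (fun k => Rabs (w t k)))) <= Lc * (INR n * D t)).
      { rewrite (rsum_ext n _ (fun j => Lc * rsum n (fun k => Rabs (w t j) * Rabs (w t k)))) by (intros; rewrite rsum_scal; ring).
        rewrite rsum_scal. apply Rmult_le_compat_l; auto.
        apply Rle_trans with (rsum n (fun j => rsum n (fun k => 1 / 2 * (w t j * w t j) + 1 / 2 * (w t k * w t k)))).
        - apply rsum_le; intros j Hj. apply rsum_le; intros k Hk.
          pose proof (pow2_ge_0 (Rabs (w t j) - Rabs (w t k))) as P.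
          pose proof (pow2_abs (w t j)) as A1. pose proof (pow2_abs (w t k)) as A2. nra.
        - right. rewrite (rsum_ext n _ (fun j => INR n * (1 / 2 * (w t j * w t j)) + 1 / 2 * D t)).
          2:{ intros j Hj. rewrite rsum_plus, rsum_const, rsum_scal. auto. }
          rewrite rsum_plus, rsum_const, !rsum_scal. unfold D. field. }
      unfold Kg. specialize (HDp t). lra. }
  intros t j Ht Hj.
  pose proof (gronwall T D _ Kg 0 HT HKg HD Hd t Ht) as G.
  assert (D0 : D 0 = 0).
  { apply rsum_zero. intros k Hk. unfold w. rewrite H0 by auto. ring. }
  rewrite D0 in G. replace (0 / Kg) with 0 in G by (field; lra).
  assert (Hj2 : w t j * w t j <= D t) by (apply (rsum_term_le n (fun j => w t j * w t j)); auto; intros; nra).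
  assert (w t j = 0) by nra. unfold w in H. lra.
Qed.

Section Final.
Variable m : nat.
Let r := S (S (S m)).
Variables (K : nat) (phi : nat -> nat -> R -> R).
Hypothesis Q : quasi_interpolant_basis r K phi.

Section OneN.
Variable N : nat.
Hypothesis HN : (1 <= N)%nat.

Lemma weak1_iff y y' : weak1 phi N y y' <-> forall chi, spline r N chi ->
  L2ip (lc phi N y') chi + L2ip (Derive (fun x => lc phi N y x * lc phi N (ucoord N y) x)) chi = 0.
Proof.
  assert (p1 := lc_pwc m K phi Q N y HN). assert (p2 := lc_pwc m K phi Q N (ucoord N y) HN).
  assert (p3 := lc_pwc m K phi Q N y' HN). assert (p4 := lc_pwc_D m K phi Q N y HN).
  assert (p5 := lc_pwc_D m K phi Q N (ucoord N y) HN).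
  assert (E : forall w, L2ip (lc phi N y') (lc phi N w) + L2ip (Derive (fun x => lc phi N y x * lc phi N (ucoord N y) x)) (lc phi N w)
     = I (fun x => (lc phi N y' x + (Derive (lc phi N y) x * lc phi N (ucoord N y) x
     + lc phi N y x * Derive (lc phi N (ucoord N y)) x)) * lc phi N w x)).
  { intros w. assert (p6 := lc_pwc m K phi Q N w HN).
    replace (Derive (fun x => lc phi N y x * lc phi N (ucoord N y) x)) with
     (fun x => Derive (lc phi N y) x * lc phi N (ucoord N y) x + lc phi N y x * Derive (lc phi N (ucoord N y)) x).
    - transitivity (I (fun x => lc phi N y' x * lc phi N w x) + I (fun x => (Derive (lc phi N y) x * lc phi N (ucoord N y) x + lc phi N y x * Derive (lc phi N (ucoord N y)) x) * lc phi N w x)).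
      reflexivity. rewrite <- (I_plus N) by (auto; pw). f_equal. extensionality x. ring.
    - extensionality x. symmetry. apply is_derive_unique.
      apply (is_derive_mult (lc phi N y) (lc phi N (ucoord N y))). 3: intros; apply Rmult_comm.
      apply (spl_is_derive m N); auto; apply (lc_spline m K phi Q); auto.
      apply (spl_is_derive m N); auto; apply (lc_spline m K phi Q); auto. }
  split.
  - intros H chi Hchi. destruct (spline_lc m K phi Q N chi HN Hchi) as [w ->]. rewrite E. apply H.
  - intros H w. rewrite <- E. apply H. apply (lc_spline m K phi Q); auto.
Qed.

Lemma weak2_iff y y' : weak2 phi N y y' <-> forall chi, spline r N chi ->
  L2ip (fun x => lc phi N y x * lc phi N (ucoord N y') x) chi
  + 1 / 3 * L2ip (fun x => lc phi N y x ^ 3 * Derive (lc phi N (ucoord N y')) x) (Derive chi)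
  + L2ip (fun x => lc phi N y x * Derive (lc phi N y) x) chi
  + L2ip (fun x => lc phi N y x * lc phi N (ucoord N y) x * Derive (lc phi N (ucoord N y)) x) chi
  + 1 / 3 * L2ip (fun x => lc phi N y x ^ 3 * (lc phi N (ucoord N y) x * Derive_n (lc phi N (ucoord N y)) 2 x
       - Derive (lc phi N (ucoord N y)) x ^ 2)) (Derive chi) = 0.
Proof.
  assert (p1 := lc_pwc m K phi Q N y HN). assert (p2 := lc_pwc m K phi Q N (ucoord N y) HN).
  assert (p3 := lc_pwc m K phi Q N (ucoord N y') HN). assert (p4 := lc_pwc_D m K phi Q N y HN).
  assert (p5 := lc_pwc_D m K phi Q N (ucoord N y) HN). assert (p6 := lc_pwc_D m K phi Q N (ucoord N y') HN).
  assert (p7 := lc_pwc_D2 m K phi Q N (ucoord N y) HN).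
  unfold weak2. set (eh := lc phi N y) in *. set (uh := lc phi N (ucoord N y)) in *. set (uht := lc phi N (ucoord N y')) in *.
  assert (E : forall w, L2ip (fun x => eh x * uht x) (lc phi N w)
  + 1 / 3 * L2ip (fun x => eh x ^ 3 * Derive uht x) (Derive (lc phi N w))
  + L2ip (fun x => eh x * Derive eh x) (lc phi N w) + L2ip (fun x => eh x * uh x * Derive uh x) (lc phi N w)
  + 1 / 3 * L2ip (fun x => eh x ^ 3 * (uh x * Derive_n uh 2 x - Derive uh x ^ 2)) (Derive (lc phi N w))
     = I (fun x => eh x * uht x * lc phi N w x + 1 / 3 * (eh x ^ 3 * Derive uht x) * Derive (lc phi N w) x
      + eh x * Derive eh x * lc phi N w x + eh x * uh x * Derive uh x * lc phi N w x
      + 1 / 3 * (eh x ^ 3 * (uh x * Derive_n uh 2 x - Derive uh x ^ 2)) * Derive (lc phi N w) x)).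
  { intros w. assert (p8 := lc_pwc m K phi Q N w HN). assert (p9 := lc_pwc_D m K phi Q N w HN).
    set (chi := lc phi N w) in *. set (dchi := Derive chi) in *.
    unfold L2ip.
    change (I (fun x => eh x * uht x * chi x) + 1 / 3 * I (fun x => eh x ^ 3 * Derive uht x * dchi x)
      + I (fun x => eh x * Derive eh x * chi x) + I (fun x => eh x * uh x * Derive uh x * chi x)
      + 1 / 3 * I (fun x => eh x ^ 3 * (uh x * Derive_n uh 2 x - Derive uh x ^ 2) * dchi x) =
     I (fun x => eh x * uht x * chi x + 1 / 3 * (eh x ^ 3 * Derive uht x) * dchi x
      + eh x * Derive eh x * chi x + eh x * uh x * Derive uh x * chi x
      + 1 / 3 * (eh x ^ 3 * (uh x * Derive_n uh 2 x - Derive uh x ^ 2)) * dchi x)).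
    rewrite <- !(I_scal N) by (auto; pw). rewrite <- !(I_plus N) by (auto; pw). f_equal. extensionality x. ring. }
  split.
  - intros H chi Hchi. destruct (spline_lc m K phi Q N chi HN Hchi) as [w ->]. rewrite E. apply H.
  - intros H w. cbv zeta. rewrite <- E. apply H. apply (lc_spline m K phi Q); auto.
Qed.

Variables (T : R) (eta0 u0 : R -> R).
Hypothesis HT : 0 < T.

Lemma dt_lc (c : R -> nat -> R) dc t : Icc 0 T t -> (forall k, (k < N)%nat -> hasd T (fun s => c s k) t (dc k)) ->
  dt T (fun s => lc phi N (c s)) t = lc phi N dc.
Proof.
  intros Ht H. extensionality x. unfold dt. apply Derive_on_hasd; auto.
  apply (hasd_rsum T N (fun k s => c s k * phi N (S k) x) (fun k => dc k * phi N (S k) x)). intros k Hk.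
  replace (dc k * phi N (S k) x) with (phi N (S k) x * dc k) by ring.
  apply hasd_ext with (fun s => phi N (S k) x * c s k); auto. intros; ring. apply hasd_scal; auto.
Qed.

Lemma curve_semidiscrete (y dy : R -> nat -> R) :
  (forall t k, Icc 0 T t -> (k < N + N)%nat -> hasd T (fun s => y s k) t (dy t k)) ->
  (forall k, (k < N + N)%nat -> y 0 k = interp N eta0 u0 k) ->
  (forall t, Icc 0 T t -> weak1 phi N (y t) (dy t) /\ weak2 phi N (y t) (dy t)) ->
  semidiscrete_solution r N phi T eta0 u0 (fun t => lc phi N (y t)) (fun t => lc phi N (ucoord N (y t))).
Proof.
  intros Hy H0 Hw.
  assert (Hh : forall (c : R -> nat -> R) dc t x, Icc 0 T t -> (forall k, (k < N)%nat -> hasd T (fun s => c s k) t (dc k)) ->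
     ex_derive_on (Icc 0 T) (fun s => lc phi N (c s) x) t).
  { intros c dc t x Ht H. exists (lc phi N dc x). apply hasd_is_derive_on.
    apply (hasd_rsum T N (fun k s => c s k * phi N (S k) x) (fun k => dc k * phi N (S k) x)). intros k Hk.
    replace (dc k * phi N (S k) x) with (phi N (S k) x * dc k) by ring.
    apply hasd_ext with (fun s => phi N (S k) x * c s k); auto. intros; ring. apply hasd_scal; auto. }
  assert (D1 : forall t, Icc 0 T t -> dt T (fun s => lc phi N (y s)) t = lc phi N (dy t)).
  { intros t Ht. apply dt_lc; auto. intros; apply Hy; auto; lia. }
  assert (D2 : forall t, Icc 0 T t -> dt T (fun s => lc phi N (ucoord N (y s))) t = lc phi N (ucoord N (dy t))).
  { intros t Ht. apply (dt_lc (fun s => ucoord N (y s))); auto. intros k Hk; apply (Hy t (N + k)%nat); auto; lia. }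
  split; [|split; [|split; [|split]]].
  - intros t Ht. split; apply (lc_spline m K phi Q); auto.
  - intros t x Ht. split. apply (Hh y (dy t)); auto. intros; apply Hy; auto; lia.
    apply (Hh (fun s => ucoord N (y s)) (ucoord N (dy t))); auto. intros k Hk; apply (Hy t (N + k)%nat); auto; lia.
  - intros t Ht. rewrite D1 by auto. exact (proj1 (weak1_iff (y t) (dy t)) (proj1 (Hw t Ht))).
  - intros t Ht. unfold dx. rewrite D2 by auto. exact (proj1 (weak2_iff (y t) (dy t)) (proj2 (Hw t Ht))).
  - intros x. rewrite <- (interp_lc phi N eta0 u0), <- (interp_ucoord phi N eta0 u0). split; unfold lc; apply rsum_ext; intros k Hk.
    rewrite H0 by lia; auto. unfold ucoord. rewrite H0 by lia; auto.
Qed.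

(** Coordinates are read off from finitely many point values by [sampling]. This turns a solution,
    assumed differentiable in time only for each x separately, into a differentiable curve in
    R^(2N). *)
Lemma semidiscrete_curve (eh uh : R -> R -> R) : semidiscrete_solution r N phi T eta0 u0 eh uh ->
  exists y dy : R -> nat -> R,
  (forall t, Icc 0 T t -> eh t = lc phi N (y t) /\ uh t = lc phi N (ucoord N (y t))) /\
  (forall t k, Icc 0 T t -> (k < N + N)%nat -> hasd T (fun s => y s k) t (dy t k)) /\
  (forall k, (k < N + N)%nat -> y 0 k = interp N eta0 u0 k) /\
  (forall t, Icc 0 T t -> weak1 phi N (y t) (dy t) /\ weak2 phi N (y t) (dy t)).
Proof.
  intros [Hs [Hd [Hw1 [Hw2 H0]]]].
  destruct (sampling m K phi Q N HN) as [n [xs [W HW]]].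
  set (smp := fun (e u : R -> R) k => if Nat.ltb k N then rsum n (fun i => W k i * e (xs i)) else rsum n (fun i => W (k - N)%nat i * u (xs i))).
  assert (sa : forall e u k, (k < N)%nat -> smp e u k = rsum n (fun i => W k i * e (xs i))).
  { intros e u k Hk. unfold smp. apply Nat.ltb_lt in Hk. rewrite Hk. auto. }
  assert (sb : forall e u k, smp e u (N + k)%nat = rsum n (fun i => W k i * u (xs i))).
  { intros e u k. unfold smp. replace (Nat.ltb (N + k) N) with false by (symmetry; apply Nat.ltb_ge; lia).
    replace (N + k - N)%nat with k by lia. auto. }
  assert (rec : forall e u a b, e = lc phi N a -> u = lc phi N b -> lc phi N (smp e u) = e /\ lc phi N (ucoord N (smp e u)) = u).
  { intros e u a b -> ->. split; extensionality x; unfold lc at 1 3; apply rsum_ext; intros k Hk; f_equal.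
    rewrite sa by auto. apply HW; auto. unfold ucoord. rewrite sb. apply HW; auto. }
  assert (recs : forall e u, spline r N e -> spline r N u -> lc phi N (smp e u) = e /\ lc phi N (ucoord N (smp e u)) = u).
  { intros e u He Hu. destruct (spline_lc m K phi Q N e HN He) as [a Ea]. destruct (spline_lc m K phi Q N u HN Hu) as [b Eb].
    apply (rec e u a b); auto. }
  set (y := fun t => smp (eh t) (uh t)). set (dy := fun t => smp (dt T eh t) (dt T uh t)).
  assert (Hey : forall t, Icc 0 T t -> eh t = lc phi N (y t) /\ uh t = lc phi N (ucoord N (y t))).
  { intros t Ht. destruct (Hs t Ht) as [S1 S2]. destruct (recs (eh t) (uh t) S1 S2). split; symmetry; auto. }
  assert (Hpt : forall f t x, Icc 0 T t -> ex_derive_on (Icc 0 T) (fun s => f s x) t -> hasd T (fun s => f s x) t (dt T f t x)).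
  { intros f t x Ht [l Hl]. apply hasd_is_derive_on in Hl. unfold dt. rewrite (Derive_on_hasd T _ t l); auto. }
  assert (Hyd : forall t k, Icc 0 T t -> (k < N + N)%nat -> hasd T (fun s => y s k) t (dy t k)).
  { intros t k Ht Hk. unfold y, dy, smp. destruct (Nat.ltb k N).
    - apply (hasd_rsum T n (fun i s => W k i * eh s (xs i)) (fun i => W k i * dt T eh t (xs i))). intros i Hi.
      apply (hasd_scal T (W k i) (fun s => eh s (xs i))). apply Hpt; auto. apply Hd; auto.
    - apply (hasd_rsum T n (fun i s => W (k - N)%nat i * uh s (xs i)) (fun i => W (k - N)%nat i * dt T uh t (xs i))). intros i Hi.
      apply (hasd_scal T (W (k - N)%nat i) (fun s => uh s (xs i))). apply Hpt; auto. apply Hd; auto. }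
  assert (Hdt : forall t, Icc 0 T t -> dt T eh t = lc phi N (dy t) /\ dt T uh t = lc phi N (ucoord N (dy t))).
  { intros t Ht.
    assert (Y : forall (f : R -> R -> R) (c : R -> nat -> R) dc, (forall s, Icc 0 T s -> f s = lc phi N (c s)) ->
       (forall k, (k < N)%nat -> hasd T (fun s => c s k) t (dc k)) -> dt T f t = lc phi N dc).
    { intros f c dc Hf Hc. extensionality x. unfold dt. apply Derive_on_hasd; auto.
      apply hasd_ext with (fun s => lc phi N (c s) x); auto. intros s Hs'. rewrite Hf; auto.
      apply (hasd_rsum T N (fun k s => c s k * phi N (S k) x) (fun k => dc k * phi N (S k) x)). intros k Hk.
      replace (dc k * phi N (S k) x) with (phi N (S k) x * dc k) by ring.
      apply hasd_ext with (fun s => phi N (S k) x * c s k); auto. intros; ring. apply hasd_scal; auto. }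
    split.
    - apply (Y eh y (dy t)). intros; apply Hey; auto. intros; apply Hyd; auto; lia.
    - apply (Y uh (fun s => ucoord N (y s)) (ucoord N (dy t))). intros; apply Hey; auto. intros; apply (Hyd t (N + k)%nat); auto; lia. }
  exists y, dy. split; [auto|]. split; [auto|]. split.
  - intros k Hk. assert (I0 : Icc 0 T 0) by (unfold Icc; lra).
    assert (E1 : eh 0 = lc phi N (interp N eta0 u0)).
    { rewrite interp_lc. extensionality x. apply H0. }
    assert (E2 : uh 0 = lc phi N (ucoord N (interp N eta0 u0))).
    { rewrite interp_ucoord. extensionality x. apply H0. }
    unfold y. destruct (Nat.lt_ge_cases k N) as [Hlt|Hge].
    + rewrite sa by auto. rewrite E1. apply HW; auto.
    + replace k with (N + (k - N))%nat by lia. rewrite sb, E2.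
      rewrite (HW (ucoord N (interp N eta0 u0)) (k - N)%nat) by lia. reflexivity.
  - intros t Ht. destruct (Hey t Ht) as [E1 E2]. destruct (Hdt t Ht) as [E3 E4]. split.
    + apply (proj2 (weak1_iff (y t) (dy t))). intros chi Hchi. specialize (Hw1 t Ht chi Hchi). rewrite E3 in Hw1.
      rewrite <- E1, <- E2. exact Hw1.
    + apply (proj2 (weak2_iff (y t) (dy t))). intros chi Hchi. specialize (Hw2 t Ht chi Hchi). unfold dx in Hw2. rewrite E4 in Hw2.
      rewrite <- E1, <- E2. exact Hw2.
Qed.
End OneN.

Lemma Lb_family n N (G : (nat -> R) -> Prop) (Phi : (nat -> R) -> nat -> R) :
  (forall k, (k < N)%nat -> Lb n G (fun y => Phi y k)) ->
  exists B, 0 <= B /\ forall k y z, (k < N)%nat -> G y -> G z -> Rabs (Phi y k - Phi z k) <= B * dist n y z.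
Proof.
  intros H.
  assert (H' : forall k, exists B, 0 <= B /\ ((k < N)%nat -> forall y z, G y -> G z -> Rabs (Phi y k - Phi z k) <= B * dist n y z)).
  { intros k. destruct (classic (k < N)%nat) as [Hk|Hk].
    - destruct (H k Hk) as [B [HB [_ H2]]]. exists B. split; [auto|]. intros _ y z Hy Hz. apply (H2 y z 0); auto.
    - exists 0. split; [lra|]. intros; exfalso; auto. }
  apply choice in H'. destruct H' as [B HB].
  exists (rsum N B). split. apply rsum_nonneg; intros; apply HB.
  intros k y z Hk Hy Hz. eapply Rle_trans. apply HB; auto. apply Rmult_le_compat_r. apply dist_pos.
  apply (rsum_term_le N B); auto. intros; apply HB.
Qed.

Let L := (K + r + 6)%nat.

Lemma main_bound (M : nat) (T c0 : R) (eta0 u0 : R -> R) (eta u : R -> R -> R) : (L + 6 <= M)%nat ->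
  0 < T -> 0 < c0 -> serre_solution M T eta0 u0 eta u ->
  (forall t x, Icc 0 T t -> Icc 0 1 x -> c0 <= eta t x) ->
  exists C h0, 0 < h0 /\
  forall N : nat, (1 <= N)%nat -> hstep N <= h0 ->
  exists eta_h u_h : R -> R -> R,
    semidiscrete_solution r N phi T eta0 u0 eta_h u_h /\
    (forall eta_h' u_h' : R -> R -> R,
       semidiscrete_solution r N phi T eta0 u0 eta_h' u_h' ->
       forall t x, Icc 0 T t -> eta_h' t x = eta_h t x /\ u_h' t x = u_h t x) /\
    (forall t, Icc 0 T t ->
       L2norm (fun x => eta t x - eta_h t x) + L2norm (fun x => u t x - u_h t x)
       <= C * hstep N ^ r).
Proof.
  intros HM HT Hc0 Hsol Hlow.
  destruct (exact_slice m L M T c0 eta0 u0 eta u HM HT Hsol Hlow) as [B Hsl].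
  assert (Hdeta : forall t x, Icc 0 T t -> hasd T (fun s => eta s x) t (dt T eta t x)).
  { intros t x Ht. apply (exact_hasd_eta L M T eta0 u0 eta u); auto. }
  assert (Hdu : forall t x, Icc 0 T t -> hasd T (fun s => u s x) t (dt T u t x)).
  { intros t x Ht. apply (exact_hasd_u L M T eta0 u0 eta u); auto. }
  destruct (energy_curve m K phi Q T c0 B eta u (dt T eta) (dt T u) HT Hc0 Hsl Hdeta Hdu) as [C [h1 [HC [Hh1 Hcur]]]].
  destruct (energy_static m K phi Q B c0 Hc0) as [C2 [h2 [HC2 [Hh2 Hst]]]].
  destruct (Qh_approx m K phi Q B) as [Ca [HCa Happ]].
  (* The interpolation errors of eta and u contribute [Ca] each, the discrete error [C]. *)
  exists (2 * Ca + C), (Rmin h1 h2). split. apply Rmin_glb_lt; auto.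
  intros N HN Hh.
  assert (Hhh1 : hstep N <= h1) by (eapply Rle_trans; [exact Hh|apply Rmin_l]).
  assert (Hhh2 : hstep N <= h2) by (eapply Rle_trans; [exact Hh|apply Rmin_r]).
  assert (Hp := hstep_pos N HN). set (h := hstep N) in *.
  assert (Hrho : 0 < h ^ 2) by (apply pow_lt; auto).
  set (nu := state_norm phi N). set (n := (N + N)%nat).
  assert (nus : forall c a, nu (fun k => c * a k) = Rabs c * nu a) by (intros; apply (state_norm_scal m K phi Q); auto).
  assert (nut : forall a b, nu (fun k => a k + b k) <= nu a + nu b) by (intros; apply (state_norm_triang m K phi Q); auto).
  assert (nup : forall a, 0 <= nu a) by (intros; apply state_norm_pos).
  destruct (state_norm_ge m K phi Q N HN) as [Cg [HCg Hge]].
  destruct (state_norm_le m K phi Q N HN) as [Cl [HCl Hle]].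
  set (Y := fun t => interp N (eta t) (u t)).
  assert (HYb : forall t k, Icc 0 T t -> Rabs (Y t k) <= B).
  { intros t k Ht. destruct (Hsl t Ht) as [[_ be] [_ bu] _ _ _ _ _ _ _ _ _ _ _ _ _].
    unfold Y, interp. destruct (Nat.ltb k N). apply (be O); lia. apply (bu O); lia. }
  (* [B] bounds the coordinates of the comparison state, which are nodal values; the other term
     bounds those of an error in the ball of radius [h^2]. *)
  set (R0 := B + Cg * h ^ 2).
  destruct (rhs_exists m K phi Q N HN (c0 / 2) R0 ltac:(lra)) as [Phi [HPw [HPu HPL]]].
  destruct (Lb_family n n (good phi N (c0 / 2) R0) Phi HPL) as [LP [HLP HPlip]].
  set (Z := fun t (y : nat -> R) k => Y t k - radial nu (h ^ 2) (fun k => Y t k - y k) k).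
  assert (HZ : forall t y, Icc 0 T t -> good phi N (c0 / 2) R0 (Z t y)).
  { intros t y Ht. set (e := radial nu (h ^ 2) (fun k => Y t k - y k)).
    assert (He : nu e <= h ^ 2) by (apply radial_le; auto).
    split.
    - intros k Hk. unfold Z. fold e. unfold R0. unfold Rminus. eapply Rle_trans. apply Rabs_triang. rewrite Rabs_Ropp.
      apply Rplus_le_compat. apply HYb; auto.
      pose proof (dist_coord n e (fun _ => 0) k Hk) as H1. cbv beta in H1. rewrite Rminus_0_r in H1.
      eapply Rle_trans; [exact H1|]. eapply Rle_trans; [apply Hge|]. apply Rmult_le_compat_l; auto.
    - intros x Hx.
      (* Only the positivity half of the energy lemma is wanted, so the slots for the time
         derivatives are filled with [e]. *)
      destruct (Hst N (eta t) (u t) (dt T eta t) (dt T u t) e (ucoord N e) e e HN Hhh2 (Hsl t Ht) He) as [Hpos _].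
      destruct (Hpos x Hx) as [H1 _]. cbv beta in H1. rewrite <- (interp_lc phi N (eta t) (u t)) in H1.
      unfold Z. fold e. rewrite (lc_minus phi N (Y t) e). exact H1. }
  set (F := fun t y => Phi (Z t y)).
  (* Variation in time and in state are tracked together: equal times give the Lipschitz bound,
     distinct ones continuity along a curve. *)
  assert (HZd : forall s t y z, dist n (Z s y) (Z t z) <= dist n (Y s) (Y t) + Cg * (2 * (Cl * (dist n (Y s) (Y t) + dist n y z)))).
  { intros s t y z.
    set (ey := fun k => Y s k - y k). set (ez := fun k => Y t k - z k).
    apply Rle_trans with (dist n (Y s) (Y t) + dist n (fun k => radial nu (h ^ 2) ey k - radial nu (h ^ 2) ez k) (fun _ => 0)).
    - unfold dist. rewrite <- rsum_plus. apply rsum_le. intros k Hk. unfold Z. fold ey ez.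
      replace (Y s k - radial nu (h ^ 2) ey k - (Y t k - radial nu (h ^ 2) ez k)) with
        ((Y s k - Y t k) + - (radial nu (h ^ 2) ey k - radial nu (h ^ 2) ez k)) by ring.
      eapply Rle_trans. apply Rabs_triang. rewrite Rabs_Ropp, Rminus_0_r. lra.
    - apply Rplus_le_compat_l. eapply Rle_trans. apply Hge. apply Rmult_le_compat_l; auto.
      eapply Rle_trans. apply (radial_lip nu (h ^ 2) nup nus nut Hrho). apply Rmult_le_compat_l; [lra|].
      eapply Rle_trans. apply Hle. apply Rmult_le_compat_l; auto. unfold dist. rewrite <- rsum_plus. apply rsum_le.
      intros k Hk. unfold ey, ez. replace (Y s k - y k - (Y t k - z k) - 0) with ((Y s k - Y t k) + - (y k - z k)) by ring.
      eapply Rle_trans. apply Rabs_triang. rewrite Rabs_Ropp. lra. }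
  set (Lc := LP * (Cg * (2 * Cl))).
  assert (HLc : 0 <= Lc) by (unfold Lc; repeat apply Rmult_le_pos; lra).
  assert (Hlip : forall t y z j, Icc 0 T t -> (j < n)%nat -> Rabs (F t y j - F t z j) <= Lc * dist n y z).
  { intros t y z j Ht Hj. unfold F. eapply Rle_trans. apply HPlip; auto.
    unfold Lc. rewrite Rmult_assoc. apply Rmult_le_compat_l; auto.
    eapply Rle_trans. apply HZd. replace (dist n (Y t) (Y t)) with 0. right; ring.
    symmetry. apply rsum_zero. intros; rewrite Rminus_diag, Rabs_R0; auto. }
  assert (HYc : forall k, cont (fun t => Y (clamp T t) k)).
  { intros k. apply (hasd_clamp_cont T (fun t => Y t k) (fun t => interp N (dt T eta t) (dt T u t) k)). lra.
    intros t Ht. apply (interp_hasd T eta u (dt T eta) (dt T u)); auto. }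
  assert (Hcont : forall y : R -> nat -> R, (forall k, (k < n)%nat -> cont (fun t => y t k)) ->
     forall j, (j < n)%nat -> cont (fun t => F (clamp T t) (y t) j)).
  { intros y Hy j Hj.
    (* The lower half of the indices carries the coordinates of the comparison state, the upper half
       those of the curve. *)
    apply (cont_of_bound _ (n + n) (fun k t => if Nat.ltb k n then Y (clamp T t) k else y t (k - n)%nat) (LP * (1 + Cg * (2 * Cl)))).
    { apply Rmult_le_pos; auto. assert (0 <= Cg * (2 * Cl)) by (repeat apply Rmult_le_pos; lra). lra. }
    { intros k Hk. destruct (Nat.ltb k n) eqn:E. apply HYc. apply Nat.ltb_ge in E. apply Hy. lia. }
    intros s t. unfold F. eapply Rle_trans. apply HPlip; auto; apply HZ; apply clamp_in; lra.
    rewrite Rmult_assoc. apply Rmult_le_compat_l; auto. eapply Rle_trans. apply HZd.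
    rewrite rsum_app.
    rewrite (rsum_ext n _ (fun k => Rabs (Y (clamp T s) k - Y (clamp T t) k))).
    2:{ intros k Hk. apply Nat.ltb_lt in Hk. rewrite Hk. auto. }
    rewrite (rsum_ext n (fun i => Rabs ((if Nat.ltb (n + i) n then Y (clamp T s) (n + i)%nat else y s (n + i - n)%nat) - (if Nat.ltb (n + i) n then Y (clamp T t) (n + i)%nat else y t (n + i - n)%nat))) (fun k => Rabs (y s k - y t k))).
    2:{ intros k Hk. replace (Nat.ltb (n + k) n) with false by (symmetry; apply Nat.ltb_ge; lia). replace (n + k - n)%nat with k by lia. auto. }
    change (rsum n (fun k => Rabs (Y (clamp T s) k - Y (clamp T t) k))) with (dist n (Y (clamp T s)) (Y (clamp T t))).
    change (rsum n (fun k => Rabs (y s k - y t k))) with (dist n (y s) (y t)).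
    pose proof (dist_pos n (y s) (y t)). pose proof (dist_pos n (Y (clamp T s)) (Y (clamp T t))). lra. }
  destruct (picard n T Lc F (Y 0) HT HLc Hlip Hcont) as [y [Hy0 Hyd]].
  set (dy := fun t => F t (y t)).
  assert (Hyh : forall t k, Icc 0 T t -> (k < N + N)%nat -> hasd T (fun s => y s k) t (dy t k)).
  { intros t k Ht Hk. apply is_derive_hasd. apply Hyd; auto. }
  assert (Zin : forall t z, nu (fun k => Y t k - z k) <= h ^ 2 -> Z t z = z).
  { intros t z Hz. unfold Z. rewrite (radial_inside nu (h ^ 2) _ Hz). extensionality k. ring. }
  assert (Hweak : forall t, Icc 0 T t -> nu (fun k => Y t k - y t k) <= h ^ 2 -> weak1 phi N (y t) (dy t) /\ weak2 phi N (y t) (dy t)).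
  { intros t Ht Hn. unfold dy, F. pose proof (HZ t (y t) Ht) as Hg. rewrite (Zin t (y t) Hn) in *. apply HPw; auto. }
  pose proof (Hcur N y dy HN Hhh1 Hyh Hy0 Hweak) as Hres.
  assert (Hinit : forall k, (k < N + N)%nat -> interp N (eta 0) (u 0) k = interp N eta0 u0 k).
  { intros k Hk. destruct Hsol as [_ [_ [_ Hi]]].
    assert (Hnode : forall j, (j < N)%nat -> Icc 0 1 (node N (S j))).
    { intros j Hj. split. rewrite <- (node_0 N). apply node_mono; auto; lia. rewrite <- (node_N N) by auto. apply node_mono; auto; lia. }
    unfold interp. destruct (Nat.ltb k N) eqn:E.
    - apply Nat.ltb_lt in E. apply Hi; auto.
    - apply Nat.ltb_ge in E. apply Hi. apply Hnode. lia. }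
  exists (fun t => lc phi N (y t)), (fun t => lc phi N (ucoord N (y t))). split; [|split].
  - apply (curve_semidiscrete N HN T eta0 u0 HT y dy); auto.
    intros k Hk. rewrite Hy0 by auto. apply Hinit; auto.
    intros t Ht. apply Hweak; auto. left. apply Hres; auto.
  - intros eh' uh' Hs'. destruct (semidiscrete_curve N HN T eta0 u0 HT eh' uh' Hs') as [z [dz [Ez [Hz [Hz0 Hzw]]]]].
    assert (Hz0' : forall k, (k < N + N)%nat -> z 0 k = interp N (eta 0) (u 0) k) by (intros; rewrite Hz0, Hinit; auto).
    (* A discrete solution satisfies the weak equations at all times, so the proviso about the
       neighbourhood is dropped; the conclusion places it inside, where [Z] is the identity. *)
    pose proof (Hcur N z dz HN Hhh1 Hz Hz0' (fun t Ht _ => Hzw t Ht)) as Hresz.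
    assert (Heq : forall t j, Icc 0 T t -> (j < n)%nat -> y t j = z t j).
    { apply (lipschitz_ode_unique n T Lc F y z HT HLc Hlip); auto.
      - intros t j Ht Hj.
        assert (Hn : nu (fun k => Y t k - z t k) <= h ^ 2) by (left; apply Hresz; auto).
        pose proof (HZ t (z t) Ht) as Hg. unfold F. rewrite (Zin t (z t) Hn) in *.
        destruct (Hzw t Ht) as [W1 W2]. rewrite <- (HPu (z t) (dz t) Hg W1 W2 j Hj). apply Hz; auto.
      - intros j Hj. rewrite Hy0, Hz0' by auto. auto. }
    intros t x Ht. destruct (Ez t Ht) as [-> ->]. split; unfold lc; apply rsum_ext; intros k Hk; unfold ucoord; rewrite Heq; auto; unfold n; lia.
  - intros t Ht. destruct (Hres t Ht) as [Hn _].
    destruct (Hsl t Ht) as [Le Lu _ _ _ _ _ _ _ _ _ _ _ _ _].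
    assert (Ce : cont (eta t)) by (apply (Ck_cont L), Le). assert (Cu : cont (u t)) by (apply (Ck_cont L), Lu).
    assert (tri : forall f g c, cont f -> CkB L B f -> lc phi N g = Qh phi N f -> L2norm (fun x => f x - lc phi N c x) <= Ca * h ^ r + L2norm (lc phi N (fun k => g k - c k))).
    { intros f g c Hf HfB Eg. assert (pq : pwc N (Qh phi N f)) by (rewrite Qh_lc; apply (lc_pwc m K phi Q); auto).
      assert (pc := lc_pwc m K phi Q N c HN).
      rewrite lc_minus, Eg.
      rewrite (L2norm_ext N _ (fun x => -1 * (Qh phi N f x - f x) + (Qh phi N f x - lc phi N c x))); auto; [|pw|intros; ring].
      eapply Rle_trans. apply (L2norm_triang N (fun x => -1 * (Qh phi N f x - f x))); auto; pw.
      apply Rplus_le_compat_r. rewrite (L2norm_scal N) by (auto; pw). rewrite Rabs_left by lra.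
      replace (- -1 * L2norm (fun x => Qh phi N f x - f x)) with (L2norm (fun x => Qh phi N f x - f x)) by ring.
      apply Happ; auto. apply CkB_le with L; auto. unfold L; lia. }
    pose proof (tri (eta t) (Y t) (y t) Ce Le (interp_lc phi N (eta t) (u t))) as T1.
    pose proof (tri (u t) (ucoord N (Y t)) (ucoord N (y t)) Cu Lu (interp_ucoord phi N (eta t) (u t))) as T2.
    unfold state_norm in Hn.
    change (ucoord N (fun k => interp N (eta t) (u t) k - y t k)) with (fun k => ucoord N (Y t) k - ucoord N (y t) k) in Hn.
    pose proof (L2norm_pos (Derive (lc phi N (fun k => ucoord N (Y t) k - ucoord N (y t) k)))).
    change (fun k => interp N (eta t) (u t) k - y t k) with (fun k => Y t k - y t k) in Hn. fold h r in Hn.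
    lra.
Qed.
End Final.

Theorem theorem2p1 :
  forall (r K : nat), (3 <= r)%nat ->
  exists M : nat,
  forall (phi : nat -> nat -> R -> R), quasi_interpolant_basis r K phi ->
  forall (T c0 : R) (eta0 u0 : R -> R) (eta u : R -> R -> R),
  0 < T -> 0 < c0 ->
  Ck_per M eta0 -> Ck_per M u0 ->
  serre_solution M T eta0 u0 eta u ->
  (forall eta' u' : R -> R -> R, serre_solution M T eta0 u0 eta' u' ->
     forall t x, Icc 0 T t -> eta' t x = eta t x /\ u' t x = u t x) ->
  (forall t x, Icc 0 T t -> Icc 0 1 x -> c0 <= eta t x) ->
  exists C h0 : R, 0 < h0 /\
  forall N : nat, (1 <= N)%nat -> hstep N <= h0 ->
  exists eta_h u_h : R -> R -> R,
    semidiscrete_solution r N phi T eta0 u0 eta_h u_h /\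
    (forall eta_h' u_h' : R -> R -> R,
       semidiscrete_solution r N phi T eta0 u0 eta_h' u_h' ->
       forall t x, Icc 0 T t -> eta_h' t x = eta_h t x /\ u_h' t x = u_h t x) /\
    (forall t, Icc 0 T t ->
       L2norm (fun x => eta t x - eta_h t x) + L2norm (fun x => u t x - u_h t x)
       <= C * hstep N ^ r).
Proof.
  intros r K Hr. destruct r as [|[|[|m]]]; try lia.
  (* The order [K + r + 6] covers both [K + 6] for the superconvergence estimate and [K + r] for the
     approximation property; the final 6 pays for forming the products and time derivatives of the
     exact solution. *)
  exists (K + S (S (S m)) + 6 + 6)%nat.
  intros phi Q T c0 eta0 u0 eta u HT Hc0 _ _ Hsol _ Hlow.
  exact (main_bound m K phi Q _ T c0 eta0 u0 eta u (le_n _) HT Hc0 Hsol Hlow).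
Qed.
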